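(* Let $E\subset\mathbb{R}^d$, $\mu$, $A$, $B$, $(\mathcal{E}^0,D(\mathcal{E}^0))$, $D(\mathcal{E}^{0,E})$ and the semigroup $(T_t)_{t>0}$ on $L^2(E,\mu)$ be as in the context, and put $D:=D(\mathcal{E}^{0,E})_b$. (a) If $(\mathcal{E}^0,D(\mathcal{E}^0))$ is transient, then $(T_t)_{t>0}$ is also transient. (b) If there exists a sequence of functions $(\chi_n)_{n\ge1}\subset D$ with $0\le\chi_n\le1$ and $\lim_{n\to\infty}\chi_n=1$ $\mu$-a.e. satisfying $$\lim_{n\to\infty}\Big(\mathcal{E}^0(g,\chi_n)+\int_E\langle B,\nabla\chi_n\rangle g\,d\mu\Big)=0$$ for any non-negative bounded $g$ in the extended Dirichlet space of $D(\mathcal{E}^0)$, then $(T_t)_{t>0}$ is not transient.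
   Context: Setting. $E\subset\mathbb{R}^d$ is either open or closed; if $E$ is closed, $dx(\partial E)=0$. $\varphi\in L^1_{loc}(E,dx)$, $\varphi>0$ $dx$-a.e., and $d\mu:=\varphi\,dx$, a $\sigma$-finite measure on $\mathcal{B}(E)$ with full support; $(\cdot,\cdot)$ is the inner product of $L^2(E,\mu)$. $C_0^\infty(E)$ is the set of smooth functions with compact support in $E$ if $E$ is open, and the set of restrictions to $E$ of functions in $C_0^\infty(\mathbb{R}^d)$ if $E$ is closed. $\langle\cdot,\cdot\rangle$ and $|\cdot|$ are the Euclidean inner product and norm. $V\subset\subset E$ means $V$ is relatively open in $E$ with compact closure contained in $E$. $A=(a_{ij})_{1\le i,j\le d}$ with $a_{ij}\in L^1_{loc}(E,\mu)$ is a possibly non-symmetric matrix with symmetric part $\tilde a_{ij}=\frac12(a_{ij}+a_{ji})$, and for each $V\subset\subset E$ there is $\nu_V>0$ with $\nu_V^{-1}|\xi|^2\le\sum_{i,j}\tilde a_{ij}(x)\xi_i\xi_j\le\nu_V|\xi|^2$ for all $\xi\in\mathbb{R}^d$, $x\in V$. The form $\mathcal{E}^0(f,g):=\int_E\langle A\nabla f,\nabla g\rangle\,d\mu$, $f,g\in C_0^\infty(E)$, is assumed closable on $L^2(E,\mu)$ and to satisfy the strong sector condition $|\mathcal{E}^0(f,g)|\le K\mathcal{E}^0(f,f)^{1/2}\mathcal{E}^0(g,g)^{1/2}$ for some $K>0$; its closure is $(\mathcal{E}^0,D(\mathcal{E}^0))$, with generator $(L^0,D(L^0))$. $\nabla$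 is the weak gradient, extended to $D(\mathcal{E}^0)$ as $L^2_{loc}(E,\mathbb{R}^d,\mu)$-limit along $\mathcal{E}^0_1$-approximating sequences in $C_0^\infty(E)$. For $V\subset\subset E$, $C_0^\infty(V):=\{u\in C_0^\infty(E):\mathrm{supp}(u)\subset V\}$, $(\mathcal{E}^{0,V},D(\mathcal{E}^{0,V}))$ is the closure of $(\mathcal{E}^0,C_0^\infty(V))$ on $L^2(V,\mu)$, and $D(\mathcal{E}^{0,E}):=\bigcup_{V\subset\subset E}D(\mathcal{E}^{0,V})\subset D(\mathcal{E}^0)$. For a function space $W$: $W_b$ is the set of $\mu$-a.e. bounded elements, $W_0$ the set of elements with compact support in $E$ (support of $|u|d\mu$), $W_{0,b}=W_0\cap W_b$. $B=(B_1,\dots,B_d)\in L^2_{loc}(E,\mathbb{R}^d,\mu)$ is $\mu$-divergence free: $\int_E\langle B,\nabla f\rangle\,d\mu=0$ for all $f\in C_0^\infty(E)$. It is assumed that $D(L^0)_{0,b}$ is a dense subset of $L^1(E,\mu)$. The operator $\overline{L}$ and the semigroups. For $V\subset\subset E$ let $(L^{0,V},D(L^{0,V}))$ be the generator of $(\mathcal{E}^{0,V},D(\mathcal{E}^{0,V}))$ on $L^2(V,\mu)$. The operator $L^Vu:=L^{0,V}u+\langle B,\nabla u\rangle$, $u\in D(L^{0,V})_b$, is closable on $L^1(V,\mu)$ and its closure $\overline{L}^V$ generates a sub-Markovian $C_0$-resolvent of contractions $(\overline{G}^V_\alpha)_{\alpha>0}$. For open $V_n\subset\subset E$ with $\overline{V}_n\subset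 V_{n+1}$, $\bigcup_nV_n=E$, and $f\in L^1(E,\mu)$, the limit $\overline{G}_\alpha f:=\lim_{n\to\infty}\overline{G}^{V_n}_\alpha(f1_{V_n})$ exists $\mu$-a.e., is independent of the choice of $(V_n)$, and $(\overline{G}_\alpha)_{\alpha>0}$ is a sub-Markovian $C_0$-resolvent of contractions on $L^1(E,\mu)$. $(\overline{L},D(\overline{L}))$ is its generator and $(\overline{T}_t)_{t>0}$ the corresponding sub-Markovian $C_0$-semigroup of contractions on $L^1(E,\mu)$. $(\overline L,D(\overline L))$ extends $L^0u+\langle B,\nabla u\rangle$, $u\in D(L^0)_{0,b}$; moreover $D(\overline{L})_b\subset D(\mathcal{E}^0)$, and for $u\in D(\overline{L})_b$, $v\in D(\mathcal{E}^{0,E})_b$, $\mathcal{E}^0(u,v)-\int_E\langle B,\nabla u\rangle v\,d\mu=-\int_E\overline{L}u\,v\,d\mu$ and $\mathcal{E}^0(u,u)\le-\int_E\overline{L}u\,u\,d\mu$. $(T_t)_{t>0}$ is the unique sub-Markovian $C_0$-semigroup of contractions on $L^2(E,\mu)$ with $T_t=\overline{T}_t$ on $L^1(E,\mu)\cap L^2(E,\mu)$. Transience. For $f\in L^1(E,\mu)$, $f\ge0$, $Gf:=\lim_{N\to\infty}\int_0^N\overline{T}_tf\,dt\in[0,\infty]$. $(T_t)_{t>0}$ is transient if there is $g\in L^1(E,\mu)$, $g>0$ $\mu$-a.e., with $Gg<\infty$ $\mu$-a.e. A Dirichlet form is transient if its associated semigroup (considered on $L^1(E,\mu)$) is transient in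 the same sense. The extended Dirichlet space of $D(\mathcal{E}^0)$ is the set of measurable $g$ with $|g|<\infty$ $\mu$-a.e. for which there is an $\mathcal{E}^0$-Cauchy sequence $(g_k)\subset D(\mathcal{E}^0)$ with $g_k\to g$ $\mu$-a.e.; for such $g$ and $u\in D(\mathcal{E}^0)$, $\mathcal{E}^0(g,u):=\lim_k\mathcal{E}^0(g_k,u)$. *)

(* Defs.v *)
From HB Require Import structures.
From mathcomp Require Import all_boot all_order all_algebra.
From mathcomp Require Import all_classical all_reals all_analysis.
From mathcomp Require Import measurable_realfun.
Set Implicit Arguments.
Unset Strict Implicit.
Unset Printing Implicit Defensive.
Import Order.TTheory GRing.Theory Num.Theory.
Import numFieldNormedType.Exports.
Local Open Scope classical_set_scope.
Local Open Scope ring_scope.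

(* Conventions used throughout:
   - R^d is 'rV[R]_d with its Borel sigma-algebra.
   - The weighted measure mu = phi dx is a measure on R^d carried by E, so a
     function on E is represented by any function on R^d, and L^p(E, mu) is
     Lfun mu p up to mu-a.e. equality. For V included in E, L^p(V, mu) is
     the subspace of (classes of) functions vanishing mu-a.e. outside V.
   - Unbounded operators are given by their graphs, as relations between
     functions; semigroups are families T : R -> (R^d -> R) -> (R^d -> R),
     only used at times t > 0 and only meaningful up to mu-a.e. equality. *)

Definition borel_matrix_display : measure_display. Proof. exact. Qed.

Section borel_matrix.
Context {R : realType} {m n : nat}.
Let borel : set (set 'M[R]_(m, n)) := <<s open >>.
Let borel0 : borel set0. Proof. exact: sigma_algebra0. Qed.
Let borelC A : borel A -> borel (~` A). Proof. exact: sigma_algebraC. Qed.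
Let borel_bigcup (F : _^nat) :
  (forall i, borel (F i)) -> borel (\bigcup_i F i).
Proof. exact: sigma_algebra_bigcup. Qed.

HB.instance Definition _ := @isMeasurable.Build borel_matrix_display
  'M[R]_(m, n) borel borel0 borelC borel_bigcup.
End borel_matrix.



Section lebesgue_rV.
Local Open Scope ereal_scope.

Section sigma_finite_image.
Context d1 d2 (T1 : measurableType d1) (T2 : measurableType d2) (R : realType).
Variables (mu : {measure set T1 -> \bar R}) (f : T1 -> T2) (g : T2 -> T1).
Hypotheses (mf : measurable_fun setT f) (mg : measurable_fun setT g).
Hypotheses (fK : cancel f g) (mu_sf : sigma_finite setT mu).

Let nu := pushforward mu f.

Let nu_sigma_additive : semi_sigma_additive nu.
Proof.
exact: (@measure_semi_sigma_additive _ _ _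
  (measure_function_pushforward__canonical__measure_function_Measure mu mf)).
Qed.

#[local] HB.instance Definition _ := isMeasure.Build _ _ _ nu
  (measure0 mu) (fun A => measure_ge0 mu _) nu_sigma_additive.

Let nu_sigma_finite : sigma_finite setT nu.
Proof.
have [F FT Foo] := mu_sf.
exists (fun i => g @^-1` F i).
  by rewrite -preimage_bigcup -FT preimage_setT.
move=> i; have [mFi Fioo] := Foo i; split.
  by rewrite -[X in measurable X]setTI; exact: mg.
rewrite /nu /pushforward -comp_preimage (_ : g \o f = id)//.
by apply/funext => x /=; rewrite fK.
Qed.

#[local] HB.instance Definition _ := Measure_isSigmaFinite.Build _ _ _ nu
  nu_sigma_finite.

Definition sigma_finite_image : {sigma_finite_measure set T2 -> \bar R} :=
  nu.

End sigma_finite_image.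

Lemma product_sigma_finite d1 d2 (T1 : measurableType d1)
    (T2 : measurableType d2) (R : realType)
    (m1 : {sigma_finite_measure set T1 -> \bar R})
    (m2 : {sigma_finite_measure set T2 -> \bar R}) :
  sigma_finite setT (m1 \x m2).
Proof.
have /sigma_finiteP[F [TF ndF Foo]] := sigma_finiteT m1.
have /sigma_finiteP[G [TG ndG Goo]] := sigma_finiteT m2.
exists (fun n => F n `*` G n).
  rewrite -setXTT TF TG predeqE => -[x y]; split.
    move=> [/= [n _ Fnx] [k _ Gky]]; exists (maxn n k) => //; split.
    - by move: x Fnx; exact/subsetPset/ndF/leq_maxl.
    - by move: y Gky; exact/subsetPset/ndG/leq_maxr.
  by move=> [n _ []/= ? ?]; split; exists n.
move=> k; have [? ?] := Foo k; have [? ?] := Goo k.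
split; first exact: measurableX.
by rewrite product_measure1E// lte_mul_pinfty// ge0_fin_numE.
Qed.

Context {R : realType}.
Local Notation mR := (measurableTypeR R).

Definition tuple_cons n (p : mR * n.-tuple mR) : n.+1.-tuple mR :=
  [tuple of p.1 :: p.2].
Definition tuple_uncons n (t : n.+1.-tuple mR) : mR * n.-tuple mR :=
  (thead t, [tuple of behead t]).

Lemma tuple_consK n : cancel (@tuple_cons n) (@tuple_uncons n).
Proof.
by move=> [x t]; rewrite /tuple_uncons /tuple_cons theadE; congr pair; apply: val_inj.
Qed.

Lemma measurable_tuple_cons n : measurable_fun setT (@tuple_cons n).
Proof.
exact: (@measurable_cons _ _ _ _ (@fst mR (n.-tuple mR)) _ snd
  measurable_fst measurable_snd).
Qed.

Lemma measurable_tuple_uncons n : measurable_fun setT (@tuple_uncons n).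
Proof.
apply/measurable_fun_pairP; split; first exact: measurable_tnth.
exact: measurable_behead.
Qed.

Fixpoint lebesgue_tuple n : {sigma_finite_measure set (n.-tuple mR) -> \bar R} :=
  if n is m.+1 then
    sigma_finite_image (@measurable_tuple_cons m) (@measurable_tuple_uncons m)
      (@tuple_consK m)
      (product_sigma_finite (@lebesgue_measure R) (lebesgue_tuple m))
  else \d_ ([tuple] : 0.-tuple mR).

Context (d : nat).

Let row_of (t : d.-tuple mR) : 'rV[R]_d := \row_i tnth t i.
Let unrow (v : 'rV[R]_d) : d.-tuple mR := [tuple v ord0 i | i < d].

Let row_ofK : cancel row_of unrow.
Proof. by move=> t; apply: eq_from_tnth => i; rewrite tnth_mktuple mxE. Qed.

Let mrow_of : measurable_fun [set: d.-tuple mR] row_of.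
Proof.
apply: (@measurability _ _ _ _ _ _ (@open 'rV[R]_d)) => //.
move=> _ [U oU <-]; rewrite setTI.
pose box (i : d.-tuple rat * nat) : set (d.-tuple mR) :=
  \bigcap_(j in [set: 'I_d])
    ((fun t => tnth t j) @^-1` ball (ratr (tnth i.1 j) : R) (i.2.+1%:R^-1)).
pose F k := if unpickle k is Some i then
  if `[< box i `<=` row_of @^-1` U >] then box i else set0 else set0.
have mbox i : measurable (box i).
  apply: fin_bigcap_measurable; first exact: finite_finset.
  move=> j _; rewrite -[X in measurable X]setTI.
  apply: measurable_tnth => //; by apply: open_measurable; exact: ball_open.
suff -> : row_of @^-1` U = \bigcup_k F k.
  apply: bigcup_measurable => k _; rewrite /F.
  by case: unpickle => [i|//]; case: ifPn.
rewrite predeqE => t; split => [Ut|[k _]]; last first.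
  rewrite /F; case: unpickle => [i|//].
  by case: ifPn => // /asboolP; exact.
have /nbhs_ballP[e /= e0 eU] := open_nbhs_nbhs (conj oU Ut).
have [k ke] : exists k : nat, (k.+1%:R^-1 < e / 2)%R.
  exists (Num.truncn (e / 2)^-1); rewrite invf_plt ?posrE ?divr_gt0 ?ltr0n//.
  exact: truncnS_gt.
have k0 : (0 < k.+1%:R^-1 :> R)%R by rewrite invr_gt0 ltr0n.
have /boolp.choice[q qt] : forall j : 'I_d, exists q : rat,
    ball (tnth t j : R) (k.+1%:R^-1) (ratr q).
  move=> j; have [|x [tq [q _ qE]]] := @dense_rat R _ _
    (@ball_open R R^o (tnth t j : R) (k.+1%:R^-1)).
    by exists (tnth t j : R); exact: ballxx.
  by exists q; rewrite qE.
exists (pickle ([tuple q j | j < d], k)) => //.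
rewrite /F pickleK ifT; last first.
  apply/asboolP => s ts; apply: eU; split => // i j; rewrite !mxE.
  have := ts j I => /=; rewrite tnth_mktuple => qs.
  rewrite (splitr e).
  exact: ball_triangle (le_ball (ltW ke) (qt j)) (le_ball (ltW ke) qs).
by move=> j _ /=; rewrite tnth_mktuple; apply: ball_sym; exact: qt.
Qed.

Let munrow : measurable_fun [set: 'rV[R]_d] unrow.
Proof.
apply/measurable_fun_tnthP => i.
rewrite (_ : _ \o _ = fun v : 'rV[R]_d => v ord0 i); last first.
  by apply/funext => v /=; rewrite tnth_mktuple.
apply: (@measurability _ _ _ _ _ _ (@RGenOpens.G R)).
  exact: RGenOpens.measurableE.
move=> _ [_ [a [b ->] <-]]; rewrite setTI; apply: sub_sigma_algebra.
apply: open_comp; last exact: interval_open.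
by move=> v _; exact: coord_continuous.
Qed.

(* d-dimensional Lebesgue measure: iterated product of the one-dimensional one,
   transported from tuples to row vectors. *)
Definition lebesgue_rV : {sigma_finite_measure set 'rV[R]_d -> \bar R} :=
  sigma_finite_image mrow_of munrow row_ofK (sigma_finiteT (lebesgue_tuple d)).
End lebesgue_rV.

Section calculus.
Context {R : realType} {d : nat}.
Local Notation X := 'rV[R]_d.
Implicit Types (E V : set X) (f : X -> R).

Definition dotp (x y : X) : R := (x *m y^T) 0 0.

Definition partial (i : 'I_d) f : X -> R :=
  fun x => 'D_(delta_mx 0 i) (f : X -> R^o) x.

Definition grad f (x : X) : X := \row_i partial i f x.

Fixpoint Ck (k : nat) f : Prop :=
  if k is k'.+1 then
    (forall x, differentiable (f : X -> R^o) x) /\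
    (forall i, Ck k' (partial i f))
  else continuous (f : X -> R^o).

Definition smooth f : Prop := forall k, Ck k f.

Definition supp f : set X := closure [set x | f x != 0].

(* V \subset\subset E *)
Definition rel_compact E V : Prop :=
  [/\ exists2 U : set X, open U & V = E `&` U,
      compact (closure V) & closure V `<=` E].

Definition exhaustion E (V_ : nat -> set X) : Prop :=
  [/\ forall n, rel_compact E (V_ n),
      forall n, closure (V_ n) `<=` V_ n.+1 & \bigcup_n V_ n = E].

(* For E open: smooth functions with compact support in E (extended by 0).
   For E closed: elements of C_0^infty(R^d), considered on E only. *)
Definition C0infty E f : Prop :=
  [/\ smooth f, compact (supp f) & open E -> supp f `<=` E].

(* The support is that of the restriction of f to E. *)
Definition C0infty_in E V f : Prop :=
  C0infty E f /\ closure (E `&` [set x | f x != 0]) `<=` V.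

Definition loc_integrable (m : {measure set X -> \bar R}) E f : Prop :=
  forall K, compact K -> K `<=` E -> m.-integrable K (EFin \o f).

Definition open_or_closed_null_boundary E : Prop :=
  open E \/ (closed E /\ lebesgue_rV d (closure E `\` interior E) = 0%E).

Definition full_support (m : {measure set X -> \bar R}) E : Prop :=
  forall x, E x -> forall U, open U -> U x -> (0 < m (E `&` U))%E.

Definition symmetric_part (M : 'M[R]_d) : 'M[R]_d := 2^-1 *: (M + M^T).

Definition loc_elliptic E (A : X -> 'M[R]_d) : Prop :=
  forall V, rel_compact E V -> exists2 nu : R, 0 < nu &
    forall (xi x : X), V x ->
      nu^-1 * dotp xi xi
        <= \sum_i \sum_j symmetric_part (A x) i j * xi 0 i * xi 0 j
        <= nu * dotp xi xi.

End calculus.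

Section function_spaces.
Context {R : realType} {d : nat}.
Local Notation X := 'rV[R]_d.
Variable mu : {measure set X -> \bar R}.
Implicit Types (u w : X -> R) (L : (X -> R) -> (X -> R) -> Prop).

Definition ae_bounded u : Prop :=
  exists M : R, {ae mu, forall x, `|u x| <= M}.

(* Support of the measure |u| dmu. *)
Definition supp_density E u : set X :=
  [set x | E x /\ forall U, open U -> U x ->
     (0 < \int[mu]_(y in E `&` U) `|u y|%:E)%E].

Definition Lp_cvg (p : \bar R) (u_ : nat -> X -> R) u : Prop :=
  'N[mu]_p[EFin \o (u_ n \- u)%R]%E @[n --> \oo] --> 0%E.

Definition graph_closure L u w : Prop :=
  [/\ u \in Lfun mu 1, w \in Lfun mu 1 &
      exists u_ w_ : nat -> X -> R,
        [/\ forall n, L (u_ n) (w_ n), Lp_cvg 1 u_ u & Lp_cvg 1 w_ w]].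

(* u = (alpha - L)^{-1} f *)
Definition resolvent L (alpha : R) (f u : X -> R) : Prop :=
  exists2 w, L u w & {ae mu, forall x, alpha * u x - w x = f x}.

Record sub_markovian_C0_semigroup (p : \bar R)
    (T : R -> (X -> R) -> (X -> R)) : Prop := {
  semigroup_Lp : forall t f, 0 < t -> f \in Lfun mu p -> T t f \in Lfun mu p;
  semigroup_linear : forall t a f g,
    0 < t -> f \in Lfun mu p -> g \in Lfun mu p ->
    {ae mu, forall x, T t (fun y => a * f y + g y) x = a * T t f x + T t g x};
  semigroup_contraction : forall t f, 0 < t -> f \in Lfun mu p ->
    ('N[mu]_p[EFin \o T t f] <= 'N[mu]_p[EFin \o f])%E;
  semigroup_add : forall s t f, 0 < s -> 0 < t -> f \in Lfun mu p ->
    {ae mu, forall x, T (s + t) f x = T s (T t f) x};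
  semigroup_C0 : forall f, f \in Lfun mu p ->
    'N[mu]_p[EFin \o (T t f \- f)%R]%E @[t --> 0^'+] --> 0%E;
  semigroup_sub_markovian : forall t f, 0 < t -> f \in Lfun mu p ->
    {ae mu, forall x, 0 <= f x <= 1} ->
    {ae mu, forall x, 0 <= T t f x <= 1} }.

Definition semigroup_generator (p : \bar R)
    (T : R -> (X -> R) -> (X -> R)) u w : Prop :=
  [/\ u \in Lfun mu p, w \in Lfun mu p &
      'N[mu]_p[EFin \o (fun x => t^-1 * (T t u x - u x) - w x)%R]%E
        @[t --> 0^'+] --> 0%E].

(* int_0^N T_t f dt in L^1: since t |-> T_t f is continuous in L^1, with limit
   f at 0, this vector-valued integral is the L^1-limit of Riemann sums. *)
Definition time_integral (T : R -> (X -> R) -> (X -> R)) (N : R)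
    (f : X -> R) : X -> R :=
  xget (cst 0) [set h | h \in Lfun mu 1 /\
    Lp_cvg 1
      (fun n x => \sum_(i < n.+1) N / n.+1%:R * T (N * i.+1%:R / n.+1%:R) f x)
      h].

(* Gf for f >= 0; the integrals increase mu-a.e. with N, so integer N suffice. *)
Definition potential (T : R -> (X -> R) -> (X -> R)) (f : X -> R) :
    X -> \bar R :=
  fun x => limn (fun N : nat => (time_integral T N%:R f x)%:E).

Definition transient_L1 (T : R -> (X -> R) -> (X -> R)) : Prop :=
  exists g, [/\ g \in Lfun mu 1, {ae mu, forall x, 0 < g x} &
    {ae mu, forall x, (potential T g x < +oo)%E}].

Definition L1_L2_consistent (Tb T : R -> (X -> R) -> (X -> R)) : Prop :=
  forall t f, 0 < t -> f \in Lfun mu 1 -> f \in Lfun mu 2%:E ->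
    {ae mu, forall x, T t f x = Tb t f x}.

(* Transience of a semigroup on L^2 is that of its extension to L^1. *)
Definition transient (T : R -> (X -> R) -> (X -> R)) : Prop :=
  exists Tb, [/\ sub_markovian_C0_semigroup 1 Tb, L1_L2_consistent Tb T &
    transient_L1 Tb].

End function_spaces.

Section forms.
Context {R : realType} {d : nat}.
Local Notation X := 'rV[R]_d.
Variables (E : set X) (mu : {measure set X -> \bar R}) (A : X -> 'M[R]_d).
Implicit Types (C D : set (X -> R)) (f g u v w : X -> R) (V : set X).

(* E^0 on smooth functions; grad f x *m (A x)^T is the row vector A grad f. *)
Definition form0 f g : R :=
  \int[mu]_(x in E) dotp (grad f x *m (A x)^T) (grad g x).

Definition form_cauchy (a : (X -> R) -> (X -> R) -> R)
    (u_ : nat -> X -> R) : Prop :=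
  forall e, 0 < e -> exists N : nat, forall m n, (N <= m)%N -> (N <= n)%N ->
    a (u_ m \- u_ n) (u_ m \- u_ n) < e.

Definition form_approx C (u_ : nat -> X -> R) u : Prop :=
  [/\ forall n, C (u_ n), form_cauchy form0 u_ & Lp_cvg mu 2%:E u_ u].

Definition closable_form : Prop :=
  forall u_ : nat -> X -> R, form_approx (C0infty E) u_ (cst 0) ->
    form0 (u_ n) (u_ n) @[n --> \oo] --> (0 : R).

Definition strong_sector : Prop :=
  exists2 K : R, 0 < K & forall f g, C0infty E f -> C0infty E g ->
    `|form0 f g| <= K * Num.sqrt (form0 f f) * Num.sqrt (form0 g g).

Definition closure_dom C : set (X -> R) :=
  [set u | u \in Lfun mu 2%:E /\ exists u_ : nat -> X -> R, form_approx C u_ u].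

(* D(E^0), D(E^{0,V}) and D(E^{0,E}) *)
Definition form_dom : set (X -> R) := closure_dom (C0infty E).
Definition form_dom_in V : set (X -> R) := closure_dom (C0infty_in E V).
Definition form_dom_loc : set (X -> R) :=
  [set u | exists2 V, rel_compact E V & form_dom_in V u].

(* The closed form E^0; it extends all the forms E^{0,V}. *)
Definition form u v : R :=
  xget 0 [set l | exists u_ v_ : nat -> X -> R,
    [/\ form_approx (C0infty E) u_ u, form_approx (C0infty E) v_ v &
        form0 (u_ n) (v_ n) @[n --> \oo] --> (l : R)]].

Definition wgrad u : X -> X :=
  xget (cst 0) [set F : X -> X |
    (forall i, measurable_fun E (fun x => F x 0 i : R)) /\
    exists2 u_ : nat -> X -> R, form_approx (C0infty E) u_ u &
      forall K : set X, compact K -> K `<=` E ->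
        (\int[mu]_(x in K) (dotp (grad (u_ n) x - F x)%R (grad (u_ n) x - F x)%R)%:E)%E
          @[n --> \oo] --> 0%E].

(* Generator on L^2(V, mu) of the restriction of E^0 to D. *)
Definition form_generator D V u w : Prop :=
  [/\ D u, w \in Lfun mu 2%:E, {ae mu, forall x, ~ V x -> w x = 0} &
      forall v, D v -> form u v = - \int[mu]_(x in E) (w x * v x)].

(* (L^0, D(L^0)) and (L^{0,V}, D(L^{0,V})) *)
Definition generator0 := form_generator form_dom E.
Definition generator0_in V := form_generator (form_dom_in V) V.

(* D(L^0)_{0,b} *)
Definition generator0_dom_0b : set (X -> R) :=
  [set u | [/\ exists w, generator0 u w, compact (supp_density mu E u) &
     ae_bounded mu u]].

Definition dense_generator0_dom_0b : Prop :=
  (forall u, generator0_dom_0b u -> u \in Lfun mu 1) /\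
  (forall f e, f \in Lfun mu 1 -> 0 < e ->
    exists2 u, generator0_dom_0b u & ('N[mu]_1[EFin \o (f \- u)%R] < e%:E)%E).

Definition form_transient : Prop :=
  exists T0, [/\ sub_markovian_C0_semigroup mu 2%:E T0,
    forall u w, semigroup_generator mu 2%:E T0 u w <-> generator0 u w &
    transient mu T0].

Definition extended_approx (g_ : nat -> X -> R) g : Prop :=
  [/\ forall n, form_dom (g_ n), form_cauchy form g_ &
      {ae mu, forall x, g_ n x @[n --> \oo] --> (g x : R)}].

(* Elements are finite mu-a.e., hence represented by real-valued functions. *)
Definition extended_space : set (X -> R) :=
  [set g | measurable_fun setT g /\ exists g_ : nat -> X -> R, extended_approx g_ g].

Definition extended_form g u : R :=
  xget 0 [set l | exists2 g_ : nat -> X -> R, extended_approx g_ g &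
    form (g_ n) u @[n --> \oo] --> (l : R)].

Variable B : X -> X.

Definition L2_loc_field : Prop :=
  (forall i, measurable_fun E (fun x => B x 0 i)) /\
  loc_integrable mu E (fun x => dotp (B x) (B x)).

Definition divergence_free : Prop :=
  forall f, C0infty E f -> \int[mu]_(x in E) dotp (B x) (grad f x) = 0.

(* L^V u = L^{0,V} u + <B, grad u> on D(L^{0,V})_b, as an operator on
   L^1(V, mu). *)
Definition drift_op_in V u w : Prop :=
  [/\ ae_bounded mu u, w \in Lfun mu 1 &
      exists2 w0, generator0_in V u w0 &
        {ae mu, forall x, (V x -> w x = w0 x + dotp (B x) (wgrad u x)) /\
                          (~ V x -> w x = 0)}].

(* Tb is the semigroup on L^1(E, mu) whose resolvent is the mu-a.e. limit, along
   any exhaustion (V_n), of the resolvents of the closures of L^{V_n}. *)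
Record constructed_L1_semigroup (Tb : R -> (X -> R) -> (X -> R)) : Prop := {
  L1_semigroup : sub_markovian_C0_semigroup mu 1 Tb;
  L1_resolvent : forall alpha f (V_ : nat -> set X),
    0 < alpha -> f \in Lfun mu 1 -> exhaustion E V_ ->
    exists (u_ : nat -> X -> R) u,
      [/\ forall n, resolvent mu (graph_closure mu (drift_op_in (V_ n)))
                      alpha (f \_ (V_ n)) (u_ n),
          resolvent mu (semigroup_generator mu 1 Tb) alpha f u &
          {ae mu, forall x, u_ n x @[n --> \oo] --> (u x : R)}] }.

(* Known properties of the generator Lb of the semigroup constructed above: it
   extends L^0 u + <B, grad u> on D(L^0)_{0,b}, and D(Lb)_b is included in
   D(E^0) with an integration by parts formula and an energy inequality. *)
Record L1_generator_properties (Tb : R -> (X -> R) -> (X -> R)) : Prop := {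
  L1_generator_extends : forall u w0, generator0_dom_0b u -> generator0 u w0 ->
    exists2 w, semigroup_generator mu 1 Tb u w &
      {ae mu, forall x, E x -> w x = w0 x + dotp (B x) (wgrad u x)};
  L1_generator_dom : forall u w, semigroup_generator mu 1 Tb u w ->
    ae_bounded mu u -> form_dom u;
  L1_generator_by_parts : forall u w v, semigroup_generator mu 1 Tb u w ->
    ae_bounded mu u -> form_dom_loc v -> ae_bounded mu v ->
    form u v - \int[mu]_(x in E) (dotp (B x) (wgrad u x) * v x)
      = - \int[mu]_(x in E) (w x * v x);
  L1_generator_energy : forall u w, semigroup_generator mu 1 Tb u w ->
    ae_bounded mu u ->
    form u u <= - \int[mu]_(x in E) (w x * u x) }.

End forms.

(* Main.v *)
Require Import Defs.
From HB Require Import structures.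
From mathcomp Require Import finmap all_boot all_order all_algebra.
From mathcomp Require Import all_classical all_reals all_analysis.
From mathcomp Require Import measurable_realfun zify ring lra.
Set Implicit Arguments.
Unset Strict Implicit.
Unset Printing Implicit Defensive.
Import Order.TTheory GRing.Theory Num.Theory.
Import numFieldNormedType.Exports.
Local Open Scope classical_set_scope.
Local Open Scope ring_scope.

(* (a) If g > 0 has finite potential for the semigroup of E^0, divide it by one plus its
   potential to get g' > 0. Approximating the potential of g' by damped time integrals, whose
   energies stay bounded, yields |int g' w| <= C E^0(w, w)^(1/2) on the form domain. The time
   integrals h_N of g' for the perturbed semigroup satisfy E^0(h_N, h_N) <= int g' h_N, because B
   is divergence free, so int g' h_N <= C^2 and the potential of g' is finite.

   (b) If the semigroup were transient, one could truncate a function with finite potential to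
   g' >= 0 supported where that potential is at most k; by the maximum principle the damped
   potentials u_n of g' increase to some u <= k, with bounded energies. Near-minimizers of the
   energy over the convex sets of v with u_n <= v <= u that solve the equation as well as the u_j,
   j >= n, are E^0-Cauchy by the parallelogram identity; hence u lies in the extended Dirichlet
   space and E^0(u, chi_n) + int <B, grad chi_n> u = int g' chi_n, which tends to int g' > 0. *)

(** * Sequences, integrals and L^p spaces *)

Section real_sequences.
Context (R : realType).
Implicit Types (u v : nat -> R).

(** At the level of the form, normal contractions and weak compactness are both avoided. Truncation
    is done by composing smooth functions of compact support with the rational function
    [soft_trunc], which stays in that class; weak limits give way to near-minimizers, for which the
    parallelogram identity suffices because [form v v] does not see the antisymmetric part of [A].
    The values of [form], [wgrad] and [extended_form] are picked by [xget], so each needs existence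
    of a limit and its independence of the approximating sequence. For [extended_form] this is the
    fact that a form-Cauchy sequence tending to 0 almost everywhere, without convergence in L^2, has
    energies tending to 0. The energy inequality and the integration by parts concern bounded
    functions only, so every source is cut to values in [0, 1]: it then lies in L^1 and L^2, where
    the semigroups can be compared, and its time integral up to t is at most t. In (b) that bound
    blows up and the maximum principle supplies a uniform one. Damping at level 1/(n+1) up to time
    (n+1)^2 makes the level tend to 0 together with the remainder, of size e^-(n+1). *)

Lemma cvg_ge_cst u (l c : R) : u n @[n --> \oo] --> l ->
  (forall n, c <= u n) -> c <= l.
Proof.
move=> ul cu; rewrite -(cvg_lim _ ul)//; apply: limr_ge; first exact: cvgP ul.
exact: nearW.
Qed.

Lemma cvg_le_cst u (l c : R) : u n @[n --> \oo] --> l ->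
  (forall n, u n <= c) -> l <= c.
Proof.
move=> ul cu; rewrite -(cvg_lim _ ul)//; apply: limr_le; first exact: cvgP ul.
exact: nearW.
Qed.

Lemma cvg_le_cvg u v (l m : R) : u n @[n --> \oo] --> l ->
  v n @[n --> \oo] --> m -> (forall n, u n <= v n) -> l <= m.
Proof.
move=> ul vm uv; rewrite -subr_ge0; apply: (cvg_ge_cst (cvgB vm ul)) => n.
by rewrite /= subr_ge0.
Qed.

Lemma cvg_seqP u (l : R) : (forall e, 0 < e -> exists N : nat, forall n,
  (N <= n)%N -> `|u n - l| < e) <-> u n @[n --> \oo] --> l.
Proof.
split=> [H|H].
- apply/cvgrPdist_lt => e /H[N HN]; exists N => // n /= Nn.
  by rewrite distrC; exact: HN.
- move=> e e0; have /cvgrPdist_lt/(_ _ e0)[N _ HN] := H.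
  by exists N => n Nn; rewrite distrC; exact: HN.
Qed.

Lemma cvg_dist_le u v (l : R) : (forall n, `|u n - l| <= v n) ->
  v n @[n --> \oo] --> (0 : R) -> u n @[n --> \oo] --> l.
Proof.
move=> uv /cvg_seqP v0; apply/cvg_seqP => e /v0[N HN]; exists N => n Nn.
apply: (le_lt_trans (uv n)); apply: le_lt_trans (HN n Nn).
by rewrite subr0 ler_norm.
Qed.

Lemma ge_self_cvg (phi : nat -> nat) : (forall k, (k <= phi k)%N) ->
  phi k @[k --> \oo] --> \oo.
Proof.
by move=> H A [N _ HN]; exists N => // k /= Nk; apply: HN; exact: leq_trans (H k).
Qed.

Lemma cvg_subseq u (l : R) (phi : nat -> nat) : (forall k, (k <= phi k)%N) ->
  u n @[n --> \oo] --> l -> u (phi n) @[n --> \oo] --> l.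
Proof. by move=> /ge_self_cvg phioo; exact: cvg_comp. Qed.

Lemma cauchy_cvg_seq u : (forall e, 0 < e -> exists N : nat, forall m n,
  (N <= m)%N -> (N <= n)%N -> `|u m - u n| <= e) -> cvgn u.
Proof.
move=> H; apply/cauchy_cvgP/cauchy_exP => e e0.
have e20 : 0 < e / 2 by rewrite divr_gt0.
have [N HN] := H _ e20; exists (u N); exists N => // n /= Nn.
rewrite /ball/=; apply: le_lt_trans (HN N n (leqnn _) Nn) _.
by rewrite ltr_pdivrMr// ltr_pMr// ltr1n.
Qed.

End real_sequences.

Section real_integral.
Context d (T : measurableType d) (R : realType).
Variable mu : {measure set T -> \bar R}.
Implicit Types (D : set T) (f g : T -> R).

Lemma ae_foralln (P : nat -> set T) : (forall n, {ae mu, forall x, P n x}) ->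
  {ae mu, forall x, forall n, P n x}.
Proof. by move=> aP; exact/ae_foralln. Qed.

Lemma integrable_ae_le D f g : measurable D -> measurable_fun D f ->
  mu.-integrable D (EFin \o g) -> {ae mu, forall x, D x -> `|f x| <= g x} ->
  mu.-integrable D (EFin \o f).
Proof.
move=> mD mf ig fg.
have mg : measurable_fun D g by exact/measurable_EFinP/(measurable_int mu).
apply/integrableP; split; first exact/measurable_EFinP.
case/integrableP: ig => _; apply: le_lt_trans.
apply: ae_ge0_le_integral => //.
- by apply: measurableT_comp => //; exact/measurable_EFinP.
- by apply: measurableT_comp => //; exact/measurable_EFinP.
apply: filterS fg => x fg Dx /=; rewrite lee_fin (le_trans (fg Dx))//.
exact: ler_norm.
Qed.

Lemma ae_le_Rintegral D f g : measurable D ->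
  mu.-integrable D (EFin \o f) -> mu.-integrable D (EFin \o g) ->
  {ae mu, forall x, D x -> f x <= g x} ->
  \int[mu]_(x in D) f x <= \int[mu]_(x in D) g x.
Proof.
move=> mD if_ ig fg.
rewrite -subr_ge0 -RintegralB//.
have mf : measurable_fun D f by exact/measurable_EFinP/(measurable_int mu).
have mg : measurable_fun D g by exact/measurable_EFinP/(measurable_int mu).
have -> : \int[mu]_(x in D) (g x - f x) = \int[mu]_(x in D) `|g x - f x|.
  congr fine; apply: ae_eq_integral => //.
  - by apply/measurable_EFinP; exact: measurable_funB.
  - by apply/measurable_EFinP/measurableT_comp => //; exact: measurable_funB.
  - apply: filterS fg => x fg Dx; congr EFin; rewrite ger0_norm// subr_ge0.
    exact: fg.
exact: Rintegral_ge0.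
Qed.

Lemma ae_eq_Rintegral D f g : measurable D ->
  measurable_fun D f -> measurable_fun D g ->
  {ae mu, forall x, D x -> f x = g x} ->
  \int[mu]_(x in D) f x = \int[mu]_(x in D) g x.
Proof.
move=> mD mf mg fg; congr fine; apply: ae_eq_integral => //.
- exact/measurable_EFinP.
- exact/measurable_EFinP.
- by apply: filterS fg => x fg /fg ->.
Qed.

Lemma dominated_cvg_Rintegral D (f_ : nat -> T -> R) f g : measurable D ->
  (forall n, measurable_fun D (f_ n)) -> measurable_fun D f ->
  {ae mu, forall x, D x -> f_ n x @[n --> \oo] --> f x} ->
  mu.-integrable D (EFin \o g) ->
  (forall n, {ae mu, forall x, D x -> `|f_ n x| <= g x}) ->
  mu.-integrable D (EFin \o f) /\
  \int[mu]_(x in D) f_ n x @[n --> \oo] --> \int[mu]_(x in D) f x.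
Proof.
move=> mD mf_ mf f_f ig f_g.
have [|||||if0 _ cvgf] := @dominated_convergence _ T R mu D mD
  (fun n => EFin \o f_ n) (EFin \o f) (EFin \o g).
- by move=> n; exact/measurable_EFinP.
- exact/measurable_EFinP.
- by apply: filterS f_f => x H Dx; apply: cvg_EFin; [exact: nearW|exact: H].
- exact: ig.
- have := ae_foralln f_g; apply: filterS => x H n Dx /=; rewrite lee_fin.
  exact: H.
split => //.
apply: (@fine_cvg _ _ _ _ (fun n => \int[mu]_(x in D) (f_ n x)%:E)%E).
rewrite fineK; last exact: integrable_fin_num.
exact: cvgf.
Qed.

Lemma Rintegral_eq0_ae D f : measurable D -> mu.-integrable D (EFin \o f) ->
  (forall x, D x -> 0 <= f x) -> \int[mu]_(x in D) f x = 0 ->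
  {ae mu, forall x, D x -> f x = 0}.
Proof.
move=> mD if_ f0 intf.
have mf : measurable_fun D (EFin \o f) by exact: (measurable_int mu).
have H : ae_eq mu D (EFin \o f) (cst 0%E).
  apply/(ae_eq_integral_abs _ mD mf).
  rewrite (_ : (\int[mu]_(x in D) _)%E = (\int[mu]_(x in D) (f x)%:E)%E); last first.
    by apply: eq_integral => x /set_mem xD; rewrite /= ger0_norm ?f0.
  have := congr1 EFin intf; rewrite /Rintegral fineK//.
  exact: integrable_fin_num.
by apply: filterS H => x H /H [].
Qed.

(** The upper limit is measurable without any convergence and agrees with the limit wherever the
    latter exists, so one representative serves for almost everywhere limits. *)
Lemma ae_measurable_lim D (f_ : nat -> T -> R) : measurable D ->
  (forall n, measurable_fun D (f_ n)) ->
  exists2 f : T -> R, measurable_fun D f &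
    forall x, cvgn (f_ ^~ x) -> f_ n x @[n --> \oo] --> (f x : R).
Proof.
move=> mD mf_.
exists (fun x => fine (limn_esup (fun n => (f_ n x)%:E))).
  apply: (@measurableT_comp _ _ _ _ _ _ fine) => //.
  by apply: measurable_fun_limn_esup => n; exact/measurable_EFinP.
move=> x /cvg_ex[l fl].
have Hl : (f_ n x)%:E @[n --> \oo] --> l%:E.
  by apply: cvg_EFin => //; exact: nearW.
by rewrite (cvg_limn_einf_sup Hl).2.
Qed.

(** The functions [2 ^+ n * F n] have integrals at most [2^-1 ^+ n], hence an integrable and thus
    almost everywhere finite sum; it dominates each of its terms and serves as [M]. *)
Lemma rapid_ae D (F : nat -> T -> R) : measurable D ->
  (forall n, measurable_fun D (F n)) -> (forall n x, D x -> 0 <= F n x) ->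
  (forall n, \int[mu]_(x in D) (F n x)%:E <= (4^-1 ^+ n)%:E)%E ->
  {ae mu, forall x, D x -> exists M, forall n, F n x <= M * 2^-1 ^+ n}.
Proof.
move=> mD mF F0 intF.
pose G n x := (2 ^+ n * F n x)%:E.
have mG n : measurable_fun D (G n).
  by apply/measurable_EFinP; apply: measurable_funM.
have G0 n x : D x -> (0 <= G n x)%E.
  by move=> Dx; rewrite lee_fin mulr_ge0 ?exprn_ge0// F0.
have intG n : (\int[mu]_(x in D) G n x <= (2^-1 ^+ n)%:E)%E.
  rewrite /G; under eq_integral do rewrite EFinM.
  rewrite ge0_integralZl//; first last.
  - by move=> x Dx; rewrite lee_fin F0.
  - exact/measurable_EFinP.
  apply: (le_trans (lee_wpmul2l _ (intF n))); first by rewrite lee_fin exprn_ge0.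
  rewrite -EFinM lee_fin -exprMn.
  suff -> : 2 * 4^-1 = 2^-1 :> R by [].
  by field.
have SG : (\int[mu]_(x in D) (\sum_(n <oo) G n x) < +oo)%E.
  rewrite integral_nneseries//.
  have H : (\sum_(n <oo) (2^-1 ^+ n : R)%:E < +oo)%E.
    rewrite (@le_lt_trans _ _ 2%:E) ?ltry//.
    apply: lime_le.
      by apply: is_cvg_nneseries => n _ _; rewrite lee_fin exprn_ge0.
    apply: nearW => n; rewrite sumEFin lee_fin.
    have -> : \sum_(0 <= i < n) 2^-1 ^+ i = series (geometric 1 2^-1) n :> R.
      by rewrite /series /=; apply: eq_bigr => i _; rewrite mul1r.
    rewrite geometric_seriesE; last by rewrite lt_eqF// invf_lt1// ltr1n.
    have : 0 <= (2^-1 : R) ^+ n by rewrite exprn_ge0.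
    rewrite /= mul1r; set y := _ ^+ n => y0.
    have -> : (1 - y) / (1 - 2^-1) = 2 * (1 - y) :> R by field.
    lra.
  apply: le_lt_trans H; apply: lee_nneseries => n _.
  - by move=> _; apply: integral_ge0 => x Dx; exact: G0.
  - exact: intG.
have iS : mu.-integrable D (fun x => \sum_(n <oo) G n x)%E.
  apply/integrableP; split.
    apply: ge0_emeasurable_sum => //.
    by move=> n x Dx _; exact: G0.
  under eq_integral => x xD.
    rewrite gee0_abs; last first.
      by apply: nneseries_ge0 => n _ _; apply: G0; exact: set_mem.
    over.
  exact: SG.
have := integrable_ae mD iS; apply: filterS => x H Dx.
have := H Dx; set S := (\sum_(n <oo) _)%E => Sfin.
exists (fine S) => n.
have : (G n x <= S)%E.
  have G0x k : (0 <= G k x)%E by exact: G0.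
  apply: (@le_trans _ _ (\sum_(0 <= k < n.+1) G k x)%E).
    by rewrite big_nat_recr//= leeDr// sume_ge0.
  by apply: nneseries_lim_ge => k _ _; exact: G0x.
have F2 : (2 ^+ n * 2^-1 ^+ n = 1 :> R) by rewrite -exprMn divff ?expr1n.
rewrite -(fineK Sfin) lee_fin => GS.
have -> : F n x = 2 ^+ n * F n x * 2^-1 ^+ n by rewrite mulrAC F2 mul1r.
by apply: ler_wpM2r => //; rewrite exprn_ge0.
Qed.

Lemma geometric_cauchy_cvg (a : nat -> R) (M : R) :
  (forall n, `|a n.+1 - a n| <= M * 2^-1 ^+ n) -> cvgn a.
Proof.
move=> aM.
have -> : a = (fun n => a 0%N + series (fun k => a k.+1 - a k) n).
  apply/funext => n; rewrite /series /= telescope_sumr//.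
  by rewrite addrC subrK.
apply: is_cvgD; first exact: is_cvg_cst.
apply: normed_cvg.
apply: (@series_le_cvg _ _ (geometric M 2^-1)) => //.
- by move=> n /=.
- by move=> n /=; apply: le_trans (aM n).
- apply: is_cvg_geometric_series.
  by rewrite gtr0_norm// invf_lt1// ltr1n.
Qed.

End real_integral.

(** * L^p seminorms, completeness and almost everywhere convergent subsequences *)

Section Lp.
Context d (T : measurableType d) (R : realType).
Variables (mu : {measure set T -> \bar R}) (p : R).
Hypothesis p1 : 1 <= p.
Implicit Types (f g : T -> R).

Let p1E : (1 <= p%:E)%E. Proof. by rewrite lee_fin. Qed.
Let p0 : 0 < p. Proof. exact: lt_le_trans p1. Qed.

(** A real-valued seminorm, so that [lra] and limits of real sequences apply. It carries information
    only on [Lfun]: an infinite norm is sent to 0. *)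
Definition nrm f := fine ('N[mu]_p%:E[EFin \o f])%E.

Lemma Lfun_meas f : f \in Lfun mu p%:E -> measurable_fun setT f.
Proof. by rewrite inE => /andP[]; rewrite inE. Qed.

Lemma Lfun_fin f : f \in Lfun mu p%:E -> ('N[mu]_p%:E[EFin \o f] < +oo)%E.
Proof. by rewrite inE => /andP[_]; rewrite inE. Qed.

Lemma LfunI f : measurable_fun setT f -> ('N[mu]_p%:E[EFin \o f] < +oo)%E ->
  f \in Lfun mu p%:E.
Proof. by move=> mf nf; rewrite inE; apply/andP; split; rewrite inE. Qed.

Lemma nrmE f : f \in Lfun mu p%:E -> ('N[mu]_p%:E[EFin \o f] = (nrm f)%:E)%E.
Proof.
by move=> /Lfun_fin ff; rewrite /nrm fineK// ge0_fin_numE ?Lnorm_ge0.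
Qed.

Lemma nrm_ge0 f : 0 <= nrm f.
Proof. by apply: fine_ge0; exact: Lnorm_ge0. Qed.

Lemma LfunD f g : f \in Lfun mu p%:E -> g \in Lfun mu p%:E ->
  (fun x => f x + g x) \in Lfun mu p%:E.
Proof.
move=> lf lg; apply: LfunI.
  by apply: measurable_funD; exact: Lfun_meas.
apply: (le_lt_trans (eminkowski _ (Lfun_meas lf) (Lfun_meas lg) p1E)).
by rewrite lte_add_pinfty// Lfun_fin.
Qed.

Lemma nrmD f g : f \in Lfun mu p%:E -> g \in Lfun mu p%:E ->
  nrm (fun x => f x + g x) <= nrm f + nrm g.
Proof.
move=> lf lg; rewrite -lee_fin EFinD -!nrmE//; last exact: LfunD.
by apply: eminkowski => //; exact: Lfun_meas.
Qed.

Lemma LfunZ a f : f \in Lfun mu p%:E -> (fun x => a * f x) \in Lfun mu p%:E.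
Proof.
move=> lf; rewrite (_ : (fun x => _) = a \o* f).
  exact: Lfun_scale.
by apply/funext => x /=; rewrite mulrC.
Qed.

Lemma nrmZ a f : f \in Lfun mu p%:E -> nrm (fun x => a * f x) = `|a| * nrm f.
Proof.
move=> lf; apply: EFin_inj; rewrite EFinM -!nrmE//; last exact: LfunZ.
exact: (LnormZ (Lfun_Sub p1E lf) a).
Qed.

Lemma LfunN f : f \in Lfun mu p%:E -> (fun x => - f x) \in Lfun mu p%:E.
Proof.
move=> lf; have := LfunZ (-1) lf.
by under eq_fun do rewrite mulN1r.
Qed.

Lemma LfunB f g : f \in Lfun mu p%:E -> g \in Lfun mu p%:E ->
  (fun x => f x - g x) \in Lfun mu p%:E.
Proof. by move=> lf lg; apply: LfunD => //; exact: LfunN. Qed.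

Lemma Lfun0 : (fun _ : T => 0 : R) \in Lfun mu p%:E.
Proof.
apply: LfunI; first exact: measurable_cst.
by rewrite (_ : EFin \o _ = cst 0%E)// Lnorm0// gt_eqF// lte_fin.
Qed.

Lemma nrm0 : nrm (fun _ : T => 0 : R) = 0.
Proof. by rewrite /nrm (_ : EFin \o _ = cst 0%E)// Lnorm0// gt_eqF// lte_fin. Qed.

Lemma nrmN f : f \in Lfun mu p%:E -> nrm (fun x => - f x) = nrm f.
Proof.
move=> lf; have := nrmZ (-1) lf; rewrite normrN1 mul1r => <-.
by congr nrm; apply/funext => x; rewrite mulN1r.
Qed.

Lemma nrmB f g : f \in Lfun mu p%:E -> g \in Lfun mu p%:E ->
  nrm (fun x => f x - g x) <= nrm f + nrm g.
Proof.
by move=> lf lg; rewrite -(nrmN lg); apply: nrmD => //; exact: LfunN.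
Qed.

Lemma nrmBC f g : f \in Lfun mu p%:E -> g \in Lfun mu p%:E ->
  nrm (fun x => f x - g x) = nrm (fun x => g x - f x).
Proof.
move=> lf lg; rewrite -nrmN; last exact: LfunB.
by congr nrm; apply/funext => x; rewrite opprB.
Qed.

Lemma nrm_triangle f g h : f \in Lfun mu p%:E -> g \in Lfun mu p%:E ->
  h \in Lfun mu p%:E ->
  nrm (fun x => f x - h x) <= nrm (fun x => f x - g x) + nrm (fun x => g x - h x).
Proof.
move=> lf lg lh.
have -> : (fun x => f x - h x) = (fun x => (f x - g x) + (g x - h x)).
  by apply/funext => x; rewrite addrA subrK.
by apply: nrmD; exact: LfunB.
Qed.

Lemma Lfun_sum (I : Type) (r : seq I) (F : I -> T -> R) :
  (forall i, F i \in Lfun mu p%:E) ->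
  (fun x => \sum_(i <- r) F i x) \in Lfun mu p%:E.
Proof.
move=> lF; elim: r => [|i r IH].
  rewrite (_ : (fun x => _) = (fun _ => 0)); first exact: Lfun0.
  by apply/funext => x; rewrite big_nil.
rewrite (_ : (fun x => _) = (fun x => F i x + \sum_(i <- r) F i x)).
  exact: LfunD.
by apply/funext => x; rewrite big_cons.
Qed.

Lemma nrm_sum (I : Type) (r : seq I) (F : I -> T -> R) :
  (forall i, F i \in Lfun mu p%:E) ->
  nrm (fun x => \sum_(i <- r) F i x) <= \sum_(i <- r) nrm (F i).
Proof.
move=> lF; elim: r => [|i r IH].
  rewrite (_ : (fun x => _) = (fun _ => 0)); first by rewrite nrm0 big_nil.
  by apply/funext => x; rewrite big_nil.
rewrite (_ : (fun x => _) = (fun x => F i x + \sum_(i <- r) F i x)).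
  rewrite big_cons (le_trans (nrmD _ _))//; first exact: Lfun_sum.
  by rewrite lerD2l.
by apply/funext => x; rewrite big_cons.
Qed.

Lemma Lnorm_ae_le f g : measurable_fun setT f -> measurable_fun setT g ->
  {ae mu, forall x, `|f x| <= `|g x|} ->
  ('N[mu]_p%:E[EFin \o f] <= 'N[mu]_p%:E[EFin \o g])%E.
Proof.
move=> mf mg fg; rewrite unlock /Lnorm.
have pw (h : T -> R) : measurable_fun setT h -> measurable_fun setT (fun x => ((`|h x|) `^ p)%:E).
  move=> mh; apply/measurable_EFinP.
  apply: (@measurableT_comp _ _ _ _ _ _ (fun y : R => y `^ p)) => //.
  exact: measurableT_comp.
apply: gt0_ler_poweR.
- by rewrite invr_ge0 ltW.
- by rewrite in_itv/= leey integral_ge0// => x _; exact: poweR_ge0.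
- by rewrite in_itv/= leey integral_ge0// => x _; exact: poweR_ge0.
apply: ae_ge0_le_integral => //.
- by move=> x _; exact: poweR_ge0.
- exact: (pw f).
- by move=> x _; exact: poweR_ge0.
- exact: (pw g).
apply: filterS fg => x fg _; rewrite /= lee_fin.
by rewrite ge0_ler_powR ?nnegrE// ltW.
Qed.

Lemma Lfun_le f g : measurable_fun setT f -> g \in Lfun mu p%:E ->
  {ae mu, forall x, `|f x| <= `|g x|} -> f \in Lfun mu p%:E.
Proof.
move=> mf lg fg; apply: LfunI => //; apply: le_lt_trans (Lfun_fin lg).
by apply: Lnorm_ae_le => //; exact: Lfun_meas.
Qed.

Lemma nrm_le f g : measurable_fun setT f -> g \in Lfun mu p%:E ->
  {ae mu, forall x, `|f x| <= `|g x|} -> nrm f <= nrm g.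
Proof.
move=> mf lg fg; have lf := Lfun_le mf lg fg.
rewrite -lee_fin -!nrmE//.
by apply: Lnorm_ae_le => //; exact: Lfun_meas.
Qed.

Lemma nrm_ae_eq f g : measurable_fun setT f -> g \in Lfun mu p%:E ->
  {ae mu, forall x, f x = g x} -> nrm f = nrm g.
Proof.
move=> mf lg fg; have lf : f \in Lfun mu p%:E.
  by apply: (Lfun_le mf lg); apply: filterS fg => x ->.
apply/eqP; rewrite eq_le; apply/andP; split; apply: nrm_le => //.
- by apply: filterS fg => x ->.
- exact: Lfun_meas.
- by apply: filterS fg => x ->.
Qed.

Lemma nrm0_ae f : f \in Lfun mu p%:E -> nrm f = 0 -> {ae mu, forall x, f x = 0}.
Proof.
move=> lf f0; have := @fine_Lnormr_eq0 _ T R mu p%:E p1E (Lfun_Sub p1E lf) f0.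
by apply: filterS => x /(_ I).
Qed.

Lemma Lnorm_cvgP (u_ : nat -> T -> R) u :
  (forall n, u_ n \in Lfun mu p%:E) -> u \in Lfun mu p%:E ->
  ('N[mu]_p%:E[EFin \o (u_ n \- u)%R]%E @[n --> \oo] --> 0%E) <->
  (nrm (fun x => u_ n x - u x) @[n --> \oo] --> (0 : R)).
Proof.
move=> lu_ lu.
have E n : ('N[mu]_p%:E[EFin \o (u_ n \- u)%R] = (nrm (fun x => u_ n x - u x)%R)%:E)%E.
  by rewrite -nrmE//; exact: LfunB.
split=> [|H].
- under eq_fun do rewrite E.
  by move/fine_cvg.
- by under eq_fun do rewrite E; apply: cvg_EFin => //; exact: nearW.
Qed.

Lemma integral_powR_nrm f : f \in Lfun mu p%:E ->
  (\int[mu]_x ((`|f x|) `^ p)%:E)%E = ((nrm f) `^ p)%:E.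
Proof.
move=> lf; rewrite -poweR_EFin -nrmE// powR_Lnorm ?gt_eqF//.
Qed.

(** Here 8 = 2 * 4: after multiplication by [2 ^+ n] the norms are at most [4^-1 ^+ n], and so are
    their p-th powers since p >= 1. [rapid_ae] then bounds the p-th power of [2 ^+ n * f_ n x]
    uniformly in n, and a p-th root gives the rate. *)
Lemma rapid_Lp (f_ : nat -> T -> R) : (forall n, f_ n \in Lfun mu p%:E) ->
  (forall n, nrm (f_ n) <= 8^-1 ^+ n) ->
  {ae mu, forall x, exists M, forall n, `|f_ n x| <= M * 2^-1 ^+ n}.
Proof.
move=> lf nf.
have lg n : (fun x => 2 ^+ n * f_ n x) \in Lfun mu p%:E by exact: LfunZ.
pose F n x := (`|2 ^+ n * f_ n x|) `^ p.
have : {ae mu, forall x, setT x -> exists M, forall n, F n x <= M * 2^-1 ^+ n}.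
  apply: rapid_ae => //.
  - move=> n; apply: (@measurableT_comp _ _ _ _ _ _ (fun y : R => y `^ p)) => //.
    by apply: measurableT_comp => //; exact: (Lfun_meas (lg n)).
  - by move=> n x _; exact: powR_ge0.
  - move=> n; rewrite integral_powR_nrm// lee_fin nrmZ//.
    have H : `|2 ^+ n| * nrm (f_ n) <= 4^-1 ^+ n.
      rewrite ger0_norm ?exprn_ge0//.
      apply: (le_trans (ler_wpM2l _ (nf n))); first by rewrite exprn_ge0.
      by rewrite -exprMn (_ : 2 * 8^-1 = 4^-1 :> R)//; field.
    apply: (@le_trans _ _ ((4^-1 ^+ n) `^ p)).
      rewrite ge0_ler_powR// ?nnegrE ?exprn_ge0//; first exact: ltW.
      by rewrite mulr_ge0// nrm_ge0.
    rewrite -{2}[4^-1 ^+ n](@powRr1 R) ?exprn_ge0//.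
    apply: ger_powR => //; rewrite exprn_gt0//=.
    by rewrite exprn_ile1// invf_le1// ler1n.
apply: filterS => x /(_ I)[M HM].
have M0 : 0 <= M.
  by have := HM 0%N; rewrite expr0 mulr1; apply: le_trans; exact: powR_ge0.
exists (M `^ p^-1) => n.
have H : F n x <= M.
  by apply: (le_trans (HM n)); rewrite ler_piMr// exprn_ile1// invf_le1// ler1n.
have : `|2 ^+ n * f_ n x| <= M `^ p^-1.
  have <- : (F n x) `^ p^-1 = `|2 ^+ n * f_ n x|.
    by rewrite /F -powRrM divff ?gt_eqF// powRr1.
  by rewrite ge0_ler_powR ?nnegrE ?powR_ge0// invr_ge0 ltW.
rewrite normrM ger0_norm ?exprn_ge0// => H2.
by rewrite exprVn ler_pdivlMr ?exprn_gt0// mulrC.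
Qed.

(** The power is [expR (p * ln y)] only for y > 0. When the limit is 0, the inequality y^p <= y for
    0 < y <= 1 squeezes instead. *)
Lemma cvg_powR (y : nat -> R) l : (forall n, 0 <= y n) ->
  y n @[n --> \oo] --> l -> (y n) `^ p @[n --> \oo] --> l `^ p.
Proof.
move=> y0 yl.
have l0 : 0 <= l.
  exact: (cvg_ge_cst yl).
move: l0; rewrite le_eqVlt => /predU1P[l0|l0].
- rewrite -l0 powR0 ?gt_eqF//.
  rewrite -l0 in yl.
  apply: (@squeeze_cvgr _ _ _ _ (cst 0) y) => //; last exact: cvg_cst.
  near=> n; rewrite powR_ge0/=.
  have y1 : y n <= 1.
    by near: n; apply: (cvgr_le _ yl).
  have := y0 n; rewrite le_eqVlt => /predU1P[<-|yn0].
    by rewrite powR0 ?gt_eqF.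
  rewrite -{2}[y n](@powRr1 R)//.
  by apply: ger_powR => //; rewrite yn0.
- have H : expR (p * ln (y n)) @[n --> \oo] --> expR (p * ln l).
    apply: (@continuous_cvg _ _ _ _ _ _ (fun z => expR z)); first exact: continuous_expR.
    apply: cvgM; first exact: cvg_cst.
    apply: (@continuous_cvg _ _ _ _ _ _ (fun z => ln z)) => //.
    exact: continuous_ln.
  rewrite /powR (gt_eqF l0).
  apply: cvg_trans H; apply: near_eq_cvg; near=> n.
  by rewrite gt_eqF//; near: n; apply: (cvgr_gt _ yl).
Unshelve. all: by end_near. Qed.

(** Fatou's lemma for the p-th powers. It also yields membership in L^p, which is how limits known
    only almost everywhere are shown to lie in the space. *)
Lemma Lp_fatou (f_ : nat -> T -> R) f M : (forall n, f_ n \in Lfun mu p%:E) ->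
  measurable_fun setT f ->
  {ae mu, forall x, f_ n x @[n --> \oo] --> (f x : R)} ->
  (forall n, nrm (f_ n) <= M) -> f \in Lfun mu p%:E /\ nrm f <= M.
Proof.
move=> lf mf ff fM.
have M0 : 0 <= M := le_trans (nrm_ge0 (f_ 0%N)) (fM 0%N).
have pw (h : T -> R) : measurable_fun setT h -> measurable_fun setT (fun x => ((`|h x|) `^ p)%:E).
  move=> mh; apply/measurable_EFinP.
  apply: (@measurableT_comp _ _ _ _ _ _ (fun y : R => y `^ p)) => //.
  exact: measurableT_comp.
have H : (\int[mu]_x ((`|f x|) `^ p)%:E <= (M `^ p)%:E)%E.
  apply: (@le_trans _ _ (\int[mu]_x limn_einf (fun n => ((`|f_ n x|) `^ p)%:E))%E).
    apply: ae_ge0_le_integral => //.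
    - exact: pw.
    - move=> x _; rewrite limn_einf_lim; apply: lime_ge.
        exact: is_cvg_einfs.
      by apply: nearW => n; apply: le_ereal_inf_tmp => _ [k _ <-]; rewrite lee_fin powR_ge0.
    - rewrite (_ : (fun x => _) = (fun x => - limn_esup (fun n => - ((`|f_ n x|) `^ p)%:E))%E)//.
      apply: measurableT_comp => //; apply: measurable_fun_limn_esup => n.
      by apply: measurableT_comp => //; apply: pw; exact: (Lfun_meas (lf n)).
    - apply: filterS ff => x fx _.
      have C : (`|f_ n x| `^ p)%:E @[n --> \oo] --> (`|f x| `^ p)%:E.
        apply: cvg_EFin; first exact: nearW.
        by apply: cvg_powR => //; exact: cvg_norm.
      by rewrite (cvg_limn_einf_sup C).1.
  apply: (le_trans (fatou _ measurableT _ _)).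
  - by move=> n; apply: pw; exact: (Lfun_meas (lf n)).
  - by move=> n x _; rewrite lee_fin powR_ge0.
  rewrite limn_einf_lim; apply: lime_le; first exact: is_cvg_einfs.
  apply: nearW => n; apply: (@le_trans _ _ (\int[mu]_x ((`|f_ n x|) `^ p)%:E)%E).
    by apply: ereal_inf_lbound; exists n => /=.
  rewrite integral_powR_nrm// lee_fin ge0_ler_powR// ?nnegrE ?nrm_ge0//.
  exact: ltW.
have lff : f \in Lfun mu p%:E.
  apply: LfunI => //; rewrite unlock /Lnorm poweR_lty//.
  by apply: le_lt_trans (ltry (M `^ p)); exact: H.
split => //; move: H; rewrite integral_powR_nrm// lee_fin => H.
rewrite -(@powRr1 _ (nrm f)) ?nrm_ge0// -(@powRr1 _ M)//.
rewrite -(divff (lt0r_neq0 p0)) !powRrM ge0_ler_powR ?nnegrE ?powR_ge0//.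
by rewrite invr_ge0 ltW.
Qed.

(** Summing the thresholds up to k and adding k makes the selection monotone and at least k at
    once. *)
Lemma fast_subseq (P : nat -> nat -> Prop) :
  (forall k, exists N, forall n, (N <= n)%N -> P k n) ->
  exists phi : nat -> nat, [/\ forall k, (k <= phi k)%N,
    {homo phi : m n / (m <= n)%N} & forall k n, (phi k <= n)%N -> P k n].
Proof.
move=> /boolp.choice[N HN].
exists (fun k => (\sum_(i < k.+1) N i + k)%N); split.
- by move=> k; rewrite leq_addl.
- apply: homo_leq => [m|m n l|m]; [exact: leqnn|exact: leq_trans|].
  by rewrite [X in (_ <= X + _)%N]big_ord_recr/= leq_add// leq_addr.
- move=> k n kn; apply: HN; apply: leq_trans kn.
  by rewrite big_ord_recr/= addnAC leq_addl.
Qed.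

Definition nrm_cauchy (u_ : nat -> T -> R) := forall e, 0 < e ->
  exists N : nat, forall m n, (N <= m)%N -> (N <= n)%N ->
    nrm (fun x => u_ m x - u_ n x) < e.

Lemma Lp_cauchy_ae (u_ : nat -> T -> R) : (forall n, u_ n \in Lfun mu p%:E) ->
  nrm_cauchy u_ -> exists phi u, [/\ forall k, (k <= phi k)%N,
    measurable_fun setT u &
    {ae mu, forall x, u_ (phi k) x @[k --> \oo] --> (u x : R)}].
Proof.
move=> lu cu.
have [phi [phi1 phi2 phi3]] : exists phi : nat -> nat,
    [/\ forall k, (k <= phi k)%N, {homo phi : m n / (m <= n)%N} &
    forall k n, (phi k <= n)%N -> forall m, (n <= m)%N ->
       nrm (fun x => u_ m x - u_ n x) < 8^-1 ^+ k].
  apply: fast_subseq => k; have [|N HN] := cu (8^-1 ^+ k); first by rewrite exprn_gt0.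
  exists N => n Nn m nm; apply: HN => //; exact: leq_trans nm.
have [u mu_ Hu] := @ae_measurable_lim _ T R setT (fun k => u_ (phi k)) measurableT
  (fun k => Lfun_meas (lu (phi k))).
exists phi, u; split => //.
have := @rapid_Lp (fun k x => u_ (phi k.+1) x - u_ (phi k) x).
case.
- by move=> n; exact: LfunB.
- by move=> n; apply/ltW/phi3 => //; exact: phi2.
move=> A [mA A0 sA]; exists A; split => //; apply: subset_trans sA.
move=> x /= Hx [M HM]; apply: Hx; apply: Hu.
exact: geometric_cauchy_cvg HM.
Qed.

(** The almost everywhere limit of a fast subsequence is the limit in norm: for fixed n, Fatou's
    lemma is applied to [u_ n - u_ (phi (k + N))] as k grows. *)
Lemma Lp_complete (u_ : nat -> T -> R) : (forall n, u_ n \in Lfun mu p%:E) ->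
  nrm_cauchy u_ -> exists2 u, u \in Lfun mu p%:E &
    nrm (fun x => u_ n x - u x) @[n --> \oo] --> (0 : R).
Proof.
move=> lu cu; have [phi [u [phi1 mu_ Hu]]] := Lp_cauchy_ae lu cu.
have key e : 0 < e -> exists N : nat, forall n, (N <= n)%N ->
    (fun x => u_ n x - u x) \in Lfun mu p%:E /\ nrm (fun x => u_ n x - u x) <= e.
  move=> e0; have [N HN] := cu _ e0; exists N => n Nn.
  apply: (@Lp_fatou (fun k x => u_ n x - u_ (phi (k + N)%N) x)).
  - by move=> k; exact: LfunB.
  - by apply: measurable_funB => //; exact: Lfun_meas (lu n).
  - apply: filterS Hu => x ux; apply: cvgB; first exact: cvg_cst.
    apply: (cvg_subseq (u := fun k => u_ (phi k) x) (phi := fun k => (k + N)%N)) => //.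
    by move=> k; exact: leq_addr.
  - move=> k; apply/ltW/HN => //.
    by apply: leq_trans (phi1 _); exact: leq_addl.
exists u.
  (* [u] is recovered as [u_ N] minus a function of L^p. *)
  have [N HN] := key 1 ltr01.
  have [H _] := HN N (leqnn _).
  have := LfunB (lu N) H.
  by under eq_fun do rewrite opprB addrCA subrr addr0.
apply/cvgrPdist_le => e e0; have [N HN] := key e e0.
exists N => // n /= Nn; rewrite sub0r normrN ger0_norm ?nrm_ge0//.
by have [] := HN n Nn.
Qed.

Lemma nrm_cvg_cauchy (u_ : nat -> T -> R) u : (forall n, u_ n \in Lfun mu p%:E) ->
  u \in Lfun mu p%:E -> nrm (fun x => u_ n x - u x) @[n --> \oo] --> (0 : R) ->
  nrm_cauchy u_.
Proof.
move=> lu_ lu H e e0; have e2 : 0 < e / 2 by rewrite divr_gt0.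
have /cvgrPdist_lt/(_ _ e2)[N _ HN] := H.
exists N => m n Nm Nn; apply: (le_lt_trans (nrm_triangle (lu_ m) lu (lu_ n))).
rewrite (splitr e); apply: ltrD.
  by have := HN m Nm; rewrite sub0r normrN ger0_norm ?nrm_ge0.
by have := HN n Nn; rewrite sub0r normrN ger0_norm ?nrm_ge0// nrmBC.
Qed.

(** A subsequence converges almost everywhere to some [v]; Fatou's lemma then puts the norm of
    [u - v] below every e > 0. *)
Lemma Lp_cvg_ae (u_ : nat -> T -> R) u : (forall n, u_ n \in Lfun mu p%:E) ->
  u \in Lfun mu p%:E -> nrm (fun x => u_ n x - u x) @[n --> \oo] --> (0 : R) ->
  exists2 phi, (forall k, (k <= phi k)%N) &
    {ae mu, forall x, u_ (phi k) x @[k --> \oo] --> (u x : R)}.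
Proof.
move=> lu_ lu Hu.
have [phi [v [phi1 mv Hv]]] := Lp_cauchy_ae lu_ (nrm_cvg_cauchy lu_ lu Hu).
exists phi => //.
have phioo := ge_self_cvg phi1.
have key e : 0 < e -> (fun x => u x - v x) \in Lfun mu p%:E /\ nrm (fun x => u x - v x) <= e.
  move=> e0.
  have /cvgrPdist_le/(_ _ e0)[N _ HN] := Hu.
  apply: (@Lp_fatou (fun k x => u x - u_ (phi (k + N)%N) x)).
  - by move=> k; exact: LfunB.
  - by apply: measurable_funB => //; exact: Lfun_meas lu.
  - apply: filterS Hv => x ux; apply: cvgB; first exact: cvg_cst.
    apply: (cvg_subseq (u := fun k => u_ (phi k) x) (phi := fun k => (k + N)%N)) => //.
    by move=> k; exact: leq_addr.
  - move=> k; rewrite nrmBC//.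
    have := HN (phi (k + N)%N); rewrite sub0r normrN ger0_norm ?nrm_ge0//; apply => /=.
    by apply: leq_trans (phi1 _); exact: leq_addl.
have H0 : nrm (fun x => u x - v x) = 0.
  apply/eqP; rewrite eq_le nrm_ge0 andbT; apply/ler_addgt0Pr => e e0.
  by rewrite add0r; have [] := key _ e0.
have := nrm0_ae (key 1 ltr01).1 H0.
apply: filterS2 Hv => x ux /eqP; rewrite subr_eq0 => /eqP E.
by rewrite E.
Qed.

End Lp.

Section Lp_order.
Context d (T : measurableType d) (R : realType).
Variables (mu : {measure set T -> \bar R}).

(** The exponents may differ, because semigroups on L^2 and on L^1 are compared later. Subsequences
    are extracted one after the other, the second inside the first. *)
Lemma Lp_cvg_le (p q : R) (u_ v_ : nat -> T -> R) u v : 1 <= p -> 1 <= q ->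
  (forall n, u_ n \in Lfun mu p%:E) -> u \in Lfun mu p%:E ->
  (forall n, v_ n \in Lfun mu q%:E) -> v \in Lfun mu q%:E ->
  nrm mu p (fun x => u_ n x - u x) @[n --> \oo] --> (0 : R) ->
  nrm mu q (fun x => v_ n x - v x) @[n --> \oo] --> (0 : R) ->
  (forall n, {ae mu, forall x, u_ n x <= v_ n x}) ->
  {ae mu, forall x, u x <= v x}.
Proof.
move=> p1 q1 lu_ lu lv_ lv Hu Hv uv.
have [phi phi1 phiu] := Lp_cvg_ae p1 lu_ lu Hu.
have lv_' n : v_ (phi n) \in Lfun mu q%:E by [].
have phioo := ge_self_cvg phi1.
have Hv' : nrm mu q (fun x => v_ (phi n) x - v x) @[n --> \oo] --> (0 : R).
  exact: (cvg_comp _ _ phioo Hv).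
have [psi psi1 psiv] := Lp_cvg_ae q1 lv_' lv Hv'.
have psioo := ge_self_cvg psi1.
have := ae_foralln uv.
apply: filterS3 phiu psiv => x ux vx uvx.
have ux' : u_ (phi (psi n)) x @[n --> \oo] --> (u x : R).
  exact: (cvg_comp _ _ psioo ux).
exact: (cvg_le_cvg ux' vx).
Qed.

End Lp_order.

(** * Semigroups and their time integrals *)

Lemma at_right0P (R : realType) (P : R -> Prop) :
  (\forall t \near 0^'+, P t) <-> exists2 e : R, 0 < e & forall t, 0 < t < e -> P t.
Proof.
split.
- move=> /nbhs_ballP[e /= e0 He]; exists e => // t /andP[t0 te]; apply: He => //=.
  by rewrite /ball/= sub0r normrN gtr0_norm.
- move=> [e e0 He]; apply/nbhs_ballP; exists e => // t /=.
  rewrite /ball/= sub0r normrN => te t0; apply: He; rewrite t0/=.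
  by rewrite gtr0_norm in te.
Qed.

Lemma cvge_at_right0P (R : realType) (F : R -> \bar R) (g : R -> R) :
  (forall t, 0 < t -> F t = (g t)%:E) -> (forall t, 0 < t -> 0 <= g t) ->
  (F t @[t --> 0^'+] --> 0%E) <->
  (forall e : R, 0 < e -> exists2 del : R, 0 < del & forall t, 0 < t < del -> g t < e).
Proof.
move=> Fg g0; split => [H e e0|H].
- have /fine_cvg := H => /cvgrPdist_lt /(_ _ e0)/at_right0P[del del0 Hd].
  exists del => // t td; have t0 : 0 < t by case/andP: td.
  by have := Hd t td; rewrite /= Fg//= sub0r normrN ger0_norm// g0.
- have C : g t @[t --> 0^'+] --> (0 : R).
    apply/cvgrPdist_lt => e /H[del del0 Hd]; apply/at_right0P; exists del => // t td.
    have t0 : 0 < t by case/andP: td.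
    by rewrite sub0r normrN ger0_norm ?g0//; exact: Hd.
  have C' : (g t)%:E @[t --> 0^'+] --> 0%E by apply: cvg_EFin => //; exact: nearW.
  apply: cvg_trans C'; apply: near_eq_cvg; apply/at_right0P; exists 1 => // t /andP[t0 _].
  by rewrite Fg.
Qed.

Section semigroup.
Context (R : realType) (d : nat).
Local Notation X := 'rV[R]_d.
Variables (mu : {measure set X -> \bar R}) (p : R).
Hypothesis p1 : 1 <= p.
Implicit Types (f g u w : X -> R) (s t : R).

(** Right endpoints: [T] is meaningful at positive times only. *)
Definition riemann (T : R -> (X -> R) -> (X -> R)) (del : R) (k : nat) f : X -> R :=
  fun x => \sum_(i < k) del * T (del * i.+1%:R) f x.

(* For [p = 1] this is [time_integral]. *)
Definition Lp_time_integral (T : R -> (X -> R) -> (X -> R)) (N : R) f : X -> R :=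
  xget (cst 0) [set h | h \in Lfun mu p%:E /\
    Lp_cvg mu p%:E
      (fun n x => \sum_(i < n.+1) N / n.+1%:R * T (N * i.+1%:R / n.+1%:R) f x)
      h].

Section fixed_semigroup.
Variable T : R -> (X -> R) -> (X -> R).
Hypothesis HT : sub_markovian_C0_semigroup mu p%:E T.

Local Notation Lp := (Lfun mu p%:E).
Local Notation N := (nrm mu p).
Local Notation I := (Lp_time_integral T).

Lemma semigroup_meas t f : 0 < t -> f \in Lp -> measurable_fun setT (T t f).
Proof. by move=> t0 lf; apply: (@Lfun_meas _ _ _ mu p); exact: (semigroup_Lp HT). Qed.

Lemma semigroup_nrm t f : 0 < t -> f \in Lp -> N (T t f) <= N f.
Proof.
move=> t0 lf; have := semigroup_contraction HT t0 lf.
by rewrite !nrmE// ?lee_fin//; exact: (semigroup_Lp HT).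
Qed.

Lemma semigroup_0 t : 0 < t -> {ae mu, forall x, T t (fun _ => 0) x = 0}.
Proof.
move=> t0; have l0 := @Lfun0 _ _ _ mu p p1.
apply: (nrm0_ae p1); first exact: (semigroup_Lp HT).
apply/eqP; rewrite eq_le nrm_ge0 andbT.
by apply: (le_trans (semigroup_nrm t0 l0)); rewrite nrm0.
Qed.

Lemma semigroup_Z t a f : 0 < t -> f \in Lp ->
  {ae mu, forall x, T t (fun y => a * f y) x = a * T t f x}.
Proof.
move=> t0 lf.
have -> : (fun y => a * f y) = (fun y => a * f y + 0).
  by apply/funext => y; rewrite addr0.
have := semigroup_linear HT a t0 lf (@Lfun0 _ _ _ mu p p1).
by apply: filterS2 (semigroup_0 t0) => x -> ->; rewrite addr0.
Qed.

Lemma semigroup_B t f g : 0 < t -> f \in Lp -> g \in Lp ->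
  {ae mu, forall x, T t (fun y => f y - g y) x = T t f x - T t g x}.
Proof.
move=> t0 lf lg.
have -> : (fun y => f y - g y) = (fun y => -1 * g y + f y).
  by apply/funext => y; rewrite mulN1r addrC.
by apply: filterS (semigroup_linear HT (-1) t0 lg lf) => x ->; rewrite mulN1r addrC.
Qed.

Lemma semigroup_sum t (c : R) (I : Type) (r : seq I) (F : I -> X -> R) : 0 < t ->
  (forall i, F i \in Lp) ->
  {ae mu, forall x, T t (fun y => \sum_(i <- r) c * F i y) x
                    = \sum_(i <- r) c * T t (F i) x}.
Proof.
move=> t0 lF; elim: r => [|i r IH].
  have -> : (fun y => \sum_(i <- [::]) c * F i y) = (fun _ => 0).
    by apply/funext => y; rewrite big_nil.
  by apply: filterS (semigroup_0 t0) => x ->; rewrite big_nil.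
have -> : (fun y => \sum_(j <- i :: r) c * F j y)
  = (fun y => c * F i y + \sum_(j <- r) c * F j y).
  by apply/funext => y; rewrite big_cons.
have lS : (fun y => \sum_(i <- r) c * F i y) \in Lp.
  by apply: Lfun_sum => // j; exact: LfunZ.
apply: filterS2 IH (semigroup_linear HT c t0 (lF i) lS) => x IH ->.
by rewrite big_cons IH.
Qed.

Definition modulus f (e del : R) := forall s t, 0 < s -> 0 < t -> `|s - t| < del ->
  N (fun x => T s f x - T t f x) <= e.

(** Strong continuity at 0 becomes uniform over all positive times: T_t f - T_s f = T_s (T_(t-s) f -
    f) for s < t, and T_s is a contraction. *)
Lemma semigroup_modulus f e : f \in Lp -> 0 < e -> exists2 del, 0 < del &
  modulus f e del /\ forall t, 0 < t < del -> N (fun x => T t f x - f x) < e.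
Proof.
move=> lf e0.
have [H _] := @cvge_at_right0P R (fun t => 'N[mu]_p%:E[EFin \o (T t f \- f)%R]%E)
  (fun t => N (fun x => T t f x - f x)) (fun (t : R) (t0 : 0 < t) =>
   nrmE (LfunB p1 (semigroup_Lp HT t0 lf) lf)) (fun t _ => nrm_ge0 mu p _).
have [del del0 Hd] := H (semigroup_C0 HT lf) _ e0.
exists del => //; split => //.
have key s t : 0 < s -> s < t -> t - s < del ->
    N (fun x => T t f x - T s f x) <= e.
  move=> s0 st tsd.
  have ts0 : 0 < t - s by rewrite subr_gt0.
  have t0 : 0 < t := lt_trans s0 st.
  have lts := semigroup_Lp HT ts0 lf.
  apply: (@le_trans _ _ (N (T s (fun x => T (t - s) f x - f x)))).
    apply: nrm_le => //.
    - by apply: measurable_funB; exact: semigroup_meas.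
    - by apply: (semigroup_Lp HT) => //; exact: LfunB.
    - have := semigroup_add HT s0 ts0 lf; rewrite subrKC.
      by apply: filterS2 (semigroup_B s0 lts lf) => x -> ->.
  apply: (le_trans (semigroup_nrm s0 (LfunB p1 lts lf))).
  by apply/ltW/Hd; rewrite ts0.
move=> s t s0 t0 std; have [st|ts|<-] := ltgtP s t.
- rewrite (nrmBC p1); [|exact: (semigroup_Lp HT)|exact: (semigroup_Lp HT)].
  by apply: key => //; rewrite distrC gtr0_norm ?subr_gt0 in std.
- by apply: key => //; rewrite gtr0_norm ?subr_gt0 in std.
- under eq_fun do rewrite subrr.
  by rewrite nrm0// ltW.
Qed.

Lemma riemann_Lp del k f : 0 < del -> f \in Lp -> riemann T del k f \in Lp.
Proof.
move=> d0 lf; apply: Lfun_sum => // i; apply: LfunZ => //.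
by apply: (semigroup_Lp HT) => //; rewrite mulr_gt0.
Qed.

(** Each cell of length [del] is cut into [m.+1] pieces. All new evaluation times lie within [del]
    of the right endpoint of their cell, so a cell contributes at most [del * e]. *)
Lemma riemann_refine f e del0 del k m : f \in Lp -> modulus f e del0 ->
  0 < del -> del <= del0 ->
  N (fun x => riemann T del k f x - riemann T (del / m.+1%:R) (k * m.+1) f x)
    <= k%:R * del * e.
Proof.
move=> lf He d0 dd0.
have dm0 : 0 < del / m.+1%:R by rewrite divr_gt0.
elim: k => [|k IH].
  rewrite mul0n mul0r mul0r.
  under eq_fun do rewrite /riemann !big_ord0 subrr.
  by rewrite nrm0.
have m0 : (m.+1%:R : R) != 0 by rewrite pnatr_eq0.
have S (c : R) : \sum_(j < m.+1) del / m.+1%:R * c = del * c.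
  rewrite sumr_const card_ord -[LHS]mulr_natl; field.
  by rewrite addrC natr1.
pose D x := \sum_(j < m.+1) (del / m.+1%:R) *
  (T (del * k.+1%:R) f x - T (del / m.+1%:R * (k * m.+1 + j).+1%:R) f x).
have lTk : T (del * k.+1%:R) f \in Lp.
  by apply: (semigroup_Lp HT) => //; rewrite mulr_gt0.
have lTj (j : 'I_m.+1) : T (del / m.+1%:R * (k * m.+1 + j).+1%:R) f \in Lp.
  by apply: (semigroup_Lp HT) => //; rewrite mulr_gt0.
have -> : (fun x => riemann T del k.+1 f x - riemann T (del / m.+1%:R) (k.+1 * m.+1) f x)
  = (fun x => (riemann T del k f x - riemann T (del / m.+1%:R) (k * m.+1) f x) + D x).
  apply/funext => x; rewrite /D.
  under eq_bigr do rewrite mulrBr.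
  rewrite big_split/= sumrN S.
  rewrite /riemann big_ord_recr/= mulSnr.
  rewrite big_split_ord/=.
  by rewrite opprD !addrA; congr (_ - _); rewrite -!addrA; congr (_ + _); rewrite addrC.
have lD : D \in Lp by apply: Lfun_sum => // j; apply: LfunZ => //; exact: LfunB.
apply: (le_trans (nrmD p1 _ lD)).
  by apply: LfunB => //; exact: riemann_Lp.
rewrite -(natr1 k) !mulrDl mul1r lerD//.
apply: (le_trans (nrm_sum _ _ _)) => //.
  by move=> j; apply: LfunZ => //; exact: LfunB.
apply: (@le_trans _ _ (\sum_(j < m.+1) del / m.+1%:R * e)).
  apply: ler_sum => j _; rewrite nrmZ//; last exact: LfunB.
  rewrite gtr0_norm// ler_pM2l//; apply: He.
  - by rewrite mulr_gt0.
  - by rewrite mulr_gt0.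
  have -> : del * k.+1%:R - del / m.+1%:R * (k * m.+1 + j).+1%:R
     = del * ((m.+1%:R - j.+1%:R) / m.+1%:R).
    rewrite -(addnS (k * m.+1) j) natrD natrM -(natr1 k).
    by field; rewrite addrC natr1.
  have H1 : 0 <= (m.+1%:R - j.+1%:R) / m.+1%:R :> R.
    by rewrite divr_ge0//= subr_ge0 ler_nat.
  have H2 : (m.+1%:R - j.+1%:R) / m.+1%:R < 1 :> R.
    by rewrite ltr_pdivrMr// mul1r ltrBlDr ltrDl.
  rewrite ger0_norm; last by rewrite mulr_ge0// ltW.
  by apply: lt_le_trans dd0; rewrite gtr_pMr.
by rewrite S.
Qed.

Lemma riemann_sumE t n f x :
  \sum_(i < n.+1) t / n.+1%:R * T (t * i.+1%:R / n.+1%:R) f x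
  = riemann T (t / n.+1%:R) n.+1 f x.
Proof. by apply: eq_bigr => i _; rewrite (mulrAC t i.+1%:R). Qed.

Lemma div_lt_eventually t del : 0 < del -> exists M : nat, forall n,
  (M <= n)%N -> t / n.+1%:R < del.
Proof.
move=> d0; exists (Num.truncn (t / del)) => n Mn.
rewrite ltr_pdivrMr// mulrC -ltr_pdivrMr//.
apply: lt_le_trans (truncnS_gt _) _.
by rewrite ler_nat.
Qed.

(** Grids with [m.+1] and [n.+1] cells are both compared with their common refinement; each
    comparison costs t * (e / (3 t)) = e / 3. *)
Lemma riemann_cvg t f : 0 < t -> f \in Lp -> exists2 h, h \in Lp &
  N (fun x => riemann T (t / n.+1%:R) n.+1 f x - h x) @[n --> \oo] --> (0 : R).
Proof.
move=> t0 lf.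
have ld n : riemann T (t / n.+1%:R) n.+1 f \in Lp.
  by apply: riemann_Lp => //; rewrite divr_gt0.
apply: (Lp_complete p1 ld) => e e0.
have e30 : 0 < e / (3 * t) by rewrite divr_gt0// mulr_gt0.
have [del d0 [Hd _]] := semigroup_modulus lf e30.
have [M HM] := div_lt_eventually t d0; exists M => m n Mm Mn.
have C := @riemann_Lp (t / n.+1%:R / m.+1%:R) (n.+1 * m.+1)%N f _ lf.
have {}C : riemann T (t / n.+1%:R / m.+1%:R) (n.+1 * m.+1) f \in Lp.
  by apply: C; rewrite !divr_gt0.
apply: (le_lt_trans (nrm_triangle p1 (ld m) C (ld n))).
have te k : k.+1%:R * (t / k.+1%:R) * (e / (3 * t)) = e / 3.
  by field; rewrite gt_eqF//= addrC natr1.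
have H1 : N (fun x => riemann T (t / m.+1%:R) m.+1 f x
     - riemann T (t / n.+1%:R / m.+1%:R) (n.+1 * m.+1) f x) <= e / 3.
  have -> : t / n.+1%:R / m.+1%:R = t / m.+1%:R / n.+1%:R by rewrite mulrAC.
  rewrite mulnC -(te m); apply: (riemann_refine _ _ lf Hd).
  - by rewrite divr_gt0.
  - exact/ltW/HM.
have H2 : N (fun x => riemann T (t / n.+1%:R / m.+1%:R) (n.+1 * m.+1) f x
     - riemann T (t / n.+1%:R) n.+1 f x) <= e / 3.
  rewrite nrmBC// -(te n); apply: (riemann_refine _ _ lf Hd).
  - by rewrite divr_gt0.
  - exact/ltW/HM.
lra.
Qed.

Lemma time_integral_spec t f : 0 < t -> f \in Lp -> I t f \in Lp /\
  N (fun x => riemann T (t / n.+1%:R) n.+1 f x - I t f x) @[n --> \oo] --> (0 : R).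
Proof.
move=> t0 lf; have [h lh Hh] := riemann_cvg t0 lf.
have ld n : riemann T (t / n.+1%:R) n.+1 f \in Lp.
  by apply: riemann_Lp => //; rewrite divr_gt0.
have E : (fun n x => \sum_(i < n.+1) t / n.+1%:R * T (t * i.+1%:R / n.+1%:R) f x)
  = (fun n => riemann T (t / n.+1%:R) n.+1 f).
  by apply/funext => n; apply/funext => x; exact: riemann_sumE.
have : exists h, h \in Lp /\ Lp_cvg mu p%:E
   (fun n x => \sum_(i < n.+1) t / n.+1%:R * T (t * i.+1%:R / n.+1%:R) f x) h.
  exists h; split => //; rewrite E; exact/(Lnorm_cvgP p1 ld lh).
move=> /(xgetPex (cst 0)) [lI]; rewrite -/(I t f) E => HI; split => //.
exact/(Lnorm_cvgP p1 ld lI).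
Qed.

Lemma time_integral_Lp t f : 0 < t -> f \in Lp -> I t f \in Lp.
Proof. by move=> t0 lf; have [] := time_integral_spec t0 lf. Qed.

Lemma time_integral_approx f e del0 del k : f \in Lp -> modulus f e del0 ->
  0 < del -> del <= del0 ->
  N (fun x => I (k.+1%:R * del) f x - riemann T del k.+1 f x) <= k.+1%:R * del * e.
Proof.
move=> lf He d0 dd0.
have kd0 : 0 < k.+1%:R * del by rewrite mulr_gt0.
have [lI HI] := time_integral_spec kd0 lf.
have lr := @riemann_Lp del k.+1 f d0 lf.
have HI' : N (fun x => riemann T (del / m.+1%:R) (k.+1 * m.+1) f x
    - I (k.+1%:R * del) f x) @[m --> \oo] --> (0 : R).
  (* The index n stands for n+1 cells, whence the predecessor: [k.+1 * m.+1] cells on an interval of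
     length (k+1) del have length [del / m.+1]. *)
  have := cvg_subseq (phi := fun m => (k.+1 * m.+1).-1) _ HI.
  have -> : (fun m => N (fun x => riemann T (k.+1%:R * del / (k.+1 * m.+1).-1.+1%:R) (k.+1 * m.+1).-1.+1 f x
      - I (k.+1%:R * del) f x)) = (fun m => N (fun x => riemann T (del / m.+1%:R) (k.+1 * m.+1) f x
      - I (k.+1%:R * del) f x)).
    apply/funext => m; rewrite prednK ?muln_gt0//.
    have -> : k.+1%:R * del / (k.+1 * m.+1)%:R = del / m.+1%:R :> R.
      by rewrite natrM; field; rewrite !(addrC 1) !natr1 !pnatr_eq0.
    by [].
  apply => m; rewrite mulSn addSn/=; exact: leq_addr.
rewrite -[leRHS]add0r.
apply: (cvg_ge_cst (cvgD HI' (cvg_cst _))) => m /=.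
have lm : riemann T (del / m.+1%:R) (k.+1 * m.+1) f \in Lp.
  by apply: riemann_Lp => //; rewrite divr_gt0.
apply: (le_trans (nrm_triangle p1 lI lm lr)).
rewrite (nrmBC p1 lI lm) lerD2l nrmBC//.
exact: (riemann_refine _ _ lf He).
Qed.


Lemma nrm_le_eps f (c : R) : f \in Lp -> 0 <= c ->
  (forall e, 0 < e -> N f <= c * e) -> {ae mu, forall x, f x = 0}.
Proof.
move=> lf c0 H; apply: (nrm0_ae p1 lf).
apply/eqP; rewrite eq_le nrm_ge0 andbT; apply/ler_addgt0Pr => e e0.
rewrite add0r; have c10 : 0 < c + 1 by rewrite ltr_wpDl.
apply: (le_trans (H (e / (c + 1)) _)); first by rewrite divr_gt0.
by rewrite mulrA ler_pdivrMr// [leRHS]mulrC ler_pM2r// lerDl.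
Qed.

Lemma riemann_add del k l f : 0 < del -> f \in Lp ->
  {ae mu, forall x, riemann T del (k.+1 + l) f x
    = riemann T del k.+1 f x + T (k.+1%:R * del) (riemann T del l f) x}.
Proof.
move=> d0 lf; have kd0 : 0 < k.+1%:R * del by rewrite mulr_gt0.
have lTi (i : 'I_l) : T (del * i.+1%:R) f \in Lp.
  by apply: (semigroup_Lp HT) => //; rewrite mulr_gt0.
have H1 := semigroup_sum del (index_enum 'I_l) kd0 lTi.
have H2 : {ae mu, forall x, forall i, T (k.+1%:R * del + del * i.+1%:R) f x
     = T (k.+1%:R * del) (T (del * i.+1%:R) f) x}.
  apply: ae_foralln => i; apply: (semigroup_add HT) => //; first by rewrite mulr_gt0.
apply: filterS2 H1 H2 => x H1 H2.
rewrite /riemann big_split_ord/= -/(riemann T del k.+1 f x); congr (_ + _).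
rewrite H1; apply: eq_bigr => i _.
rewrite -H2 -addSn natrD; congr (_ * T _ f x); ring.
Qed.

(** For multiples of a common step the identity holds, by [riemann_add], between Riemann sums over
    one fine grid; the three approximation errors are proportional to the three times, whose total
    is twice the largest. *)
Lemma time_integral_add_multiple del k l f : 0 < del -> f \in Lp ->
  {ae mu, forall x, I ((k.+1 + l.+1)%:R * del) f x
    = I (k.+1%:R * del) f x + T (k.+1%:R * del) (I (l.+1%:R * del) f) x}.
Proof.
move=> del0 lf.
have kd0 n : 0 < n.+1%:R * del by rewrite mulr_gt0.
have lI n : I (n.+1%:R * del) f \in Lp by exact: time_integral_Lp.
pose D x := I ((k.+1 + l.+1)%:R * del) f x - I (k.+1%:R * del) f x
  - T (k.+1%:R * del) (I (l.+1%:R * del) f) x.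
have lTI : T (k.+1%:R * del) (I (l.+1%:R * del) f) \in Lp.
  exact: (semigroup_Lp HT).
have lD : D \in Lp by apply: LfunB => //; apply: LfunB => //; rewrite addSn.
suff : {ae mu, forall x, D x = 0}.
  apply: filterS => x /eqP; rewrite /D subr_eq0 => /eqP <-.
  by rewrite addrC subrK.
apply: (@nrm_le_eps _ (2 * ((k.+1 + l.+1)%:R * del))) => //.
  by rewrite mulr_ge0// addSn ltW.
move=> e e0; have [dl0 dl00 [Hd _]] := semigroup_modulus lf e0.
have [M HM] := div_lt_eventually del dl00; have {HM}Hm := HM M (leqnn M).
have dm0 : 0 < del / M.+1%:R by rewrite divr_gt0.
have E n : n.+1%:R * del = (n * M.+1 + M).+1%:R * (del / M.+1%:R).
  rewrite -addnS -mulSnr natrM; field.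
  by rewrite addrC natr1.
have ap n := time_integral_approx (n * M.+1 + M) lf Hd dm0 (ltW Hm).
pose r n := riemann T (del / M.+1%:R) (n * M.+1 + M).+1 f.
have lr n : r n \in Lp by exact: riemann_Lp.
have A n : N (fun x => I (n.+1%:R * del) f x - r n x) <= n.+1%:R * del * e.
  by rewrite E; exact: ap.
have lTr : T (k.+1%:R * del) (r l) \in Lp by exact: (semigroup_Lp HT).
have F : {ae mu, forall x, D x =
   (I ((k + l.+1).+1%:R * del) f x - r (k + l.+1)%N x) - (I (k.+1%:R * del) f x - r k x)
   - T (k.+1%:R * del) (fun y => I (l.+1%:R * del) f y - r l y) x}.
  have := @riemann_add (del / M.+1%:R) (k * M.+1 + M) (l * M.+1 + M).+1 f dm0 lf.
  rewrite -E -/(r k) -/(r l).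
  have -> : ((k * M.+1 + M).+1 + (l * M.+1 + M).+1 = ((k + l.+1) * M.+1 + M).+1)%N.
    by rewrite -!addnS -!mulSnr -mulnDl; congr (_ * _)%N; lia.
  rewrite -/(r (k + l.+1)%N).
  apply: filterS2 (semigroup_B (kd0 k) (lI l) (lr l)) => x -> H.
  rewrite /D addSn H; ring.
have lIrl : (fun y => I (l.+1%:R * del) f y - r l y) \in Lp by exact: LfunB.
have lA1 : (fun x => I ((k + l.+1).+1%:R * del) f x - r (k + l.+1)%N x) \in Lp by exact: LfunB.
have lA2 : (fun x => I (k.+1%:R * del) f x - r k x) \in Lp by exact: LfunB.
have lA3 : T (k.+1%:R * del) (fun y => I (l.+1%:R * del) f y - r l y) \in Lp.
  exact: (semigroup_Lp HT).
rewrite (nrm_ae_eq p1 _ _ F); [|exact: Lfun_meas lD|]; last first.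
  by apply: LfunB => //; exact: LfunB.
apply: (le_trans (nrmB p1 (LfunB p1 lA1 lA2) lA3)).
have := nrmB p1 lA1 lA2.
have := A (k + l.+1)%N; have := A k; have := A l.
have := semigroup_nrm (kd0 k) lIrl.
have -> : 2 * ((k.+1 + l.+1)%:R * del) * e = (k + l.+1).+1%:R * del * e
   + k.+1%:R * del * e + l.+1%:R * del * e.
  by rewrite addSn -(addSn k) natrD; ring.
lra.
Qed.

(** Both Riemann sums are taken with the same number n+1 of cells. Termwise, the lengths differ by
    |s - t| / (n+1) and the evaluation times by at most |s - t|, which the modulus controls. *)
Lemma time_integral_continuous f e del0 s t : f \in Lp -> modulus f e del0 ->
  0 < s -> 0 < t -> `|s - t| < del0 ->
  N (fun x => I s f x - I t f x) <= `|s - t| * N f + t * e.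
Proof.
move=> lf He s0 t0 std.
have [lIs HIs] := time_integral_spec s0 lf.
have [lIt HIt] := time_integral_spec t0 lf.
rewrite -[leRHS](add0r) -[X in _ <= X + _](add0r).
apply: (cvg_ge_cst (cvgD (cvgD HIs HIt) (cvg_cst _))) => n /=.
pose r (z : R) := riemann T (z / n.+1%:R) n.+1 f.
have n0 : 0 < n.+1%:R :> R by [].
have lr (z : R) : 0 < z -> r z \in Lp by move=> z0; apply: riemann_Lp => //; rewrite divr_gt0.
have lT (z : R) (i : nat) : 0 < z -> T (z / n.+1%:R * i.+1%:R) f \in Lp.
  by move=> z0; apply: (semigroup_Lp HT) => //; rewrite mulr_gt0// divr_gt0.
have H : N (fun x => r s x - r t x) <= `|s - t| * N f + t * e.
  pose F (i : 'I_n.+1) x := (s - t) / n.+1%:R * T (s / n.+1%:R * i.+1%:R) f x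
     + t / n.+1%:R * (T (s / n.+1%:R * i.+1%:R) f x - T (t / n.+1%:R * i.+1%:R) f x).
  have -> : (fun x => r s x - r t x) = (fun x => \sum_(i < n.+1) F i x).
    apply/funext => x; rewrite /r /riemann -sumrB; apply: eq_bigr => i _.
    rewrite /F; ring.
  have lF1 (i : 'I_n.+1) : (fun x => (s - t) / n.+1%:R * T (s / n.+1%:R * i.+1%:R) f x) \in Lp.
    by apply: LfunZ => //; exact: lT.
  have lF2 (i : 'I_n.+1) : (fun x => t / n.+1%:R * (T (s / n.+1%:R * i.+1%:R) f x
       - T (t / n.+1%:R * i.+1%:R) f x)) \in Lp.
    by apply: LfunZ => //; apply: LfunB => //; exact: lT.
  apply: (le_trans (nrm_sum p1 _ _)) => [i|]; first exact: LfunD.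
  apply: (@le_trans _ _ (\sum_(i < n.+1) ((`|s - t| * N f + t * e) / n.+1%:R))).
    apply: ler_sum => i _; apply: (le_trans (nrmD p1 (lF1 i) (lF2 i))).
    rewrite [leRHS]mulrDl lerD//.
    - rewrite nrmZ//; last exact: lT.
      rewrite normrM (gtr0_norm (_ : 0 < n.+1%:R^-1)) ?invr_gt0//.
      rewrite -!mulrA ler_wpM2l// [leRHS]mulrC ler_wpM2l ?invr_ge0 ?(ltW n0)//.
      by apply: semigroup_nrm => //; rewrite mulr_gt0// divr_gt0.
    - rewrite nrmZ//; last by apply: LfunB => //; exact: lT.
      rewrite (gtr0_norm (divr_gt0 t0 n0)) [leRHS]mulrAC ler_wpM2l ?divr_ge0 ?(ltW t0)//.
      apply: He; rewrite ?mulr_gt0 ?divr_gt0//.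
      rewrite -mulrBl -mulrBl normrM normrM -mulrA.
      apply: le_lt_trans std; rewrite ler_piMr// gtr0_norm ?invr_gt0//.
      by rewrite ger0_norm// mulrC ler_pdivrMr// mul1r ler_nat.
  rewrite sumr_const card_ord -[X in X <= _]mulr_natl mulrCA divff ?mulr1//.
have lrs := lr s s0; have lrt := lr t t0.
apply: (le_trans (nrm_triangle p1 lIs lrs lIt)).
apply: (@le_trans _ _ (N (fun x => I s f x - r s x) + (N (fun x => r s x - r t x)
   + N (fun x => r t x - I t f x)))).
  by rewrite lerD2l; exact: nrm_triangle.
rewrite (nrmBC p1 lIs lrs) -[leRHS]/(N (fun x => r s x - I s f x)
  + N (fun x => r t x - I t f x) + (`|s - t| * N f + t * e)).
by move: H; lra.
Qed.

(** [s] is itself a multiple of the step [dd = s / M.+1], and only [t] is rounded up, to a multiple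
    [t']; continuity of the time integral in its length removes the rounding as the step shrinks. *)
Lemma time_integral_add s t f : 0 < s -> 0 < t -> f \in Lp ->
  {ae mu, forall x, I (s + t) f x = I s f x + T s (I t f) x}.
Proof.
move=> s0 t0 lf.
have st0 : 0 < s + t by rewrite addr_gt0.
have lI (z : R) : 0 < z -> I z f \in Lp by move=> z0; exact: time_integral_Lp.
pose D x := I (s + t) f x - I s f x - T s (I t f) x.
have lTI (z : R) : 0 < z -> T s (I z f) \in Lp.
  by move=> z0; apply: (semigroup_Lp HT) => //; exact: lI.
have lD : D \in Lp by apply: LfunB; rewrite ?LfunB ?lTI ?lI.
suff : {ae mu, forall x, D x = 0}.
  apply: filterS => x /eqP; rewrite /D subr_eq0 => /eqP <-.
  by rewrite [RHS]addrC subrK.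
apply: (@nrm_le_eps _ (2 * N f + 2 * s + 2 * t)) => //.
  by rewrite !addr_ge0// mulr_ge0// ?nrm_ge0// ltW.
move=> e e0; have [dl0 dl00 [Hd _]] := semigroup_modulus lf e0.
have m0 : 0 < Num.min dl0 e by rewrite lt_min dl00.
have [M HM] := div_lt_eventually s m0; have {HM}Hm := HM M (leqnn M).
pose dd := s / M.+1%:R; have dd0 : 0 < dd by rewrite divr_gt0.
pose l := Num.truncn (t / dd).
have /andP[l1 l2] : l%:R * dd <= t < l.+1%:R * dd.
  have tdd : 0 <= t / dd by rewrite divr_ge0// ltW.
  by have := truncn_itv tdd; rewrite -/l ler_pdivlMr// ltr_pdivrMr.
pose t' := l.+1%:R * dd; have t'0 : 0 < t' by rewrite mulr_gt0.
have tt' : `|t - t'| <= dd.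
  rewrite distrC ger0_norm ?subr_ge0 ?(ltW l2)// lerBlDr.
  by rewrite /t' -natr1 mulrDl mul1r addrC lerD2l.
have ddl : dd < Num.min dl0 e by [].
move: ddl; rewrite lt_min => /andP[ddl dde].
have sE : s = M.+1%:R * dd by rewrite /dd mulrCA divff ?mulr1// gt_eqF.
have H : {ae mu, forall x, I (s + t') f x = I s f x + T s (I t' f) x}.
  have E0 : s + t' = (M.+1 + l.+1)%:R * dd by rewrite natrD mulrDl -sE.
  by have := time_integral_add_multiple M l dd0 lf; rewrite -E0 -sE -/t'.
have st'0 : 0 < s + t' by rewrite addr_gt0.
have lIB : (fun x => I t' f x - I t f x) \in Lp by apply: LfunB => //; exact: lI.
have F : {ae mu, forall x, D x = (I (s + t) f x - I (s + t') f x)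
    + T s (fun x => I t' f x - I t f x) x}.
  apply: filterS2 H (semigroup_B s0 (lI _ t'0) (lI _ t0)) => x H ->.
  rewrite /D H; ring.
have lA1 : (fun x => I (s + t) f x - I (s + t') f x) \in Lp by apply: LfunB; rewrite ?lI.
have lA2 : T s (fun x => I t' f x - I t f x) \in Lp by apply: (semigroup_Lp HT).
rewrite (nrm_ae_eq p1 _ _ F); [|exact: Lfun_meas lD|exact: LfunD].
apply: (le_trans (nrmD p1 lA1 lA2)).
have B1 := @time_integral_continuous f e dl0 (s + t) (s + t') lf Hd st0 st'0.
have B2 := @time_integral_continuous f e dl0 t' t lf Hd t'0 t0.
have B3 := semigroup_nrm s0 lIB.
have E1 : s + t - (s + t') = t - t' by ring.
rewrite E1 in B1; rewrite distrC in B2.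
have {}B1 := B1 (le_lt_trans tt' ddl); have {}B2 := B2 (le_lt_trans tt' ddl).
have tt'e : `|t - t'| <= e := le_trans tt' (ltW dde).
have t'e : t' <= t + s.
  have : t' - t <= s.
    apply: (@le_trans _ _ `|t - t'|); first by rewrite distrC ler_norm.
    by apply: (le_trans tt'); rewrite /dd ler_pdivrMr// ler_peMr ?(ltW s0)// ler1n.
  by rewrite lerBlDl.
have P1 : `|t - t'| * N f <= e * N f by rewrite ler_wpM2r// nrm_ge0.
have P2 : t' * e <= (t + s) * e by rewrite ler_wpM2r// ltW.
apply: (le_trans (lerD B1 (le_trans B3 B2))).
apply: (@le_trans _ _ (e * N f + (s * e + (t + s) * e) + (e * N f + t * e))).
  by rewrite !mulrDl; move: P1 P2; rewrite !mulrDl; lra.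
by rewrite le_eqVlt; apply/orP; left; apply/eqP; ring.
Qed.

(** For small t a single cell, that is t T_t f, is already a good enough Riemann sum. *)
Lemma time_integral_small f e : f \in Lp -> 0 < e -> exists2 del, 0 < del &
  forall t, 0 < t < del -> N (fun x => t^-1 * I t f x - f x) <= e.
Proof.
move=> lf e0; have e20 : 0 < e / 2 by rewrite divr_gt0.
have [del d0 [Hd Hd']] := semigroup_modulus lf e20.
exists del => // t /andP[t0 td].
have lI := time_integral_Lp t0 lf.
have lT := semigroup_Lp HT t0 lf.
have := time_integral_approx 0 lf Hd t0 (ltW td).
rewrite mul1r; set r := riemann T t 1 f => H.
have rE : r = (fun x => t * T t f x).
  by apply/funext => x; rewrite /r /riemann big_ord1 mulr1.
have E : (fun x => t^-1 * I t f x - f x) =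
   (fun x => t^-1 * (I t f x - r x) + (T t f x - f x)).
  by apply/funext => x; rewrite rE; field; rewrite gt_eqF.
have lr : r \in Lp by rewrite rE; exact: LfunZ.
have lIr : (fun x => I t f x - r x) \in Lp by exact: LfunB.
rewrite E; apply: (le_trans (nrmD p1 (LfunZ p1 _ lIr) (LfunB p1 lT lf))).
rewrite nrmZ// gtr0_norm ?invr_gt0//.
have H1 : t^-1 * N (fun x => I t f x - r x) <= e / 2.
  by rewrite ler_pdivrMl.
have := Hd' t; rewrite t0 td => /(_ isT); lra.
Qed.

(** Computing I_(s+t) f in two ways gives T_s I_t f - I_t f = T_t I_s f - I_s f. The difference
    quotient minus its expected limit is therefore T_t h - h with h = I_s f / s - f, and h tends to
    0 with s. *)
Lemma time_integral_generator t f : 0 < t -> f \in Lp ->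
  semigroup_generator mu p%:E T (I t f) (fun x => T t f x - f x).
Proof.
move=> t0 lf; have lI := time_integral_Lp t0 lf.
have lT := semigroup_Lp HT t0 lf.
have lw : (fun x => T t f x - f x) \in Lp by exact: LfunB.
split => //.
pose g s x := s^-1 * (T s (I t f) x - I t f x) - (T t f x - f x).
have lg s : 0 < s -> g s \in Lp.
  move=> s0; apply: LfunB => //; apply: LfunZ => //; apply: LfunB => //.
  exact: (semigroup_Lp HT).
apply: (@cvge_at_right0P R (fun s => 'N[mu]_p%:E[EFin \o g s]%E)
  (fun s => N (g s)) _ _).2 => [s s0|s s0|e e0].
- by rewrite -nrmE//; exact: lg.
- exact: nrm_ge0.
have e40 : 0 < e / 4 by rewrite divr_gt0.
have [del d0 Hd] := time_integral_small lf e40.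
exists del => // s sd; have s0 : 0 < s by case/andP: sd.
pose h x := s^-1 * I s f x - f x.
have lIs := time_integral_Lp s0 lf.
have lsI : (fun x => s^-1 * I s f x) \in Lp by exact: LfunZ.
have lh : h \in Lp by exact: LfunB.
have E : {ae mu, forall x, g s x = T t h x - h x}.
  have H1 := time_integral_add s0 t0 lf.
  have H2 := time_integral_add t0 s0 lf.
  have H3 := semigroup_B t0 lsI lf.
  have H4 := semigroup_Z s^-1 t0 lIs.
  have H12 : {ae mu, forall x, T s (I t f) x - I t f x = T t (I s f) x - I s f x}.
    apply: filterS2 H1 H2 => x; rewrite (addrC s t) => -> H.
    apply/eqP; rewrite -subr_eq0; apply/eqP; move/eqP: H.
    by rewrite -subr_eq0 => /eqP <-; ring.
  apply: filterS3 H12 H3 H4 => x H12 H3 H4.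
  by rewrite /g H12 H3 H4 /h; ring.
rewrite (nrm_ae_eq p1 _ _ E); last 2 first.
- exact: Lfun_meas (lg s s0).
- by apply: LfunB => //; exact: (semigroup_Lp HT).
apply: (le_lt_trans (nrmB p1 (semigroup_Lp HT t0 lh) lh)).
have := semigroup_nrm t0 lh; have := Hd s sd; rewrite -/h; lra.
Qed.

Lemma semigroup_sub_markovian_le t f M : 0 < t -> 0 < M -> f \in Lp ->
  {ae mu, forall x, 0 <= f x <= M} -> {ae mu, forall x, 0 <= T t f x <= M}.
Proof.
move=> t0 M0 lf fM.
have lg : (fun x => M^-1 * f x) \in Lp by exact: LfunZ.
have := semigroup_sub_markovian HT t0 lg _; case.
  apply: filterS fM => x /andP[f0 f1]; rewrite mulr_ge0 ?invr_ge0 ?(ltW M0)//=.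
  by rewrite ler_pdivrMl// mulr1.
move=> A [mA A0 sA].
have : {ae mu, forall x, 0 <= T t (fun x => M^-1 * f x) x <= 1} by exists A.
apply: filterS2 (semigroup_Z M^-1 t0 lf) => x ->.
by rewrite ler_pdivrMl// mulr1 pmulr_rge0// invr_gt0.
Qed.

End fixed_semigroup.

Local Notation Lp := (Lfun mu p%:E).
Local Notation N := (nrm mu p).

(** If L generates [T], this is the semigroup of L - a. Its time integrals over long intervals
    approximate the resolvent of L at level a and, being time integrals, belong to the domain of the
    generator. *)
Definition damped (a : R) (T : R -> (X -> R) -> (X -> R)) t f : X -> R :=
  fun x => expR (- (a * t)) * T t f x.

Lemma damped_semigroup a T : 0 <= a -> sub_markovian_C0_semigroup mu p%:E T ->
  sub_markovian_C0_semigroup mu p%:E (damped a T).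
Proof.
move=> a0 HT.
have e01 t : 0 < t -> expR (- (a * t)) <= 1.
  by move=> t0; rewrite -expR0 ler_expR oppr_le0 mulr_ge0// ltW.
split.
- by move=> t f t0 lf; apply: LfunZ => //; exact: (semigroup_Lp HT).
- move=> t b f g t0 lf lg; apply: filterS (semigroup_linear HT b t0 lf lg) => x H.
  rewrite /damped H; ring.
- move=> t f t0 lf; have lT := semigroup_Lp HT t0 lf.
  have lD : damped a T t f \in Lp by exact: LfunZ.
  rewrite !nrmE// lee_fin nrmZ// gtr0_norm ?expR_gt0//.
  apply: le_trans (semigroup_nrm HT t0 lf).
  by rewrite ler_piMl ?nrm_ge0// e01.
- move=> s t f s0 t0 lf; have lT := semigroup_Lp HT t0 lf.
  apply: filterS2 (semigroup_add HT s0 t0 lf) (semigroup_Z HT (expR (- (a * t))) s0 lT) => x H1 H2.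
  by rewrite /damped H2 H1 mulrA -expRD; congr (expR _ * _); ring.
- move=> f lf.
  have lB t : 0 < t -> (fun x => damped a T t f x - f x) \in Lp.
    by move=> t0; apply: LfunB => //; apply: LfunZ => //; exact: (semigroup_Lp HT).
  apply: (@cvge_at_right0P R (fun t => 'N[mu]_p%:E[EFin \o (damped a T t f \- f)%R]%E)
    (fun t => N (fun x => damped a T t f x - f x)) _ _).2 => [s s0|s s0|e e0].
  + by rewrite -nrmE//; exact: lB.
  + exact: nrm_ge0.
  have e20 : 0 < e / 2 by rewrite divr_gt0.
  have [del d0 [_ Hd]] := semigroup_modulus HT lf e20.
  have c0 : 0 < 2 * (a * N f) + 1.
    by rewrite ltr_wpDl// mulr_ge0// mulr_ge0// nrm_ge0.
  exists (Num.min del (e / (2 * (a * N f) + 1))); first by rewrite lt_min d0 divr_gt0.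
  move=> t /andP[t0]; rewrite lt_min => /andP[td te].
  have lT := semigroup_Lp HT t0 lf.
  have E : (fun x => damped a T t f x - f x) = (fun x =>
     expR (- (a * t)) * (T t f x - f x) + (expR (- (a * t)) - 1) * f x).
    by apply/funext => x; rewrite /damped; ring.
  have lTf : (fun x => T t f x - f x) \in Lp by exact: LfunB.
  rewrite E; apply: (le_lt_trans (nrmD p1 (LfunZ p1 _ lTf) (LfunZ p1 _ lf))).
  rewrite !nrmZ// gtr0_norm ?expR_gt0//.
  have H1 : expR (- (a * t)) * N (fun x => T t f x - f x) < e / 2.
    apply: (@le_lt_trans _ _ (N (fun x => T t f x - f x))); last by apply: Hd; rewrite t0.
    by rewrite ler_piMl ?nrm_ge0// e01.
  have H2 : `|expR (- (a * t)) - 1| * N f <= a * t * N f.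
    rewrite ler_wpM2r ?nrm_ge0// distrC ger0_norm ?subr_ge0 ?e01//.
    have := expR_ge1Dx (- (a * t)); lra.
  have H3 : a * t * N f <= e / 2.
    move: te; rewrite ltr_pdivlMr// => te.
    have : 0 <= t by exact: ltW.
    move: te; set n := N f; lra.
  lra.
- move=> t f t0 lf f01; apply: filterS (semigroup_sub_markovian HT t0 lf f01) => x.
  move=> /andP[H1 H2]; rewrite /damped mulr_ge0 ?expR_ge0//=.
  by rewrite mulr_ile1 ?expR_ge0 ?e01.
Qed.

(** The error of the difference quotient for [T] is e^(at) times that of the damped one, plus
    multiples of [w] and [u] with coefficients e^(at) - 1 and (e^(at) - 1) / t - a, both of which
    tend to 0. *)
Lemma damped_generator a T u w : 0 <= a -> sub_markovian_C0_semigroup mu p%:E T ->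
  semigroup_generator mu p%:E (damped a T) u w ->
  semigroup_generator mu p%:E T u (fun x => w x + a * u x).
Proof.
move=> a0 HT [lu lw C].
have HD := damped_semigroup a0 HT.
have lau : (fun x => a * u x) \in Lp by exact: LfunZ.
have lwau : (fun x => w x + a * u x) \in Lp by exact: LfunD.
split => //.
pose h t x := t^-1 * (damped a T t u x - u x) - w x.
pose g t x := t^-1 * (T t u x - u x) - (w x + a * u x).
have lh t : 0 < t -> h t \in Lp.
  move=> t0; apply: LfunB => //; apply: LfunZ => //; apply: LfunB => //.
  exact: (semigroup_Lp HD).
have lg t : 0 < t -> g t \in Lp.
  move=> t0; apply: LfunB => //; apply: LfunZ => //; apply: LfunB => //.
  exact: (semigroup_Lp HT).
have Hh := (@cvge_at_right0P R (fun t => 'N[mu]_p%:E[EFin \o h t]%E)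
  (fun t => N (h t)) (fun (t : R) (t0 : 0 < t) => nrmE (lh t t0))
  (fun t _ => nrm_ge0 mu p _)).1 C.
apply: (@cvge_at_right0P R (fun t => 'N[mu]_p%:E[EFin \o g t]%E)
  (fun t => N (g t)) (fun (t : R) (t0 : 0 < t) => nrmE (lg t t0))
  (fun t _ => nrm_ge0 mu p _)).2 => e e0.
pose c := N w + N u + 1.
have c0 : 0 < c by rewrite ltr_wpDl// addr_ge0// nrm_ge0.
have e40 : 0 < e / 4 by rewrite divr_gt0.
have [del d0 Hd] := Hh _ e40.
have ec0 : 0 < e / (4 * c) by rewrite divr_gt0// mulr_gt0.
have b1 : 0 < 2 * a + 1 by rewrite ltr_wpDl// mulr_ge0.
have b2 : 0 < 2 * a ^+ 2 + 2 * a + 1.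
  by rewrite ltr_wpDl// addr_ge0// mulr_ge0// exprn_ge0.
exists (Num.min del (Num.min (1 / (2 * a + 1)) (e / (4 * c) / (2 * a ^+ 2 + 2 * a + 1)))).
  by rewrite !lt_min d0/= !(divr_gt0, mulr_gt0).
move=> t /andP[t0]; rewrite !lt_min ltr_pdivlMr// ltr_pdivlMr// => /and3P[td td1 td2].
have at0 : 0 <= a * t by rewrite mulr_ge0// ltW.
have aat0 : 0 <= a * (a * t) by rewrite mulr_ge0.
have at1 : a * t <= 1 / 2 by lra.
have at2 : 2 * (a * t) <= e / (4 * c).
  apply: le_trans (ltW td2); rewrite !mulrDr; lra.
have at3 : 2 * (a * (a * t)) <= e / (4 * c).
  apply: le_trans (ltW td2); rewrite !mulrDr; lra.
have ex1 : 1 + a * t <= expR (a * t) by exact: expR_ge1Dx.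
have ex2 : expR (a * t) * (1 - a * t) <= 1.
  apply: (@le_trans _ _ (expR (a * t) * expR (- (a * t)))).
    by rewrite ler_wpM2l ?expR_ge0//; exact: expR_ge1Dx.
  by rewrite expRxMexpNx_1.
(* From e^y (1 - y) <= 1 and (1 + y + 2 y^2)(1 - y) = 1 + y^2 (1 - 2 y) >= 1 for 0 <= y <= 1/2. *)
have ex3 : expR (a * t) <= 1 + a * t + 2 * (a * t) * (a * t).
  have h1 : 0 < 1 - a * t by lra.
  rewrite -(ler_pM2r h1); apply: (le_trans ex2).
  have h2 : 0 <= (a * t) * (a * t) * (1 - 2 * (a * t)) by rewrite !mulr_ge0//; lra.
  lra.
have ex4 : (a * t) * (a * t) <= (a * t) * (1 / 2) by rewrite ler_wpM2l.
have B1 : `|expR (a * t) - 1| <= e / (4 * c).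
  by rewrite ger0_norm; lra.
have B2 : `|t^-1 * (expR (a * t) - 1) - a| <= e / (4 * c).
  have -> : t^-1 * (expR (a * t) - 1) - a = t^-1 * (expR (a * t) - 1 - a * t).
    by field; rewrite gt_eqF.
  rewrite normrM gtr0_norm ?invr_gt0// ler_pdivrMl// ger0_norm; last lra.
  apply: le_trans (ler_wpM2l (ltW t0) at3); lra.
have B3 : `|expR (a * t) - 1| <= 1.
  by rewrite ger0_norm; lra.
have E : g t = (fun x => (expR (a * t) * h t x + (expR (a * t) - 1) * w x)
   + (t^-1 * (expR (a * t) - 1) - a) * u x).
  apply/funext => x; rewrite /g /h /damped.
  have : expR (a * t) * expR (- (a * t)) = 1 by rewrite expRxMexpNx_1.
  set y := expR (a * t); set z := expR _ => yz.
  have -> : y * (t^-1 * (z * T t u x - u x) - w x) = t^-1 * (y * z) * T t u x - t^-1 * y * u x - y * w x by ring.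
  rewrite yz; ring.
have lht := lh t t0.
rewrite E.
have l1 : (fun x => expR (a * t) * h t x) \in Lp by exact: LfunZ.
have l2 : (fun x => (expR (a * t) - 1) * w x) \in Lp by exact: LfunZ.
have l3 : (fun x => (t^-1 * (expR (a * t) - 1) - a) * u x) \in Lp by exact: LfunZ.
apply: (le_lt_trans (nrmD p1 (LfunD p1 l1 l2) l3)).
have := nrmD p1 l1 l2; rewrite !nrmZ//.
have := Hd t; rewrite t0 td => /(_ isT) B0.
have B4 : `|expR (a * t)| <= 2.
  by rewrite -[expR _](subrK 1) (le_trans (ler_normD _ _))// normr1; lra.
have Q1 : `|expR (a * t)| * N (h t) <= 2 * N (h t) by rewrite ler_wpM2r// nrm_ge0.
have Q2 : `|expR (a * t) - 1| * N w <= e / (4 * c) * N w by rewrite ler_wpM2r ?nrm_ge0.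
have Q3 : `|t^-1 * (expR (a * t) - 1) - a| * N u <= e / (4 * c) * N u.
  by rewrite ler_wpM2r ?nrm_ge0.
have Q4 : e / (4 * c) * N w + e / (4 * c) * N u <= e / 4.
  rewrite -mulrDr; apply: (@le_trans _ _ (e / (4 * c) * c)).
    by rewrite ler_wpM2l ?(ltW ec0)// /c lerDl.
  by rewrite le_eqVlt; apply/orP; left; apply/eqP; field; rewrite gt_eqF.
lra.
Qed.

End semigroup.

(** * Order properties of semigroups and of their time integrals *)

Section comparison.
Context (R : realType) (d : nat).
Local Notation X := 'rV[R]_d.
Variables (mu : {measure set X -> \bar R}).
Implicit Types (f g : X -> R) (T : R -> (X -> R) -> (X -> R)).

Lemma time_integral_le (p q : R) T T' t f f' : 1 <= p -> 1 <= q ->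
  sub_markovian_C0_semigroup mu p%:E T -> sub_markovian_C0_semigroup mu q%:E T' ->
  0 < t -> f \in Lfun mu p%:E -> f' \in Lfun mu q%:E ->
  (forall s, 0 < s -> {ae mu, forall x, T s f x <= T' s f' x}) ->
  {ae mu, forall x, Lp_time_integral mu p T t f x <= Lp_time_integral mu q T' t f' x}.
Proof.
move=> p1 q1 HT HT' t0 lf lf' H.
have [lI HI] := time_integral_spec p1 HT t0 lf.
have [lI' HI'] := time_integral_spec q1 HT' t0 lf'.
have tn n : 0 < t / n.+1%:R by rewrite divr_gt0.
apply: (Lp_cvg_le p1 q1 _ lI _ lI' HI HI').
- by move=> n; exact: riemann_Lp.
- by move=> n; exact: riemann_Lp.
- move=> n.
  have : {ae mu, forall x, forall i : nat, T (t / n.+1%:R * i.+1%:R) f x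
      <= T' (t / n.+1%:R * i.+1%:R) f' x}.
    by apply: ae_foralln => i; apply: H; rewrite mulr_gt0.
  apply: filterS => x Hx; rewrite /riemann; apply: ler_sum => i _.
  by rewrite ler_wpM2l// ltW.
Qed.

Lemma time_integral_bounds (p : R) T t f a b : 1 <= p ->
  sub_markovian_C0_semigroup mu p%:E T -> 0 < t -> f \in Lfun mu p%:E ->
  (forall s, 0 < s -> {ae mu, forall x, a <= T s f x <= b}) ->
  {ae mu, forall x, t * a <= Lp_time_integral mu p T t f x <= t * b}.
Proof.
move=> p1 HT t0 lf H.
have [lI HI] := time_integral_spec p1 HT t0 lf.
have tn n : 0 < t / n.+1%:R by rewrite divr_gt0.
have lr n : riemann T (t / n.+1%:R) n.+1 f \in Lfun mu p%:E by exact: riemann_Lp.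
have [phi phi1 phiu] := Lp_cvg_ae p1 lr lI HI.
have : {ae mu, forall x, forall n i : nat, a <= T (t / n.+1%:R * i.+1%:R) f x <= b}.
  by apply: ae_foralln => n; apply: ae_foralln => i; apply: H; rewrite mulr_gt0.
apply: filterS2 phiu => x ux Hx.
have E n c : \sum_(i < n.+1) t / n.+1%:R * c = t * c.
  rewrite sumr_const card_ord -[LHS]mulr_natl mulrA mulrCA divff ?mulr1//.
apply/andP; split.
- apply: (cvg_ge_cst ux) => n; rewrite -(E (phi n) a) /riemann.
  apply: ler_sum => i _; apply: ler_wpM2l; first exact/ltW/tn.
  by have /andP[] := Hx (phi n) i.
- apply: (cvg_le_cst ux) => n; rewrite -(E (phi n) b) /riemann.
  apply: ler_sum => i _; apply: ler_wpM2l; first exact/ltW/tn.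
  by have /andP[] := Hx (phi n) i.
Qed.

Lemma nrm1E f : f \in Lfun mu 1 -> nrm mu 1 f = \int[mu]_x `|f x|.
Proof.
by move=> lf; rewrite /nrm Lnorm1.
Qed.

Section L1.
Variable T : R -> (X -> R) -> (X -> R).
Hypothesis HT : sub_markovian_C0_semigroup mu 1 T.
Let HT1 : sub_markovian_C0_semigroup mu 1%:E T := HT.
Let p11 : (1 : R) <= 1 := lexx _.

Lemma Lfun1_le f g : measurable_fun setT f -> g \in Lfun mu 1 ->
  {ae mu, forall x, `|f x| <= `|g x|} -> f \in Lfun mu 1.
Proof. exact: Lfun_le. Qed.

(** The sub-Markov property speaks of functions with values in [0, 1], hence by scaling of bounded
    ones. The truncations min(|f|, n+1) converge to [f] in L^1 by dominated convergence, and
    positivity passes to the limit by contraction. *)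
Lemma semigroup_ge0 t f : 0 < t -> f \in Lfun mu 1 ->
  {ae mu, forall x, 0 <= f x} -> {ae mu, forall x, 0 <= T t f x}.
Proof.
move=> t0 lf f0.
pose g n x := Num.min (`|f x|) n.+1%:R.
have mf := Lfun_meas lf.
have mg n : measurable_fun setT (g n).
  apply: measurable_minr => //; exact: measurableT_comp.
have lg n : g n \in Lfun mu 1.
  apply: (Lfun1_le (mg n) lf); apply: nearW => x.
  by rewrite ger0_norm /g ?ge_min ?lexx// le_min normr_ge0/=.
have Tg n : {ae mu, forall x, 0 <= T t (g n) x}.
  have := @semigroup_sub_markovian_le _ _ mu 1 p11 T HT1 t (g n) n.+1%:R t0.
  case/(_ _ (lg n) _) => //.
    by apply: nearW => x; rewrite /g le_min normr_ge0 ler0n/= ge_min lexx orbT.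
  move=> A [mA A0 sA]; exists A; split => //; apply: subset_trans sA.
  by move=> x /= H1 H2; apply: H1; case/andP: H2.
have gf : nrm mu 1 (fun x => g n x - f x) @[n --> \oo] --> (0 : R).
  have iabs : mu.-integrable setT (EFin \o (fun x => `|f x|)).
    by apply/Lfun1_integrable; exact: Lfun_norm.
  have [|||||_ C] := @dominated_cvg_Rintegral _ _ R mu setT
     (fun n x => `|g n x - f x|) (fun=> 0) (fun x => `|f x|) measurableT.
  - by move=> n; apply: measurableT_comp => //; exact: measurable_funB.
  - exact: measurable_cst.
  - apply: filterS f0 => x fx0 _; apply/cvg_seqP => e e0.
    exists (Num.truncn (f x)).+1 => n Nn.
    rewrite /g (ger0_norm fx0) (min_idPl _) ?subrr ?normr0 ?subrr ?normr0//.
    apply: ltW; apply: (lt_le_trans (truncnS_gt _)); rewrite ler_nat.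
    exact: leqW.
  - exact: iabs.
  - move=> n; apply: filterS f0 => x fx0 _; rewrite normr_id.
    rewrite distrC ger0_norm /g ger0_norm//; last by rewrite subr_ge0 ge_min lexx.
    by rewrite gerBl// le_min fx0/=.
  move: C; rewrite (_ : \int[mu]_x 0 = 0); last first.
    by rewrite /Rintegral integral0.
  under eq_fun => n do rewrite -(nrm1E (LfunB p11 (lg n) lf)).
  by [].
have lT n : T t (g n) \in Lfun mu 1 by exact: (semigroup_Lp HT).
have lTf : T t f \in Lfun mu 1 by exact: (semigroup_Lp HT).
apply: (@Lp_cvg_le _ _ R mu 1 1 (fun _ _ => 0) (fun n => T t (g n)) (fun _ => 0) (T t f) p11 p11) => //.
- by move=> n; exact: Lfun0.
- exact: Lfun0.
- under eq_fun => n do under eq_fun do rewrite subr0.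
  by rewrite nrm0//; exact: cvg_cst.
apply: cvg_dist_le gf => n; rewrite subr0 ger0_norm ?nrm_ge0//.
have lB := LfunB p11 (lg n) lf.
apply: le_trans (semigroup_nrm HT1 t0 lB).
apply: nrm_le => //.
- by apply: measurable_funB; [exact: Lfun_meas (lT n)|exact: Lfun_meas lTf].
- exact: (semigroup_Lp HT).
- have HB := semigroup_B HT1 t0 (lg n) lf.
  by apply: filterS HB => x ->.
Qed.

Lemma semigroup_le t f g : 0 < t -> f \in Lfun mu 1 -> g \in Lfun mu 1 ->
  {ae mu, forall x, f x <= g x} -> {ae mu, forall x, T t f x <= T t g x}.
Proof.
move=> t0 lf lg fg.
have lB := LfunB p11 lg lf.
have H : {ae mu, forall x, 0 <= T t (fun x => g x - f x) x}.
  by apply: semigroup_ge0 => //; apply: filterS fg => x; rewrite subr_ge0.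
have H2 := semigroup_B HT1 t0 lg lf.
apply: filterS2 H H2 => x H1 {}H2.
by move: H1; rewrite H2 subr_ge0.
Qed.

Lemma time_integral_ge0 t f : 0 < t -> f \in Lfun mu 1 ->
  {ae mu, forall x, 0 <= f x} ->
  {ae mu, forall x, 0 <= Lp_time_integral mu 1 T t f x}.
Proof.
move=> t0 lf f0.
have l0 := @Lfun0 _ _ _ mu 1 p11.
have [lI HI] := time_integral_spec p11 HT1 t0 lf.
apply: (@Lp_cvg_le _ _ R mu 1 1 (fun _ _ => 0) _ (fun _ => 0) _ p11 p11 _ _ _ lI _ HI) => //.
- by move=> n; apply: riemann_Lp => //; rewrite divr_gt0.
- under eq_fun => n do under eq_fun do rewrite subr0.
  by rewrite nrm0//; exact: cvg_cst.
- move=> n.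
  have : {ae mu, forall x, forall i : nat, 0 <= T (t / n.+1%:R * i.+1%:R) f x}.
    by apply: ae_foralln => i; apply: semigroup_ge0 => //; rewrite mulr_gt0// divr_gt0.
  apply: filterS => x Hx; apply: sumr_ge0 => i _.
  by rewrite mulr_ge0// divr_ge0// ltW.
Qed.

(** The increment is T_s applied to the nonnegative I_(t-s) f. *)
Lemma time_integral_mono s t f : 0 < s -> s <= t -> f \in Lfun mu 1 ->
  {ae mu, forall x, 0 <= f x} ->
  {ae mu, forall x, Lp_time_integral mu 1 T s f x <= Lp_time_integral mu 1 T t f x}.
Proof.
move=> s0; rewrite le_eqVlt => /predU1P[<- _ _|st lf f0]; first exact: nearW.
have ts0 : 0 < t - s by rewrite subr_gt0.
have := time_integral_add p11 HT1 s0 ts0 lf; rewrite subrKC => H.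
have lI := time_integral_Lp p11 HT1 ts0 lf.
have H2 := semigroup_ge0 s0 lI (time_integral_ge0 ts0 lf f0).
by apply: filterS2 H H2 => x ->; rewrite lerDl.
Qed.

End L1.
End comparison.

(** * A maximum principle for damped potentials in L^1 *)

Section maximum_principle.
Context (R : realType) (d : nat).
Local Notation X := 'rV[R]_d.
Variables (mu : {measure set X -> \bar R}).
Variable T : R -> (X -> R) -> (X -> R).
Hypothesis HT : sub_markovian_C0_semigroup mu 1 T.
Let HT1 : sub_markovian_C0_semigroup mu 1%:E T := HT.
Let p11 : (1 : R) <= 1 := lexx _.
Implicit Types (f g u w : X -> R).

(** With v = (u - k)^+, the function u - v takes values in [0, k], so T_t (u - v) <= k. Hence T_t u
    - u <= T_t v - v where u > k, and 0 <= T_t v - v elsewhere; the integral of T_t v - v is at most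
    0 by contraction. *)
Lemma semigroup_truncation t u (k : R) : 0 < t -> 0 < k -> u \in Lfun mu 1 ->
  {ae mu, forall x, 0 <= u x} ->
  \int[mu]_(x in [set x | k < u x]) (T t u x - u x) <= 0.
Proof.
move=> t0 k0 lu u0.
have mu_ : measurable_fun setT u := Lfun_meas lu.
have mD : measurable [set x | k < u x].
  rewrite -[X in measurable X]setTI.
  by apply: measurable_fun_ltr => //; exact: measurable_cst.
pose v x := Num.max (u x - k) 0.
have mv : measurable_fun setT v.
  by apply: measurable_maxr => //; apply: measurable_funB.
have lv : v \in Lfun mu 1.
  apply: (Lfun1_le mv lu); apply: filterS u0 => x ux0.
  rewrite ger0_norm ?le_max ?lexx ?orbT// ger0_norm// /v ge_max ux0 andbT.
  by rewrite lerBlDr lerDl ltW.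
have v0 : {ae mu, forall x, 0 <= v x}.
  by apply: nearW => x; rewrite /v le_max lexx orbT.
have lTv : T t v \in Lfun mu 1 by exact: (semigroup_Lp HT).
have lTu : T t u \in Lfun mu 1 by exact: (semigroup_Lp HT).
have lm : (fun x => u x - v x) \in Lfun mu 1 by exact: (LfunB p11).
have Tm : {ae mu, forall x, T t (fun x => u x - v x) x <= k}.
  have H : {ae mu, forall x, 0 <= u x - v x <= k}.
    apply: filterS u0 => x ux0; rewrite /v maxEle; case: ifPn => h.
      by rewrite subr0 ux0/= -subr_le0.
    by rewrite opprB addrC subrK ltW/=.
  by apply: filterS (semigroup_sub_markovian_le p11 HT1 t0 k0 lm H) => x /andP[].
have key : {ae mu, forall x, (if k < u x then T t u x - u x else 0) <= T t v x - v x}.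
  have Tv0 := semigroup_ge0 HT t0 lv v0.
  have HB := semigroup_B HT1 t0 lu lv.
  apply: filterS3 Tv0 HB Tm => x Tv0 HB Tm.
  case: ifPn => h.
    have -> : v x = u x - k by rewrite /v (max_idPl _)// subr_ge0 ltW.
    by move: Tm; rewrite HB; lra.
  by rewrite /v (max_idPr _) ?subr0// subr_le0 leNgt.
have i1 : mu.-integrable setT (EFin \o (fun x => T t v x - v x)).
  by apply/Lfun1_integrable; exact: (LfunB p11).
have i2 : mu.-integrable setT (EFin \o (fun x => T t u x - u x)).
  by apply/Lfun1_integrable; exact: (LfunB p11).
have rE : (fun x => if k < u x then T t u x - u x else 0)
  = ((fun x => T t u x - u x) \_ [set x | k < u x]).
  by apply/funext => x; rewrite patchE; congr (if _ then _ else _); apply/idP/idP; rewrite inE.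
have i3 : mu.-integrable setT (EFin \o (fun x => if k < u x then T t u x - u x else 0)).
  rewrite rE -restrict_EFin; apply/(integrable_mkcond _ mD).
  exact: integrableS i2.
rewrite Rintegral_mkcond -rE.
apply: (@le_trans _ _ (\int[mu]_x (T t v x - v x))).
  by apply: ae_le_Rintegral => //; apply: filterS key.
rewrite RintegralB//; [|exact/Lfun1_integrable|exact/Lfun1_integrable].
rewrite subr_le0.
have nE g : g \in Lfun mu 1 -> {ae mu, forall x, 0 <= g x} -> \int[mu]_x g x = nrm mu 1 g.
  move=> lg g0; rewrite nrm1E//; apply: ae_eq_Rintegral => //.
  - exact: Lfun_meas lg.
  - by apply: measurableT_comp => //; exact: Lfun_meas lg.
  - by apply: filterS g0 => x g0 _; rewrite ger0_norm.
rewrite (nE _ lTv (semigroup_ge0 HT t0 lv v0)) (nE _ lv v0).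
exact: (semigroup_nrm HT1).
Qed.

(** The difference quotient at a small time has a nonpositive integral over {u > k} and differs from
    [w] by less than e in L^1. *)
Lemma generator_truncation u w (k : R) : 0 < k ->
  semigroup_generator mu 1 T u w -> {ae mu, forall x, 0 <= u x} ->
  \int[mu]_(x in [set x | k < u x]) w x <= 0.
Proof.
move=> k0 [lu lw C] u0.
have mu_ : measurable_fun setT u := Lfun_meas lu.
set D := [set x | k < u x].
have mD : measurable D.
  rewrite -[X in measurable X]setTI.
  by apply: measurable_fun_ltr => //; exact: measurable_cst.
pose h t x := t^-1 * (T t u x - u x) - w x.
have lq t : 0 < t -> (fun x => t^-1 * (T t u x - u x)) \in Lfun mu 1.
  move=> t0; apply: (LfunZ p11); apply: (LfunB p11) => //.
  exact: (semigroup_Lp HT).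
have lh t : 0 < t -> h t \in Lfun mu 1.
  by move=> t0; apply: (LfunB p11) => //; exact: lq.
have Hh := (@cvge_at_right0P R (fun t => 'N[mu]_1[EFin \o h t]%E)
  (fun t => nrm mu 1 (h t)) (fun (t : R) (t0 : 0 < t) => nrmE (lh t t0))
  (fun t _ => nrm_ge0 mu 1 _)).1 C.
apply/ler_addgt0Pr => e /Hh[del d0 Hd]; rewrite add0r.
have t0 : 0 < del / 2 by rewrite divr_gt0.
have {}Hd := Hd (del / 2) _.
have {}Hd : nrm mu 1 (h (del / 2)) < e by apply: Hd; rewrite t0/= ltr_pdivrMr// ltr_pMr// ltr1n.
set t := del / 2 in t0 Hd.
have intD g : g \in Lfun mu 1 -> mu.-integrable D (EFin \o g).
  by move=> /Lfun1_integrable; apply: integrableS.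
have -> : \int[mu]_(x in D) w x
  = \int[mu]_(x in D) (t^-1 * (T t u x - u x)) - \int[mu]_(x in D) h t x.
  rewrite -RintegralB//; [|exact/intD/lq|exact/intD/lh].
  by apply: eq_Rintegral => x _; rewrite /h; ring.
have H1 : \int[mu]_(x in D) (t^-1 * (T t u x - u x)) <= 0.
  rewrite RintegralZl//.
    by rewrite pmulr_rle0 ?invr_gt0//; exact: semigroup_truncation.
  by apply/intD/(LfunB p11) => //; exact: (semigroup_Lp HT).
have H2 : `|\int[mu]_(x in D) h t x| <= nrm mu 1 (h t).
  apply: (le_trans (le_normr_Rintegral mD (intD _ (lh t t0)))).
  rewrite nrm1E; last exact: lh.
  have ia : mu.-integrable setT (EFin \o (fun x => `|h t x|)).
    by apply/Lfun1_integrable/Lfun_norm; exact: lh.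
  have ir : mu.-integrable setT (EFin \o ((fun x => `|h t x|) \_ D)).
    by rewrite -restrict_EFin; apply/(integrable_mkcond _ mD); exact: integrableS ia.
  rewrite Rintegral_mkcond; apply: ae_le_Rintegral => //.
  by apply/nearW => x _; rewrite patchE; case: ifPn => _; [exact: lexx|exact: normr_ge0].
move: H2; rewrite ler_norml => /andP[]; lra.
Qed.

(* The potential u solves a u - L u = f - e^{-at} T_t f, while L u integrates
   to something nonpositive over {u > k}, where f vanishes. *)
Lemma damped_maximum_principle f (a t k : R) : 0 < a -> 0 < t -> 0 < k ->
  f \in Lfun mu 1 -> {ae mu, forall x, 0 <= f x} ->
  {ae mu, forall x, f x != 0 -> Lp_time_integral mu 1 (damped a T) t f x <= k} ->
  {ae mu, forall x, Lp_time_integral mu 1 (damped a T) t f x <= k}.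
Proof.
move=> a0 t0 k0 lf f0; set u := Lp_time_integral _ _ _ _ _ => uk.
have HD1 : sub_markovian_C0_semigroup mu 1%:E (damped a T).
  exact: (damped_semigroup p11 (ltW a0) HT1).
have HD : sub_markovian_C0_semigroup mu 1 (damped a T) := HD1.
have u0 : {ae mu, forall x, 0 <= u x} by exact: (time_integral_ge0 HD).
have gen := damped_generator p11 (ltW a0) HT1 (time_integral_generator p11 HD1 t0 lf).
have := generator_truncation k0 gen u0.
have lu : u \in Lfun mu 1 by exact: (time_integral_Lp p11 HD1).
have mu_ : measurable_fun setT u := Lfun_meas lu.
set D := [set x | _]; set w := (fun x => _) => intw.
have mD : measurable D.
  rewrite -[X in measurable X]setTI.
  by apply: measurable_fun_ltr => //; exact: measurable_cst.
have lTf : damped a T t f \in Lfun mu 1 by exact: (semigroup_Lp HD).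
have lw : w \in Lfun mu 1.
  by apply: (LfunD p11); [exact: (LfunB p11)|exact: (LfunZ p11)].
have intD g : g \in Lfun mu 1 -> mu.-integrable D (EFin \o g).
  by move=> /Lfun1_integrable; apply: integrableS.
have H : \int[mu]_(x in D) (a * u x) <= \int[mu]_(x in D) w x.
  apply: ae_le_Rintegral => //; [by apply/intD/(LfunZ p11)|exact: intD|].
  have Tf0 := semigroup_ge0 HD t0 lf f0.
  apply: filterS2 uk Tf0 => x uk Tf0 Dx; rewrite /w lerDr.
  have -> : f x = 0.
    by apply/eqP/negP => /negP /uk; rewrite leNgt => /negP; apply; exact: Dx.
  by rewrite subr0.
have D0 : {ae mu, forall x, D x -> u x = 0}.
  apply: Rintegral_eq0_ae => //.
  - exact: intD.
  - by move=> x Dx; exact/ltW/(lt_trans k0).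
  - apply/eqP; rewrite eq_le; apply/andP; split.
      have := le_trans H intw; rewrite RintegralZl//; last exact: intD.
      by rewrite pmulr_rle0.
    by apply: Rintegral_ge0 => x Dx; exact/ltW/(lt_trans k0).
apply: filterS D0 => x D0; rewrite leNgt; apply/negP => ux.
by have := D0 ux => ux0; move: ux; rewrite ux0 ltNge (ltW k0).
Qed.

End maximum_principle.

(** * Relatively compact sets and smooth functions *)

Section topology_rV.
Context (R : realType) (d : nat).
Local Notation X := 'rV[R]_d.
Implicit Types (E V K : set X) (f : X -> R).

Lemma open_measurable_rV (U : set X) : open U -> measurable U.
Proof. by move=> oU; exact: sub_sigma_algebra. Qed.

Lemma closed_measurable_rV (U : set X) : closed U -> measurable U.
Proof.
move=> cU; rewrite -[U]setCK; apply: measurableC.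
by apply: open_measurable_rV; exact: closed_openC.
Qed.

Lemma compact_closed_rV (K : set X) : compact K -> closed K.
Proof. by apply: compact_closed; exact: norm_hausdorff. Qed.

Lemma continuous_measurable_rV f : continuous (f : X -> R^o) ->
  measurable_fun setT f.
Proof.
move=> cf; apply: (@measurability _ _ _ _ _ _ (@RGenOpens.G R)).
  exact: RGenOpens.measurableE.
move=> _ [_ [a [b ->] <-]]; rewrite setTI; apply: open_measurable_rV.
by apply: open_comp; [move=> x _; exact: cf|exact: interval_open].
Qed.

Lemma rel_compact0 E : rel_compact E set0.
Proof.
split; [by exists set0; [exact: open0|rewrite setI0]| |].
- by rewrite closure0; exact: compact0.
- by rewrite closure0.
Qed.

Lemma closureU_sub (A B : set X) : closure (A `|` B) `<=` closure A `|` closure B.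
Proof.
have H : closed (closure A `|` closure B).
  by apply: closedU; exact: closed_closure.
rewrite [X in _ `<=` X](closure_id _).1//; apply: closureS.
by apply: setUSS; exact: subset_closure.
Qed.

Lemma rel_compactU E V W : rel_compact E V -> rel_compact E W ->
  rel_compact E (V `|` W).
Proof.
move=> [[U oU VU] cV VE] [[U' oU' WU] cW WE]; split.
- by exists (U `|` U'); [exact: openU|rewrite VU WU setIUr].
- apply: (subclosed_compact _ (compactU cV cW)); first exact: closed_closure.
  exact: closureU_sub.
- by apply: (subset_trans (@closureU_sub _ _)); rewrite subUset.
Qed.

Lemma rel_compact_sub E V : rel_compact E V -> V `<=` E.
Proof. by move=> [[U _ ->] _ _] x []. Qed.

Lemma rel_compactI E V U : rel_compact E V -> open U -> rel_compact E (V `&` U).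
Proof.
move=> [[U' oU' VU] cV VE] oU.
have S : closure (V `&` U) `<=` closure V by apply: closureS; exact: subIsetl.
split.
- by exists (U' `&` U); [exact: openI|rewrite VU setIA].
- by apply: (subclosed_compact _ cV S); exact: closed_closure.
- exact: subset_trans S VE.
Qed.

Lemma closed_ball_compact (x : X) (r : R) : 0 < r -> compact (closed_ball x r).
Proof.
move=> r0; apply: bounded_closed_compact; last exact: closed_ball_closed.
exists (`|x| + r); split; first exact: num_real.
move=> M HM y; rewrite closed_ballE// /closed_ball_/= => xy.
rewrite (le_trans _ (ltW HM))// -[y](subrK x) addrC.
by rewrite (le_trans (ler_normD _ _))// lerD2l distrC.
Qed.

(** For open [E], half the radius of a ball inside [E] works; for closed [E] the radius 1 does,
    since [E] meets a closed ball in a compact set. *)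
Lemma rel_compact_nbhs E x : open E \/ closed E -> E x ->
  exists2 r : R, 0 < r & rel_compact E (E `&` ball x r).
Proof.
move=> oc Ex.
have [r r0 Hr] : exists2 r : R, 0 < r & compact (E `&` closed_ball x r).
  case: oc => [oE|cE].
  - have /nbhs_ballP[e /= e0 He] := open_nbhs_nbhs (conj oE Ex).
    exists (e / 2); first by rewrite divr_gt0.
    rewrite (_ : E `&` _ = closed_ball x (e / 2)).
      by apply: closed_ball_compact; rewrite divr_gt0.
    apply/seteqP; split => [y []//|y Hy]; split => //; apply: He.
    move: Hy; rewrite closed_ballE ?divr_gt0// /closed_ball_/= -ball_normE /=.
    by move=> /le_lt_trans; apply; rewrite ltr_pdivrMr// ltr_pMr// ltr1n.
  - exists 1 => //; rewrite setIC; apply: compact_closedI => //.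
    exact: closed_ball_compact.
exists r => //.
have S : closure (E `&` ball x r) `<=` E `&` closed_ball x r.
  have cl : closed (E `&` closed_ball x r) by exact: compact_closed_rV.
  rewrite [X in _ `<=` X](closure_id _).1//; apply: closureS.
  by apply: setIS; exact: subset_closed_ball.
split.
- by exists (ball x r) => //; exact: ball_open.
- by apply: (subclosed_compact _ Hr S); exact: closed_closure.
- by apply: (subset_trans S); exact: subIsetl.
Qed.

Lemma compact_sub_rel_compact E K : open E \/ closed E -> compact K -> K `<=` E ->
  exists2 V, rel_compact E V & K `<=` V.
Proof.
move=> oc cK KE.
pose r x := if pselect (E x) is left Ex then
  s2val (cid2 (rel_compact_nbhs oc Ex)) else 1 : R.
have rP x : E x -> 0 < r x /\ rel_compact E (E `&` ball x (r x)).
  move=> Ex; rewrite /r; case: pselect => // Ex'.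
  by case: (cid2 _) => s s0 Hs /=.
move: (cK); rewrite compact_cover => /(_ X K (fun x => (ball x (r x))°)).
case.
- by move=> x Kx; exact: open_interior.
- move=> x Kx; exists x => //; apply: nbhsx_ballx.
  by have [] := rP _ (KE _ Kx).
move=> D DK KD; exists (\bigcup_(x in [set` D]) (E `&` ball x (r x))).
- have : forall x, x \in finmap.enum_fset D -> E x.
    by move=> x xD; apply: KE; apply: set_mem; apply: DK.
  rewrite bigcup_fset; elim: (finmap.enum_fset D) => [|x s IH] H.
    by rewrite big_nil; exact: rel_compact0.
  rewrite big_cons; apply: rel_compactU.
    by have [] := rP x (H x (mem_head _ _)).
  by apply: IH => y ys; apply: H; rewrite inE ys orbT.
- move=> x Kx; have [y Dy Hy] := KD _ Kx; exists y => //; split; first exact: KE.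
  exact: interior_subset Hy.
Qed.

Lemma rational_rV (x : X) (e : R) : 0 < e -> exists q : 'rV[rat]_d,
  ball x e (map_mx ratr q : X).
Proof.
move=> e0.
have /boolp.choice[q qt] : forall j : 'I_d, exists q : rat,
    ball (x 0 j : R) e (ratr q).
  move=> j; have [|y [tq [q _ qE]]] := @dense_rat R _ _
    (@ball_open R R^o (x 0 j : R) e).
    by exists (x 0 j : R); exact: ballxx.
  by exists q; rewrite qE.
exists (\row_j q j); split => // i j; rewrite !mxE (ord1 i).
exact: qt.
Qed.

(** Traces on [E] of balls with rational centers and radii 1/(n+1), those that are not relatively
    compact being replaced by the empty set. The countable cover turns local almost everywhere
    statements into global ones. *)
Lemma rel_compact_countable_cover E : open E \/ closed E ->
  exists2 V_ : nat -> set X, forall k, rel_compact E (V_ k) & E = \bigcup_k V_ k.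
Proof.
move=> oc.
pose W (i : 'rV[rat]_d * nat) : set X :=
  E `&` (ball (map_mx ratr i.1 : X) (i.2.+1%:R^-1)).
pose V_ (k : nat) := match @choice.unpickle ('rV[rat]_d * nat)%type k with
  | Some i => if `[< rel_compact E (W i) >] then W i else set0
  | None => set0 end.
exists V_.
- move=> k; rewrite /V_; case: choice.unpickle => [i|]; last exact: rel_compact0.
  by case: ifPn => [/asboolP//|_]; exact: rel_compact0.
- apply/seteqP; split => [x Ex|x [k _]]; last first.
    rewrite /V_; case: choice.unpickle => [i|//]; case: ifPn => // _; by case.
  have [r r0 Hr] := rel_compact_nbhs oc Ex.
  have [n nr] : exists n : nat, n.+1%:R^-1 < r / 2.
    exists (Num.truncn (r / 2)^-1); rewrite invf_plt ?posrE ?divr_gt0//.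
    exact: truncnS_gt.
  have n0 : 0 < n.+1%:R^-1 :> R by rewrite invr_gt0.
  have [q xq] := rational_rV x n0.
  exists (choice.pickle (q, n)) => //; rewrite /V_ choice.pickleK.
  have -> : `[< rel_compact E (W (q, n)) >].
    apply/asboolP; rewrite /W /=.
    rewrite (_ : E `&` ball _ _ = (E `&` ball x r) `&` ball (map_mx ratr q : X) (n.+1%:R^-1)).
      by apply: rel_compactI => //; exact: ball_open.
    rewrite -setIA; congr (_ `&` _); apply/esym/setIidr => y Hy.
    rewrite (splitr r); apply: (ball_triangle (y := (map_mx ratr q : X))).
      exact: (le_ball (ltW nr) xq).
    exact: (le_ball (ltW nr) Hy).
  by split => //; exact: ball_sym.
Qed.

End topology_rV.

(** * The measure [mu] on [E] *)

Section reference_measure.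
Context (R : realType) (d : nat).
Local Notation X := 'rV[R]_d.
Variables (E : set X) (phi : X -> R) (mu : {measure set X -> \bar R}).
Hypothesis ocE : open_or_closed_null_boundary E.
Hypothesis iphi : loc_integrable (lebesgue_rV d) E phi.
Hypothesis muE : forall S : set X, measurable S ->
    mu S = (\int[lebesgue_rV d]_(x in E `&` S) (phi x)%:E)%E.

Lemma open_or_closed : open E \/ closed E.
Proof. by case: ocE => [|[]]; [left|right]. Qed.

Lemma measurable_domain : measurable E.
Proof.
by case: open_or_closed; [exact: open_measurable_rV|exact: closed_measurable_rV].
Qed.

Lemma rel_compact_measurable V : rel_compact E V -> measurable V.
Proof.
move=> [[U oU ->] _ _]; apply: measurableI; first exact: measurable_domain.
exact: open_measurable_rV.
Qed.

Lemma ae_domain : {ae mu, forall x, E x}.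
Proof.
exists (~` E); split.
- by apply: measurableC; exact: measurable_domain.
- rewrite muE; last by apply: measurableC; exact: measurable_domain.
  by rewrite setICr integral_set0.
- by [].
Qed.

(** [phi] is given as integrable on compact sets only, and [E] is a countable union of compact
    closures contained in it. *)
Lemma measurable_density : measurable_fun E phi.
Proof.
have [V_ HV EV] := rel_compact_countable_cover open_or_closed.
have -> : E = \bigcup_k closure (V_ k).
  apply/seteqP; split => [x|x [k _]]; last by have [_ _ VE] := HV k => /VE.
  by rewrite {1}EV => -[k _ Vx]; exists k => //; exact: subset_closure.
have mc k : measurable (closure (V_ k)).
  by apply: closed_measurable_rV; exact: closed_closure.
apply: (iffRL (measurable_fun_bigcup _ mc)) => k; have [_ cV VE] := HV k.
by apply/measurable_EFinP; exact: (measurable_int _ (iphi cV VE)).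
Qed.

(** For closed [E] this is the null boundary hypothesis. It matters because a function vanishing on
    part of [E] has a known gradient there only at interior points of [E]. *)
Lemma ae_interior : {ae mu, forall x, E° x}.
Proof.
have mI : measurable E° by apply: open_measurable_rV; exact: open_interior.
exists (~` E°); split; [exact: measurableC| |by []].
rewrite muE; last exact: measurableC.
case: ocE => [oE|[cE nE]].
  by rewrite (interior_id _).1// setICr integral_set0.
have EB : E `&` ~` E° = closure E `\` E° by rewrite -(closure_id _).1.
have mB : measurable (E `&` ~` E°).
  by apply: measurableI; [exact: measurable_domain|exact: measurableC].
apply: null_set_integral => //; last by rewrite EB.
apply: (measurable_funS (E := E)) => //; first exact: measurable_domain.
by apply/measurable_EFinP; exact: measurable_density.
Qed.

Lemma domain_compact_finite K : compact K -> K `<=` E -> (mu K < +oo)%E.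
Proof.
move=> cK KE.
have mK : measurable K by apply: closed_measurable_rV; exact: compact_closed_rV.
rewrite muE// (setIidr KE).
exact: integrable_lty (iphi cK KE).
Qed.

Lemma rel_compact_finite_measure V : rel_compact E V -> (mu V < +oo)%E.
Proof.
move=> HV; have [_ cV VE] := HV.
apply: le_lt_trans (domain_compact_finite cV VE).
apply: le_measure.
- by apply: mem_set; exact: rel_compact_measurable HV.
- by apply: mem_set; apply: closed_measurable_rV; exact: closed_closure.
- exact: subset_closure.
Qed.

End reference_measure.

(** * Calculus with smooth functions and a smooth truncation *)

Section calculus_rules.
Context (R : realType) (d : nat).
Local Notation X := 'rV[R]_d.
Implicit Types (E V : set X) (f g : X -> R) (i : 'I_d) (k : nat).

Lemma Ck_continuous k f : Ck k f -> continuous (f : X -> R^o).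
Proof. by case: k => [//|k] [df _] x; exact: differentiable_continuous. Qed.

Lemma CkW k f : Ck k.+1 f -> Ck k f.
Proof.
elim: k f => [|k IH] f; first exact: Ck_continuous.
by move=> [df pf]; split => // i; apply: IH; exact: pf.
Qed.

Lemma partialD i f g x : differentiable (f : X -> R^o) x ->
  differentiable (g : X -> R^o) x ->
  partial i (fun y => f y + g y) x = partial i f x + partial i g x.
Proof.
move=> df dg; rewrite /partial.
exact: (@deriveD _ _ _ (f : X -> R^o) (g : X -> R^o) x _
  (diff_derivable df) (diff_derivable dg)).
Qed.

Lemma partialM i f g x : differentiable (f : X -> R^o) x ->
  differentiable (g : X -> R^o) x ->
  partial i (fun y => f y * g y) x = f x * partial i g x + g x * partial i f x.
Proof.
move=> df dg; rewrite /partial.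
exact: (@deriveM _ _ (f : X -> R^o) (g : X -> R^o) x _
  (diff_derivable df) (diff_derivable dg)).
Qed.

Lemma partialV i f x : differentiable (f : X -> R^o) x -> f x != 0 ->
  partial i (fun y => (f y)^-1) x = - ((f x)^-1 * (f x)^-1) * partial i f x.
Proof.
move=> df fx; rewrite /partial.
rewrite (@deriveV _ _ (f : X -> R^o) x _ fx (diff_derivable df)).
by rewrite expr2 invfM.
Qed.

Lemma partial_cst i (c : R) x : partial i (fun _ => c) x = 0.
Proof. exact: derive_cst. Qed.

Lemma differentiable_mul f g x : differentiable (f : X -> R^o) x ->
  differentiable (g : X -> R^o) x ->
  differentiable ((fun y => f y * g y) : X -> R^o) x.
Proof. by move=> df dg; exact: (differentiableM df dg). Qed.

Lemma differentiable_add f g x : differentiable (f : X -> R^o) x ->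
  differentiable (g : X -> R^o) x ->
  differentiable ((fun y => f y + g y) : X -> R^o) x.
Proof. by move=> df dg; exact: (differentiableD df dg). Qed.

Lemma Ck_cst k (c : R) : Ck k (fun _ : X => c).
Proof.
elim: k c => [|k IH] c; first exact: cst_continuous.
split=> [x|i]; first exact: differentiable_cst.
rewrite (_ : partial i _ = fun _ => 0); first exact: IH.
by apply/funext => x; exact: partial_cst.
Qed.

Lemma CkD k f g : Ck k f -> Ck k g -> Ck k (fun x => f x + g x).
Proof.
elim: k f g => [|k IH] f g.
  by move=> /= cf cg x; exact: (continuousD (cf x) (cg x)).
move=> [df pf] [dg pg]; split=> [x|i]; first exact: differentiable_add.
rewrite (_ : partial i _ = fun x => partial i f x + partial i g x).
  by apply: IH; [exact: pf|exact: pg].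
by apply/funext => x; exact: partialD.
Qed.

Lemma CkM k f g : Ck k f -> Ck k g -> Ck k (fun x => f x * g x).
Proof.
elim: k f g => [|k IH] f g.
  by move=> /= cf cg x; exact: (continuousM (cf x) (cg x)).
move=> Hf Hg; have Hf' := CkW Hf; have Hg' := CkW Hg.
case: Hf Hg => [df pf] [dg pg]; split=> [x|i]; first exact: differentiable_mul.
rewrite (_ : partial i _ = fun x => f x * partial i g x + g x * partial i f x).
  by apply: CkD; apply: IH => //; [exact: pg|exact: pf].
by apply/funext => x; exact: partialM.
Qed.

Lemma CkV k f : (forall x, f x != 0) -> Ck k f -> Ck k (fun x => (f x)^-1).
Proof.
move=> f0; elim: k => [|k IH].
  by move=> /= cf x; exact: (@continuousV _ _ f x (f0 x) (cf x)).
move=> Hf; have Hf' := CkW Hf; case: Hf => [df pf]; split=> [x|i].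
  by apply: (@differentiableV R X f x (df x)); exact: f0.
rewrite (_ : partial i _ = fun x => (-1 * ((f x)^-1 * (f x)^-1)) * partial i f x).
  apply: CkM; last exact: pf.
  by apply: CkM; [exact: Ck_cst|apply: CkM; exact: IH].
by apply/funext => x; rewrite partialV// mulN1r.
Qed.

Lemma smoothD f g : smooth f -> smooth g -> smooth (fun x => f x + g x).
Proof. by move=> sf sg k; exact: CkD. Qed.

Lemma smoothM f g : smooth f -> smooth g -> smooth (fun x => f x * g x).
Proof. by move=> sf sg k; exact: CkM. Qed.

Lemma smoothV f : (forall x, f x != 0) -> smooth f -> smooth (fun x => (f x)^-1).
Proof. by move=> f0 sf k; exact: CkV. Qed.

Lemma smooth_cst (c : R) : smooth (fun _ : X => c).
Proof. by move=> k; exact: Ck_cst. Qed.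

Lemma smooth_differentiable f x : smooth f -> differentiable (f : X -> R^o) x.
Proof. by move=> /(_ 1%N)[]. Qed.

Lemma smooth_continuous f : smooth f -> continuous (f : X -> R^o).
Proof. by move=> /(_ 0%N). Qed.

Lemma partial_continuous i f : smooth f -> continuous (partial i f : X -> R^o).
Proof. by move=> /(_ 1%N)[_ /(_ i)]. Qed.

Lemma partial_near0 i f x : (\forall y \near x, f y = 0) -> partial i f x = 0.
Proof.
move=> H; rewrite /partial -(derive_cst (0 : R^o) x (delta_mx 0 i)).
by apply: near_eq_derive; apply: filterS H => y ->.
Qed.

Lemma gradE f x i : grad f x 0 i = partial i f x.
Proof. by rewrite mxE. Qed.

Lemma grad_near0 f x : (\forall y \near x, f y = 0) -> grad f x = 0.
Proof. by move=> H; apply/rowP => i; rewrite gradE partial_near0// mxE. Qed.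

Lemma gradD f g x : smooth f -> smooth g ->
  grad (fun y => f y + g y) x = grad f x + grad g x.
Proof.
move=> sf sg; apply/rowP => i; rewrite !mxE partialD//; exact: smooth_differentiable.
Qed.

Lemma gradM f g x : smooth f -> smooth g ->
  grad (fun y => f y * g y) x = f x *: grad g x + g x *: grad f x.
Proof.
move=> sf sg; apply/rowP => i; rewrite !mxE partialM//; exact: smooth_differentiable.
Qed.

Lemma gradZ (c : R) f x : smooth f -> grad (fun y => c * f y) x = c *: grad f x.
Proof.
move=> sf; rewrite (gradM _ (smooth_cst c) sf).
rewrite (_ : grad (fun _ => c) x = 0) ?scaler0 ?addr0//.
by apply/rowP => i; rewrite gradE partial_cst mxE.
Qed.

Lemma smoothZ (c : R) f : smooth f -> smooth (fun x => c * f x).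
Proof. by move=> sf; apply: smoothM => //; exact: smooth_cst. Qed.

Lemma gradB f g x : smooth f -> smooth g -> grad (f \- g) x = grad f x - grad g x.
Proof.
move=> sf sg.
rewrite (_ : f \- g = fun y => f y + -1 * g y); last by apply/funext => y; rewrite mulN1r.
by rewrite gradD ?gradZ ?scaleN1r//; exact: smoothZ.
Qed.

Lemma smoothB f g : smooth f -> smooth g -> smooth (f \- g).
Proof.
move=> sf sg.
rewrite (_ : f \- g = fun y => f y + -1 * g y); last by apply/funext => y; rewrite mulN1r.
by apply: smoothD => //; exact: smoothZ.
Qed.

Lemma supp_sub f g : (forall x, f x = 0 -> g x = 0) -> supp g `<=` supp f.
Proof.
move=> fg; apply: closureS => x /=; apply: contra_neq; exact: fg.
Qed.

Lemma supp_notin f x : ~ supp f x -> f x = 0.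
Proof.
by move=> H; apply/eqP/negPn/negP => fx; apply: H; exact: subset_closure.
Qed.

Lemma supp_grad f x : ~ supp f x -> grad f x = 0.
Proof.
move=> H; apply: grad_near0.
have : nbhs x (~` supp f).
  by apply: open_nbhs_nbhs; split => //; apply: closed_openC; exact: closed_closure.
by apply: filterS => y; exact: supp_notin.
Qed.

Lemma C0infty_smooth E f : C0infty E f -> smooth f.
Proof. by case. Qed.

Lemma C0infty_sub E f g : C0infty E f -> smooth g ->
  (forall x, f x = 0 -> g x = 0) -> C0infty E g.
Proof.
move=> [sf cf Ef] sg fg; have S := supp_sub fg; split => //.
- by apply: (subclosed_compact _ cf S); exact: closed_closure.
- by move=> /Ef; exact: subset_trans.
Qed.

Lemma suppD f g : supp (fun x => f x + g x) `<=` supp f `|` supp g.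
Proof.
apply: (subset_trans _ (@closureU_sub R d _ _)); apply: closureS => x /= fg.
have [f0|] := eqVneq (f x) 0; last by left.
by right; apply: contra_neq fg => ->; rewrite f0 addr0.
Qed.

Lemma C0inftyD E f g : C0infty E f -> C0infty E g ->
  C0infty E (fun x => f x + g x).
Proof.
move=> [sf cf Ef] [sg cg Eg]; split; first exact: smoothD.
- apply: (subclosed_compact _ (compactU cf cg)); first exact: closed_closure.
  exact: suppD.
- move=> oE; apply: (subset_trans (@suppD f g)); rewrite subUset.
  by split; [exact: Ef|exact: Eg].
Qed.

Lemma C0inftyM E f g : C0infty E f -> smooth g -> C0infty E (fun x => f x * g x).
Proof.
move=> Hf sg; apply: (C0infty_sub Hf).
- by apply: smoothM => //; exact: C0infty_smooth Hf.
- by move=> x ->; rewrite mul0r.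
Qed.

Lemma C0inftyZ E (c : R) f : C0infty E f -> C0infty E (fun x => c * f x).
Proof.
move=> Hf; apply: (C0infty_sub Hf).
- by apply: smoothZ => //; exact: C0infty_smooth Hf.
- by move=> x ->; rewrite mulr0.
Qed.

Lemma C0inftyB E f g : C0infty E f -> C0infty E g -> C0infty E (f \- g).
Proof.
move=> Hf Hg.
rewrite (_ : f \- g = fun y => f y + -1 * g y); last by apply/funext => y; rewrite mulN1r.
by apply: C0inftyD => //; exact: C0inftyZ.
Qed.

Lemma C0infty_compact E f : open E \/ closed E -> C0infty E f ->
  compact (E `&` supp f).
Proof.
move=> oc [sf cf Ef]; case: oc => [oE|cE].
  by rewrite (setIidr (Ef oE)).
by rewrite setIC; exact: compact_closedI.
Qed.

Lemma compact_support_bounded f (K : set X) : compact K ->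
  continuous (f : X -> R^o) -> (forall x, ~ K x -> f x = 0) ->
  exists2 M : R, 0 <= M & forall x, `|f x| <= M.
Proof.
move=> cK cf f0.
have cfK : compact ((f : X -> R^o) @` K).
  by apply: continuous_compact => //; apply: continuous_subspaceT => x; exact: cf.
have [M [Mr HM]] := compact_bounded cfK.
exists (`|M| + 1) => [|x]; first by rewrite addr_ge0.
have [Kx|nKx] := pselect (K x); last by rewrite f0// normr0 addr_ge0.
by apply: HM; [rewrite (le_lt_trans (ler_norm _))// ltrDl|exists x].
Qed.

Lemma C0infty_bounded E f : C0infty E f -> exists2 M : R, 0 <= M & forall x, `|f x| <= M.
Proof.
move=> [sf cf _]; apply: (compact_support_bounded cf); first exact: smooth_continuous.
by move=> x; exact: supp_notin.
Qed.

Lemma partial_bounded E f i : C0infty E f ->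
  exists2 M : R, 0 <= M & forall x, `|partial i f x| <= M.
Proof.
move=> [sf cf _]; apply: (compact_support_bounded cf); first exact: partial_continuous.
by move=> x /supp_grad; rewrite -gradE => ->; rewrite mxE.
Qed.

(* A smooth bounded substitute for truncation: it is the identity to first
   order at [0], bounded for [0 < l], and tends to the identity as [l -> 0]. *)
Definition soft_trunc (l s : R) := s * (1 + l * (s * s))^-1.
(** The derivative of [soft_trunc l] at [s]; see [grad_soft_trunc]. *)
Definition soft_trunc' (l s : R) := (1 - l * (s * s)) * ((1 + l * (s * s))^-1 * (1 + l * (s * s))^-1).

Lemma soft_trunc_den (l s : R) : 0 <= l -> 1 <= 1 + l * (s * s).
Proof. by move=> l0; rewrite lerDl mulr_ge0// -expr2 sqr_ge0. Qed.

Lemma soft_trunc_den0 (l s : R) : 0 <= l -> 1 + l * (s * s) != 0.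
Proof. by move=> l0; rewrite gt_eqF// (lt_le_trans ltr01)// soft_trunc_den. Qed.

Lemma soft_trunc_le (l s : R) : 0 <= l -> `|soft_trunc l s| <= `|s|.
Proof.
move=> l0; have H := soft_trunc_den s l0.
rewrite normrM normfV ler_piMr// invf_le1.
  by rewrite ger0_norm// (le_trans ler01).
by rewrite normr_gt0 soft_trunc_den0.
Qed.

(** For |s| <= 1 by [soft_trunc_le]; for |s| > 1 because |s| <= s^2 <= (1 + l s^2) / l. *)
Lemma soft_trunc_bounded (l s : R) : 0 < l -> `|soft_trunc l s| <= 1 + l^-1.
Proof.
move=> l0; have [s1|s1] := lerP `|s| 1.
  apply: (le_trans (soft_trunc_le s (ltW l0))); apply: (le_trans s1).
  by rewrite lerDl invr_ge0 ltW.
have H := soft_trunc_den s (ltW l0).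
rewrite normrM normfV (@ger0_norm _ (1 + _)) ?(le_trans ler01)//.
rewrite ler_pdivrMr ?(lt_le_trans ltr01)//.
apply: (@le_trans _ _ (`|s| * `|s|)).
  by rewrite ler_peMr// ltW.
rewrite -normrM ger0_norm; last by rewrite -expr2 sqr_ge0.
have : 0 <= s * s by rewrite -expr2 sqr_ge0.
set y := s * s => y0.
have -> : (1 + l^-1) * (1 + l * y) = 1 + l^-1 + l * y + y by field; rewrite gt_eqF.
have : 0 < l^-1 by rewrite invr_gt0.
have : 0 <= l * y by rewrite mulr_ge0// ltW.
lra.
Qed.

Lemma soft_trunc'_le (l s : R) : 0 <= l -> `|soft_trunc' l s| <= 1.
Proof.
move=> l0; rewrite /soft_trunc'.
have y0 : 0 <= l * (s * s) by rewrite mulr_ge0// -expr2 sqr_ge0.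
set y := l * (s * s) in y0 *.
have d0 : 0 < 1 + y by lra.
rewrite !normrM !normfV (@ger0_norm _ (1 + y)) ?(ltW d0)//.
rewrite -invfM ler_pdivrMr ?mulr_gt0// mul1r.
have : 0 <= y * y by rewrite mulr_ge0.
by rewrite ler_norml; lra.
Qed.

Lemma soft_trunc0 l : soft_trunc l 0 = 0.
Proof. by rewrite /soft_trunc mul0r. Qed.

Lemma cvg_soft_trunc (l : R) (u : nat -> R) (s : R) : 0 <= l ->
  u n @[n --> \oo] --> s -> soft_trunc l (u n) @[n --> \oo] --> soft_trunc l s.
Proof.
move=> l0 us; apply: cvgM => //; apply: cvgV; first exact: soft_trunc_den0.
apply: cvgD; first exact: cvg_cst.
by apply: cvgM; [exact: cvg_cst|exact: cvgM].
Qed.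

Lemma cvg_soft_trunc' (l : R) (u : nat -> R) (s : R) : 0 <= l ->
  u n @[n --> \oo] --> s -> soft_trunc' l (u n) @[n --> \oo] --> soft_trunc' l s.
Proof.
move=> l0 us.
have H : (1 + l * (u n * u n))^-1 @[n --> \oo] --> (1 + l * (s * s))^-1.
  apply: cvgV; first exact: soft_trunc_den0.
  apply: cvgD; first exact: cvg_cst.
  by apply: cvgM; [exact: cvg_cst|exact: cvgM].
apply: cvgM; last exact: cvgM.
apply: cvgB; first exact: cvg_cst.
by apply: cvgM; [exact: cvg_cst|exact: cvgM].
Qed.

Lemma cvg_soft_trunc_id (l : nat -> R) (s : R) : (forall n, 0 <= l n) ->
  l n @[n --> \oo] --> (0 : R) ->
  soft_trunc (l n) s @[n --> \oo] --> s /\ soft_trunc' (l n) s @[n --> \oo] --> (1 : R).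
Proof.
move=> l0 ln.
have H0 : l n * (s * s) @[n --> \oo] --> (0 : R).
  by rewrite -(mul0r (s * s)); apply: cvgM => //; exact: cvg_cst.
have H : (1 + l n * (s * s))^-1 @[n --> \oo] --> (1 : R).
  have : (1 + l n * (s * s))^-1 @[n --> \oo] --> ((1 + 0)^-1 : R).
    apply: cvgV; first by rewrite addr0 oner_neq0.
    by apply: cvgD => //; exact: cvg_cst.
  by rewrite addr0 invr1.
split.
  by rewrite -[X in _ --> X]mulr1; apply: cvgM => //; exact: cvg_cst.
have A : 1 - l n * (s * s) @[n --> \oo] --> (1 - 0 : R).
  by apply: cvgB => //; exact: cvg_cst.
have : soft_trunc' (l n) s @[n --> \oo] --> ((1 - 0) * (1 * 1) : R).
  by apply: cvgM => //; exact: cvgM.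
by rewrite subr0 !mulr1.
Qed.

(** As the level grows, the truncation flattens everything, except that its slope at 0 remains 1:
    composed with a smooth [v], it isolates the gradient of [v] on {v = 0}. *)
Lemma cvg_soft_trunc_infty (s : R) :
  soft_trunc n%:R s @[n --> \oo] --> (0 : R) /\
  soft_trunc' n%:R s @[n --> \oo] --> (if s == 0 then 1 else 0 : R).
Proof.
have [->|s0] := eqVneq s 0.
  split.
    by under eq_fun do rewrite soft_trunc0; exact: cvg_cst.
  rewrite /soft_trunc'; under eq_fun do rewrite !mul0r !mulr0 subr0 addr0 invr1 !mulr1.
  exact: cvg_cst.
have y0 : 0 < s * s by rewrite -expr2 exprn_even_gt0.
have B n : (1 + n%:R * (s * s))^-1 <= (1 + (s * s)^-1) * n.+1%:R^-1 :> R.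
  have d1 : 0 < 1 + n%:R * (s * s) by rewrite ltr_wpDr// mulr_ge0// ltW.
  set y := s * s in y0 d1 *.
  have -> : (1 + y^-1) * n.+1%:R^-1 = (1 + y) / (y * n.+1%:R) :> R.
    have nn : (n.+1%:R : R) != 0 by rewrite pnatr_eq0.
    have yn : y != 0 by rewrite gt_eqF.
    by move: (n.+1%:R) nn => z nn; field; rewrite nn yn.
  rewrite -[X in X <= _]div1r ler_pdivrMr// mulrAC ler_pdivlMr; last exact: (mulr_gt0 y0).
  rewrite mul1r -(natr1 n); have : 0 <= n%:R :> R by [].
  set N := n%:R => N0.
  have Ny : 0 <= N * y by rewrite mulr_ge0// ltW.
  have : 0 <= N * y * y by rewrite mulr_ge0// ltW.
  lra.
have H : (1 + n%:R * (s * s))^-1 @[n --> \oo] --> (0 : R).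
  apply: (@cvg_dist_le _ _ (fun n => (1 + (s * s)^-1) * n.+1%:R^-1)).
    move=> n; rewrite subr0 ger0_norm//.
    by rewrite invr_ge0 (le_trans ler01)// soft_trunc_den.
  rewrite -[X in _ --> X](mulr0 (1 + (s * s)^-1)).
  by apply: cvgM; [exact: cvg_cst|exact: cvg_harmonic].
split.
  by rewrite -[X in _ --> X](mulr0 s); apply: cvgM => //; exact: cvg_cst.
apply: (@cvg_dist_le _ _ (fun n => (1 + n%:R * (s * s))^-1)) => // n.
rewrite subr0 /soft_trunc'.
have := soft_trunc_den s (ler0n R n); set y := n%:R * (s * s) => y1.
have q : 0 < 1 + y by exact: lt_le_trans y1.
rewrite !normrM !normfV (gtr0_norm q) mulrA ler_piMl ?invr_ge0 ?(ltW q)//.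
by rewrite ler_pdivrMr// mul1r ler_norml; lra.
Qed.

Lemma smooth_soft_trunc l f : 0 <= l -> smooth f -> smooth (fun x => soft_trunc l (f x)).
Proof.
move=> l0 sf; apply: smoothM => //; apply: smoothV.
  by move=> x; exact: soft_trunc_den0.
apply: smoothD; first exact: smooth_cst.
by apply: smoothZ; exact: smoothM.
Qed.

Lemma grad_soft_trunc l f x : 0 <= l -> smooth f ->
  grad (fun x => soft_trunc l (f x)) x = soft_trunc' l (f x) *: grad f x.
Proof.
move=> l0 sf.
pose q y := 1 + l * (f y * f y).
have sq : smooth q.
  by apply: smoothD; [exact: smooth_cst|apply: smoothZ; exact: smoothM].
have q0 y : q y != 0 by exact: soft_trunc_den0.
have df := smooth_differentiable x sf.
have dq := smooth_differentiable x sq.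
have dqV := smooth_differentiable x (smoothV q0 sq).
apply/rowP => i; rewrite gradE [RHS]mxE gradE /soft_trunc.
rewrite (partialM _ df dqV) (partialV _ dq (q0 x)).
rewrite (@partialD i (fun _ => 1) (fun y => l * (f y * f y))); last 2 first.
- exact: differentiable_cst.
- by apply: smooth_differentiable; apply: smoothZ; exact: smoothM.
rewrite partial_cst add0r (@partialM i (fun _ => l) (fun y => f y * f y)); last 2 first.
- exact: differentiable_cst.
- by apply: smooth_differentiable; exact: smoothM.
rewrite partial_cst mulr0 addr0 (partialM _ df df) /soft_trunc' -/(q x).
have qx0 := q0 x; rewrite /q in qx0 *.
by field.
Qed.

Lemma C0infty_soft_trunc E l f : 0 <= l -> C0infty E f ->
  C0infty E (fun x => soft_trunc l (f x)).
Proof.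
move=> l0 Hf; apply: (C0infty_sub Hf).
  by apply: smooth_soft_trunc => //; exact: C0infty_smooth Hf.
by move=> x ->; rewrite soft_trunc0.
Qed.

(** The support condition concerns [f] on [E] only, so a whole neighbourhood of zeros is at hand
    only around interior points of [E]. *)
Lemma C0infty_in_grad E V f x : C0infty_in E V f -> E° x -> ~ V x -> grad f x = 0.
Proof.
move=> [Hf HV] Ex nVx; apply: grad_near0.
have : nbhs x (E° `&` ~` closure (E `&` [set x | f x != 0])).
  apply: open_nbhs_nbhs; split.
    by apply: openI; [exact: open_interior|apply: closed_openC; exact: closed_closure].
  by split => // /HV.
apply: filterS => y [/interior_subset Ey H].
by apply/eqP/negPn/negP => fy; apply: H; apply: subset_closure.
Qed.

Lemma C0infty_in_eq0 E V f x : C0infty_in E V f -> E x -> ~ V x -> f x = 0.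
Proof.
move=> [Hf HV] Ex nVx; apply/eqP/negPn/negP => fy; apply: nVx; apply: HV.
exact: subset_closure.
Qed.

Lemma dotpE (x y : X) : dotp x y = \sum_i x 0 i * y 0 i.
Proof. by rewrite /dotp mxE; apply: eq_bigr => i _; rewrite mxE. Qed.

Lemma dotp_ge0 (x : X) : 0 <= dotp x x.
Proof. by rewrite dotpE; apply: sumr_ge0 => i _; rewrite -expr2 sqr_ge0. Qed.

Lemma dotpDl (x y z : X) : dotp (x + y) z = dotp x z + dotp y z.
Proof. by rewrite /dotp mulmxDl mxE. Qed.

Lemma dotpZl (c : R) (x z : X) : dotp (c *: x) z = c * dotp x z.
Proof. by rewrite /dotp -scalemxAl mxE. Qed.

Lemma dotpC (x y : X) : dotp x y = dotp y x.
Proof. by rewrite !dotpE; apply: eq_bigr => i _; rewrite mulrC. Qed.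

Lemma dotpDr (x y z : X) : dotp z (x + y) = dotp z x + dotp z y.
Proof. by rewrite dotpC dotpDl !(dotpC z). Qed.

Lemma dotpZr (c : R) (x z : X) : dotp z (c *: x) = c * dotp z x.
Proof. by rewrite dotpC dotpZl dotpC. Qed.

Lemma dotp0l (x : X) : dotp 0 x = 0.
Proof. by rewrite -(scale0r 0) dotpZl mul0r. Qed.

Lemma dotp0r (x : X) : dotp x 0 = 0.
Proof. by rewrite dotpC dotp0l. Qed.

Lemma dotpBr (x y z : X) : dotp z (x - y) = dotp z x - dotp z y.
Proof. by rewrite -scaleN1r dotpDr dotpZr mulN1r. Qed.

Lemma dotpBl (x y z : X) : dotp (x - y) z = dotp x z - dotp y z.
Proof. by rewrite dotpC dotpBr !(dotpC z). Qed.

Lemma dotp_eq0 (x : X) : dotp x x = 0 -> x = 0.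
Proof.
rewrite dotpE => /eqP; rewrite psumr_eq0; last by move=> i _; rewrite -expr2 sqr_ge0.
move=> /allP H; apply/rowP => i; rewrite mxE; apply/eqP.
by have := H i (mem_index_enum i); rewrite /= -expr2 sqrf_eq0.
Qed.

Lemma dotp_young (x y : X) (t : R) : 0 < t ->
  `|dotp x y| <= t * dotp x x + t^-1 * dotp y y.
Proof.
move=> t0.
have H (s : R) : 0 <= dotp (t *: x + s *: y) (t *: x + s *: y) by exact: dotp_ge0.
have E s : dotp (t *: x + s *: y) (t *: x + s *: y) = t ^+ 2 * dotp x x
     + 2 * t * s * dotp x y + s ^+ 2 * dotp y y.
  by rewrite !(dotpDl, dotpDr, dotpZl, dotpZr) (dotpC y x); ring.
have := H 1; have := H (-1); rewrite !E => h1 h2.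
have a0 := dotp_ge0 x; have b0 := dotp_ge0 y.
rewrite -(ler_pM2l t0).
have -> : t * (t * dotp x x + t^-1 * dotp y y) = t ^+ 2 * dotp x x + dotp y y.
  by field; rewrite gt_eqF.
rewrite -{1}(gtr0_norm t0) -normrM ler_norml.
have := mulr_ge0 (sqr_ge0 t) a0; lra.
Qed.

Lemma dotpB_le (x y z : X) :
  dotp (x - z) (x - z) <= 2 * dotp (x - y) (x - y) + 2 * dotp (y - z) (y - z).
Proof.
have -> : x - z = (x - y) + (y - z) by rewrite addrA subrK.
set a := x - y; set b := y - z.
clearbody a b; have := dotp_ge0 (a - b); rewrite !(dotpBl, dotpBr) !(dotpDl, dotpDr) (dotpC b a); lra.
Qed.

End calculus_rules.

Section integral_supplements.
Context d (T : measurableType d) (R : realType).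
Variable mu : {measure set T -> \bar R}.
Implicit Types (D : set T) (f g : T -> R).

Lemma fatou_cvg D (f_ : nat -> T -> R) f (M : \bar R) : measurable D ->
  (forall n, measurable_fun D (f_ n)) -> measurable_fun D f ->
  (forall n x, D x -> 0 <= f_ n x) -> (forall x, D x -> 0 <= f x) ->
  {ae mu, forall x, D x -> f_ n x @[n --> \oo] --> f x} ->
  (forall n, \int[mu]_(x in D) (f_ n x)%:E <= M)%E ->
  (\int[mu]_(x in D) (f x)%:E <= M)%E.
Proof.
move=> mD mf_ mf f_0 f0 ff fM.
have me n : measurable_fun D (fun x => (f_ n x)%:E) by exact/measurable_EFinP.
apply: (@le_trans _ _ (\int[mu]_(x in D) limn_einf (fun n => (f_ n x)%:E))%E).
  apply: ae_ge0_le_integral => //.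
  - exact/measurable_EFinP.
  - move=> x Dx; rewrite limn_einf_lim; apply: lime_ge; first exact: is_cvg_einfs.
    by apply: nearW => n; apply: le_ereal_inf_tmp => _ [k _ <-]; rewrite lee_fin f_0.
  - rewrite (_ : (fun x => _) = (fun x => - limn_esup (fun n => - (f_ n x)%:E))%E)//.
    apply: measurableT_comp => //; apply: measurable_fun_limn_esup => n.
    exact: measurableT_comp.
  - apply: filterS ff => x fx Dx.
    have C : (f_ n x)%:E @[n --> \oo] --> (f x)%:E.
      by apply: cvg_EFin; [exact: nearW|exact: fx].
    by rewrite (cvg_limn_einf_sup C).1.
apply: (le_trans (fatou _ mD me _)).
- by move=> n x Dx; rewrite lee_fin f_0.
rewrite limn_einf_lim; apply: lime_le; first exact: is_cvg_einfs.
apply: nearW => n; apply: (@le_trans _ _ (\int[mu]_(x in D) (f_ n x)%:E)%E) => //.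
by apply: ereal_inf_lbound; exists n => /=.
Qed.

Lemma integrable_le D f g : measurable D -> measurable_fun D f ->
  mu.-integrable D (EFin \o g) -> (forall x, D x -> `|f x| <= g x) ->
  mu.-integrable D (EFin \o f).
Proof. by move=> mD mf ig fg; apply: (integrable_ae_le mD mf ig); exact: nearW. Qed.

Lemma integrable_restrict_eq D K f : measurable D -> measurable K -> K `<=` D ->
  mu.-integrable K (EFin \o f) -> (forall x, D x -> ~ K x -> f x = 0) ->
  mu.-integrable D (EFin \o f).
Proof.
move=> mD mK KD iK f0.
have E : (EFin \o f) \_ D = (EFin \o f) \_ K.
  apply/funext => x; rewrite !patchE.
  have [xK|xK] := boolP (x \in K).
    by rewrite (mem_set (KD _ (set_mem xK))).
  have [/set_mem xD|//] := boolP (x \in D).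
  by rewrite /= f0// => Kx; move: xK; rewrite (mem_set Kx).
by apply/(integrable_mkcond _ mD); rewrite E; apply/(integrable_mkcond _ mK).
Qed.

Lemma Rintegral_restrict_eq D K f : K `<=` D ->
  (forall x, D x -> ~ K x -> f x = 0) ->
  \int[mu]_(x in D) f x = \int[mu]_(x in K) f x.
Proof.
move=> KD f0; rewrite Rintegral_mkcond [RHS]Rintegral_mkcond; congr Rintegral.
apply/funext => x; rewrite !patchE.
have [xK|xK] := boolP (x \in K).
  by rewrite (mem_set (KD _ (set_mem xK))).
have [/set_mem xD|//] := boolP (x \in D).
by rewrite f0// => Kx; move: xK; rewrite (mem_set Kx).
Qed.

Lemma bounded_integrable D f (M : R) : measurable D -> (mu D < +oo)%E ->
  measurable_fun D f -> (forall x, D x -> `|f x| <= M) ->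
  mu.-integrable D (EFin \o f).
Proof.
move=> mD Dfin mf fM.
apply: (integrable_le mD mf (g := fun=> `|M|)).
  apply/integrableP; split; first exact: measurable_cst.
  rewrite (_ : (\int[mu]_(x in D) _)%E = (\int[mu]_(x in D) (cst `|M|%:E x))%E).
    by rewrite integral_cst// lte_mul_pinfty.
  by apply: eq_integral => x _; rewrite /= normr_id.
by move=> x Dx; rewrite (le_trans (fM x Dx))// ler_norm.
Qed.

Lemma integrable_bounded_mul D f g (M : R) : measurable D -> measurable_fun D f ->
  (forall x, D x -> `|f x| <= M) -> mu.-integrable D (EFin \o g) ->
  mu.-integrable D (EFin \o (fun x => f x * g x)).
Proof.
move=> mD mf fM ig.
have mg : measurable_fun D g by exact/measurable_EFinP/(measurable_int mu).
apply: (integrable_le mD _ (g := fun x => M * `|g x|)).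
- exact: measurable_funM.
- have := integrableZl mD M (integrable_norm ig); by [].
- by move=> x Dx; rewrite normrM ler_wpM2r// fM.
Qed.

Lemma integral_fin_integrable D f : measurable_fun D f -> (forall x, D x -> 0 <= f x) ->
  (\int[mu]_(x in D) (f x)%:E < +oo)%E -> mu.-integrable D (EFin \o f).
Proof.
move=> mf f0 fin; apply/integrableP; split; first exact/measurable_EFinP.
rewrite (_ : (\int[mu]_(x in D) _)%E = (\int[mu]_(x in D) (f x)%:E)%E)//.
by apply: eq_integral => x /set_mem Dx; rewrite /= ger0_norm// f0.
Qed.

Lemma EFin_Rintegral D f : measurable D -> mu.-integrable D (EFin \o f) ->
  (\int[mu]_(x in D) (f x)%:E)%E = (\int[mu]_(x in D) f x)%:E.
Proof. by move=> mD if_; rewrite /Rintegral fineK//; exact: integrable_fin_num. Qed.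

Lemma Rintegral_subset_le (D D' : set T) f : measurable D -> measurable D' -> D `<=` D' ->
  mu.-integrable D' (EFin \o f) -> (forall x, D' x -> 0 <= f x) ->
  \int[mu]_(x in D) f x <= \int[mu]_(x in D') f x.
Proof.
move=> mD mD' DD' if_ f0; rewrite -lee_fin -!EFin_Rintegral//.
  apply: ge0_subset_integral => //; exact: (measurable_int _ if_).
exact: integrableS if_.
Qed.

Lemma Lfun2I f : measurable_fun setT f ->
  mu.-integrable setT (EFin \o (fun x => f x ^+ 2)) -> f \in Lfun mu 2%:E.
Proof.
move=> mf if2; apply: LfunI => //; rewrite unlock /Lnorm poweR_lty//.
case/integrableP: if2 => _; apply: le_lt_trans; apply: ge0_le_integral => //.
- by move=> x _; exact: poweR_ge0.
- apply/measurable_EFinP; apply: (@measurableT_comp _ _ _ _ _ _ (fun y : R => y `^ 2)) => //.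
  exact: measurableT_comp.
- by apply/measurable_EFinP; apply: measurableT_comp => //; exact: measurable_funX.
- by move=> x _ /=; rewrite lee_fin powR_mulrn// normrX.
Qed.

Lemma nrm2_sqr f : f \in Lfun mu 2%:E -> nrm mu 2 f ^+ 2 = \int[mu]_x (f x ^+ 2).
Proof.
move=> lf; have p1 : (1 : R) <= 2 by rewrite ler1n.
have := integral_powR_nrm p1 lf; rewrite powR_mulrn ?nrm_ge0// => H.
apply: EFin_inj; rewrite -H /Rintegral fineK.
  apply: eq_integral => x _; rewrite powR_mulrn//.
  by rewrite -normrX ger0_norm// sqr_ge0.
by apply: integrable_fin_num => //; exact: Lfun2_integrable_sqr.
Qed.

Lemma L2_young f g (t : R) : f \in Lfun mu 2%:E -> g \in Lfun mu 2%:E -> 0 < t ->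
  `|\int[mu]_x (f x * g x)| <= t * nrm mu 2 f ^+ 2 + t^-1 * nrm mu 2 g ^+ 2.
Proof.
move=> lf lg t0; rewrite !nrm2_sqr//.
have iff := Lfun2_integrable_sqr lf; have igg := Lfun2_integrable_sqr lg.
have ifg : mu.-integrable setT (EFin \o (fun x => f x * g x)).
  by apply/Lfun1_integrable; exact: (Lfun2_mul_Lfun1 lf lg).
apply: (le_trans (le_normr_Rintegral _ ifg)) => //.
have i1 := integrableZl measurableT t iff.
have i2 := integrableZl measurableT t^-1 igg.
rewrite -!RintegralZl// -RintegralD//.
apply: le_Rintegral => //.
- exact: integrable_norm.
- exact: (integrableD measurableT i1 i2).
move=> x _; rewrite normrM.
have h : 0 <= (t * `|f x| - `|g x|) ^+ 2 by rewrite sqr_ge0.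
rewrite -(ler_pM2l t0).
have -> : t * (t * f x ^+ 2 + t^-1 * g x ^+ 2) = t ^+ 2 * f x ^+ 2 + g x ^+ 2.
  by field; rewrite gt_eqF.
rewrite -[f x ^+ 2]ger0_norm ?sqr_ge0// -[g x ^+ 2]ger0_norm ?sqr_ge0// !normrX.
have t2 : 0 <= t ^+ 2 * `|f x| ^+ 2 by rewrite mulr_ge0// sqr_ge0.
have := sqr_ge0 `|g x|; move: h; rewrite sqrrB exprMn; lra.
Qed.

End integral_supplements.

Lemma sqrt_young (R : rcfType) (p q t : R) : 0 <= p -> 0 <= q -> 0 < t ->
  Num.sqrt p * Num.sqrt q <= t * p + t^-1 * q.
Proof.
move=> p0 q0 t0; rewrite -{2}(sqr_sqrtr p0) -{2}(sqr_sqrtr q0).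
move: (sqrtr_ge0 p) (sqrtr_ge0 q); move: (Num.sqrt p) (Num.sqrt q) => x y xx yy.
rewrite -(ler_pM2l t0).
have -> : t * (t * x ^+ 2 + t^-1 * y ^+ 2) = t ^+ 2 * x ^+ 2 + y ^+ 2.
  by field; rewrite gt_eqF.
have := sqr_ge0 (t * x - y); have := sqr_ge0 y; have := sqr_ge0 (t * x).
rewrite sqrrB exprMn; lra.
Qed.

(** * The closed form and the weak gradient *)

Section sectorial_form.
Context (R : realType) (d : nat).
Local Notation X := 'rV[R]_d.
Variables (P : set (X -> R)) (a : (X -> R) -> (X -> R) -> R) (K : R).
Hypothesis PB : forall f g, P f -> P g -> P (f \- g).
Hypothesis aBl : forall f g h, P f -> P g -> P h -> a (f \- g) h = a f h - a g h.
Hypothesis aBr : forall f g h, P f -> P g -> P h -> a h (f \- g) = a h f - a h g.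
Hypothesis a_ge0 : forall f, P f -> 0 <= a f f.
Hypothesis K0 : 0 < K.
Hypothesis young : forall f g (t : R), P f -> P g -> 0 < t ->
  `|a f g| <= K * (t * a f f + t^-1 * a g g).

Lemma form_sqB_eq f g : P f -> P g ->
  a (f \- g) (f \- g) = a f f - a f g - a g f + a g g.
Proof. by move=> Pf Pg; rewrite aBl ?aBr//; [ring|exact: PB]. Qed.

(** Nonnegativity of the energy of f + g, the sum being written with differences because these are
    the operation under which [P] is assumed stable. *)
Lemma form_sqB f g : P f -> P g -> a (f \- g) (f \- g) <= 2 * a f f + 2 * a g g.
Proof.
move=> Pf Pg.
have P0 : P (f \- f) by exact: PB.
have PN : P ((f \- f) \- g) by exact: PB.
have := a_ge0 (PB Pf PN); rewrite form_sqB_eq// form_sqB_eq// !(aBl, aBr)//; try exact: PB.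
lra.
Qed.

Lemma form_sq_le f g : P f -> P g -> a f f <= 2 * a (f \- g) (f \- g) + 2 * a g g.
Proof.
move=> Pf Pg.
have P0 : P (g \- g) by exact: PB.
have PN : P ((g \- g) \- g) by exact: PB.
have E : f = (f \- g) \- ((g \- g) \- g).
  by apply/funext => x /=; rewrite subrr sub0r opprK subrK.
rewrite {1 2}E; apply: (le_trans (form_sqB (PB Pf Pg) PN)).
by rewrite lerD2l form_sqB_eq// form_sqB_eq// !(aBl, aBr)//; lra.
Qed.

Lemma form_cauchy_bounded u_ : (forall n, P (u_ n)) -> form_cauchy a u_ ->
  exists2 M, 0 < M & forall n, a (u_ n) (u_ n) <= M.
Proof.
move=> Pu /(_ 1 ltr01)[N HN].
pose S := \sum_(i < N) a (u_ i) (u_ i).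
have S0 : 0 <= S by apply: sumr_ge0 => i _; exact: a_ge0.
exists (S + 2 + 2 * a (u_ N) (u_ N)).
  by rewrite ltr_wpDr ?mulr_ge0 ?a_ge0// ltr_wpDl.
move=> n; have [Nn|nN] := leqP N n.
  apply: (le_trans (form_sq_le (Pu n) (Pu N))); rewrite lerD2r.
  have := HN n N Nn (leqnn _); lra.
have : a (u_ n) (u_ n) <= S.
  rewrite /S (bigD1 (Ordinal nN))//= lerDl.
  by apply: sumr_ge0 => i _; exact: a_ge0.
have := a_ge0 (Pu N); lra.
Qed.

(** Young's form of the sector condition is applied to u - u' against v and to u' against v - v'.
    The weight [t] makes the bounded energies contribute K M / t = e / 4, and [del] makes the small
    ones contribute as much. *)
Lemma form_uniform_continuity M e : 0 < M -> 0 < e -> exists2 del, 0 < del &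
  forall u u' v v', P u -> P u' -> P v -> P v' -> a u' u' <= M -> a v v <= M ->
    a (u \- u') (u \- u') <= del -> a (v \- v') (v \- v') <= del ->
    `|a u v - a u' v'| <= e.
Proof.
move=> M0 e0.
pose t := 4 * K * M / e.
have t0 : 0 < t by rewrite divr_gt0// !mulr_gt0.
exists (e / (4 * K * t)); first by rewrite divr_gt0// mulr_gt0// mulr_gt0.
move=> u u' v v' Pu Pu' Pv Pv' uM vM du dv.
have -> : a u v - a u' v' = a (u \- u') v + a u' (v \- v').
  by rewrite aBl// aBr//; ring.
apply: (le_trans (ler_normD _ _)).
have H1 := young (PB Pu Pu') Pv t0.
have t0' : 0 < t^-1 by rewrite invr_gt0.
have H2 := young Pu' (PB Pv Pv') t0'; rewrite invrK in H2.
have E1 : K * (t * (e / (4 * K * t))) = e / 4.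
  by field; rewrite !gt_eqF.
have E2 : K * (t^-1 * M) = e / 4.
  by rewrite /t; field; rewrite !gt_eqF.
have G z w : z <= e / (4 * K * t) -> w <= M -> K * (t * z + t^-1 * w) <= e / 2.
  move=> zd wM; have -> : e / 2 = K * (t * (e / (4 * K * t)) + t^-1 * M).
    by rewrite mulrDr E1 E2; field.
  by rewrite ler_pM2l// lerD// ler_wpM2l// ltW.
have G1 := G _ _ du vM; have G2 := G _ _ dv uM.
rewrite addrC in H2.
have := le_trans H1 G1; have := le_trans H2 G2; lra.
Qed.

Lemma form_cvg u_ v_ : (forall n, P (u_ n)) -> (forall n, P (v_ n)) ->
  form_cauchy a u_ -> form_cauchy a v_ -> cvgn (fun n => a (u_ n) (v_ n)).
Proof.
move=> Pu Pv cu cv.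
have [M1 M10 HM1] := form_cauchy_bounded Pu cu.
have [M2 M20 HM2] := form_cauchy_bounded Pv cv.
apply: cauchy_cvg_seq => e e0.
have [M0 M] : 0 < M1 + M2 /\ True by split => //; exact: addr_gt0.
have [del d0 Hd] := form_uniform_continuity M0 e0.
have [N1 HN1] := cu _ d0; have [N2 HN2] := cv _ d0.
exists (maxn N1 N2) => m n; rewrite !geq_max => /andP[m1 m2] /andP[n1 n2].
apply: Hd => //.
- by apply: (le_trans (HM1 n)); rewrite lerDl ltW.
- by apply: (le_trans (HM2 m)); rewrite lerDr ltW.
- exact/ltW/HN1.
- exact/ltW/HN2.
Qed.

(** This is what makes limits of the form independent of the approximating sequences. *)
Lemma form_cvg_dist u_ u'_ v_ v'_ M : (forall n, P (u_ n)) -> (forall n, P (u'_ n)) ->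
  (forall n, P (v_ n)) -> (forall n, P (v'_ n)) -> 0 < M ->
  (forall n, a (u'_ n) (u'_ n) <= M) -> (forall n, a (v_ n) (v_ n) <= M) ->
  a (u_ n \- u'_ n) (u_ n \- u'_ n) @[n --> \oo] --> (0 : R) ->
  a (v_ n \- v'_ n) (v_ n \- v'_ n) @[n --> \oo] --> (0 : R) ->
  a (u_ n) (v_ n) - a (u'_ n) (v'_ n) @[n --> \oo] --> (0 : R).
Proof.
move=> Pu Pu' Pv Pv' M0 uM vM /cvg_seqP Cu /cvg_seqP Cv; apply/cvg_seqP => e e0.
have e20 : 0 < e / 2 by rewrite divr_gt0.
have [del d0 Hd] := form_uniform_continuity M0 e20.
have [N1 HN1] := Cu _ d0; have [N2 HN2] := Cv _ d0.
exists (maxn N1 N2) => n; rewrite geq_max => /andP[n1 n2]; rewrite subr0.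
apply: (@le_lt_trans _ _ (e / 2)); last by rewrite ltr_pdivrMr// ltr_pMr// ltr1n.
apply: Hd => //.
- by have := HN1 n n1; rewrite subr0 => /ltW; apply: le_trans; exact: ler_norm.
- by have := HN2 n n2; rewrite subr0 => /ltW; apply: le_trans; exact: ler_norm.
Qed.

Lemma form_cauchyB u_ v_ : (forall n, P (u_ n)) -> (forall n, P (v_ n)) ->
  form_cauchy a u_ -> form_cauchy a v_ -> form_cauchy a (fun n => u_ n \- v_ n).
Proof.
move=> Pu Pv cu cv e e0; have e40 : 0 < e / 4 by rewrite divr_gt0.
have [N1 HN1] := cu _ e40; have [N2 HN2] := cv _ e40.
exists (maxn N1 N2) => m n; rewrite !geq_max => /andP[m1 m2] /andP[n1 n2].
have -> : u_ m \- v_ m \- (u_ n \- v_ n) = (u_ m \- u_ n) \- (v_ m \- v_ n).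
  by apply/funext => x /=; ring.
apply: (le_lt_trans (form_sqB (PB (Pu m) (Pu n)) (PB (Pv m) (Pv n)))).
have := HN1 m n m1 n1; have := HN2 m n m2 n2; lra.
Qed.

Lemma form_cauchy_cvg u_ v_ : (forall n, P (u_ n)) -> (forall n, P (v_ n)) ->
  form_cauchy a v_ -> a (u_ n \- v_ n) (u_ n \- v_ n) @[n --> \oo] --> (0 : R) ->
  form_cauchy a u_.
Proof.
move=> Pu Pv cv /cvg_seqP H e e0; have e80 : 0 < e / 16 by rewrite divr_gt0.
have [N1 HN1] := cv _ e80; have [N2 HN2] := H _ e80.
exists (maxn N1 N2) => m n; rewrite !geq_max => /andP[m1 m2] /andP[n1 n2].
have := form_sq_le (PB (Pu m) (Pu n)) (PB (Pv m) (Pv n)).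
have -> : (u_ m \- u_ n) \- (v_ m \- v_ n) = (u_ m \- v_ m) \- (u_ n \- v_ n).
  by apply/funext => x /=; ring.
move=> /le_lt_trans; apply.
have := form_sqB (PB (Pu m) (Pv m)) (PB (Pu n) (Pv n)).
have := HN1 m n m1 n1.
have := HN2 m m2; rewrite subr0 ger0_norm ?a_ge0//; last exact: PB.
have := HN2 n n2; rewrite subr0 ger0_norm ?a_ge0//; last exact: PB.
lra.
Qed.

End sectorial_form.

(** * The form on smooth functions: integrability and local ellipticity *)

Section preform.
Context (R : realType) (d : nat).
Local Notation X := 'rV[R]_d.
Variables (E : set X) (phi : X -> R) (mu : {measure set X -> \bar R}).
Variable A : X -> 'M[R]_d.
Hypothesis ocE : open_or_closed_null_boundary E.
Hypothesis iphi : loc_integrable (lebesgue_rV d) E phi.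
Hypothesis muE : forall S : set X, measurable S ->
    mu S = (\int[lebesgue_rV d]_(x in E `&` S) (phi x)%:E)%E.
Hypothesis iA : forall i j, loc_integrable mu E (fun x => A x i j).
Hypothesis ell : loc_elliptic E A.
Implicit Types (f g h : X -> R) (V K : set X) (x xi eta : X).

Let oc : open E \/ closed E. Proof. exact: open_or_closed ocE. Qed.
Let mE : measurable E. Proof. exact: measurable_domain ocE. Qed.

Definition bil x xi eta : R := dotp (xi *m (A x)^T) eta.

Lemma bilDl x xi xi' eta : bil x (xi + xi') eta = bil x xi eta + bil x xi' eta.
Proof. by rewrite /bil mulmxDl dotpDl. Qed.

Lemma bilZl x (c : R) xi eta : bil x (c *: xi) eta = c * bil x xi eta.
Proof. by rewrite /bil -scalemxAl dotpZl. Qed.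

Lemma bilDr x xi eta eta' : bil x xi (eta + eta') = bil x xi eta + bil x xi eta'.
Proof. by rewrite /bil dotpDr. Qed.

Lemma bilZr x (c : R) xi eta : bil x xi (c *: eta) = c * bil x xi eta.
Proof. by rewrite /bil dotpZr. Qed.

Lemma bil0l x eta : bil x 0 eta = 0.
Proof. by rewrite /bil mul0mx dotp0l. Qed.

Lemma bil0r x xi : bil x xi 0 = 0.
Proof. by rewrite /bil dotp0r. Qed.

Lemma bilE x xi eta : bil x xi eta = \sum_i \sum_j A x i j * (xi 0 j * eta 0 i).
Proof.
rewrite /bil dotpE; apply: eq_bigr => i _; rewrite mxE mulr_suml.
by apply: eq_bigr => j _; rewrite mxE; ring.
Qed.

Lemma bil_symmetric_part x xi :
  bil x xi xi = \sum_i \sum_j symmetric_part (A x) i j * xi 0 i * xi 0 j.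
Proof.
have H : bil x xi xi = \sum_i \sum_j A x j i * (xi 0 j * xi 0 i).
  rewrite bilE exchange_big/=; apply: eq_bigr => i _; apply: eq_bigr => j _.
  by rewrite (mulrC (xi 0 i)).
have -> : bil x xi xi = 2^-1 * (bil x xi xi + bil x xi xi) by field.
rewrite {1}bilE H -big_split mulr_sumr/=; apply: eq_bigr => i _.
rewrite -big_split mulr_sumr/=; apply: eq_bigr => j _.
by rewrite !mxE; ring.
Qed.

Lemma bil_elliptic V : rel_compact E V -> exists2 nu : R, 0 < nu &
  forall xi x, V x -> nu^-1 * dotp xi xi <= bil x xi xi <= nu * dotp xi xi.
Proof.
move=> /ell[nu nu0 H]; exists nu => // xi x Vx; rewrite bil_symmetric_part.
exact: H.
Qed.

(** Ellipticity is assumed on relatively compact sets; a small one around the point suffices. *)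
Lemma bil_ge0 x xi : E x -> 0 <= bil x xi xi.
Proof.
move=> Ex; have [r r0 /bil_elliptic[nu nu0 H]] := rel_compact_nbhs oc Ex.
have /andP[+ _] := H xi x (conj Ex (ballxx x r0)); apply: le_trans.
by rewrite mulr_ge0 ?dotp_ge0// invr_ge0 ltW.
Qed.

Lemma smooth_measurable f : smooth f -> measurable_fun setT f.
Proof. by move=> sf; apply: continuous_measurable_rV; exact: smooth_continuous. Qed.

Lemma partial_measurable f i : smooth f -> measurable_fun setT (partial i f).
Proof. by move=> sf; apply: continuous_measurable_rV; exact: partial_continuous. Qed.

Lemma dotp_measurable (D : set X) (F G : X -> X) : measurable D ->
  (forall i, measurable_fun D (fun x => F x 0 i)) ->
  (forall i, measurable_fun D (fun x => G x 0 i)) ->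
  measurable_fun D (fun x => dotp (F x) (G x)).
Proof.
move=> mD mF mG; under eq_fun do rewrite dotpE.
by apply: measurable_sum => // i; exact: measurable_funM.
Qed.

Lemma grad_measurable D f i : smooth f -> measurable_fun D (fun x => grad f x 0 i).
Proof.
move=> sf; under eq_fun do rewrite gradE.
by apply: (@measurable_funS _ _ _ _ setT) => //; exact: partial_measurable.
Qed.

Lemma C0infty_outside f x : E x -> ~ (E `&` supp f) x -> f x = 0 /\ grad f x = 0.
Proof.
by move=> Ex H; split; [apply: supp_notin|apply: supp_grad] => sx; apply: H.
Qed.

(** The entries of [A] are locally integrable; the partial derivatives are bounded, and the
    integrand vanishes off the trace on [E] of the support of [f], which is compact. *)
Lemma preform_integrable f g : C0infty E f -> C0infty E g ->
  mu.-integrable E (EFin \o (fun x => bil x (grad f x) (grad g x))).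
Proof.
move=> Hf Hg; have cK := C0infty_compact oc Hf.
have KE : E `&` supp f `<=` E by exact: subIsetl.
have mK : measurable (E `&` supp f) by apply: closed_measurable_rV; exact: compact_closed_rV.
apply: (integrable_restrict_eq mE mK KE); last first.
  by move=> x Ex /(C0infty_outside Ex)[_ ->]; rewrite bil0l.
have -> : EFin \o (fun x => bil x (grad f x) (grad g x)) =
   (fun x => (\sum_i \sum_j ((partial j f x * partial i g x) * A x i j)%R%:E)%E).
  apply/funext => x /=; rewrite bilE -sumEFin; apply: eq_bigr => i _.
  rewrite -sumEFin; apply: eq_bigr => j _; rewrite !gradE; congr EFin; ring.
apply: integrable_sum => // i _; apply: integrable_sum => // j _.
have [M M0 HM] := partial_bounded j Hf; have [M' M'0 HM'] := partial_bounded i Hg.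
apply: (@integrable_bounded_mul _ _ _ _ _ _ _ (M * M')) => //.
- apply: (@measurable_funS _ _ _ _ setT) => //; apply: measurable_funM.
    by apply: partial_measurable; exact: C0infty_smooth Hf.
  by apply: partial_measurable; exact: C0infty_smooth Hg.
- by move=> x _; rewrite normrM ler_pM.
- exact: iA.
Qed.

Local Notation a := (form0 E mu A).

Lemma form0_linl (c : R) f g h : C0infty E f -> C0infty E g -> C0infty E h ->
  a (fun x => c * f x + g x) h = c * a f h + a g h.
Proof.
move=> Hf Hg Hh; rewrite /form0 -RintegralZl//; last exact: preform_integrable.
rewrite -RintegralD//; last 2 first.
- exact: (integrableZl mE c (preform_integrable Hf Hh)).
- exact: preform_integrable.
apply: eq_Rintegral => x _; rewrite -!/(bil _ _ _) gradD ?gradZ ?bilDl ?bilZl//.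
- exact: C0infty_smooth Hf.
- by apply: smoothZ; exact: C0infty_smooth Hf.
- exact: C0infty_smooth Hg.
Qed.

Lemma form0_linr (c : R) f g h : C0infty E f -> C0infty E g -> C0infty E h ->
  a h (fun x => c * f x + g x) = c * a h f + a h g.
Proof.
move=> Hf Hg Hh; rewrite /form0 -RintegralZl//; last exact: preform_integrable.
rewrite -RintegralD//; last 2 first.
- exact: (integrableZl mE c (preform_integrable Hh Hf)).
- exact: preform_integrable.
apply: eq_Rintegral => x _; rewrite -!/(bil _ _ _) gradD ?gradZ ?bilDr ?bilZr//.
- exact: C0infty_smooth Hf.
- by apply: smoothZ; exact: C0infty_smooth Hf.
- exact: C0infty_smooth Hg.
Qed.

Lemma subf_lin f g : f \- g = fun x => -1 * g x + f x.
Proof. by apply/funext => x /=; rewrite mulN1r addrC. Qed.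

Lemma form0Bl f g h : C0infty E f -> C0infty E g -> C0infty E h ->
  a (f \- g) h = a f h - a g h.
Proof. by move=> Hf Hg Hh; rewrite subf_lin form0_linl// mulN1r addrC. Qed.

Lemma form0Br f g h : C0infty E f -> C0infty E g -> C0infty E h ->
  a h (f \- g) = a h f - a h g.
Proof. by move=> Hf Hg Hh; rewrite subf_lin form0_linr// mulN1r addrC. Qed.

Lemma form0_ge0 f : 0 <= a f f.
Proof. by apply: Rintegral_ge0 => x Ex; exact: bil_ge0. Qed.

(** The sector condition with its square roots removed: later estimates are then linear in the
    energies, and the free weight [t] replaces an optimisation. *)
Lemma form0_young : strong_sector E mu A -> exists2 K : R, 0 < K &
  forall f g (t : R), C0infty E f -> C0infty E g -> 0 < t ->
  `|a f g| <= K * (t * a f f + t^-1 * a g g).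
Proof.
move=> [K K0 H]; exists K => // f g t Hf Hg t0.
apply: (le_trans (H f g Hf Hg)); rewrite -mulrA ler_pM2l//.
by apply: sqrt_young => //; exact: form0_ge0.
Qed.

Definition grad_sq f x : R := dotp (grad f x) (grad f x).

Lemma grad_sq_integrable f K : C0infty E f -> measurable K -> (mu K < +oo)%E ->
  mu.-integrable K (EFin \o grad_sq f).
Proof.
move=> Hf mK Kfin; have sf := C0infty_smooth Hf.
have /boolp.choice[M HM] : forall i, exists M : R, forall x, `|partial i f x| <= M.
  by move=> i; have [M _ HM] := partial_bounded i Hf; exists M.
apply: (@bounded_integrable _ _ _ _ _ _ (\sum_i M i ^+ 2)) => //.
  by apply: dotp_measurable => // i; exact: grad_measurable.
move=> x _; rewrite ger0_norm ?dotp_ge0// /grad_sq dotpE; apply: ler_sum => i _.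
rewrite gradE -expr2 -[X in X <= _](ger0_norm (sqr_ge0 _)) normrX.
have H := HM i x; rewrite lerXn2r ?nnegrE//.
exact: le_trans H.
Qed.

Lemma grad_sq_ge0 f x : 0 <= grad_sq f x.
Proof. exact: dotp_ge0. Qed.

Lemma grad_sq_le_form V : rel_compact E V -> exists2 nu : R, 0 < nu & forall f,
  C0infty E f -> \int[mu]_(x in V) grad_sq f x <= nu * a f f.
Proof.
move=> HV; have [nu nu0 H] := bil_elliptic HV; exists nu => // f Hf.
have VE := rel_compact_sub HV; have mV := rel_compact_measurable ocE HV.
have Vfin := rel_compact_finite_measure ocE iphi muE HV.
have iE := preform_integrable Hf Hf.
have iV : mu.-integrable V (EFin \o (fun x => bil x (grad f x) (grad f x))).
  exact: integrableS iE.
have ig := grad_sq_integrable Hf mV Vfin.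
rewrite mulrC -ler_pdivrMr// mulrC -RintegralZl//.
apply: (@le_trans _ _ (\int[mu]_(x in V) bil x (grad f x) (grad f x))).
  apply: le_Rintegral => //.
    have := integrableZl mV nu^-1 ig; by [].
  by move=> x Vx; have /andP[] := H (grad f x) x Vx.
by apply: (Rintegral_subset_le mV mE VE iE) => x Ex; exact: bil_ge0.
Qed.

(** Ellipticity bounds the form from above inside [V] only, whence the condition that the gradient
    vanish on the rest of [E]. *)
Lemma form_le_grad_sq V : rel_compact E V -> exists2 nu : R, 0 < nu & forall f,
  C0infty E f -> (forall x, E x -> ~ V x -> grad f x = 0) ->
  a f f <= nu * \int[mu]_(x in V) grad_sq f x.
Proof.
move=> HV; have [nu nu0 H] := bil_elliptic HV; exists nu => // f Hf f0.
have VE := rel_compact_sub HV; have mV := rel_compact_measurable ocE HV.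
have Vfin := rel_compact_finite_measure ocE iphi muE HV.
have iE := preform_integrable Hf Hf.
have ig := grad_sq_integrable Hf mV Vfin.
rewrite -RintegralZl// /form0 (Rintegral_restrict_eq _ VE); last first.
  by move=> x Ex nVx; rewrite f0// -/(bil _ _ _) bil0l.
apply: le_Rintegral => //.
- exact: integrableS iE.
- have := integrableZl mV nu ig; by [].
- by move=> x Vx; have /andP[] := H (grad f x) x Vx.
Qed.

(** For closed [E] the support may leave [E]: finiteness of [mu] on compact subsets of [E] is used
    on the trace of the support, and the complement of [E] is null. *)
Lemma C0infty_L2 f : C0infty E f -> f \in Lfun mu 2%:E.
Proof.
move=> Hf; have [M M0 HM] := C0infty_bounded Hf.
have mf : measurable_fun setT f by apply: smooth_measurable; exact: C0infty_smooth Hf.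
have cK := C0infty_compact oc Hf.
have KE : E `&` supp f `<=` E by exact: subIsetl.
have mK : measurable (E `&` supp f) by apply: closed_measurable_rV; exact: compact_closed_rV.
have Kfin := domain_compact_finite iphi muE cK KE.
apply: Lfun2I => //.
have iK : mu.-integrable (E `&` supp f) (EFin \o (fun x => f x ^+ 2)).
  apply: (@bounded_integrable _ _ _ _ _ _ (M ^+ 2)) => //.
    by apply: (@measurable_funS _ _ _ _ setT) => //; exact: measurable_funX.
  by move=> x _; rewrite normrX lerXn2r ?nnegrE.
have iE : mu.-integrable E (EFin \o (fun x => f x ^+ 2)).
  apply: (integrable_restrict_eq mE mK KE iK) => x Ex /(C0infty_outside Ex)[-> _].
  by rewrite expr0n.
have [N [mN N0 HN]] := ae_domain ocE muE.
apply/(negligible_integrable mN measurableT _ N0).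
  by apply/measurable_EFinP; exact: measurable_funX.
apply: (integrableS mE _ _ iE).
- exact: measurableD.
- by move=> x [_ Nx]; apply: contrapT => nEx; apply: Nx; exact: HN.
Qed.

End preform.

(** The hypotheses on the symmetric and antisymmetric diffusion part alone; those on [B] and on the
    semigroups enter separately. *)
Record form_setting (R : realType) (d : nat) (E : set 'rV[R]_d) (phi : 'rV[R]_d -> R)
    (mu : {measure set 'rV[R]_d -> \bar R}) (A : 'rV[R]_d -> 'M[R]_d) : Prop := {
  setting_domain : open_or_closed_null_boundary E;
  setting_density : loc_integrable (lebesgue_rV d) E phi;
  setting_measure : forall S : set 'rV[R]_d, measurable S ->
    mu S = (\int[lebesgue_rV d]_(x in E `&` S) (phi x)%:E)%E;
  setting_matrix : forall i j, loc_integrable mu E (fun x => A x i j);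
  setting_elliptic : loc_elliptic E A;
  setting_closable : closable_form E mu A;
  setting_sector : strong_sector E mu A }.

(** * The closed form: bilinearity, positivity, approximation by smooth functions *)

Section closed_form.
Context (R : realType) (d : nat).
Local Notation X := 'rV[R]_d.
Variables (E : set X) (phi : X -> R) (mu : {measure set X -> \bar R}).
Variable A : X -> 'M[R]_d.
Hypothesis H : form_setting E phi mu A.
Implicit Types (f g h u v w : X -> R) (V K : set X) (x : X).

Local Notation C := (C0infty E).
Local Notation a := (form0 E mu A).
Local Notation L2 := (Lfun mu 2%:E).
Local Notation approx := (form_approx E mu A C).
Local Notation D := (form_dom E mu A).
Local Notation form := (Defs.form E mu A).
Local Notation wgrad := (Defs.wgrad E mu A).

Let oc : open E \/ closed E. Proof. exact: open_or_closed (setting_domain H). Qed.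
Let mE : measurable E. Proof. exact: measurable_domain (setting_domain H). Qed.
Let p2 : (1 : R) <= 2. Proof. by rewrite ler1n. Qed.

Let aBl f g h : C f -> C g -> C h -> a (f \- g) h = a f h - a g h.
Proof. by apply: form0Bl; [exact: setting_domain H|exact: setting_matrix H]. Qed.
Let aBr f g h : C f -> C g -> C h -> a h (f \- g) = a h f - a h g.
Proof. by apply: form0Br; [exact: setting_domain H|exact: setting_matrix H]. Qed.
Let a_ge0 f : C f -> 0 <= a f f.
Proof. by move=> _; apply: form0_ge0; [exact: setting_domain H|exact: setting_elliptic H]. Qed.
Let a_young : exists2 K : R, 0 < K &
  forall f g (t : R), C f -> C g -> 0 < t ->
  `|a f g| <= K * (t * a f f + t^-1 * a g g).
Proof.
by apply: form0_young; [exact: setting_domain H|exact: setting_elliptic H|exact: setting_sector H].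
Qed.
Let CB f g : C f -> C g -> C (f \- g). Proof. exact: C0inftyB. Qed.
Let a_linl (c : R) f g h : C f -> C g -> C h ->
  a (fun x => c * f x + g x) h = c * a f h + a g h.
Proof. by apply: form0_linl; [exact: setting_domain H|exact: setting_matrix H]. Qed.
Let a_linr (c : R) f g h : C f -> C g -> C h ->
  a h (fun x => c * f x + g x) = c * a h f + a h g.
Proof. by apply: form0_linr; [exact: setting_domain H|exact: setting_matrix H]. Qed.
Let CL2 f : C f -> f \in L2.
Proof. exact: (C0infty_L2 (setting_domain H) (setting_density H) (setting_measure H)). Qed.


#[local] Opaque form0.

Lemma C0infty_lin (c : R) f g : C f -> C g -> C (fun x => c * f x + g x).
Proof. by move=> Cf Cg; apply: C0inftyD => //; exact: C0inftyZ. Qed.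

Lemma form_approx_L2 (u_ : nat -> X -> R) u : u \in L2 -> approx u_ u ->
  nrm mu 2 (fun x => u_ n x - u x) @[n --> \oo] --> (0 : R).
Proof. by move=> lu [Cu _ L]; apply/(Lnorm_cvgP p2) => // n; exact: CL2. Qed.

Lemma form_approx_lin (c : R) (u_ : nat -> X -> R) u (v_ : nat -> X -> R) v : u \in L2 -> v \in L2 ->
  approx u_ u -> approx v_ v ->
  approx (fun n x => c * u_ n x + v_ n x) (fun x => c * u x + v x).
Proof.
move=> lu lv Au Av.
have nu := form_approx_L2 lu Au; have nv := form_approx_L2 lv Av.
have [Cu cu _] := Au; have [Cv cv _] := Av; split.
- by move=> n; exact: C0infty_lin.
- move=> e e0.
  have q0 : 0 < 2 * c ^+ 2 + 1 by rewrite ltr_wpDl// mulr_ge0// sqr_ge0.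
  have e1 : 0 < e / 2 / (2 * c ^+ 2 + 1) by rewrite !divr_gt0.
  have e2 : 0 < e / 4 by rewrite divr_gt0.
  have [N1 HN1] := cu _ e1; have [N2 HN2] := cv _ e2.
  exists (maxn N1 N2) => m n; rewrite !geq_max => /andP[m1 m2] /andP[n1 n2].
  have -> : (fun x => c * u_ m x + v_ m x) \- (fun x => c * u_ n x + v_ n x) =
     (fun x => c * (u_ m \- u_ n) x + (v_ m \- v_ n) x).
    by apply/funext => x /=; ring.
  have Cf : C (u_ m \- u_ n) by exact: CB.
  have Cg : C (v_ m \- v_ n) by exact: CB.
  have H1 := HN1 m n m1 n1; rewrite ltr_pdivlMr// in H1.
  have H2 := HN2 m n m2 n2.
  move: (u_ m \- u_ n) (v_ m \- v_ n) Cf Cg H1 H2 => f g Cf Cg H1 H2.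
  have sq (b : R) : a (fun x => b * f x + g x) (fun x => b * f x + g x) =
      b ^+ 2 * a f f + b * (a f g + a g f) + a g g.
    have Cc := C0infty_lin b Cf Cg.
    by rewrite (a_linl b Cf Cg Cc) (a_linr b Cf Cg Cf) (a_linr b Cf Cg Cg);
      move: (a f f) (a f g) (a g f) (a g g) => *; ring.
  (* Nonnegativity of the energy of g - c f bounds that of c f + g by 2 c^2 a(f, f) + 2 a(g, g),
     which explains the thresholds chosen above. *)
  have := a_ge0 (C0infty_lin (- c) Cf Cg); have := a_ge0 Cf.
  rewrite !sq sqrrN; move: (a f f) (a g g) (a f g + a g f) H1 H2 => p q r; lra.
- apply/(Lnorm_cvgP p2).
  + by move=> n; apply: CL2; exact: C0infty_lin.
  + by apply: (LfunD p2) => //; exact: (LfunZ p2).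
  apply: (@cvg_dist_le _ _ (fun n => `|c| * nrm mu 2 (fun x => u_ n x - u x) +
      nrm mu 2 (fun x => v_ n x - v x))); last first.
    rewrite -[X in _ --> X](addr0 (0 : R)) -{1}(mulr0 `|c|).
    by apply: cvgD => //; apply: cvgM => //; exact: cvg_cst.
  move=> n; rewrite subr0 ger0_norm ?nrm_ge0//.
  have lun : (fun x => u_ n x - u x) \in L2 by apply: (LfunB p2) => //; exact: CL2.
  have lvn : (fun x => v_ n x - v x) \in L2 by apply: (LfunB p2) => //; exact: CL2.
  have -> : (fun x => c * u_ n x + v_ n x - (c * u x + v x)) =
      (fun x => c * (u_ n x - u x) + (v_ n x - v x)).
    by apply/funext => x; ring.
  rewrite -(nrmZ p2 c lun); apply: (nrmD p2) => //; exact: (LfunZ p2).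
Qed.

Lemma form_approx_cst f : C f -> approx (fun=> f) f.
Proof.
move=> Cf; split=> // [e e0|].
- by exists 0%N => m n _ _; rewrite aBl ?subrr//; exact: CB.
- apply/(Lnorm_cvgP p2) => [n| |]; try exact: CL2.
  under eq_fun do under eq_fun do rewrite subrr.
  by rewrite (nrm0 mu p2); exact: cvg_cst.
Qed.

(** The difference of the two sequences approximates 0, so closability applies. *)
Lemma form_approx_unique (u_ v_ : nat -> X -> R) u : u \in L2 -> approx u_ u -> approx v_ u ->
  a (u_ n \- v_ n) (u_ n \- v_ n) @[n --> \oo] --> (0 : R).
Proof.
move=> lu Au Av; have := form_approx_lin (-1) lu lu Av Au.
rewrite (_ : (fun x => -1 * u x + u x) = cst 0); last first.
  by apply/funext => x /=; rewrite mulN1r addNr.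
move=> /(setting_closable H).
move=> L; have E1 : (fun n => a (u_ n \- v_ n) (u_ n \- v_ n)) =
    (fun n => a (fun x => -1 * v_ n x + u_ n x) (fun x => -1 * v_ n x + u_ n x)).
  by apply/funext => n; rewrite (subf_lin (u_ n) (v_ n)).
by rewrite E1; exact: L.
Qed.

(** [form] selects a limit along some pair of sequences. A limit exists by the Cauchy property, and
    closability makes it the same along all pairs. *)
Lemma form_approx_form (u_ v_ : nat -> X -> R) u v : u \in L2 -> v \in L2 -> approx u_ u -> approx v_ v ->
  a (u_ n) (v_ n) @[n --> \oo] --> (form u v : R).
Proof.
move=> lu lv Au Av; have [K K0 young] := a_young.
have [Cu cu _] := Au; have [Cv cv _] := Av.
rewrite /Defs.form; case: xgetP => [l _ /= [u'_ [v'_ [Au' Av' L]]]|]; last first.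
  have /cvg_ex[l L] := form_cvg CB aBl aBr a_ge0 K0 young Cu Cv cu cv.
  by move=> /(_ l)/= []; exists u_, v_.
have [Cu' cu' _] := Au'; have [Cv' cv' _] := Av'.
have [M1 M10 HM1] := form_cauchy_bounded CB aBl aBr a_ge0 Cu' cu'.
have [M2 M20 HM2] := form_cauchy_bounded CB aBl aBr a_ge0 Cv cv.
have := form_cvg_dist CB aBl aBr K0 young Cu Cu' Cv Cv' (addr_gt0 M10 M20) _ _
  (form_approx_unique lu Au Au') (form_approx_unique lv Av Av').
move=> /(_ (fun n => le_trans (HM1 n) _))/(_ (fun n => le_trans (HM2 n) _)) D0.
have {}D0 : a (u_ n) (v_ n) - a (u'_ n) (v'_ n) @[n --> \oo] --> (0 : R).
  by apply: D0; rewrite ?lerDl ?lerDr ltW.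
rewrite -[l]add0r; have -> : (fun n => a (u_ n) (v_ n)) =
    (fun n => (a (u_ n) (v_ n) - a (u'_ n) (v'_ n)) + a (u'_ n) (v'_ n)).
  by apply/funext => n; rewrite subrK.
exact: cvgD.
Qed.

Lemma form_dom_L2 u : D u -> u \in L2.
Proof. by case. Qed.

Lemma form_dom_lin (c : R) u v : D u -> D v -> D (fun x => c * u x + v x).
Proof.
move=> [lu [u_ Au]] [lv [v_ Av]]; split.
  by apply: (LfunD p2) => //; exact: (LfunZ p2).
by exists (fun n x => c * u_ n x + v_ n x); exact: form_approx_lin.
Qed.

Lemma form_dom_C0infty f : C f -> D f.
Proof. by move=> Cf; split; [exact: CL2|exists (fun=> f); exact: form_approx_cst]. Qed.

Lemma form_domB u v : D u -> D v -> D (u \- v).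
Proof. by move=> Du Dv; rewrite subf_lin; exact: form_dom_lin. Qed.

Lemma form_linl (c : R) u u' v : D u -> D u' -> D v ->
  form (fun x => c * u x + u' x) v = c * form u v + form u' v.
Proof.
move=> [lu [u_ Au]] [lu' [u'_ Au']] [lv [v_ Av]].
have [Cu _ _] := Au; have [Cu' _ _] := Au'; have [Cv _ _] := Av.
have L := form_approx_form lu lv Au Av; have L' := form_approx_form lu' lv Au' Av.
have lc : (fun x => c * u x + u' x) \in L2.
  by apply: (LfunD p2) => //; exact: (LfunZ p2).
have := form_approx_form lc lv (form_approx_lin c lu lu' Au Au') Av.
under eq_fun do rewrite a_linl//.
move=> L1; apply: (cvg_unique _ L1) => //.
by apply: cvgD => //; apply: cvgM => //; exact: cvg_cst.
Qed.

Lemma form_linr (c : R) u u' v : D u -> D u' -> D v ->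
  form v (fun x => c * u x + u' x) = c * form v u + form v u'.
Proof.
move=> [lu [u_ Au]] [lu' [u'_ Au']] [lv [v_ Av]].
have [Cu _ _] := Au; have [Cu' _ _] := Au'; have [Cv _ _] := Av.
have L := form_approx_form lv lu Av Au; have L' := form_approx_form lv lu' Av Au'.
have lc : (fun x => c * u x + u' x) \in L2.
  by apply: (LfunD p2) => //; exact: (LfunZ p2).
have := form_approx_form lv lc Av (form_approx_lin c lu lu' Au Au').
under eq_fun do rewrite a_linr//.
move=> L1; apply: (cvg_unique _ L1) => //.
by apply: cvgD => //; apply: cvgM => //; exact: cvg_cst.
Qed.

Lemma formBl u v w : D u -> D v -> D w -> form (u \- v) w = form u w - form v w.
Proof. by move=> Du Dv Dw; rewrite subf_lin form_linl// mulN1r addrC. Qed.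

Lemma formBr u v w : D u -> D v -> D w -> form w (u \- v) = form w u - form w v.
Proof. by move=> Du Dv Dw; rewrite subf_lin form_linr// mulN1r addrC. Qed.

Lemma form_ge0 u : D u -> 0 <= form u u.
Proof.
move=> [lu [u_ Au]]; have [Cu _ _] := Au.
by apply: (cvg_ge_cst (form_approx_form lu lu Au Au)) => n; exact: a_ge0.
Qed.

Lemma form_young : exists2 K : R, 0 < K & forall u v (t : R), D u -> D v -> 0 < t ->
  `|form u v| <= K * (t * form u u + t^-1 * form v v).
Proof.
have [K K0 young] := a_young; exists K => // u v t [lu [u_ Au]] [lv [v_ Av]] t0.
have [Cu _ _] := Au; have [Cv _ _] := Av.
have /cvg_norm L : a (u_ n) (v_ n) @[n --> \oo] --> form u v by exact: form_approx_form.
have Lu := form_approx_form lu lu Au Au; have Lv := form_approx_form lv lv Av Av.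
apply: (cvg_le_cvg L (v := fun n => K * (t * a (u_ n) (u_ n) + t^-1 * a (v_ n) (v_ n)))).
  apply: cvgM; first exact: cvg_cst.
  by apply: cvgD; apply: cvgM => //; exact: cvg_cst.
by move=> n; exact: young.
Qed.

Lemma form_C0infty f g : C f -> C g -> form f g = a f g.
Proof.
move=> Cf Cg.
have := form_approx_form (CL2 Cf) (CL2 Cg) (form_approx_cst Cf) (form_approx_cst Cg).
by move=> L; apply: (cvg_unique _ L) => //; exact: cvg_cst.
Qed.

(** For fixed n, the energy of [u_ n - u] is the limit over m of the energies of [u_ n - u_ m],
    which the Cauchy property makes small. *)
Lemma form_approx_energy (u_ : nat -> X -> R) u : u \in L2 -> approx u_ u ->
  form (u_ n \- u) (u_ n \- u) @[n --> \oo] --> (0 : R).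
Proof.
move=> lu Au; have [Cu cu _] := Au; have Du : D u by split => //; exists u_.
apply/cvg_seqP => e e0; have e20 : 0 < e / 2 by rewrite divr_gt0.
have [N HN] := cu _ e20; exists N => n Nn.
have Dn : D (u_ n \- u) by apply: form_domB => //; exact: form_dom_C0infty.
rewrite subr0 ger0_norm; last exact: form_ge0.
apply: (@le_lt_trans _ _ (e / 2)); last by rewrite ltr_pdivrMr// ltr_pMr// ltr1n.
have Ac := form_approx_cst (Cu n).
have A1 := form_approx_lin (-1) lu (CL2 (Cu n)) Au Ac.
have lc : (fun x => -1 * u x + u_ n x) \in L2.
  by apply: (LfunD p2) => //; [exact: (LfunZ p2)|exact: CL2].
have L := form_approx_form lc lc A1 A1; rewrite -subf_lin in L.
have L2 := cvg_subseq (phi := fun k => (k + N)%N) (fun k => leq_addr _ _) L.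
apply: (cvg_le_cst L2) => m /=; rewrite -subf_lin.
by apply/ltW/HN => //; exact: leq_addl.
Qed.

End closed_form.

Lemma cvge0P (R : realType) (u : nat -> \bar R) : (forall n, (0 <= u n)%E) ->
  u n @[n --> \oo] --> 0%E <->
  forall e : R, 0 < e -> exists N : nat, forall n, (N <= n)%N -> (u n <= e%:E)%E.
Proof.
move=> u0; split=> [/fine_cvgP[[N1 _ H1] /cvg_seqP H2] e e0|H].
  have [N2 HN2] := H2 _ e0; exists (maxn N1 N2) => n; rewrite geq_max => /andP[n1 n2].
  have := HN2 n n2; rewrite subr0 /= => /(le_lt_trans (ler_norm _))/ltW.
  by rewrite -lee_fin fineK//; exact: H1.
apply/fine_cvgP; split.
  have [N HN] := H 1 ltr01; exists N => // n /= Nn.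
  by rewrite ge0_fin_numE// (le_lt_trans (HN n Nn))// ltry.
apply/cvg_seqP => e e0; have e20 : 0 < e / 2 by rewrite divr_gt0.
have [N HN] := H _ e20; exists N => n Nn; have Hn := HN n Nn.
rewrite subr0 /= ger0_norm ?fine_ge0//.
apply: (@le_lt_trans _ _ (e / 2)); last by rewrite ltr_pdivrMr// ltr_pMr// ltr1n.
by rewrite -lee_fin fineK// ge0_fin_numE// (le_lt_trans Hn)// ltry.
Qed.

Lemma cvg_sumr (R : realType) (I : Type) (r : seq I) (f : I -> nat -> R) (l : I -> R) :
  (forall i, f i n @[n --> \oo] --> l i) ->
  \sum_(i <- r) f i n @[n --> \oo] --> \sum_(i <- r) l i.
Proof.
move=> fl; elim: r => [|i r IH].
  by rewrite big_nil; under eq_fun do rewrite big_nil; exact: cvg_cst.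
by rewrite big_cons; under eq_fun do rewrite big_cons; exact: cvgD.
Qed.

(** * The weak gradient: existence, uniqueness, locality *)

Section weak_gradient.
Context (R : realType) (d : nat).
Local Notation X := 'rV[R]_d.
Variables (E : set X) (phi : X -> R) (mu : {measure set X -> \bar R}).
Variable A : X -> 'M[R]_d.
Hypothesis H : form_setting E phi mu A.
Implicit Types (f g h u v w : X -> R) (V K : set X) (x : X) (F G : X -> X).

Local Notation C := (C0infty E).
Local Notation a := (form0 E mu A).
Local Notation L2 := (Lfun mu 2%:E).
Local Notation approx := (form_approx E mu A C).
Local Notation D := (form_dom E mu A).
Local Notation wgrad := (Defs.wgrad E mu A).

Let oc : open E \/ closed E. Proof. exact: open_or_closed (setting_domain H). Qed.
Let mE : measurable E. Proof. exact: measurable_domain (setting_domain H). Qed.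
Let p2 : (1 : R) <= 2. Proof. by rewrite ler1n. Qed.
Let CS f : C f -> smooth f. Proof. exact: C0infty_smooth. Qed.

#[local] Opaque form0.

Definition grad_dist f F x : R := dotp (grad f x - F x) (grad f x - F x).

(** The defining property of [wgrad] for one given sequence, without reference to a limit
    function. *)
Definition grad_cvg (u_ : nat -> X -> R) F : Prop :=
  (forall i, measurable_fun E (fun x => F x 0 i)) /\
  forall K, compact K -> K `<=` E ->
    (\int[mu]_(x in K) (grad_dist (u_ n) F x)%:E)%E @[n --> \oo] --> 0%E.

Lemma compact_measurable_rV K : compact K -> measurable K.
Proof. by move=> cK; apply: closed_measurable_rV; exact: compact_closed_rV. Qed.

Lemma grad_dist_ge0 f F x : 0 <= grad_dist f F x.
Proof. exact: dotp_ge0. Qed.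

Lemma grad_dist_grad f g x : smooth f -> smooth g ->
  grad_dist f (grad g) x = grad_sq (f \- g) x.
Proof. by move=> sf sg; rewrite /grad_sq gradB. Qed.

Lemma grad_dist_measurable f F K : measurable K -> K `<=` E -> smooth f ->
  (forall i, measurable_fun E (fun x => F x 0 i)) -> measurable_fun K (grad_dist f F).
Proof.
move=> mK KE sf mF.
have mi i : measurable_fun K (fun x => (grad f x - F x) 0 i).
  rewrite (_ : (fun x => _) = (fun x => grad f x 0 i - F x 0 i)); last first.
    by apply/funext => x; rewrite !mxE.
  apply: measurable_funB; first exact: grad_measurable.
  exact: measurable_funS (mF i).
exact: dotp_measurable.
Qed.

(** Local ellipticity bounds gradients in L^2, on each piece of a countable cover, by energies. A
    fast subsequence makes the partial derivatives converge almost everywhere on all pieces at once,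
    and Fatou's lemma upgrades this to L^2 convergence of the whole sequence on compact sets. *)
Lemma form_cauchy_grad_cvg (u_ : nat -> X -> R) : (forall n, C (u_ n)) -> form_cauchy a u_ ->
  exists F (psi : nat -> nat), [/\ grad_cvg u_ F, forall k, (k <= psi k)%N &
    {ae mu, forall x, E x ->
      forall i, grad (u_ (psi k)) x 0 i @[k --> \oo] --> (F x 0 i : R)}].
Proof.
move=> Cu cu.
pose P k n := forall m, (n <= m)%N -> a (u_ m \- u_ n) (u_ m \- u_ n) <= 16^-1 ^+ k.
have [psi [psi_ge psi_mono psiP]] : exists psi : nat -> nat, [/\ forall k, (k <= psi k)%N,
    {homo psi : m n / (m <= n)%N} & forall k n, (psi k <= n)%N -> P k n].
  apply: fast_subseq => k.
  have e0 : 0 < 16^-1 ^+ k :> R by rewrite exprn_gt0// invr_gt0.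
  have [N HN] := cu _ e0; exists N => n Nn m nm.
  by apply/ltW/HN => //; exact: leq_trans nm.
have [V_ HV EV] := rel_compact_countable_cover oc.
have aecvg : {ae mu, forall x, E x -> forall i,
    cvgn (fun k => partial i (u_ (psi k)) x)}.
  have : {ae mu, forall x, forall j, V_ j x -> forall i,
      cvgn (fun k => partial i (u_ (psi k)) x)}.
    apply: ae_foralln => j.
    have [nu nu0 Hnu] := grad_sq_le_form (setting_domain H) (setting_density H)
      (setting_measure H) (setting_matrix H) (setting_elliptic H) (HV j).
    have mV := rel_compact_measurable (setting_domain H) (HV j).
    have Vfin := rel_compact_finite_measure (setting_domain H) (setting_density H)
      (setting_measure H) (HV j).
    pose w k := u_ (psi k.+1) \- u_ (psi k).
    have Cw k : C (w k) by exact: C0inftyB.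
    have ig k : mu.-integrable (V_ j) (EFin \o grad_sq (w k)).
      exact: (grad_sq_integrable (Cw k) mV Vfin).
    (* Energies of successive differences are at most 16^-k, so the weighted integrals are at most
       4^-k, as [rapid_ae] requires; undoing the weight leaves squared increments of order 4^-k. *)
    pose c k : R := 4 ^+ k / nu.
    have c0 k : 0 < c k by rewrite divr_gt0// exprn_gt0.
    have : {ae mu, forall x, V_ j x ->
        exists M, forall k, c k * grad_sq (w k) x <= M * 2^-1 ^+ k}.
      apply: (rapid_ae (F := fun k x => c k * grad_sq (w k) x) mV).
      - move=> k; apply: measurable_funM => //.
        by apply/measurable_EFinP; exact: (measurable_int _ (ig k)).
      - by move=> k x _; rewrite mulr_ge0 ?grad_sq_ge0// ltW.
      - move=> k; rewrite EFin_Rintegral//; last first.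
          have := integrableZl mV (c k) (ig k); by [].
        rewrite lee_fin RintegralZl//.
        apply: (@le_trans _ _ (c k * (nu * 16^-1 ^+ k))).
          rewrite ler_pM2l//; apply: (le_trans (Hnu _ (Cw k))); rewrite ler_pM2l//.
          by apply: (psiP k (psi k)) => //; apply: psi_mono.
        have -> : c k * (nu * 16^-1 ^+ k) = (4 * 16^-1) ^+ k.
          by rewrite /c exprMn; field; rewrite gt_eqF.
        by rewrite le_eqVlt; apply/orP; left; apply/eqP; congr (_ ^+ _); field.
    apply: filterS => x Hx Vx i; have [M HM] := Hx Vx.
    apply: (@geometric_cauchy_cvg _ _ (Num.sqrt (nu * `|M|))) => k.
    have -> : partial i (u_ (psi k.+1)) x - partial i (u_ (psi k)) x = grad (w k) x 0 i.
      by rewrite gradB ?mxE//; exact: CS.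
    rewrite -sqrtr_sqr.
    have -> : Num.sqrt (nu * `|M|) * 2^-1 ^+ k = Num.sqrt (nu * `|M| * (2^-1 ^+ k) ^+ 2).
      by rewrite (@sqrtrM _ (nu * `|M|) (_ ^+ 2)) ?mulr_ge0 ?(ltW nu0)// sqrtr_sqr (ger0_norm (x := 2^-1 ^+ k)).
    apply: ler_wsqrtr.
    apply: (@le_trans _ _ (grad_sq (w k) x)).
      rewrite /grad_sq dotpE (bigD1 i)//= expr2 lerDl.
      by apply: sumr_ge0 => l _; rewrite -expr2 sqr_ge0.
    rewrite -(ler_pM2l (c0 k)); apply: (le_trans (HM k)).
    have -> : c k * (nu * `|M| * (2^-1 ^+ k) ^+ 2) = `|M| * (4 * 2^-1 * 2^-1) ^+ k.
      by rewrite /c expr2 !exprMn; field; rewrite gt_eqF.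
    have -> : 4 * 2^-1 * 2^-1 = 1 :> R by field.
    rewrite expr1n mulr1; apply: (@le_trans _ _ (`|M| * 2^-1 ^+ k)).
      by rewrite ler_wpM2r ?ler_norm.
    by rewrite ler_piMr// exprn_ile1// invf_le1// ler1n.
  by apply: filterS => x Hx; rewrite EV => -[j _ Vx]; exact: Hx Vx.
have /boolp.choice[f Hf] : forall i, exists f : X -> R, measurable_fun E f /\
    forall x, cvgn (fun k => partial i (u_ (psi k)) x) ->
      partial i (u_ (psi k)) x @[k --> \oo] --> (f x : R).
  move=> i; have [f mf ff] := @ae_measurable_lim _ _ _ E
    (fun k x => partial i (u_ (psi k)) x) mE
    (fun k => measurable_funS measurableT (@subsetT _ E) (partial_measurable i (CS (Cu (psi k))))).
  by exists f.
pose F x : X := \row_i f i x.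
have mF i : measurable_fun E (fun x => F x 0 i).
  rewrite (_ : (fun x => _) = f i); first by have [] := Hf i.
  by apply/funext => x; rewrite mxE.
have FL : {ae mu, forall x, E x ->
    forall i, grad (u_ (psi k)) x 0 i @[k --> \oo] --> (F x 0 i : R)}.
  apply: filterS aecvg => x Hx Ex i; rewrite mxE.
  by under eq_fun do rewrite mxE; apply: (Hf i).2; exact: Hx.
exists F, psi; split => //; split => // K cK KE.
have [V HVV KV] := compact_sub_rel_compact oc cK KE.
have [nu nu0 Hnu] := grad_sq_le_form (setting_domain H) (setting_density H)
      (setting_measure H) (setting_matrix H) (setting_elliptic H) HVV.
have mK := compact_measurable_rV cK.
have mV := rel_compact_measurable (setting_domain H) HVV.
have Vfin := rel_compact_finite_measure (setting_domain H) (setting_density H)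
      (setting_measure H) HVV.
apply/cvge0P; first by move=> n; apply: integral_ge0 => x _; rewrite lee_fin grad_dist_ge0.
move=> e e0.
have [k0 Hk0] : exists k0 : nat, nu * 16^-1 ^+ k0 <= e.
  have : nu * 16^-1 ^+ k @[k --> \oo] --> (nu * 0 : R).
    apply: cvgM; first exact: cvg_cst.
    by apply: cvg_expr; rewrite gtr0_norm ?invr_gt0// invf_lt1// ltr1n.
  rewrite mulr0 => /cvg_seqP/(_ _ e0)[N HN]; exists N.
  by have := HN N (leqnn _); rewrite subr0 => /(le_lt_trans (ler_norm _))/ltW.
exists (psi k0) => n Hn; apply: (@le_trans _ _ (nu * 16^-1 ^+ k0)%:E); last by rewrite lee_fin.
(* Fatou's lemma runs along the subsequence for a fixed n of the original sequence; the shift by n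
   keeps the indices at least n. *)
pose s m := psi (n + m)%N.
apply: (@fatou_cvg _ _ _ mu K (fun m => grad_sq (u_ (s m) \- u_ n))) => //.
- move=> m; apply: (@measurable_funS _ _ _ _ E) => //.
  apply: dotp_measurable => // i; apply: grad_measurable; apply: smoothB; exact: CS.
- by apply: grad_dist_measurable => //; exact: CS.
- by move=> m x _; exact: grad_sq_ge0.
- by move=> x _; exact: grad_dist_ge0.
- apply: filterS FL => x Hx Kx.
  rewrite /grad_dist dotpE.
  have -> : (fun m => grad_sq (u_ (s m) \- u_ n) x) =
      (fun m => \sum_i (grad (u_ n) x 0 i - grad (u_ (s m)) x 0 i) *
                      (grad (u_ n) x 0 i - grad (u_ (s m)) x 0 i)).
    apply/funext => m; rewrite /grad_sq dotpE; apply: eq_bigr => i _.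
    by rewrite gradB ?mxE; [ring|exact: CS|exact: CS].
  apply: (cvg_sumr (f := fun i m => (grad (u_ n) x 0 i - grad (u_ (s m)) x 0 i) *
    (grad (u_ n) x 0 i - grad (u_ (s m)) x 0 i))) => i.
  have L : grad (u_ (s m)) x 0 i @[m --> \oo] --> (F x 0 i : R).
    apply: (cvg_subseq (u := fun k => grad (u_ (psi k)) x 0 i)
      (phi := fun m => (n + m)%N)) => [k|]; first exact: leq_addl.
    by apply: Hx; exact: KE.
  have -> : (grad (u_ n) x - F x) 0 i = grad (u_ n) x 0 i - F x 0 i by rewrite !mxE.
  by apply: cvgM; apply: cvgB => //; exact: cvg_cst.
- move=> m.
  have Cw : C (u_ (s m) \- u_ n) by exact: C0inftyB.
  have ig := grad_sq_integrable Cw mV Vfin.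
  apply: (@le_trans _ _ (\int[mu]_(x in V) (grad_sq (u_ (s m) \- u_ n) x)%:E)%E).
    apply: ge0_subset_integral => //.
    - exact: (measurable_int _ ig).
    - by move=> x _; rewrite lee_fin grad_sq_ge0.
  rewrite EFin_Rintegral// lee_fin; apply: (le_trans (Hnu _ Cw)); rewrite ler_pM2l//.
  apply: (psiP k0 n) => //; apply: leq_trans (psi_ge _); exact: leq_addr.
Qed.

(** Locally the L^2 distance of gradients is bounded by the energy of the difference, so the limit
    field passes from one sequence to the other. *)
Lemma grad_cvg_change (u_ v_ : nat -> X -> R) F : (forall n, C (u_ n)) ->
  (forall n, C (v_ n)) -> a (u_ n \- v_ n) (u_ n \- v_ n) @[n --> \oo] --> (0 : R) ->
  grad_cvg v_ F -> grad_cvg u_ F.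
Proof.
move=> Cu Cv L [mF HF]; split; first exact: mF.
move=> K cK KE.
have [V HVV KV] := compact_sub_rel_compact oc cK KE.
have [nu nu0 Hnu] := grad_sq_le_form (setting_domain H) (setting_density H)
      (setting_measure H) (setting_matrix H) (setting_elliptic H) HVV.
have mK := compact_measurable_rV cK.
have mV := rel_compact_measurable (setting_domain H) HVV.
have Vfin := rel_compact_finite_measure (setting_domain H) (setting_density H)
      (setting_measure H) HVV.
have ge0 (w_ : nat -> X -> R) n : (0 <= \int[mu]_(x in K) (grad_dist (w_ n) F x)%:E)%E.
  by apply: integral_ge0 => x _; rewrite lee_fin grad_dist_ge0.
apply/cvge0P => // e e0.
have e1 : 0 < e / 4 by rewrite divr_gt0.
have e2 : 0 < e / (4 * nu) by rewrite divr_gt0// mulr_gt0.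
have [N1 HN1] := (cvge0P (ge0 v_)).1 (HF K cK KE) _ e1.
have /cvg_seqP/(_ _ e2)[N2 HN2] := L.
exists (maxn N1 N2) => n; rewrite geq_max => /andP[n1 n2].
have Cw : C (u_ n \- v_ n) by exact: C0inftyB.
have ig := grad_sq_integrable Cw mV Vfin.
have mg : measurable_fun K (fun x => (grad_sq (u_ n \- v_ n) x)%:E).
  apply: measurable_funS KV _ => //; exact: (measurable_int _ ig).
have md : measurable_fun K (fun x => (grad_dist (v_ n) F x)%:E).
  by apply/measurable_EFinP; apply: grad_dist_measurable => //; exact: CS.
apply: (@le_trans _ _ (\int[mu]_(x in K) (2%:E * (grad_sq (u_ n \- v_ n) x)%:E
    + 2%:E * (grad_dist (v_ n) F x)%:E))%E).
  apply: ge0_le_integral; first exact: mK.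
  - by move=> x _; rewrite lee_fin grad_dist_ge0.
  - by apply/measurable_EFinP; apply: grad_dist_measurable => //; exact: CS.
  - by apply: emeasurable_funD; exact: measurable_funeM.
  - move=> x _; rewrite -!EFinM -EFinD lee_fin -grad_dist_grad; [|exact: CS|exact: CS].
    exact: dotpB_le.
rewrite ge0_integralD//; last 4 first.
- by move=> x _; rewrite mule_ge0// lee_fin grad_sq_ge0.
- exact: measurable_funeM.
- by move=> x _; rewrite mule_ge0// lee_fin grad_dist_ge0.
- exact: measurable_funeM.
rewrite !ge0_integralZl//; try by move=> x _; rewrite lee_fin dotp_ge0.
have -> : e = 2 * (e / 4) + 2 * (e / 4) by field.
rewrite (EFinD (2 * (e / 4))) (EFinM 2); apply: leeD; apply: lee_wpmul2l => //; last exact: HN1.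
apply: (@le_trans _ _ (\int[mu]_(x in V) (grad_sq (u_ n \- v_ n) x)%:E)%E).
  apply: ge0_subset_integral => //.
  - exact: (measurable_int _ ig).
  - by move=> x _; rewrite lee_fin grad_sq_ge0.
rewrite EFin_Rintegral// lee_fin; apply: (le_trans (Hnu _ Cw)).
have := HN2 n n2; rewrite subr0 => /(le_lt_trans (ler_norm _)).
rewrite ltr_pdivlMr ?mulr_gt0// => /ltW q.
rewrite ler_pdivlMr//; move: q; move: (a _ _) => z; lra.
Qed.

(** Whichever sequence [wgrad] was chosen along, closability and [grad_cvg_change] transfer its
    convergence to every approximating sequence. *)
Lemma wgradP (u_ : nat -> X -> R) u : u \in L2 -> approx u_ u -> grad_cvg u_ (wgrad u).
Proof.
move=> lu Au; have [Cu cu _] := Au.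
rewrite /Defs.wgrad; case: xgetP => [F _ /= [mF [v_ Av HF]]|].
  have [Cv _ _] := Av.
  apply: (grad_cvg_change Cu Cv) => //; exact: (form_approx_unique H lu).
have [F [psi [[mF HF] _ _]]] := form_cauchy_grad_cvg Cu cu.
by move=> /(_ F)/= []; split => //; exists u_.
Qed.

Lemma dotpNN (x y : X) : dotp (- x) (- y) = dotp x y.
Proof. by rewrite -(scaleN1r x) -(scaleN1r y) dotpZl dotpZr mulrA mulrNN !mul1r. Qed.

Lemma grad_cvg_integrable (u_ : nat -> X -> R) F K : (forall n, C (u_ n)) ->
  grad_cvg u_ F -> compact K -> K `<=` E ->
  mu.-integrable K (EFin \o (fun x => dotp (F x) (F x))).
Proof.
move=> Cu [mF HF] cK KE; have mK := compact_measurable_rV cK.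
have Kfin := domain_compact_finite (setting_density H) (setting_measure H) cK KE.
have ge0 n : (0 <= \int[mu]_(x in K) (grad_dist (u_ n) F x)%:E)%E.
  by apply: integral_ge0 => x _; rewrite lee_fin grad_dist_ge0.
have [N HN] := (cvge0P ge0).1 (HF K cK KE) _ ltr01.
have {HN}fin := HN N (leqnn _).
have iN : mu.-integrable K (EFin \o grad_dist (u_ N) F).
  apply: integral_fin_integrable; last exact: (le_lt_trans fin (ltry _)).
  - by apply: grad_dist_measurable => //; exact: CS.
  - by move=> x _; exact: grad_dist_ge0.
have ig := grad_sq_integrable (Cu N) mK Kfin.
have i2 := integrableD mK (integrableZl mK 2 iN) (integrableZl mK 2 ig).
have mFF : measurable_fun K (fun x => dotp (F x) (F x)).
  by apply: (measurable_funS mE KE); exact: dotp_measurable.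
apply: (integrable_le mK mFF i2) => x _; rewrite ger0_norm ?dotp_ge0//.
have := dotpB_le (F x) (grad (u_ N) x) 0; rewrite !subr0 /grad_dist => q.
by apply: (le_trans q); rewrite -(opprB (F x)) dotpNN.
Qed.

Lemma dotp_le_sq (x y : X) : `|dotp x y| <= dotp x x + dotp y y.
Proof. by have := dotp_young x y ltr01; rewrite invr1 !mul1r. Qed.

Lemma integrable_dotp K F G : measurable K ->
  measurable_fun K (fun x => dotp (F x) (G x)) ->
  mu.-integrable K (EFin \o (fun x => dotp (F x) (F x))) ->
  mu.-integrable K (EFin \o (fun x => dotp (G x) (G x))) ->
  mu.-integrable K (EFin \o (fun x => dotp (F x) (G x))).
Proof.
move=> mK mFG iF iG; apply: (integrable_le mK mFG (integrableD mK iF iG)) => x _.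
exact: dotp_le_sq.
Qed.

(** Strongly convergent gradients are tested against fields that vary with n but stay dominated in
    L^2, by Young's inequality; the variable field later carries truncations that depend on n. *)
Lemma grad_cvg_pair (u_ : nat -> X -> R) F (G_ : nat -> X -> X) g K :
  (forall n, C (u_ n)) -> grad_cvg u_ F -> compact K -> K `<=` E ->
  (forall n i, measurable_fun K (fun x => G_ n x 0 i)) ->
  mu.-integrable K (EFin \o g) ->
  (forall n, {ae mu, forall x, K x -> dotp (G_ n x) (G_ n x) <= g x}) ->
  \int[mu]_(x in K) dotp (G_ n x) (grad (u_ n) x - F x) @[n --> \oo] --> (0 : R).
Proof.
move=> Cu GF cK KE mG ig Gg; have [mF HF] := GF; have mK := compact_measurable_rV cK.
have mGG n : measurable_fun K (fun x => dotp (G_ n x) (G_ n x)) by exact: dotp_measurable.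
have mDi n i : measurable_fun K (fun x => (grad (u_ n) x - F x) 0 i).
  rewrite (_ : (fun x => _) = (fun x => grad (u_ n) x 0 i - F x 0 i)); last first.
    by apply/funext => x; rewrite !mxE.
  apply: measurable_funB; first by apply: grad_measurable; exact: CS.
  exact: measurable_funS (mF i).
have ge0 n : (0 <= \int[mu]_(x in K) (grad_dist (u_ n) F x)%:E)%E.
  by apply: integral_ge0 => x _; rewrite lee_fin grad_dist_ge0.
have HD := (cvge0P ge0).1 (HF K cK KE).
have [N0 HN0] := HD _ ltr01.
have iGG n : mu.-integrable K (EFin \o (fun x => dotp (G_ n x) (G_ n x))).
  apply: (integrable_ae_le mK (mGG n) ig); apply: filterS (Gg n) => x Hx Kx.
  by rewrite ger0_norm ?dotp_ge0// Hx.
pose I := \int[mu]_(x in K) g x.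
have GI n : \int[mu]_(x in K) dotp (G_ n x) (G_ n x) <= I.
  exact: ae_le_Rintegral.
have I0 : 0 <= I.
  by apply: le_trans (GI 0%N); apply: Rintegral_ge0 => x _; exact: dotp_ge0.
apply/cvg_seqP => e e0.
pose t := e / (4 * (I + 1)).
have I1 : 0 < I + 1 by rewrite ltr_wpDl.
have t0 : 0 < t by rewrite divr_gt0// mulr_gt0.
have s0 : 0 < t * (e / 4) by rewrite mulr_gt0// divr_gt0.
have [N1 HN1] := HD _ s0.
exists (maxn N0 N1) => n; rewrite geq_max => /andP[n0 n1]; rewrite subr0.
have id : mu.-integrable K (EFin \o grad_dist (u_ n) F).
  apply: integral_fin_integrable; last exact: (le_lt_trans (HN0 n n0) (ltry _)).
  - by apply: grad_dist_measurable => //; exact: CS.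
  - by move=> x _; exact: grad_dist_ge0.
have ip : mu.-integrable K (EFin \o (fun x => dotp (G_ n x) (grad (u_ n) x - F x))).
  by apply: integrable_dotp => //; exact: dotp_measurable.
apply: (le_lt_trans (le_normr_Rintegral _ ip)) => //.
have i1 := integrableZl mK t (iGG n); have i2 := integrableZl mK t^-1 id.
apply: (@le_lt_trans _ _ (\int[mu]_(x in K)
    (t * dotp (G_ n x) (G_ n x) + t^-1 * grad_dist (u_ n) F x))).
  apply: le_Rintegral => //.
  - exact: integrable_norm.
  - exact: (integrableD mK i1 i2).
  - by move=> x _; exact: dotp_young.
rewrite RintegralD// !RintegralZl//.
have h1 : t * \int[mu]_(x in K) dotp (G_ n x) (G_ n x) <= e / 4.
  apply: (@le_trans _ _ (t * (I + 1))).
    by rewrite ler_pM2l//; apply: (le_trans (GI n)); rewrite lerDl.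
  by rewrite /t le_eqVlt; apply/orP; left; apply/eqP; field; rewrite gt_eqF.
have h2 : t^-1 * \int[mu]_(x in K) grad_dist (u_ n) F x <= e / 4.
  rewrite mulrC ler_pdivrMr// mulrC -lee_fin -EFin_Rintegral//; exact: HN1.
have : e / 4 + e / 4 < e by lra.
exact: le_lt_trans (lerD h1 h2).
Qed.

Lemma form_dom_in_off V v : form_dom_in E mu A V v ->
  {ae mu, forall x, ~ V x -> v x = 0}.
Proof.
move=> [lv [v_ [Cv _ L]]].
have lv_ n : v_ n \in L2 by apply: (C0infty_L2 (setting_domain H) (setting_density H) (setting_measure H)); exact: (Cv n).1.
have [psi _ Hpsi] := Lp_cvg_ae p2 lv_ lv ((Lnorm_cvgP p2 lv_ lv).1 L).
have aE := ae_domain (setting_domain H) (setting_measure H).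
apply: filterS2 Hpsi aE => x Hx Ex nVx.
have E0 : (fun k => v_ (psi k) x) = (fun=> 0).
  by apply/funext => k; exact: (C0infty_in_eq0 (Cv (psi k)) Ex nVx).
by rewrite E0 in Hx; apply: (cvg_unique _ Hx) => //; exact: cvg_cst.
Qed.

Lemma form_approx_in V (v_ : nat -> X -> R) v : form_approx E mu A (C0infty_in E V) v_ v ->
  approx v_ v.
Proof. by move=> [Cv cv L]; split => // n; exact: (Cv n).1. Qed.

Lemma form_dom_in_dom V v : form_dom_in E mu A V v -> D v.
Proof.
by move=> [lv [v_ Av]]; split => //; exists v_; exact: form_approx_in Av.
Qed.

(** Smooth approximants supported in [V] have zero gradient at interior points of [E] off [V]. On
    each compact piece the integral of |wgrad v|^2 off [V] is therefore at most the distance of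
    gradients, which tends to 0. *)
Lemma wgrad_off V v : rel_compact E V -> form_dom_in E mu A V v ->
  {ae mu, forall x, E x -> ~ V x -> wgrad v x = 0}.
Proof.
move=> HV [lv [v_ Av]]; have [Cv _ _] := Av.
have GF := wgradP lv (form_approx_in Av); have [mF HF] := GF.
have Cv' n : C (v_ n) := (Cv n).1.
have [V_ HV_ EV] := rel_compact_countable_cover oc.
have mV := rel_compact_measurable (setting_domain H) HV.
suff : {ae mu, forall x, forall j, closure (V_ j) x -> ~ V x -> wgrad v x = 0}.
  apply: filterS => x Hx Ex nVx; have : (\bigcup_k V_ k) x by rewrite -EV.
  by move=> [j _ Vj]; apply: (Hx j) => //; exact: subset_closure.
apply: ae_foralln => j; have [_ cK KE] := HV_ j.
set K := closure (V_ j) in cK KE *; have mK := compact_measurable_rV cK.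
have mKV : measurable (K `\` V) by exact: measurableD.
have KVK : K `\` V `<=` K by exact: subDsetl.
have iF := grad_cvg_integrable Cv' GF cK KE.
have iFV : mu.-integrable (K `\` V) (EFin \o (fun x => dotp (wgrad v x) (wgrad v x))).
  exact: integrableS iF.
have aI := ae_interior (setting_domain H) (setting_density H) (setting_measure H).
have z : (\int[mu]_(x in K `\` V) (dotp (wgrad v x) (wgrad v x))%:E <= 0)%E.
  apply/lee_addgt0Pr => e e0; rewrite add0e.
  have ge0 n : (0 <= \int[mu]_(x in K) (grad_dist (v_ n) (wgrad v) x)%:E)%E.
    by apply: integral_ge0 => x _; rewrite lee_fin grad_dist_ge0.
  have [N HN] := (cvge0P ge0).1 (HF K cK KE) _ e0.
  apply: le_trans (HN N (leqnn _)).
  have md : measurable_fun K (fun x => (grad_dist (v_ N) (wgrad v) x)%:E).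
    by apply/measurable_EFinP; apply: grad_dist_measurable => //; exact: CS.
  apply: (@le_trans _ _ (\int[mu]_(x in K `\` V) (grad_dist (v_ N) (wgrad v) x)%:E)%E); last first.
    by apply: ge0_subset_integral => // x _; rewrite lee_fin grad_dist_ge0.
  apply: ae_ge0_le_integral => //.
  - by move=> x _; rewrite lee_fin dotp_ge0.
  - exact: (measurable_int _ iFV).
  - by move=> x _; rewrite lee_fin grad_dist_ge0.
  - exact: measurable_funS md.
  - apply: filterS aI => x Ix [Kx nVx]; rewrite lee_fin /grad_dist.
    by rewrite (C0infty_in_grad (Cv N) Ix nVx) sub0r dotpNN.
have z0 : \int[mu]_(x in K `\` V) dotp (wgrad v x) (wgrad v x) = 0.
  apply/eqP; rewrite eq_le -lee_fin -EFin_Rintegral// z/=.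
  by apply: Rintegral_ge0 => x _; exact: dotp_ge0.
have := Rintegral_eq0_ae mKV iFV (fun x _ => dotp_ge0 _) z0.
by apply: filterS => x Hx Kx nVx; apply: dotp_eq0; exact: Hx.
Qed.

End weak_gradient.

(** * The drift term *)

Lemma cvg_cst_eq (R : realType) (u : nat -> R) (l c : R) :
  u n @[n --> \oo] --> l -> (forall n, u n = c) -> l = c.
Proof.
by move=> ul uc; apply/eqP; rewrite eq_le (cvg_le_cst ul)//= ?(cvg_ge_cst ul)// => n; rewrite uc.
Qed.

Lemma sqr_le_bound (R : realDomainType) (y c : R) : `|y| <= c -> y ^+ 2 <= c ^+ 2.
Proof.
move=> yc; rewrite -(real_normK (num_real y)) lerXn2r ?nnegrE//.
exact: le_trans yc.
Qed.

Section restriction.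
Context d (T : measurableType d) (R : realType).
Variable mu : {measure set T -> \bar R}.
Implicit Types (D K : set T) (f g h u : T -> R).

Lemma measurable_fun_patch D K f : measurable K -> K `<=` D ->
  measurable_fun K f -> measurable_fun D (f \_ K).
Proof.
move=> mK KD mf; apply: (@measurable_funS _ _ _ _ setT) => //.
exact/(measurable_restrictT _ mK).
Qed.

Lemma ae_patch D K f : {ae mu, forall x, D x -> ~ K x -> f x = 0} ->
  {ae mu, forall x, D x -> f x = (f \_ K) x}.
Proof.
apply: filterS => x Hx Dx; rewrite patchE.
case: (boolP (x \in K)) => // /negP xK.
by rewrite (Hx Dx)// => Kx; apply: xK; exact: mem_set.
Qed.

Lemma Rintegral_restrict_ae D K f : measurable D -> measurable K -> K `<=` D ->
  measurable_fun D f -> {ae mu, forall x, D x -> ~ K x -> f x = 0} ->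
  \int[mu]_(x in D) f x = \int[mu]_(x in K) f x.
Proof.
move=> mD mK KD mf f0.
have mfK : measurable_fun D (f \_ K).
  apply: measurable_fun_patch => //; exact: measurable_funS mf.
rewrite (ae_eq_Rintegral mD mf mfK (ae_patch f0)).
rewrite (Rintegral_restrict_eq mu KD); last first.
  move=> x _ nK; rewrite patchE; case: (boolP (x \in K)) => // /set_mem Kx.
  by exfalso; apply: nK.
by apply: eq_Rintegral => x xK; rewrite patchE xK.
Qed.

Lemma integrable_restrict_ae D K f : measurable D -> measurable K -> K `<=` D ->
  measurable_fun D f -> {ae mu, forall x, D x -> ~ K x -> f x = 0} ->
  mu.-integrable K (EFin \o f) -> mu.-integrable D (EFin \o f).
Proof.
move=> mD mK KD mf f0 iK.
have i1 : mu.-integrable D (EFin \o (f \_ K)).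
  apply: (integrable_restrict_eq mD mK KD).
    apply: (eq_integrable mK _ _ _ iK) => x xK.
    by rewrite /= patchE xK.
  move=> x _ nK; rewrite patchE; case: (boolP (x \in K)) => // /set_mem Kx.
  by exfalso; apply: nK.
apply: (integrable_ae_le mD mf (integrable_norm i1)).
by apply: filterS (ae_patch f0) => x Hx Dx; rewrite {1}Hx.
Qed.

(** [h] is square integrable on [K]; it is extended by 0 so that Young's inequality can be used on
    the whole space. *)
Lemma cvg_L2_pair K h (u_ : nat -> T -> R) u : measurable K -> measurable_fun K h ->
  mu.-integrable K (EFin \o (fun x => h x ^+ 2)) ->
  (forall n, u_ n \in Lfun mu 2%:E) -> u \in Lfun mu 2%:E ->
  nrm mu 2 (fun x => u_ n x - u x) @[n --> \oo] --> (0 : R) ->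
  \int[mu]_(x in K) (h x * u_ n x) @[n --> \oo] --> \int[mu]_(x in K) (h x * u x).
Proof.
move=> mK mh ih lu_ lu L; have p2 : (1 : R) <= 2 by rewrite ler1n.
pose h' := h \_ K.
have E w : \int[mu]_(x in K) (h x * w x) = \int[mu]_x (h' x * w x).
  rewrite Rintegral_mkcond; apply: eq_Rintegral => x _.
  by rewrite /h' !patchE; case: ifP => // _; rewrite mul0r.
have lh : h' \in Lfun mu 2%:E.
  apply: Lfun2I; first by apply: measurable_fun_patch.
  rewrite (_ : EFin \o _ = (EFin \o (fun x => h x ^+ 2)) \_ K).
    exact/(integrable_mkcond _ mK).
  apply/funext => x /=; rewrite /h' !patchE.
  by case: ifP => // _; rewrite expr0n.
have i1 w : w \in Lfun mu 2%:E -> mu.-integrable setT (EFin \o (fun x => h' x * w x)).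
  by move=> lw; apply/Lfun1_integrable; exact: (Lfun2_mul_Lfun1 lh lw).
apply/cvg_seqP => e e0.
set c := nrm mu 2 h' ^+ 2; have c0 : 0 <= c by rewrite sqr_ge0.
pose t := e / (4 * (c + 1)).
have c1 : 0 < c + 1 by rewrite ltr_wpDl.
have t0 : 0 < t by rewrite divr_gt0// mulr_gt0.
have s0 : 0 < t * (e / 4) by rewrite mulr_gt0// divr_gt0.
have s1 : 0 < Num.sqrt (t * (e / 4)) by rewrite sqrtr_gt0.
have /cvg_seqP/(_ _ s1)[N HN] := L.
exists N => n Nn; rewrite !E -RintegralB//; [|exact: i1|exact: i1].
have -> : \int[mu]_x (h' x * u_ n x - h' x * u x) = \int[mu]_x (h' x * (u_ n x - u x)).
  by apply: eq_Rintegral => x _; rewrite mulrBr.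
have ld : (fun x => u_ n x - u x) \in Lfun mu 2%:E by exact: LfunB.
apply: (le_lt_trans (L2_young lh ld t0)).
have h1 : t * c <= e / 4.
  apply: (@le_trans _ _ (t * (c + 1))); first by rewrite ler_pM2l// lerDl.
  by rewrite /t le_eqVlt; apply/orP; left; apply/eqP; field; rewrite gt_eqF.
have h2 : t^-1 * nrm mu 2 (fun x => u_ n x - u x) ^+ 2 <= e / 4.
  rewrite mulrC ler_pdivrMr// [e / 4 * t]mulrC -(sqr_sqrtr (ltW s0)).
  have := HN n Nn; rewrite subr0 ger0_norm ?nrm_ge0// => q.
  by rewrite lerXn2r ?nnegrE ?nrm_ge0 ?sqrtr_ge0// ltW.
have : e / 4 + e / 4 < e by lra.
exact: le_lt_trans (lerD h1 h2).
Qed.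

End restriction.

Lemma continuous_soft_trunc (R : realType) (l : R) : 0 <= l ->
  continuous (soft_trunc l : R -> R).
Proof.
move=> l0 s; apply: cvgM => //; apply: cvgV; first exact: soft_trunc_den0.
apply: cvgD; first exact: cvg_cst.
by apply: cvgM; [exact: cvg_cst|exact: cvgM].
Qed.

Lemma continuous_soft_trunc' (R : realType) (l : R) : 0 <= l ->
  continuous (soft_trunc' l : R -> R).
Proof.
move=> l0 s.
have Q : l * (t * t) @[t --> s] --> l * (s * s).
  by apply: cvgM; [exact: cvg_cst|exact: cvgM].
have V : (1 + l * (t * t))^-1 @[t --> s] --> (1 + l * (s * s))^-1.
  by apply: cvgV; [exact: soft_trunc_den0|apply: cvgD => //; exact: cvg_cst].
by apply: cvgM; [apply: cvgB => //; exact: cvg_cst|exact: cvgM].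
Qed.

Section drift.
Context (R : realType) (d : nat).
Local Notation X := 'rV[R]_d.
Variables (E : set X) (phi : X -> R) (mu : {measure set X -> \bar R}).
Variable A : X -> 'M[R]_d.
Variable B : X -> X.
Hypothesis H : form_setting E phi mu A.
Hypothesis B_L2 : L2_loc_field E mu B.
Hypothesis B_div : divergence_free E mu B.
Implicit Types (f g h u v w : X -> R) (V K : set X) (x : X) (F G : X -> X).

Local Notation C := (C0infty E).
Local Notation a := (form0 E mu A).
Local Notation L2 := (Lfun mu 2%:E).
Local Notation D := (form_dom E mu A).
Local Notation wgrad := (Defs.wgrad E mu A).

Let mE : measurable E. Proof. exact: measurable_domain (setting_domain H). Qed.
Let p2 : (1 : R) <= 2. Proof. by rewrite ler1n. Qed.
Let CS f : C f -> smooth f. Proof. exact: C0infty_smooth. Qed.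
Let CL2 f : C f -> f \in L2.
Proof. exact: (C0infty_L2 (setting_domain H) (setting_density H) (setting_measure H)). Qed.

#[local] Opaque form0.

Lemma dotp_cauchy_schwarz (x y : X) : dotp x y ^+ 2 <= dotp x x * dotp y y.
Proof.
have := dotp_ge0 (dotp y y *: x - dotp x y *: y).
rewrite !(dotpBl, dotpBr, dotpZl, dotpZr) (dotpC y x).
have [->|y0] := eqVneq y 0; first by move=> _; rewrite !dotp0r expr0n mulr0.
have yy : 0 < dotp y y.
  rewrite lt_neqAle dotp_ge0 andbT eq_sym; apply: contra_neq y0; exact: dotp_eq0.
move: (dotp x x) (dotp x y) (dotp y y) yy => p q r r0 h.
by rewrite -subr_ge0 -(pmulr_rge0 _ r0); lra.
Qed.

Lemma wgrad_measurable u i : D u -> measurable_fun E (fun x => wgrad u x 0 i).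
Proof. by move=> [lu [u_ Au]]; have [] := wgradP H lu Au. Qed.

Lemma wgrad_sq_integrable u K : D u -> compact K -> K `<=` E ->
  mu.-integrable K (EFin \o (fun x => dotp (wgrad u x) (wgrad u x))).
Proof.
move=> [lu [u_ Au]]; have [Cu _ _] := Au.
exact: (grad_cvg_integrable H Cu (wgradP H lu Au)).
Qed.

Lemma drift_measurable F : (forall i, measurable_fun E (fun x => F x 0 i)) ->
  measurable_fun E (fun x => dotp (B x) (F x)).
Proof. by move=> mF; apply: dotp_measurable => //; case: B_L2. Qed.

Lemma drift_wgrad_integrable u K : D u -> compact K -> K `<=` E ->
  mu.-integrable K (EFin \o (fun x => dotp (B x) (wgrad u x))).
Proof.
move=> Du cK KE; apply: integrable_dotp => //.
- exact: compact_measurable_rV.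
- apply: (measurable_funS mE KE); apply: drift_measurable => i; exact: wgrad_measurable.
- exact: B_L2.2.
- exact: wgrad_sq_integrable.
Qed.

(** [B] is locally square integrable; the gradient of [v] vanishes off a relatively compact [V],
    which confines the integral to a compact set. *)
Lemma drift_integrable u v : form_dom_loc E mu A v -> u \in L2 -> ae_bounded mu u ->
  mu.-integrable E (EFin \o (fun x => dotp (B x) (wgrad v x) * u x)).
Proof.
move=> [V HV Dv] lu [M HM]; have [_ cK KE] := HV; have mK := compact_measurable_rV cK.
have Dv' := form_dom_in_dom Dv.
have mf : measurable_fun E (fun x => dotp (B x) (wgrad v x) * u x).
  apply: measurable_funM; first by apply: drift_measurable => i; exact: wgrad_measurable.
  by apply: (@measurable_funS _ _ _ _ setT) => //; exact: Lfun_meas lu.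
apply: (integrable_restrict_ae mE mK KE mf).
  apply: filterS (wgrad_off H HV Dv) => x Hx Ex nKx.
  by rewrite Hx ?dotp0r ?mul0r// => Vx; apply: nKx; exact: subset_closure.
have i1 := integrable_norm (drift_wgrad_integrable Dv' cK KE).
apply: (integrable_ae_le mK _ (integrableZl mK M i1)).
  exact: measurable_funS mf.
by apply: filterS HM => x Hx Kx; rewrite normrM mulrC ler_wpM2r.
Qed.

Lemma bounded_dotp_integrable K f F G (c : R) : compact K -> K `<=` E ->
  measurable_fun K f -> (forall x, `|f x| <= c) ->
  (forall i, measurable_fun K (fun x => F x 0 i)) ->
  (forall i, measurable_fun K (fun x => G x 0 i)) ->
  mu.-integrable K (EFin \o (fun x => dotp (F x) (F x))) ->
  mu.-integrable K (EFin \o (fun x => dotp (G x) (G x))) ->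
  mu.-integrable K (EFin \o (fun x => f x * dotp (F x) (G x))).
Proof.
move=> cK KE mf fc mF mG iF iG; have mK := compact_measurable_rV cK.
apply: (@integrable_bounded_mul _ _ _ mu K f (fun x => dotp (F x) (G x)) c) => //.
by apply: integrable_dotp => //; exact: dotp_measurable.
Qed.

(* [B] is tested against [u_m * soft_trunc l (v_k)], where [u_m] and [v_k] are smooth
   approximations of [u] and [v]; then m and k tend to infinity, and l to 0. *)
Lemma drift_antisymmetry u v : D u -> ae_bounded mu u -> form_dom_loc E mu A v ->
  ae_bounded mu v ->
  \int[mu]_(x in E) (dotp (B x) (wgrad u x) * v x) =
  - \int[mu]_(x in E) (dotp (B x) (wgrad v x) * u x).
Proof.
move=> Du [M HM] [V HV Dv] [M' HM']; have [_ cK KE] := HV.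
set K := closure V in cK KE *; have mK := compact_measurable_rV cK.
have VK : V `<=` K by exact: subset_closure.
have Dv' := form_dom_in_dom Dv.
have [lu [u_ Au]] := Du; have [Cu _ Lu] := Au.
have [lv [v_ Av]] := Dv; have [Cv _ Lv] := Av.
have Cv' n : C (v_ n) := (Cv n).1.
have GFu := wgradP H lu Au; have GFv := wgradP H lv (form_approx_in Av).
have [mFu _] := GFu; have [mFv _] := GFv.
have [mB iB] := B_L2; have iBK := iB K cK KE.
have mS (f : X -> R) D' : measurable_fun setT f -> measurable_fun D' f.
  by move=> mf; exact: measurable_funS mf.
have mKE (f : X -> R) : measurable_fun E f -> measurable_fun K f.
  exact: measurable_funS.
have mu1 := Lfun_meas lu; have mv1 := Lfun_meas lv.
have mut (l : R) : 0 <= l -> measurable_fun setT (soft_trunc l : R -> R).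
  by move=> l0; apply: continuous_measurable_fun; exact: continuous_soft_trunc.
have mut' (l : R) : 0 <= l -> measurable_fun setT (soft_trunc' l : R -> R).
  by move=> l0; apply: continuous_measurable_fun; exact: continuous_soft_trunc'.
have aI := ae_interior (setting_domain H) (setting_density H) (setting_measure H).
have Kfin := domain_compact_finite (setting_density H) (setting_measure H) cK KE.
have iFu := wgrad_sq_integrable Du cK KE.
have iFv := wgrad_sq_integrable Dv' cK KE.
have iBFu := drift_wgrad_integrable Du cK KE.
have iBFv := drift_wgrad_integrable Dv' cK KE.
(* The truncation is there because the bound on [v] does not pass to its approximants [v_ k]. At
   fixed k and l, the first integral converges by convergence of gradients, the second by L^2
   convergence of [u_]. *)
have step1 k (l : R) : 0 < l ->
    \int[mu]_(x in K) (soft_trunc l (v_ k x) * dotp (B x) (wgrad u x)) +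
    \int[mu]_(x in K) (soft_trunc' l (v_ k x) * dotp (B x) (grad (v_ k) x) * u x) = 0.
  move=> l0; have l0' := ltW l0.
  pose s x := soft_trunc l (v_ k x); pose s' x := soft_trunc' l (v_ k x).
  have sv := CS (Cv' k); have ss : smooth s by exact: smooth_soft_trunc.
  have ms : measurable_fun setT s by exact: smooth_measurable.
  have ms' : measurable_fun setT s'.
    by apply: (measurableT_comp (mut' l l0')); exact: smooth_measurable.
  have iv := grad_sq_integrable (Cv' k) mK Kfin.
  have mgv i : measurable_fun K (fun x => grad (v_ k) x 0 i) by exact: grad_measurable.
  have eq0 m : \int[mu]_(x in K) (s x * dotp (B x) (grad (u_ m) x)) +
      \int[mu]_(x in K) (s' x * dotp (B x) (grad (v_ k) x) * u_ m x) = 0.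
    have Cf : C (fun x => u_ m x * s x) by exact: C0inftyM.
    have gE x : grad (fun x => u_ m x * s x) x = (u_ m x * s' x) *: grad (v_ k) x + s x *: grad (u_ m) x.
      by rewrite gradM//; [rewrite /s grad_soft_trunc// scalerA|exact: CS].
    have iu := grad_sq_integrable (Cu m) mK Kfin.
    have [c c0 Hc] := C0infty_bounded (Cu m).
    have i1 : mu.-integrable K (EFin \o (fun x => s x * dotp (B x) (grad (u_ m) x))).
      apply: (@bounded_dotp_integrable _ _ _ _ (1 + l^-1)) => //.
      - exact: mS.
      - by move=> x; exact: soft_trunc_bounded.
      - by move=> i; exact: mKE.
      - by move=> i; apply: grad_measurable; exact: CS.
    have i2 : mu.-integrable K (EFin \o (fun x => (s' x * u_ m x) * dotp (B x) (grad (v_ k) x))).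
      apply: (@bounded_dotp_integrable _ _ _ _ c) => //.
      - apply: mS; apply: measurable_funM => //; apply: smooth_measurable; exact: CS.
      - move=> x; rewrite normrM -[c]mul1r ler_pM//; exact: soft_trunc'_le.
      - by move=> i; exact: mKE.
    have -> : \int[mu]_(x in K) (s' x * dotp (B x) (grad (v_ k) x) * u_ m x) =
        \int[mu]_(x in K) ((s' x * u_ m x) * dotp (B x) (grad (v_ k) x)).
      by apply: eq_Rintegral => x _; ring.
    rewrite -RintegralD// -(B_div Cf) (Rintegral_restrict_ae (D := E) (K := K))//.
    - apply: eq_Rintegral => x _; rewrite gE dotpDr !dotpZr; ring.
    - by apply: drift_measurable => i; apply: grad_measurable; exact: CS.
    - apply: filterS aI => x Ix Ex nKx; have nVx : ~ V x by move=> /VK.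
      rewrite gE (C0infty_in_grad (Cv k) Ix nVx) scaler0 add0r.
      by rewrite /s (C0infty_in_eq0 (Cv k) Ex nVx) soft_trunc0 scale0r dotp0r.
  have L1 : \int[mu]_(x in K) (s x * dotp (B x) (grad (u_ m) x)) @[m --> \oo] -->
      \int[mu]_(x in K) (s x * dotp (B x) (wgrad u x)).
    pose c := 1 + l^-1.
    have ig := integrableZl mK (c ^+ 2) iBK.
    have L0 : \int[mu]_(x in K) dotp (s x *: B x) (grad (u_ m) x - wgrad u x)
        @[m --> \oo] --> (0 : R).
      apply: (grad_cvg_pair H (G_ := fun=> fun x => s x *: B x) Cu GFu cK KE _ ig) => [n i|n].
        under eq_fun do rewrite mxE.
        by apply: measurable_funM; [exact: mS|exact: mKE].
      apply: nearW => x _; rewrite dotpZl dotpZr mulrA -expr2 ler_wpM2r ?dotp_ge0//.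
      by apply: sqr_le_bound; exact: soft_trunc_bounded.
    rewrite -[X in _ --> X]add0r.
    have -> : (fun m => \int[mu]_(x in K) (s x * dotp (B x) (grad (u_ m) x))) =
        (fun m => \int[mu]_(x in K) dotp (s x *: B x) (grad (u_ m) x - wgrad u x)
           + \int[mu]_(x in K) (s x * dotp (B x) (wgrad u x))).
      apply/funext => m; have iu := grad_sq_integrable (Cu m) mK Kfin.
      have b1 : mu.-integrable K (EFin \o (fun x => s x * dotp (B x) (grad (u_ m) x))).
        apply: (@bounded_dotp_integrable _ _ _ _ c) => //.
        - exact: mS.
        - by move=> x; exact: soft_trunc_bounded.
        - by move=> i; exact: mKE.
        - by move=> i; apply: grad_measurable; exact: CS.
      have b2 : mu.-integrable K (EFin \o (fun x => s x * dotp (B x) (wgrad u x))).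
        apply: (@bounded_dotp_integrable _ _ _ _ c) => //.
        - exact: mS.
        - by move=> x; exact: soft_trunc_bounded.
        - by move=> i; exact: mKE.
        - by move=> i; exact: mKE.
      have -> : \int[mu]_(x in K) dotp (s x *: B x) (grad (u_ m) x - wgrad u x) =
          \int[mu]_(x in K) (s x * dotp (B x) (grad (u_ m) x) - s x * dotp (B x) (wgrad u x)).
        by apply: eq_Rintegral => x _; rewrite dotpZl dotpBr mulrBr.
      by rewrite RintegralB// subrK.
    by apply: cvgD => //; exact: cvg_cst.
  have mBv : measurable_fun K (fun x => dotp (B x) (grad (v_ k) x)).
    by apply: dotp_measurable => // i; exact: mKE.
  have [c c0 Hc] : exists2 c : R, 0 <= c & forall x, grad_sq (v_ k) x <= c.
    have /boolp.choice[c Hc] : forall i, exists c : R, forall x, `|partial i (v_ k) x| <= c.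
      by move=> i; have [c _ Hc] := partial_bounded i (Cv' k); exists c.
    exists (\sum_i c i ^+ 2); first by apply: sumr_ge0 => i _; exact: sqr_ge0.
    move=> x; rewrite /grad_sq dotpE; apply: ler_sum => i _.
    by rewrite gradE -expr2; apply: sqr_le_bound; exact: Hc.
  have L2 : \int[mu]_(x in K) (s' x * dotp (B x) (grad (v_ k) x) * u_ m x) @[m --> \oo] -->
      \int[mu]_(x in K) (s' x * dotp (B x) (grad (v_ k) x) * u x).
    apply: cvg_L2_pair => //.
    - by apply: measurable_funM => //; exact: mS.
    - apply: (integrable_le mK _ (integrableZl mK c iBK)).
        by apply: measurable_funX; apply: measurable_funM => //; exact: mS.
      move=> x _; rewrite normrX normrM exprMn -[leRHS]mul1r.
      apply: ler_pM; rewrite ?exprn_ge0//.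
        by rewrite -[leRHS](expr1n _ 2) lerXn2r ?nnegrE//; exact: soft_trunc'_le.
      rewrite -normrX ger0_norm ?sqr_ge0//; apply: (le_trans (dotp_cauchy_schwarz _ _)).
      by rewrite mulrC ler_wpM2r ?dotp_ge0//; exact: Hc.
    - by move=> n; exact: CL2.
    - by apply/(Lnorm_cvgP p2) => // n; exact: CL2.
  apply: (cvg_cst_eq (cvgD L1 L2)) => m; exact: eq0.
have [psi psi_ge Hpsi] : exists2 psi : nat -> nat, (forall k, (k <= psi k)%N) &
    {ae mu, forall x, v_ (psi k) x @[k --> \oo] --> (v x : R)}.
  apply: (Lp_cvg_ae p2) => //; first by move=> n; exact: CL2.
  by apply/(Lnorm_cvgP p2) => // n; exact: CL2.
(* In the second integral both the coefficient and the gradient vary with k: the gradient is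
   replaced at a cost that tends to 0 ([L3]), then the coefficient converges by domination ([L2]),
   with [u] bounded by [M]. *)
have step2 (l : R) : 0 < l ->
    \int[mu]_(x in K) (soft_trunc l (v x) * dotp (B x) (wgrad u x)) +
    \int[mu]_(x in K) (soft_trunc' l (v x) * u x * dotp (B x) (wgrad v x)) = 0.
  move=> l0; have l0' := ltW l0.
  have mvk k : measurable_fun setT (v_ k) by apply: smooth_measurable; exact: CS.
  have ms k : measurable_fun K (fun x => soft_trunc l (v_ k x)).
    by apply: mS; apply: (measurableT_comp (mut l l0')).
  have ms' k : measurable_fun K (fun x => soft_trunc' l (v_ k x)).
    by apply: mS; apply: (measurableT_comp (mut' l l0')).
  have mBu : measurable_fun K (fun x => dotp (B x) (wgrad u x)).
    by apply: mKE; exact: drift_measurable.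
  have mBv : measurable_fun K (fun x => dotp (B x) (wgrad v x)).
    by apply: mKE; exact: drift_measurable.
  have muK : measurable_fun K u by exact: mS.
  have L1 : \int[mu]_(x in K) (soft_trunc l (v_ (psi k) x) * dotp (B x) (wgrad u x))
      @[k --> \oo] --> \int[mu]_(x in K) (soft_trunc l (v x) * dotp (B x) (wgrad u x)).
    have i1 := integrableZl mK (1 + l^-1) (integrable_norm iBFu).
    apply: (dominated_cvg_Rintegral mK _ _ _ i1 _).2.
    - by move=> n; exact: measurable_funM.
    - by apply: measurable_funM => //; apply: mS; apply: (measurableT_comp (mut l l0')).
    - apply: filterS Hpsi => x Hx _; apply: cvgM; last exact: cvg_cst.
      exact: cvg_soft_trunc.
    - move=> n; apply: nearW => x _; rewrite normrM ler_wpM2r//.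
      exact: soft_trunc_bounded.
  have L2 : \int[mu]_(x in K) (soft_trunc' l (v_ (psi k) x) * u x * dotp (B x) (wgrad v x))
      @[k --> \oo] --> \int[mu]_(x in K) (soft_trunc' l (v x) * u x * dotp (B x) (wgrad v x)).
    have i1 := integrableZl mK M (integrable_norm iBFv).
    apply: (dominated_cvg_Rintegral mK _ _ _ i1 _).2.
    - by move=> n; apply: measurable_funM => //; exact: measurable_funM.
    - apply: measurable_funM => //; apply: measurable_funM => //.
      by apply: mS; apply: (measurableT_comp (mut' l l0')).
    - apply: filterS Hpsi => x Hx _; apply: cvgM; last exact: cvg_cst.
      by apply: cvgM; [exact: cvg_soft_trunc'|exact: cvg_cst].
    - move=> n; apply: filterS HM => x Hx _; rewrite normrM ler_wpM2r// normrM.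
      by rewrite -[M]mul1r ler_pM//; exact: soft_trunc'_le.
  have L3 : \int[mu]_(x in K) dotp ((soft_trunc' l (v_ k x) * u x) *: B x) (grad (v_ k) x - wgrad v x)
      @[k --> \oo] --> (0 : R).
    apply: (grad_cvg_pair H (G_ := fun k => fun x => (soft_trunc' l (v_ k x) * u x) *: B x)
      Cv' GFv cK KE _ (integrableZl mK (M ^+ 2) iBK)) => [n i|n].
      under eq_fun do rewrite mxE.
      by apply: measurable_funM; [exact: measurable_funM|exact: mKE].
    apply: filterS HM => x Hx _; rewrite dotpZl dotpZr mulrA -expr2 ler_wpM2r ?dotp_ge0//.
    apply: sqr_le_bound.
    by rewrite normrM -[M]mul1r ler_pM//; exact: soft_trunc'_le.
  have L3' := cvg_subseq psi_ge L3.
  have := cvg_cst_eq (cvgD (cvgD L1 L3') L2) (c := 0); rewrite addr0; apply=> k.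
  rewrite -[RHS](step1 (psi k) l l0) -addrA; congr (_ + _).
  set w := v_ (psi k); have Cw : C w by exact: Cv'.
  pose s' x := soft_trunc' l (w x) * u x.
  have ms'u : measurable_fun K s' by apply: measurable_funM => //; exact: ms'.
  have s'M : {ae mu, forall x, `|s' x| <= M}.
    apply: filterS HM => x Hx; rewrite normrM -[M]mul1r ler_pM//; exact: soft_trunc'_le.
  have ib F : (forall i, measurable_fun K (fun x => F x 0 i)) ->
      mu.-integrable K (EFin \o (fun x => dotp (F x) (F x))) ->
      mu.-integrable K (EFin \o (fun x => s' x * dotp (B x) (F x))).
    move=> mF iF.
    have mBF : measurable_fun K (fun x => dotp (B x) (F x)).
      by apply: dotp_measurable => // i; exact: mKE.
    have iBF := integrable_dotp mK mBF iBK iF.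
    apply: (integrable_ae_le mK _ (integrableZl mK M (integrable_norm iBF))).
      exact: measurable_funM.
    by apply: filterS s'M => x Hx _; rewrite normrM ler_wpM2r.
  have b1 := ib (grad w) (fun i => @grad_measurable _ _ K w i (CS Cw)) (grad_sq_integrable Cw mK Kfin).
  have b2 := ib (wgrad v) (fun i => mKE _ (mFv i)) iFv.
  have -> : \int[mu]_(x in K) dotp ((soft_trunc' l (w x) * u x) *: B x) (grad w x - wgrad v x) =
      \int[mu]_(x in K) (s' x * dotp (B x) (grad w x) - s' x * dotp (B x) (wgrad v x)).
    by apply: eq_Rintegral => x _; rewrite dotpZl dotpBr mulrBr.
  rewrite RintegralB// subrK; apply: eq_Rintegral => x _; rewrite /s'; ring.
(* The level now tends to 0; the dominations use the bounds [M'] of [v] and [M] of [u]. *)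
pose l n : R := n.+1%:R^-1.
have l0 n : 0 < l n by rewrite invr_gt0 ltr0n.
have l0' n : 0 <= l n by exact: ltW.
have lcvg : l n @[n --> \oo] --> (0 : R) by exact: cvg_harmonic.
have mBu : measurable_fun K (fun x => dotp (B x) (wgrad u x)).
  by apply: mKE; exact: drift_measurable.
have mBv : measurable_fun K (fun x => dotp (B x) (wgrad v x)).
  by apply: mKE; exact: drift_measurable.
have muK : measurable_fun K u by exact: mS.
have mvK : measurable_fun K v by exact: mS.
have ms n : measurable_fun K (fun x => soft_trunc (l n) (v x)).
  by apply: mS; apply: (measurableT_comp (mut (l n) (l0' n))).
have ms' n : measurable_fun K (fun x => soft_trunc' (l n) (v x)).
  by apply: mS; apply: (measurableT_comp (mut' (l n) (l0' n))).
have L1 : \int[mu]_(x in K) (soft_trunc (l n) (v x) * dotp (B x) (wgrad u x))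
    @[n --> \oo] --> \int[mu]_(x in K) (v x * dotp (B x) (wgrad u x)).
  have i1 := integrableZl mK M' (integrable_norm iBFu).
  apply: (dominated_cvg_Rintegral mK _ _ _ i1 _).2.
  - by move=> n; exact: measurable_funM.
  - exact: measurable_funM.
  - apply: nearW => x _; apply: cvgM; last exact: cvg_cst.
    by have [] := cvg_soft_trunc_id (v x) l0' lcvg.
  - move=> n; apply: filterS HM' => x Hx _; rewrite normrM ler_wpM2r//.
    by apply: le_trans Hx; exact: soft_trunc_le.
have L2 : \int[mu]_(x in K) (soft_trunc' (l n) (v x) * u x * dotp (B x) (wgrad v x))
    @[n --> \oo] --> \int[mu]_(x in K) (1 * u x * dotp (B x) (wgrad v x)).
  have i1 := integrableZl mK M (integrable_norm iBFv).
  apply: (dominated_cvg_Rintegral mK _ _ _ i1 _).2.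
  - by move=> n; apply: measurable_funM => //; exact: measurable_funM.
  - by apply: measurable_funM => //; exact: measurable_funM.
  - apply: nearW => x _; apply: cvgM; last exact: cvg_cst.
    apply: cvgM; last exact: cvg_cst.
    by have [] := cvg_soft_trunc_id (v x) l0' lcvg.
  - move=> n; apply: filterS HM => x Hx _; rewrite normrM ler_wpM2r// normrM.
    by rewrite -[M]mul1r ler_pM//; exact: soft_trunc'_le.
have E0 := cvg_cst_eq (cvgD L1 L2) (fun n => step2 (l n) (l0 n)).
have aV : {ae mu, forall x, E x -> ~ K x -> v x = 0}.
  by apply: filterS (form_dom_in_off H Dv) => x Hx _ nKx; apply: Hx => /VK.
have aW : {ae mu, forall x, E x -> ~ K x -> wgrad v x = 0}.
  by apply: filterS (wgrad_off H HV Dv) => x Hx Ex nKx; apply: Hx => // /VK.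
rewrite (Rintegral_restrict_ae (D := E) (K := K))//; last 2 first.
- by apply: measurable_funM; [exact: drift_measurable|exact: mS].
- by apply: filterS aV => x Hx Ex nKx; rewrite Hx// mulr0.
rewrite [in RHS](Rintegral_restrict_ae (D := E) (K := K))//; last 2 first.
- by apply: measurable_funM; [exact: drift_measurable|exact: mS].
- by apply: filterS aW => x Hx Ex nKx; rewrite Hx// dotp0r mul0r.
apply/eqP; rewrite -addr_eq0 -E0; apply/eqP; congr (_ + _).
- by apply: eq_Rintegral => x _; rewrite mulrC.
- by apply: eq_Rintegral => x _; rewrite mul1r mulrC.
Qed.

End drift.

(** * The extended form *)

Lemma cvg_sqr_mul0 (R : realType) (r : nat -> R) (k : R) :
  r n @[n --> \oo] --> (0 : R) -> r n ^+ 2 * k @[n --> \oo] --> (0 : R).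
Proof.
move=> r0; have : r n * r n * k @[n --> \oo] --> (0 * 0 * k : R).
  by apply: cvgM; [exact: cvgM|exact: cvg_cst].
by rewrite !mul0r; under eq_fun do rewrite -expr2.
Qed.

Lemma young_of_sqr (R : realFieldType) (t p q r : R) : 0 < t ->
  0 <= t ^+ 2 * p + t * r + q -> 0 <= t ^+ 2 * p - t * r + q ->
  `|r| <= t * p + t^-1 * q.
Proof.
move=> t0 h1 h2; rewrite -(ler_pM2l t0).
have -> : t * (t * p + t^-1 * q) = t ^+ 2 * p + q by field; rewrite gt_eqF.
rewrite -{1}(gtr0_norm t0) -normrM ler_norml; lra.
Qed.

Section dominated.
Context d (T : measurableType d) (R : realType).
Variable mu : {measure set T -> \bar R}.
Implicit Types (D : set T) (f g : T -> R).

Lemma dominated_cvg0 D (f_ : nat -> T -> R) g : measurable D ->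
  (forall n, measurable_fun D (f_ n)) ->
  {ae mu, forall x, D x -> f_ n x @[n --> \oo] --> (0 : R)} ->
  mu.-integrable D (EFin \o g) ->
  (forall n, {ae mu, forall x, D x -> `|f_ n x| <= g x}) ->
  (\int[mu]_(x in D) (f_ n x)%:E)%E @[n --> \oo] --> 0%E.
Proof.
move=> mD mf f0 ig fg.
have m0 : measurable_fun D (fun _ : T => 0 : R) by exact: measurable_cst.
have [_] := dominated_cvg_Rintegral mD mf m0 f0 ig fg.
rewrite Rintegral_cst// mul0r => L.
have -> : (fun n => \int[mu]_(x in D) (f_ n x)%:E)%E =
    (fun n => (\int[mu]_(x in D) f_ n x)%:E).
  apply/funext => n; apply: EFin_Rintegral => //.
  exact: integrable_ae_le ig (fg n).
by apply: cvg_EFin => //; exact: nearW.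
Qed.

Lemma nrm2_cvg0 (f_ : nat -> T -> R) g : (forall n, f_ n \in Lfun mu 2%:E) ->
  g \in Lfun mu 2%:E -> {ae mu, forall x, f_ n x @[n --> \oo] --> (0 : R)} ->
  (forall n, {ae mu, forall x, `|f_ n x| <= g x}) ->
  nrm mu 2 (f_ n) @[n --> \oo] --> (0 : R).
Proof.
move=> lf lg f0 fg.
have mf n : measurable_fun setT (fun x => f_ n x ^+ 2).
  by apply: measurable_funX; exact: Lfun_meas.
have : (\int[mu]_x (f_ n x ^+ 2)%:E)%E @[n --> \oo] --> 0%E.
  apply: (dominated_cvg0 measurableT mf _ (Lfun2_integrable_sqr lg)).
    apply: filterS f0 => x Hx _; rewrite -[X in _ --> X](mulr0 (0 : R)).
    by under eq_fun do rewrite expr2; exact: cvgM.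
  by move=> n; apply: filterS (fg n) => x Hx _; rewrite ger0_norm ?sqr_ge0// sqr_le_bound.
have ge0 n : (0 <= \int[mu]_x (f_ n x ^+ 2)%:E)%E.
  by apply: integral_ge0 => x _; rewrite lee_fin sqr_ge0.
move=> /(cvge0P ge0) L; apply/cvg_seqP => e e0.
have e2 : 0 < (e / 2) ^+ 2 by rewrite exprn_gt0// divr_gt0.
have [N HN] := L _ e2; exists N => n Nn; rewrite subr0 ger0_norm ?nrm_ge0//.
apply: (@le_lt_trans _ _ (e / 2)); last by rewrite ltr_pdivrMr// ltr_pMr// ltr1n.
have := HN n Nn; rewrite EFin_Rintegral//; last exact: Lfun2_integrable_sqr.
rewrite lee_fin -nrm2_sqr//.
by rewrite ler_pXn2r ?nnegrE ?nrm_ge0// divr_ge0// ltW.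
Qed.

End dominated.

(** * Energies along smooth Cauchy sequences that tend to 0 almost everywhere *)

Section extended_form.
Context (R : realType) (d : nat).
Local Notation X := 'rV[R]_d.
Variables (E : set X) (phi : X -> R) (mu : {measure set X -> \bar R}).
Variable A : X -> 'M[R]_d.
Hypothesis H : form_setting E phi mu A.
Implicit Types (f g h u v w : X -> R) (V K : set X) (x : X) (F G : X -> X).

Local Notation C := (C0infty E).
Local Notation a := (form0 E mu A).
Local Notation L2 := (Lfun mu 2%:E).
Local Notation D := (form_dom E mu A).
Local Notation form := (Defs.form E mu A).
Local Notation bil := (bil A).

Let oc : open E \/ closed E. Proof. exact: open_or_closed (setting_domain H). Qed.
Let mE : measurable E. Proof. exact: measurable_domain (setting_domain H). Qed.
Let p2 : (1 : R) <= 2. Proof. by rewrite ler1n. Qed.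
Let CS f : C f -> smooth f. Proof. exact: C0infty_smooth. Qed.
Let CL2 f : C f -> f \in L2.
Proof. exact: (C0infty_L2 (setting_domain H) (setting_density H) (setting_measure H)). Qed.
Let CB f g : C f -> C g -> C (f \- g). Proof. exact: C0inftyB. Qed.
Let a_linl (c : R) f g h : C f -> C g -> C h ->
  a (fun x => c * f x + g x) h = c * a f h + a g h.
Proof. by apply: form0_linl; [exact: setting_domain H|exact: setting_matrix H]. Qed.
Let a_linr (c : R) f g h : C f -> C g -> C h ->
  a h (fun x => c * f x + g x) = c * a h f + a h g.
Proof. by apply: form0_linr; [exact: setting_domain H|exact: setting_matrix H]. Qed.
Let aBl f g h : C f -> C g -> C h -> a (f \- g) h = a f h - a g h.
Proof. by apply: form0Bl; [exact: setting_domain H|exact: setting_matrix H]. Qed.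
Let aBr f g h : C f -> C g -> C h -> a h (f \- g) = a h f - a h g.
Proof. by apply: form0Br; [exact: setting_domain H|exact: setting_matrix H]. Qed.
Let a_ge0 f : C f -> 0 <= a f f.
Proof. by move=> _; apply: form0_ge0; [exact: setting_domain H|exact: setting_elliptic H]. Qed.

Lemma form0E f g : a f g = \int[mu]_(x in E) bil x (grad f x) (grad g x).
Proof. by []. Qed.

#[local] Opaque form0.

Lemma bil_young x (xi eta : X) (t : R) : E x -> 0 < t ->
  `|bil x xi eta + bil x eta xi| <= t * bil x xi xi + t^-1 * bil x eta eta.
Proof.
move=> Ex t0.
have P s : 0 <= t ^+ 2 * bil x xi xi + t * s * (bil x xi eta + bil x eta xi) + s ^+ 2 * bil x eta eta.
  have := bil_ge0 (setting_domain H) (setting_elliptic H) (t *: xi + s *: eta) Ex.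
  rewrite !(bilDl, bilDr, bilZl, bilZr); move: (bil x xi xi) (bil x xi eta) (bil x eta xi) (bil x eta eta) => p q r z.
  by move=> h; apply: (le_trans h); rewrite le_eqVlt; apply/orP; left; apply/eqP; ring.
have := P 1; have := P (-1).
move: (bil x xi xi) (bil x eta eta) (bil x xi eta + bil x eta xi) => p q r h1 h2.
by apply: young_of_sqr; lra.
Qed.

(** Twice the symmetric part. It obeys a Cauchy-Schwarz inequality already under the integral sign,
    whereas the pairing by [A] itself is controlled after integration, through the sector
    condition. *)
Definition sym_form f g : R := a f g + a g f.

Lemma sym_form_young f g (t : R) : C f -> C g -> 0 < t ->
  `|sym_form f g| <= t * a f f + t^-1 * a g g.
Proof.
move=> Cf Cg t0; rewrite /sym_form.
have sq (b : R) : a (fun x => b * f x + g x) (fun x => b * f x + g x) =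
    b ^+ 2 * a f f + b * (a f g + a g f) + a g g.
  have Cc := C0infty_lin b Cf Cg.
  rewrite (a_linl b Cf Cg Cc) (a_linr b Cf Cg Cf) (a_linr b Cf Cg Cg).
  move: (a f f) (a f g) (a g f) (a g g) => *; ring.
have := a_ge0 (C0infty_lin t Cf Cg); have := a_ge0 (C0infty_lin (- t) Cf Cg).
rewrite !sq; move: (a f f) (a g g) (a f g + a g f) => p q r h1 h2.
by apply: young_of_sqr; lra.
Qed.

Lemma sym_formBr f g h : C f -> C g -> C h -> sym_form h (f \- g) = sym_form h f - sym_form h g.
Proof.
move=> Cf Cg Ch; rewrite /sym_form (aBl Cf Cg Ch) (aBr Cf Cg Ch).
move: (a h f) (a h g) (a f h) (a g h) => *; ring.
Qed.

(* A sequence whose gradients converge is Cauchy for the form, so closability applies. *)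
Lemma closable_gradient_limit (z_ : nat -> X -> R) G K : compact K -> K `<=` E ->
  (forall n, C (z_ n)) -> (forall n x, E x -> ~ K x -> grad (z_ n) x = 0) ->
  (forall i, measurable_fun K (fun x => G x 0 i)) ->
  (\int[mu]_(x in K) (grad_dist (z_ n) G x)%:E)%E @[n --> \oo] --> 0%E ->
  nrm mu 2 (z_ n) @[n --> \oo] --> (0 : R) ->
  a (z_ n) (z_ n) @[n --> \oo] --> (0 : R) /\ {ae mu, forall x, K x -> G x = 0}.
Proof.
move=> cK KE Cz z0 mG LG Lz; have mK := compact_measurable_rV cK.
have [V HV KV] := compact_sub_rel_compact oc cK KE.
have VE := rel_compact_sub HV.
have mV := rel_compact_measurable (setting_domain H) HV.
have Vfin := rel_compact_finite_measure (setting_domain H) (setting_density H)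
      (setting_measure H) HV.
have Kfin := domain_compact_finite (setting_density H) (setting_measure H) cK KE.
have [nu nu0 Hnu] := form_le_grad_sq (setting_domain H) (setting_density H)
      (setting_measure H) (setting_matrix H) (setting_elliptic H) HV.
have [nu' nu'0 Hnu'] := grad_sq_le_form (setting_domain H) (setting_density H)
      (setting_measure H) (setting_matrix H) (setting_elliptic H) HV.
have ge0 n : (0 <= \int[mu]_(x in K) (grad_dist (z_ n) G x)%:E)%E.
  by apply: integral_ge0 => x _; rewrite lee_fin grad_dist_ge0.
have {}LG := (cvge0P ge0).1 LG.
have mgd n : measurable_fun K (grad_dist (z_ n) G).
  have mi i : measurable_fun K (fun x => (grad (z_ n) x - G x) 0 i).
    rewrite (_ : (fun x => _) = (fun x => grad (z_ n) x 0 i - G x 0 i)); last first.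
      by apply/funext => x; rewrite !mxE.
    by apply: measurable_funB => //; apply: grad_measurable; exact: CS.
  exact: dotp_measurable.
have [N1 HN1] := LG 1 ltr01.
have igd n : (N1 <= n)%N -> mu.-integrable K (EFin \o grad_dist (z_ n) G).
  move=> n1; apply: integral_fin_integrable => //.
  - by move=> x _; exact: grad_dist_ge0.
  - exact: (le_lt_trans (HN1 n n1) (ltry _)).
have VK f : C f -> (forall x, E x -> ~ K x -> grad f x = 0) ->
    \int[mu]_(x in V) grad_sq f x = \int[mu]_(x in K) grad_sq f x.
  move=> Cf f0; apply: Rintegral_restrict_eq => // x Vx nKx.
  by rewrite /grad_sq f0 ?dotp0l//; exact: VE.
have cz : form_cauchy a z_.
  move=> e e0; have e1 : 0 < e / (8 * nu) by rewrite divr_gt0// mulr_gt0.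
  have [N2 HN2] := LG _ e1.
  exists (maxn N1 N2) => m n; rewrite !geq_max => /andP[m1 m2] /andP[n1 n2].
  have Cw := CB (Cz m) (Cz n).
  have w0 x : E x -> ~ K x -> grad (z_ m \- z_ n) x = 0.
    by move=> Ex nKx; rewrite gradB ?z0 ?subrr//; exact: CS.
  apply: (@le_lt_trans _ _ (nu * \int[mu]_(x in K) grad_sq (z_ m \- z_ n) x)).
    rewrite -VK//; apply: Hnu => // x Ex nVx; apply: w0 => // Kx; apply: nVx; exact: KV.
  have i1 := integrableZl mK 2 (igd m m1); have i2 := integrableZl mK 2 (igd n n1).
  have : \int[mu]_(x in K) grad_sq (z_ m \- z_ n) x <=
      \int[mu]_(x in K) (2 * grad_dist (z_ m) G x + 2 * grad_dist (z_ n) G x).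
    apply: le_Rintegral => //.
    - exact: (grad_sq_integrable Cw mK Kfin).
    - exact: (integrableD mK i1 i2).
    - move=> x _; rewrite -grad_dist_grad; [|exact: CS|exact: CS].
      apply: (le_trans (dotpB_le _ (G x) _)); rewrite lerD2l.
      by rewrite -(dotpNN (G x - _)) opprB.
  have q n' : (N1 <= n')%N -> (N2 <= n')%N -> \int[mu]_(x in K) grad_dist (z_ n') G x <= e / (8 * nu).
    by move=> h1 h2; rewrite -lee_fin -EFin_Rintegral//; [exact: HN2|exact: igd].
  have qm := q m m1 m2; have qn := q n n1 n2.
  rewrite RintegralD; [|exact: mK|exact: i1|exact: i2].
  rewrite (RintegralZl 2 mK (igd m m1)) (RintegralZl 2 mK (igd n n1)).
  move: (\int[mu]_(x in K) grad_dist (z_ m) G x) (\int[mu]_(x in K) grad_dist (z_ n) G x)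
    (\int[mu]_(x in K) grad_sq _ x) qm qn => p r z.
  rewrite !ler_pdivlMr ?mulr_gt0// => qm qn; rewrite -(ler_pM2l nu0) => qz.
  by apply: (le_lt_trans qz); lra.
have z00 : Lp_cvg mu 2%:E z_ (cst 0).
  apply/(Lnorm_cvgP p2) => [n| |]; [exact: CL2|exact: (Lfun0 mu p2)|].
  by under eq_fun do under eq_fun do rewrite subr0.
have La := setting_closable H (And3 Cz cz z00); split; first exact: La.
have iGG : mu.-integrable K (EFin \o (fun x => dotp (G x) (G x))).
  have i1 := integrableZl mK 2 (igd N1 (leqnn _)).
  have i2 := integrableZl mK 2 (grad_sq_integrable (Cz N1) mK Kfin).
  apply: (integrable_le mK _ (integrableD mK i1 i2)); first exact: dotp_measurable.
  move=> x _; rewrite ger0_norm ?dotp_ge0//.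
  have := dotpB_le (G x) (grad (z_ N1) x) 0; rewrite !subr0 => q.
  by apply: (le_trans q); rewrite -(dotpNN (G x - _)) opprB.
have G0 : \int[mu]_(x in K) dotp (G x) (G x) = 0.
  apply/eqP; rewrite eq_le; apply/andP; split; last first.
    by apply: Rintegral_ge0 => x _; exact: dotp_ge0.
  apply/ler_addgt0Pr => e e0; rewrite add0r.
  have e1 : 0 < e / 4 by rewrite divr_gt0.
  have e2 : 0 < e / (4 * nu') by rewrite divr_gt0// mulr_gt0.
  have [N2 HN2] := LG _ e1; have /cvg_seqP/(_ _ e2)[N3 HN3] := La.
  pose n := maxn N1 (maxn N2 N3).
  have n1 : (N1 <= n)%N by rewrite leq_maxl.
  have n2 : (N2 <= n)%N by rewrite /n; lia.
  have n3 : (N3 <= n)%N by rewrite /n; lia.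
  have i1 := integrableZl mK 2 (igd n n1).
  have ig := grad_sq_integrable (Cz n) mK Kfin; have i2 := integrableZl mK 2 ig.
  apply: (@le_trans _ _ (\int[mu]_(x in K) (2 * grad_dist (z_ n) G x + 2 * grad_sq (z_ n) x))).
    apply: le_Rintegral => //; first exact: (integrableD mK i1 i2).
    move=> x _; have := dotpB_le (G x) (grad (z_ n) x) 0; rewrite !subr0 => q.
    by apply: (le_trans q); rewrite -(dotpNN (G x - _)) opprB.
  rewrite RintegralD; [|exact: mK|exact: i1|exact: i2].
  rewrite (RintegralZl 2 mK (igd n n1)) (RintegralZl 2 mK ig).
  have q1 : \int[mu]_(x in K) grad_dist (z_ n) G x <= e / 4.
    by rewrite -lee_fin -EFin_Rintegral//; [exact: HN2|exact: igd].
  have q2 : \int[mu]_(x in K) grad_sq (z_ n) x <= e / 4.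
    rewrite -VK//; last by move=> x; exact: z0.
    apply: (le_trans (Hnu' _ (Cz n))).
    have := HN3 n n3; rewrite subr0 => /(le_lt_trans (ler_norm _)).
    move: (a _ _) => y; rewrite ltr_pdivlMr ?mulr_gt0// => hy.
    by rewrite ler_pdivlMr//; lra.
  move: (Rintegral _ _ _) (Rintegral _ _ _) q1 q2 => y z; lra.
by apply: filterS (Rintegral_eq0_ae mK iGG (fun x _ => dotp_ge0 _) G0) => x Hx Kx; apply: dotp_eq0; exact: Hx.
Qed.

Lemma dotpD3_le (p q r : X) :
  dotp (p + q + r) (p + q + r) <= 4 * dotp p p + 4 * dotp q q + 2 * dotp r r.
Proof.
have D2 (y z : X) : dotp (y + z) (y + z) <= 2 * dotp y y + 2 * dotp z z.
  by have := dotpB_le y 0 (- z); rewrite opprK !subr0 add0r.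
by have := D2 (p + q) r; have := D2 p q; lra.
Qed.

Lemma supp_compact f : C f -> compact (E `&` supp f) /\ E `&` supp f `<=` E.
Proof. by move=> Cf; split; [exact: C0infty_compact Cf|exact: subIsetl]. Qed.

(** The truncations tend to 0 in L^2 and their gradients to that of [v] restricted to {v = 0}, so
    closability applies. In effect, a smooth function carries no energy on its zero set. *)
Lemma soft_trunc_energy_cvg0 v : C v ->
  a (fun x => soft_trunc n%:R (v x)) (fun x => soft_trunc n%:R (v x)) @[n --> \oo] --> (0 : R).
Proof.
move=> Cv; have [cK KE] := supp_compact Cv; set K := E `&` supp v in cK KE.
have mK := compact_measurable_rV cK.
have Kfin := domain_compact_finite (setting_density H) (setting_measure H) cK KE.
have n0 n : 0 <= n%:R :> R by exact: ler0n.
have Cz n : C (fun x => soft_trunc n%:R (v x)) by exact: C0infty_soft_trunc.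
have gE n x : grad (fun x => soft_trunc n%:R (v x)) x = soft_trunc' n%:R (v x) *: grad v x.
  by apply: grad_soft_trunc => //; exact: CS.
pose c x : R := if v x == 0 then 1 else 0.
have mv : measurable_fun setT v by apply: smooth_measurable; exact: CS.
have mt n : measurable_fun K (fun x => soft_trunc' n%:R (v x)).
  apply: (@measurable_funS _ _ _ _ setT) => //; apply: measurableT_comp mv.
  by apply: continuous_measurable_fun; exact: continuous_soft_trunc'.
have mc : measurable_fun K c.
  apply: (measurable_fun_cvg (h := fun n x => soft_trunc' n%:R (v x))) => // x _.
  exact: (cvg_soft_trunc_infty (v x)).2.
apply: (closable_gradient_limit (K := K) (G := fun x => c x *: grad v x) cK KE Cz _ _ _ _).1.
- by move=> n x Ex nKx; rewrite gE supp_grad ?scaler0// => sx; apply: nKx.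
- move=> i; under eq_fun do rewrite mxE.
  by apply: measurable_funM => //; apply: grad_measurable; exact: CS.
- apply: (dominated_cvg0 mK _ _ (integrableZl mK 4 (grad_sq_integrable Cv mK Kfin))).
  + move=> n.
    have mi i : measurable_fun K
        (fun x => (grad (fun x => soft_trunc n%:R (v x)) x - c x *: grad v x) 0 i).
      rewrite (_ : (fun x => _) = (fun x => (soft_trunc' n%:R (v x) - c x) * grad v x 0 i)).
        apply: measurable_funM; first exact: measurable_funB.
        by apply: grad_measurable; exact: CS.
      by apply/funext => x; rewrite gE !mxE; ring.
    exact: dotp_measurable.
  + apply: nearW => x _; have [_ L] := cvg_soft_trunc_infty (v x).
    have -> : (fun n => grad_dist (fun x => soft_trunc n%:R (v x)) (fun x => c x *: grad v x) x) =
        (fun n => (soft_trunc' n%:R (v x) - c x) * (soft_trunc' n%:R (v x) - c x) * grad_sq v x).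
      apply/funext => n; rewrite /grad_dist gE -scalerBl dotpZl dotpZr /grad_sq; ring.
    rewrite -[X in _ --> X](mul0r (grad_sq v x)); apply: cvgM; last exact: cvg_cst.
    have L0 : soft_trunc' n%:R (v x) - c x @[n --> \oo] --> (0 : R).
      by rewrite -[X in _ --> X](subrr (c x)); apply: cvgB => //; exact: cvg_cst.
    by rewrite -[X in _ --> X](mulr0 (0 : R)); exact: cvgM.
  + move=> n; apply: nearW => x _; rewrite ger0_norm ?grad_dist_ge0//.
    rewrite /grad_dist gE -scalerBl dotpZl dotpZr mulrA -expr2 ler_wpM2r ?dotp_ge0//.
    have -> : 4 = 2 ^+ 2 :> R by rewrite expr2; ring.
    apply: sqr_le_bound; apply: (le_trans (ler_normB _ _)).
    have c1 : `|c x| <= 1 by rewrite /c; case: ifP; rewrite ?normr1 ?normr0.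
    exact: (lerD (soft_trunc'_le (v x) (n0 n)) c1).
- apply: (nrm2_cvg0 (g := fun x => `|v x|)).
  + by move=> n; exact: CL2.
  + apply: (Lfun_le p2 _ (CL2 Cv)); first exact: measurableT_comp.
    by apply: nearW => x; rewrite normr_id.
  + by apply: nearW => x; have [] := cvg_soft_trunc_infty (v x).
  + by move=> n; apply: nearW => x; exact: soft_trunc_le.
Qed.

(* Multiplying by [v] makes the supports uniformly compact, so that closability applies. *)
Lemma gradient_limit_vanishes (w_ : nat -> X -> R) F v : (forall n, C (w_ n)) ->
  grad_cvg E mu w_ F -> {ae mu, forall x, w_ n x @[n --> \oo] --> (0 : R)} -> C v ->
  {ae mu, forall x, (E `&` supp v) x -> v x *: F x = 0}.
Proof.
move=> Cw GF w0 Cv; have [mF HF] := GF.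
have [cK KE] := supp_compact Cv; set K := E `&` supp v in cK KE *.
have mK := compact_measurable_rV cK.
have Kfin := domain_compact_finite (setting_density H) (setting_measure H) cK KE.
have l1 : 0 <= 1 :> R by [].
have Sw n : smooth (fun x => soft_trunc 1 (w_ n x)).
  by apply: smooth_soft_trunc => //; exact: CS.
pose z_ n x := v x * soft_trunc 1 (w_ n x).
have Cz n : C (z_ n) by exact: C0inftyM.
have gE n x : grad (z_ n) x = (v x * soft_trunc' 1 (w_ n x)) *: grad (w_ n) x
    + soft_trunc 1 (w_ n x) *: grad v x.
  by rewrite gradM ?grad_soft_trunc ?scalerA//; exact: CS.
have [c c0 Hc] := C0infty_bounded Cv.
have mv : measurable_fun setT v by apply: smooth_measurable; exact: CS.
have mS (f : X -> R) D' : measurable_fun setT f -> measurable_fun D' f.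
  by move=> mf; exact: measurable_funS mf.
have mw n : measurable_fun K (fun x => soft_trunc 1 (w_ n x)) by apply: mS; exact: smooth_measurable.
have mw' n : measurable_fun K (fun x => soft_trunc' 1 (w_ n x)).
  apply: mS; apply: (measurableT_comp (f := soft_trunc' 1)).
    by apply: continuous_measurable_fun; exact: continuous_soft_trunc'.
  by apply: smooth_measurable; exact: CS.
have mFK i : measurable_fun K (fun x => F x 0 i) by exact: measurable_funS (mF i).
have iF := grad_cvg_integrable H Cw GF cK KE.
have mD n : measurable_fun K (grad_dist (w_ n) F).
  exact: (grad_dist_measurable H mK KE (CS (Cw n)) mF).
apply: (closable_gradient_limit (K := K) (z_ := z_) cK KE Cz _ _ _ _).2.
- move=> n x Ex nKx; have [v0 gv0] := C0infty_outside Ex nKx.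
  by rewrite gE v0 gv0 mul0r scale0r scaler0 addr0.
- by move=> i; under eq_fun do rewrite mxE; apply: measurable_funM => //; exact: mS.
(* The difference between grad (z_ n) and v F splits into three parts: [e1] from the convergence of
   gradients, [e2] from the gradient of [v], [e3] from the derivative of the truncation, which tends
   to 1. *)
- pose e1 n x := (v x * soft_trunc' 1 (w_ n x)) *: (grad (w_ n) x - F x).
  pose e2 n x := soft_trunc 1 (w_ n x) *: grad v x.
  pose e3 n x := (v x * (soft_trunc' 1 (w_ n x) - 1)) *: F x.
  have dE n x : grad_dist (z_ n) (fun x => v x *: F x) x =
      dotp (e1 n x + e2 n x + e3 n x) (e1 n x + e2 n x + e3 n x).
    rewrite /grad_dist gE; set q := _ - _; suff -> : q = e1 n x + e2 n x + e3 n x by [].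
    by rewrite /q /e1 /e2 /e3; apply/rowP => i; rewrite !mxE; ring.
  have l01 : 0 < 1 :> R by [].
  have t1 x n : `|soft_trunc 1 (w_ n x)| <= 2.
    by have := soft_trunc_bounded (w_ n x) l01; rewrite invr1.
  have t1' x n : `|soft_trunc' 1 (w_ n x)| <= 1 by exact: soft_trunc'_le.
  have dsq (r : R) (y : X) : dotp (r *: y) (r *: y) = r ^+ 2 * dotp y y.
    by rewrite dotpZl dotpZr mulrA expr2.
  have L2' : (\int[mu]_(x in K) (dotp (e2 n x) (e2 n x))%:E)%E @[n --> \oo] --> 0%E.
    apply: (dominated_cvg0 mK _ _ (integrableZl mK (2 ^+ 2) (grad_sq_integrable Cv mK Kfin))).
    - move=> n; have mi i : measurable_fun K (fun x => e2 n x 0 i).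
        under eq_fun do rewrite mxE; apply: measurable_funM => //; apply: grad_measurable; exact: CS.
      exact: dotp_measurable.
    - apply: filterS w0 => x Hx _.
      have L : soft_trunc 1 (w_ n x) @[n --> \oo] --> (0 : R).
        by rewrite -(soft_trunc0 (1 : R)); exact: cvg_soft_trunc.
      by under eq_fun do rewrite dsq; exact: cvg_sqr_mul0.
    - move=> n; apply: nearW => x _; rewrite ger0_norm ?dotp_ge0// dsq.
      by rewrite ler_wpM2r ?dotp_ge0//; exact: sqr_le_bound.
  have L3' : (\int[mu]_(x in K) (dotp (e3 n x) (e3 n x))%:E)%E @[n --> \oo] --> 0%E.
    apply: (dominated_cvg0 mK _ _ (integrableZl mK ((c * 2) ^+ 2) iF)).
    - move=> n; have mi i : measurable_fun K (fun x => e3 n x 0 i).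
        under eq_fun do rewrite mxE; apply: measurable_funM => //; apply: measurable_funM; first exact: mS.
        exact: measurable_funB.
      exact: dotp_measurable.
    - apply: filterS w0 => x Hx _.
      have L : v x * (soft_trunc' 1 (w_ n x) - 1) @[n --> \oo] --> (0 : R).
        rewrite -[X in _ --> X](mulr0 (v x)); apply: cvgM; first exact: cvg_cst.
        rewrite -[X in _ --> X](subrr (1 : R)); apply: cvgB; last exact: cvg_cst.
        have s1 : soft_trunc' (1 : R) 0 = 1.
          by rewrite /soft_trunc' !mul0r mulr0 subr0 addr0 invr1 !mulr1.
        by have := cvg_soft_trunc' l1 Hx; rewrite s1.
      by under eq_fun do rewrite dsq; exact: cvg_sqr_mul0.
    - move=> n; apply: nearW => x _; rewrite ger0_norm ?dotp_ge0// dsq.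
      rewrite ler_wpM2r ?dotp_ge0//; apply: sqr_le_bound; rewrite normrM ler_pM//.
      apply: (le_trans (ler_normB _ _)); rewrite normr1.
      by rewrite -[leRHS]/(1 + 1) lerD2r.
  have ge0 (q : nat -> X -> X) n : (0 <= \int[mu]_(x in K) (dotp (q n x) (q n x))%:E)%E.
    by apply: integral_ge0 => x _; rewrite lee_fin dotp_ge0.
  have c1 : 0 < c ^+ 2 + 1 by rewrite ltr_wpDl// sqr_ge0.
  apply/cvge0P; first by move=> n; apply: integral_ge0 => x _; rewrite lee_fin grad_dist_ge0.
  move=> e ep.
  have e444 : e / 4 + (e / 4 + e / 4) <= e by lra.
  have e8 : 2 * (e / 16) <= e / 4 by lra.
  have r1 : 0 < e / (16 * (c ^+ 2 + 1)) by rewrite divr_gt0// mulr_gt0.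
  have r2 : 0 < e / 16 by rewrite divr_gt0.
  have [N1 HN1] := (cvge0P (ge0 (fun n x => grad (w_ n) x - F x))).1 (HF K cK KE) _ r1.
  have [N2 HN2] := (cvge0P (ge0 e2)).1 L2' _ r2.
  have [N3 HN3] := (cvge0P (ge0 e3)).1 L3' _ r2.
  exists (maxn N1 (maxn N2 N3)) => n nN.
  have {}HN1 := HN1 n (leq_trans (leq_maxl _ _) nN).
  have {}HN2 := HN2 n (leq_trans (leq_trans (leq_maxl _ _) (leq_maxr _ _)) nN).
  have {}HN3 := HN3 n (leq_trans (leq_trans (leq_maxr _ _) (leq_maxr _ _)) nN).
  have me2 : measurable_fun K (fun x => (dotp (e2 n x) (e2 n x))%:E).
    apply/measurable_EFinP; have mi i : measurable_fun K (fun x => e2 n x 0 i).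
      under eq_fun do rewrite mxE; apply: measurable_funM => //; apply: grad_measurable; exact: CS.
    exact: dotp_measurable.
  have me3 : measurable_fun K (fun x => (dotp (e3 n x) (e3 n x))%:E).
    apply/measurable_EFinP; have mi i : measurable_fun K (fun x => e3 n x 0 i).
      under eq_fun do rewrite mxE; apply: measurable_funM => //; apply: measurable_funM; first exact: mS.
      exact: measurable_funB.
    exact: dotp_measurable.
  have me1 : measurable_fun K (fun x => (grad_dist (w_ n) F x)%:E) by exact/measurable_EFinP.
  apply: (@le_trans _ _ (\int[mu]_(x in K) ((4 * (c ^+ 2 + 1))%:E * (grad_dist (w_ n) F x)%:E
     + (4%:E * (dotp (e2 n x) (e2 n x))%:E + 2%:E * (dotp (e3 n x) (e3 n x))%:E)))%E).
    apply: ge0_le_integral; first exact: mK.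
    - by move=> x _; rewrite lee_fin grad_dist_ge0.
    - apply/measurable_EFinP.
      have mi i : measurable_fun K (fun x => (grad (z_ n) x - v x *: F x) 0 i).
        rewrite (_ : (fun x => _) = (fun x => grad (z_ n) x 0 i - v x * F x 0 i)).
          apply: measurable_funB; first by apply: grad_measurable; exact: CS.
          by apply: measurable_funM => //; exact: mS.
        by apply/funext => x; rewrite !mxE.
      exact: dotp_measurable.
    - by apply: emeasurable_funD; [|apply: emeasurable_funD]; exact: measurable_funeM.
    - move=> x _; rewrite -!EFinM -!EFinD lee_fin dE; apply: (le_trans (dotpD3_le _ _ _)).
      rewrite addrA !lerD2r -mulrA ler_pM2l// /e1 dsq ler_wpM2r ?grad_dist_ge0//.
      apply: (@le_trans _ _ (c ^+ 2)); last by rewrite lerDl.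
      by apply: sqr_le_bound; rewrite normrM -[c]mulr1 ler_pM.
  have g4 : 0 <= 4 * (c ^+ 2 + 1) by rewrite mulr_ge0// ltW.
  rewrite ge0_integralD//; last 4 first.
  - by move=> x _; rewrite mule_ge0// lee_fin grad_dist_ge0.
  - exact: measurable_funeM.
  - by move=> x _; rewrite adde_ge0// mule_ge0// lee_fin dotp_ge0.
  - by apply: emeasurable_funD; exact: measurable_funeM.
  rewrite ge0_integralD//; last 4 first.
  - by move=> x _; rewrite mule_ge0// lee_fin dotp_ge0.
  - exact: measurable_funeM.
  - by move=> x _; rewrite mule_ge0// lee_fin dotp_ge0.
  - exact: measurable_funeM.
  rewrite !ge0_integralZl//; try by move=> x _; rewrite lee_fin dotp_ge0.
  have p1 : ((4 * (c ^+ 2 + 1))%:E * \int[mu]_(x in K) (grad_dist (w_ n) F x)%:E <= (e / 4)%:E)%E.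
    have -> : e / 4 = 4 * (c ^+ 2 + 1) * (e / (16 * (c ^+ 2 + 1))) by field; rewrite gt_eqF.
    by rewrite [leRHS]EFinM; apply: lee_wpmul2l.
  have p2' : (4%:E * \int[mu]_(x in K) (dotp (e2 n x) (e2 n x))%:E <= (e / 4)%:E)%E.
    have -> : e / 4 = 4 * (e / 16) by field.
    by rewrite [leRHS]EFinM; apply: lee_wpmul2l.
  have p3 : (2%:E * \int[mu]_(x in K) (dotp (e3 n x) (e3 n x))%:E <= (e / 4)%:E)%E.
    apply: (@le_trans _ _ (2 * (e / 16))%:E).
      by rewrite [leRHS]EFinM; apply: lee_wpmul2l.
    by rewrite lee_fin.
  apply: (le_trans (leeD p1 (leeD p2' p3))); by rewrite -!EFinD lee_fin.
- have l01 : 0 < 1 :> R by [].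
  have lv : (fun x => 2 * `|v x|) \in L2.
    apply: (LfunZ p2); apply: (Lfun_le p2 _ (CL2 Cv)); first exact: measurableT_comp.
    by apply: nearW => x; rewrite normr_id.
  apply: (nrm2_cvg0 _ lv).
  + by move=> n; exact: CL2.
  + apply: filterS w0 => x Hx; rewrite -[X in _ --> X](mulr0 (v x)).
    apply: cvgM; first exact: cvg_cst.
    by rewrite -(soft_trunc0 1); exact: cvg_soft_trunc.
  + move=> n; apply: nearW => x; rewrite normrM mulrC ler_wpM2r//.
    by have := soft_trunc_bounded (w_ n x) l01; rewrite invr1.
Qed.

(* Only the symmetric part of [A] is bounded on compact sets, hence the detour through the
   symmetrized form. *)
Lemma smooth_form_cvg0 (w_ : nat -> X -> R) : (forall n, C (w_ n)) -> form_cauchy a w_ ->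
  {ae mu, forall x, w_ n x @[n --> \oo] --> (0 : R)} ->
  a (w_ n) (w_ n) @[n --> \oo] --> (0 : R).
Proof.
move=> Cw cw w0.
have [F [psi [GF _ _]]] := form_cauchy_grad_cvg H Cw cw; have [mF HF] := GF.
have [M M0 HM] := form_cauchy_bounded CB aBl aBr a_ge0 Cw cw.
(* [v] is split into its truncation f at a high level, of small energy, and a rest g whose gradient
   vanishes on {v = 0}. The gradients of [w_ k] are then tested only where [v] does not vanish, and
   there they tend to 0 because [F] does vanish. *)
have sym0 v : C v -> sym_form (w_ k) v @[k --> \oo] --> (0 : R).
  move=> Cv; have [cK KE] := supp_compact Cv; set K := E `&` supp v in cK KE.
  have mK := compact_measurable_rV cK.
  have [V HV KV] := compact_sub_rel_compact oc cK KE.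
  have [nu nu0 Hnu] := bil_elliptic (setting_elliptic H) HV.
  have vF := gradient_limit_vanishes Cw GF w0 Cv; rewrite -/K in vF.
  have Kfin := domain_compact_finite (setting_density H) (setting_measure H) cK KE.
  apply/cvg_seqP => e e0.
  have e84 : e / 8 + e / 8 <= e / 4 by lra.
  have e44 : e / 4 + e / 4 < e by lra.
  pose t := e / (8 * M); have t0 : 0 < t by rewrite divr_gt0// mulr_gt0.
  have s0 : 0 < t * (e / 8) by rewrite mulr_gt0// divr_gt0.
  have /cvg_seqP/(_ _ s0)[n Hn] := soft_trunc_energy_cvg0 Cv.
  have {}Hn := Hn n (leqnn _); rewrite subr0 in Hn.
  set f := fun x => soft_trunc n%:R (v x) in Hn.
  have n0 : 0 <= n%:R :> R by exact: ler0n.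
  have Cf : C f by exact: C0infty_soft_trunc.
  have Cg : C (v \- f) by exact: CB.
  set g := v \- f in Cg.
  have gE x : grad g x = (1 - soft_trunc' n%:R (v x)) *: grad v x.
    rewrite /g gradB ?grad_soft_trunc ?scalerBl ?scale1r//; [exact: CS|exact: CS|exact: CS].
  pose t2 := (8 * (a g g + 1)) / e.
  have ag0 := a_ge0 Cg.
  have t20 : 0 < t2 by rewrite divr_gt0// mulr_gt0// ltr_wpDl.
  pose S := K `&` [set x | v x != 0].
  have mv : measurable_fun setT v by apply: smooth_measurable; exact: CS.
  have mS : measurable S.
    apply: measurableI => //.
    have -> : [set x | v x != 0] = setT `&` v @^-1` (~` [set 0]).
      by rewrite setTI; apply/seteqP; split => x /= /eqP.
    by apply: mv => //; exact: measurableC.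
  have SK : S `<=` K by exact: subIsetl.
  have SE : S `<=` E by apply: subset_trans KE.
  have ge0 k : (0 <= \int[mu]_(x in K) (grad_dist (w_ k) F x)%:E)%E.
    by apply: integral_ge0 => x _; rewrite lee_fin grad_dist_ge0.
  have s20 : 0 < e / (8 * t2 * nu) by rewrite divr_gt0// mulr_gt0// mulr_gt0.
  have [N HN] := (cvge0P ge0).1 (HF K cK KE) _ s20.
  exists N => k Nk; rewrite subr0.
  have -> : sym_form (w_ k) v = sym_form (w_ k) f + sym_form (w_ k) g.
    by rewrite /g sym_formBr// addrC subrK.
  apply: (le_lt_trans (ler_normD _ _)).
  have h1 : `|sym_form (w_ k) f| <= e / 4.
    apply: (le_trans (sym_form_young (Cw k) Cf t0)).
    have q1 : t * a (w_ k) (w_ k) <= e / 8.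
      apply: (@le_trans _ _ (t * M)); first by rewrite ler_pM2l.
      by rewrite /t le_eqVlt; apply/orP; left; apply/eqP; field; rewrite gt_eqF.
    have q2 : t^-1 * a f f <= e / 8.
      rewrite mulrC ler_pdivrMr// [e / 8 * t]mulrC; apply: ltW.
      exact: le_lt_trans (ler_norm _) Hn.
    exact: le_trans (lerD q1 q2) e84.
  have h2 : `|sym_form (w_ k) g| <= e / 4.
    have Sg x : E x -> ~ S x -> grad g x = 0.
      move=> Ex nS; rewrite gE; have [v0|v0] := eqVneq (v x) 0.
        by rewrite v0 /soft_trunc' !mul0r mulr0 subr0 addr0 invr1 !mulr1 subrr scale0r.
      rewrite supp_grad ?scaler0// => sx; apply: nS; split => //.
    have iwg := preform_integrable (setting_domain H) (setting_matrix H) (Cw k) Cg.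
    have igw := preform_integrable (setting_domain H) (setting_matrix H) Cg (Cw k).
    have iww := preform_integrable (setting_domain H) (setting_matrix H) (Cw k) (Cw k).
    have igg := preform_integrable (setting_domain H) (setting_matrix H) Cg Cg.
    have SS i : mu.-integrable E i -> mu.-integrable S i by move=> ii; exact: integrableS ii.
    have -> : sym_form (w_ k) g = \int[mu]_(x in S)
        (bil x (grad (w_ k) x) (grad g x) + bil x (grad g x) (grad (w_ k) x)).
      rewrite /sym_form !form0E -(RintegralD mE iwg igw).
      apply: (Rintegral_restrict_eq mu SE) => x Ex nS.
      by rewrite Sg// bil0l bil0r addr0.
    have i0 := integrableD mS (SS _ iwg) (SS _ igw).
    have t2i : 0 < t2^-1 by rewrite invr_gt0.
    have i1 := integrableZl mS t2 (SS _ iww); have i2 := integrableZl mS t2^-1 (SS _ igg).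
    apply: (le_trans (le_normr_Rintegral _ i0)) => //.
    apply: (@le_trans _ _ (\int[mu]_(x in S) (t2 * bil x (grad (w_ k) x) (grad (w_ k) x)
        + t2^-1 * bil x (grad g x) (grad g x)))).
      apply: le_Rintegral => //.
      - exact: integrable_norm.
      - exact: (integrableD mS i1 i2).
      - by move=> x Sx; apply: bil_young => //; exact: SE.
    rewrite RintegralD; [|exact: mS|exact: i1|exact: i2].
    rewrite (RintegralZl t2 mS (SS _ iww)) (RintegralZl t2^-1 mS (SS _ igg)).
    have q2 : t2^-1 * \int[mu]_(x in S) bil x (grad g x) (grad g x) <= e / 8.
      rewrite mulrC ler_pdivrMr//; apply: (@le_trans _ _ (a g g)).
        rewrite form0E; apply: (Rintegral_subset_le mS mE SE igg) => x Ex.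
        exact: (bil_ge0 (setting_domain H) (setting_elliptic H) _ Ex).
      have -> : e / 8 * t2 = a g g + 1 by rewrite /t2; field; rewrite gt_eqF.
      by rewrite lerDl.
    have q1 : t2 * \int[mu]_(x in S) bil x (grad (w_ k) x) (grad (w_ k) x) <= e / 8.
      have igs : mu.-integrable S (EFin \o grad_sq (w_ k)).
        by apply: integrableS (grad_sq_integrable (Cw k) mK Kfin).
      have md := grad_dist_measurable H mK KE (CS (Cw k)) mF.
      have id : mu.-integrable K (EFin \o grad_dist (w_ k) F).
        apply: integral_fin_integrable => //.
        - by move=> x _; exact: grad_dist_ge0.
        - exact: (le_lt_trans (HN k Nk) (ltry _)).
      apply: (@le_trans _ _ (t2 * (nu * \int[mu]_(x in S) grad_sq (w_ k) x))).
        rewrite ler_pM2l// -(RintegralZl nu mS igs); apply: le_Rintegral; first exact: mS.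
        - exact: SS.
        - exact: (integrableZl mS nu igs).
        - by move=> x [Kx _]; have /andP[] := Hnu (grad (w_ k) x) x (KV _ Kx).
      have -> : \int[mu]_(x in S) grad_sq (w_ k) x = \int[mu]_(x in S) grad_dist (w_ k) F x.
        apply: ae_eq_Rintegral => //.
        - by apply/measurable_EFinP; exact: (measurable_int mu igs).
        - exact: measurable_funS md.
        - apply: filterS vF => x Hx [Kx v0]; rewrite /grad_dist.
          have /eqP := Hx Kx; rewrite scaler_eq0 (negbTE v0)/= => /eqP ->.
          by rewrite subr0.
      apply: (@le_trans _ _ (t2 * (nu * (e / (8 * t2 * nu))))).
        rewrite !ler_pM2l//.
        apply: (@le_trans _ _ (\int[mu]_(x in K) grad_dist (w_ k) F x)).
          by apply: Rintegral_subset_le => // x _; exact: grad_dist_ge0.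
        by rewrite -lee_fin -EFin_Rintegral//; exact: HN.
      by rewrite le_eqVlt; apply/orP; left; apply/eqP; field; rewrite !gt_eqF.
    exact: le_trans (lerD q1 q2) e84.
  exact: le_lt_trans (lerD h1 h2) e44.
(* Twice the energy of w_k is the symmetric pairing of w_k with w_k - w_m plus that with w_m.
   Young's inequality bounds the first by the energies of w_k and of w_k - w_m; the second tends to
   0 for fixed m. *)
apply/cvg_seqP => e e0; have e20 : 0 < e / 2 by rewrite divr_gt0.
have ar (p q r : R) : q < e / 2 -> `|r| < e / 2 -> `|2 * p - r| <= 1 * p + 1^-1 * q ->
      p < e.
  rewrite invr1 !mul1r => h1 h2 h3; have := ler_norm (2 * p - r); have := ler_norm r; lra.
have [m Hm] := cw _ e20; have /cvg_seqP/(_ _ e20)[N HN] := sym0 _ (Cw m).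
exists (maxn m N) => k; rewrite geq_max => /andP[mk Nk].
rewrite subr0 ger0_norm; last exact: a_ge0.
have h1 := Hm k m mk (leqnn _); have h2 := HN k Nk; rewrite subr0 in h2.
have h3 := sym_form_young (Cw k) (CB (Cw k) (Cw m)) ltr01.
have E2 : sym_form (w_ k) (w_ k) = 2 * a (w_ k) (w_ k) by rewrite /sym_form mulr_natl.
have E3 := sym_formBr (Cw k) (Cw m) (Cw k).
rewrite E3 E2 in h3.
exact: ar h1 h2 h3.
Qed.

End extended_form.

Section extended_form_limit.
Context (R : realType) (d : nat).
Local Notation X := 'rV[R]_d.
Variables (E : set X) (phi : X -> R) (mu : {measure set X -> \bar R}).
Variable A : X -> 'M[R]_d.
Hypothesis H : form_setting E phi mu A.
Implicit Types (f g h u v w : X -> R).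

Local Notation C := (C0infty E).
Local Notation a := (form0 E mu A).
Local Notation L2 := (Lfun mu 2%:E).
Local Notation D := (form_dom E mu A).
Local Notation form := (Defs.form E mu A).

Let p2 : (1 : R) <= 2. Proof. by rewrite ler1n. Qed.
Let CL2 f : C f -> f \in L2.
Proof. exact: (C0infty_L2 (setting_domain H) (setting_density H) (setting_measure H)). Qed.
Let CD f : C f -> D f. Proof. exact: (form_dom_C0infty H). Qed.
Let DB u v : D u -> D v -> D (u \- v). Proof. exact: (form_domB H). Qed.
Let fBl u v w : D u -> D v -> D w -> form (u \- v) w = form u w - form v w.
Proof. exact: (formBl H). Qed.
Let fBr u v w : D u -> D v -> D w -> form w (u \- v) = form w u - form w v.
Proof. exact: (formBr H). Qed.
Let f_ge0 u : D u -> 0 <= form u u. Proof. exact: (form_ge0 H). Qed.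

#[local] Opaque form0 Defs.form.

Lemma form_dom_smooth_approx w (e : R) : D w -> 0 < e ->
  exists f, [/\ C f, form (f \- w) (f \- w) < e & nrm mu 2 (fun x => f x - w x) < e].
Proof.
move=> [lw [w_ Aw]] e0; have [Cw _ _] := Aw.
have /cvg_seqP/(_ _ e0)[N1 HN1] := form_approx_energy H lw Aw.
have /cvg_seqP/(_ _ e0)[N2 HN2] := form_approx_L2 H lw Aw.
exists (w_ (maxn N1 N2)); split; first exact: Cw.
- have := HN1 _ (leq_maxl N1 N2); rewrite subr0; exact: le_lt_trans (ler_norm _).
- have := HN2 _ (leq_maxr N1 N2); rewrite subr0; exact: le_lt_trans (ler_norm _).
Qed.

(** Each [w_ n] is replaced by a smooth function within 8^-n in energy and in L^2. The rate makes
    the difference tend to 0 almost everywhere, as [smooth_form_cvg0] asks for. *)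
Lemma form_cvg0 (w_ : nat -> X -> R) : (forall n, D (w_ n)) -> form_cauchy form w_ ->
  {ae mu, forall x, w_ n x @[n --> \oo] --> (0 : R)} ->
  form (w_ n) (w_ n) @[n --> \oo] --> (0 : R).
Proof.
move=> Dw cw w0.
have e0 k : 0 < 8^-1 ^+ k :> R by rewrite exprn_gt0// invr_gt0.
have ecvg : (8^-1 ^+ k : R) @[k --> \oo] --> (0 : R).
  by apply: cvg_expr; rewrite gtr0_norm ?invr_gt0// invf_lt1// ltr1n.
have /boolp.choice[f Hf] : forall k, exists f, [/\ C f,
    form (f \- w_ k) (f \- w_ k) < 8^-1 ^+ k & nrm mu 2 (fun x => f x - w_ k x) < 8^-1 ^+ k].
  by move=> k; exact: form_dom_smooth_approx.
have Cf k : C (f k) by have [] := Hf k.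
have Df k : D (f k) by exact: CD.
have fw : form (f k \- w_ k) (f k \- w_ k) @[k --> \oo] --> (0 : R).
  apply: (cvg_dist_le _ ecvg) => k; have [_ /ltW h _] := Hf k.
  by rewrite subr0 ger0_norm//; exact: f_ge0 (DB (Df k) (Dw k)).
have cf : form_cauchy form f.
  exact: (form_cauchy_cvg DB fBl fBr f_ge0 Df Dw cw fw).
have cfa : form_cauchy a f.
  move=> e /cf[N HN]; exists N => m n mN nN; have := HN m n mN nN.
  by rewrite (form_C0infty H (C0inftyB (Cf m) (Cf n)) (C0inftyB (Cf m) (Cf n))).
have f0 : {ae mu, forall x, f n x @[n --> \oo] --> (0 : R)}.
  have ld k : (fun x => f k x - w_ k x) \in L2.
    by apply: (LfunB p2); [exact: CL2|exact: form_dom_L2].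
  have nd k : nrm mu 2 (fun x => f k x - w_ k x) <= 8^-1 ^+ k by have [_ _ /ltW] := Hf k.
  apply: filterS2 w0 (rapid_Lp p2 ld nd) => x Hx [M HM].
  have L : f n x - w_ n x @[n --> \oo] --> (0 : R).
    apply: (@cvg_dist_le _ _ (fun n => M * 2^-1 ^+ n)) => [n|]; first by rewrite subr0.
    rewrite -[X in _ --> X](mulr0 M); apply: cvgM; first exact: cvg_cst.
    by apply: cvg_expr; rewrite gtr0_norm ?invr_gt0// invf_lt1// ltr1n.
  rewrite -[X in _ --> X](addr0 (0 : R)).
  have -> : (fun n => f n x) = (fun n => (f n x - w_ n x) + w_ n x).
    by apply/funext => n; rewrite subrK.
  exact: cvgD.
have La := smooth_form_cvg0 H Cf cfa f0.
have L2' : 2 * form (f n \- w_ n) (f n \- w_ n) + 2 * a (f n) (f n) @[n --> \oo] --> (2 * 0 + 2 * 0 : R).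
  by apply: cvgD; apply: cvgM => //; exact: cvg_cst.
rewrite !mulr0 addr0 in L2'; apply: (cvg_dist_le _ L2') => n.
rewrite subr0 (ger0_norm (f_ge0 (Dw n))).
have := form_sq_le DB fBl fBr f_ge0 (Dw n) (Df n).
rewrite (form_C0infty H (Cf n) (Cf n)); move=> /le_trans; apply; rewrite lerD2r ler_pM2l//.
have -> : form (w_ n \- f n) (w_ n \- f n) = form (f n \- w_ n) (f n \- w_ n).
  have := form_sqB_eq DB fBl fBr (Dw n) (Df n).
  have := form_sqB_eq DB fBl fBr (Df n) (Dw n).
  by move=> -> ->; move: (form _ _) (form _ _) (form _ _) (form _ _) => *; ring.
by [].
Qed.

(** The value chosen by [xget] is reached along every approximating sequence: two of them differ by
    a form-Cauchy sequence tending to 0 almost everywhere, to which [form_cvg0] applies. *)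
Lemma extended_form_cvg (g_ : nat -> X -> R) g u : extended_approx E mu A g_ g -> D u ->
  form (g_ n) u @[n --> \oo] --> (extended_form E mu A g u : R).
Proof.
move=> Ag Du; have [K K0 young] := form_young H.
have [Dg cg g0] := Ag.
have cu : form_cauchy form (fun=> u).
  by move=> e e0; exists 0%N => m n _ _; rewrite (fBl Du Du (DB Du Du)) subrr.
have /cvg_ex[/= l L] := form_cvg DB fBl fBr f_ge0 K0 young Dg (fun=> Du) cg cu.
rewrite /extended_form; case: xgetP => [l' _ /= [g'_ Ag' L']|]; last first.
  by move=> /(_ l)/= []; exists g_.
have [Dg' cg' g'0] := Ag'.
have d0 : {ae mu, forall x, (g_ n \- g'_ n) x @[n --> \oo] --> (0 : R)}.
  apply: filterS2 g0 g'0 => x Hx Hx'; rewrite -[X in _ --> X](subrr (g x)).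
  exact: cvgB.
have Ld := form_cvg0 (fun n => DB (Dg n) (Dg' n)) (form_cauchyB DB fBl fBr f_ge0 Dg Dg' cg cg') d0.
have [M1 M10 HM1] := form_cauchy_bounded DB fBl fBr f_ge0 Dg' cg'.
have Lu : form (u \- u) (u \- u) @[n --> \oo] --> (0 : R).
  by rewrite (fBl Du Du (DB Du Du)) subrr; exact: cvg_cst.
have M2 : 0 < M1 + form u u by rewrite ltr_wpDr// f_ge0.
have := form_cvg_dist DB fBl fBr K0 young Dg Dg' (fun=> Du) (fun=> Du) M2 _ _ Ld Lu.
move=> /(_ (fun n => le_trans (HM1 n) _))/(_ (fun n => _)) D0.
have {}D0 : form (g_ n) u - form (g'_ n) u @[n --> \oo] --> (0 : R).
  by apply: D0; rewrite ?lerDl ?lerDr ?(f_ge0 Du)// (ltW M10).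
rewrite -[l']add0r; have -> : (fun n => form (g_ n) u) =
    (fun n => (form (g_ n) u - form (g'_ n) u) + form (g'_ n) u).
  by apply/funext => n; rewrite subrK.
exact: cvgD.
Qed.

End extended_form_limit.

(** * Transience *)

Section monotone_sequences.
Context (R : realType).
Implicit Types (s : nat -> R).

(** The index 0 is set aside throughout: the results on time integrals concern positive lengths. *)
Lemma nondecreasing_succ s : (forall n, s n.+1 <= s n.+2) ->
  {homo (fun n => s n.+1) : m n / (m <= n)%N >-> m <= n}.
Proof. by move=> H; apply/nondecreasing_seqP. Qed.

Lemma cvg_lim_succ s : (forall n, s n.+1 <= s n.+2) ->
  (s N)%:E @[N --> \oo] --> ereal_sup (range (fun n => (s n.+1)%:E)).
Proof.
move=> H; rewrite -(cvg_shiftS (fun N => (s N)%:E)); apply: ereal_nondecreasing_cvgn.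
by move=> m n mn; rewrite lee_fin; exact: (nondecreasing_succ H).
Qed.

Lemma lim_succ_lty_bounded s : (forall n, s n.+1 <= s n.+2) ->
  (limn (fun N => (s N)%:E) < +oo)%E -> cvgn (fun n => s n.+1).
Proof.
move=> H; have C := cvg_lim_succ H; rewrite (cvg_lim _ C)// => fin.
have lb : ((s 1%N)%:E <= ereal_sup (range (fun n => (s n.+1)%:E)))%E.
  by apply: ereal_sup_ubound; exists 0%N.
have fn : ereal_sup (range (fun n => (s n.+1)%:E)) \is a fin_num.
  by rewrite fin_numElt fin (lt_le_trans _ lb)// ltNyr.
apply: nondecreasing_is_cvgn; first exact: nondecreasing_succ.
exists (fine (ereal_sup (range (fun n => (s n.+1)%:E)))) => _ [n _ <-].
by rewrite -lee_fin fineK//; apply: ereal_sup_ubound; exists n.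
Qed.

Lemma bounded_lim_succ_lty s (M : R) : (forall n, s n.+1 <= s n.+2) ->
  (forall n, s n.+1 <= M) -> (limn (fun N => (s N)%:E) < +oo)%E.
Proof.
move=> H sM; rewrite (cvg_lim _ (cvg_lim_succ H))//.
apply: (@le_lt_trans _ _ M%:E); last exact: ltry.
by apply: ge_ereal_sup => _ [n _ <-]; rewrite lee_fin.
Qed.

End monotone_sequences.

Section potentials.
Context (R : realType) (d : nat).
Local Notation X := 'rV[R]_d.
Variable mu : {measure set X -> \bar R}.
Variable T : R -> (X -> R) -> (X -> R).
Hypothesis HT : sub_markovian_C0_semigroup mu 1 T.
Implicit Types (f g h : X -> R).

Local Notation I := (Lp_time_integral mu 1 T).
Let p11 : (1 : R) <= 1 := lexx _.

Lemma time_integral_succ g : g \in Lfun mu 1 -> {ae mu, forall x, 0 <= g x} ->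
  {ae mu, forall x, forall n, 0 <= I n.+1%:R g x /\ I n.+1%:R g x <= I n.+2%:R g x}.
Proof.
move=> lg g0; apply: ae_foralln => n.
have h1 := time_integral_ge0 HT (ltr0Sn R n) lg g0.
have h2 : {ae mu, forall x, I n.+1%:R g x <= I n.+2%:R g x}.
  by apply: time_integral_mono => //; rewrite ler_nat.
by apply: filterS2 h1 h2.
Qed.

(** Time integrals increase with their length and stay bounded where the potential is finite, so
    their limit along the integers dominates them all. A real measurable majorant can be divided by
    and truncated at. *)
Lemma potential_majorant g : g \in Lfun mu 1 -> {ae mu, forall x, 0 <= g x} ->
  {ae mu, forall x, (potential mu T g x < +oo)%E} ->
  exists2 G : X -> R, measurable_fun setT G &
    forall t, 0 < t -> {ae mu, forall x, I t g x <= G x}.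
Proof.
move=> lg g0 fin.
have lI n : I n.+1%:R g \in Lfun mu 1 by exact: (time_integral_Lp p11 HT).
have [G mG HG] := ae_measurable_lim measurableT (fun n => Lfun_meas (lI n)).
exists G => // t t0.
pose n := Num.truncn t.
have tn : t <= n.+1%:R by apply: ltW; exact: truncnS_gt.
have Im := time_integral_mono HT t0 tn lg g0.
apply: filterS3 fin (time_integral_succ lg g0) Im => x Hx Sx Ix.
apply: (le_trans Ix).
have mono k : I k.+1%:R g x <= I k.+2%:R g x by have [] := Sx k.
have C := lim_succ_lty_bounded (s := fun N => I N%:R g x) mono Hx.
have L := HG x C; rewrite -(cvg_lim _ L)//.
apply: (nondecreasing_cvgn_le _ C).
exact: (nondecreasing_succ (s := fun N => I N%:R g x)).
Qed.

(** By Fatou's lemma the limit of g I_n g is integrable, hence finite almost everywhere; dividing by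
    g > 0 bounds the increasing time integrals. *)
Lemma potential_lty g (c : R) : g \in Lfun mu 1 -> {ae mu, forall x, 0 < g x} ->
  (forall n, (\int[mu]_x `|g x * I n.+1%:R g x|%:E <= c%:E)%E) ->
  {ae mu, forall x, (potential mu T g x < +oo)%E}.
Proof.
move=> lg g0 Hc.
have g0' : {ae mu, forall x, 0 <= g x} by apply: filterS g0 => x /ltW.
have lI n : I n.+1%:R g \in Lfun mu 1 by exact: (time_integral_Lp p11 HT).
pose f n x := `|g x * I n.+1%:R g x|%:E.
have mf n : measurable_fun setT (f n).
  apply/measurable_EFinP; apply: measurableT_comp => //.
  by apply: measurable_funM; apply: Lfun_meas; [exact: lg|exact: lI].
have f0 n x : (0 <= f n x)%E by rewrite lee_fin.
have L0 x : (0 <= limn_einf (f ^~ x))%E.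
  rewrite limn_einf_lim; apply: lime_ge; first exact: is_cvg_einfs.
  by apply: nearW => n; apply: le_ereal_inf_tmp => _ [k _ <-]; exact: f0.
have mL : measurable_fun setT (fun x => limn_einf (f ^~ x)).
  rewrite (_ : (fun x => _) = (fun x => - limn_esup (fun n => - f n x))%E)//.
  apply: measurableT_comp => //; apply: measurable_fun_limn_esup => n.
  exact: measurableT_comp.
have iL : mu.-integrable setT (fun x => limn_einf (f ^~ x)).
  apply/integrableP; split => //.
  apply: (@le_lt_trans _ _ c%:E); last exact: ltry.
  under eq_integral do rewrite gee0_abs//.
  apply: (le_trans (fatou _ measurableT mf _)) => //.
  rewrite limn_einf_lim; apply: lime_le; first exact: is_cvg_einfs.
  apply: nearW => n; apply: (@le_trans _ _ (\int[mu]_x f n x)%E); last exact: Hc.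
  by apply: ereal_inf_lbound; exists n => /=.
have := integrable_ae measurableT iL.
apply: filterS3 (time_integral_succ lg g0') g0 => x Sx gx /(_ Logic.I).
rewrite ge0_fin_numE// => Lx.
have mono k : I k.+1%:R g x <= I k.+2%:R g x by have [] := Sx k.
have fE n : f n x = (g x * I n.+1%:R g x)%:E.
  by rewrite /f ger0_norm// mulr_ge0 ?(ltW gx)//; have [] := Sx n.
have ndf : {homo (f ^~ x) : m n / (m <= n)%N >-> (m <= n)%E}.
  move=> m n mn; rewrite !fE lee_fin ler_pM2l//.
  exact: (nondecreasing_succ (s := fun N => I N%:R g x)).
have Cf := ereal_nondecreasing_cvgn ndf.
rewrite (cvg_limn_einf_sup Cf).1 in Lx.
have ub n : (f n x <= ereal_sup (range (f ^~ x)))%E by apply: ereal_sup_ubound; exists n.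
have fn : ereal_sup (range (f ^~ x)) \is a fin_num.
  by rewrite fin_numElt Lx andbT (lt_le_trans _ (ub 0%N))// fE ltNyr.
apply: (bounded_lim_succ_lty (s := fun N => I N%:R g x)
  (M := fine (ereal_sup (range (f ^~ x))) / g x) mono) => n.
rewrite -(ler_pM2l gx).
rewrite mulrCA divff ?gt_eqF// mulr1 -lee_fin fineK// -fE; exact: ub.
Qed.

End potentials.

Lemma domain_Rintegral (R : realType) (d : nat) (E : set 'rV[R]_d) (phi : 'rV[R]_d -> R)
    (mu : {measure set 'rV[R]_d -> \bar R}) (A : 'rV[R]_d -> 'M[R]_d) (f : 'rV[R]_d -> R) :
  form_setting E phi mu A -> measurable_fun setT f ->
  \int[mu]_(x in E) f x = \int[mu]_x f x.
Proof.
move=> H mf; symmetry; apply: Rintegral_restrict_ae => //.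
  exact: measurable_domain (setting_domain H).
by apply: filterS (ae_domain (setting_domain H) (setting_measure H)) => x Ex _ /(_ Ex).
Qed.

Lemma cvg_expRN_nat (R : realType) : expR (- n.+1%:R) @[n --> \oo] --> (0 : R).
Proof.
have h : (n.+1%:R^-1 : R) @[n --> \oo] --> (0 : R) by exact: cvg_harmonic.
apply: (cvg_dist_le _ h) => n; rewrite subr0 ger0_norm ?expR_ge0// expRN.
rewrite lef_pV2 ?posrE ?expR_gt0//.
by apply: le_trans (expR_ge1Dx _); rewrite lerDr.
Qed.

Section energy_bound.
Context (R : realType) (d : nat).
Local Notation X := 'rV[R]_d.
Variables (E : set X) (phi : X -> R) (mu : {measure set X -> \bar R}).
Variable A : X -> 'M[R]_d.
Hypothesis H : form_setting E phi mu A.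
Implicit Types (f g h u v w : X -> R).

Local Notation L1 := (Lfun mu 1).
Local Notation L2 := (Lfun mu 2%:E).
Local Notation D := (form_dom E mu A).
Local Notation form := (Defs.form E mu A).

Let p2 : (1 : R) <= 2. Proof. by rewrite ler1n. Qed.
Let p11 : (1 : R) <= 1 := lexx _.

#[local] Opaque form0 Defs.form.

Lemma L2_pair_integrable f g : f \in L2 -> g \in L2 ->
  mu.-integrable setT (EFin \o (fun x => f x * g x)).
Proof. by move=> lf lg; apply/Lfun1_integrable; exact: (Lfun2_mul_Lfun1 lf lg). Qed.

Lemma cvg_L2_pair0 h (u_ : nat -> X -> R) : h \in L2 -> (forall n, u_ n \in L2) ->
  nrm mu 2 (u_ n) @[n --> \oo] --> (0 : R) ->
  \int[mu]_x (h x * u_ n x) @[n --> \oo] --> (0 : R).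
Proof.
move=> lh lu L.
have := cvg_L2_pair measurableT (Lfun_meas lh) (Lfun2_integrable_sqr lh) lu (Lfun0 mu p2).
under eq_fun do under eq_fun do rewrite subr0.
move=> /(_ L); suff -> : \int[mu]_x (h x * 0) = 0 by [].
under eq_Rintegral do rewrite mulr0.
by rewrite Rintegral_cst// mul0r.
Qed.

Variables (T0 Tb0 : R -> (X -> R) -> (X -> R)).
Hypothesis HT0 : sub_markovian_C0_semigroup mu 2%:E T0.
Hypothesis genT0 : forall u w, semigroup_generator mu 2%:E T0 u w <-> generator0 E mu A u w.
Hypothesis HTb0 : sub_markovian_C0_semigroup mu 1 Tb0.
Hypothesis cons : L1_L2_consistent mu Tb0 T0.
Variables (g g' G : X -> R).
Hypothesis lg : g \in L1.
Hypothesis HG : forall t, 0 < t -> {ae mu, forall x, Lp_time_integral mu 1 Tb0 t g x <= G x}.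
Hypothesis lg' : g' \in L1.
Hypothesis lg'2 : g' \in L2.
Hypothesis g'01 : {ae mu, forall x, 0 <= g' x <= 1}.
Hypothesis g'g : {ae mu, forall x, g' x <= g x}.
Hypothesis g'G : {ae mu, forall x, g' x * `|G x| <= `|g x|}.

Let c0 := \int[mu]_x `|g x|.

(* The resolvents [u] of [T0] at levels tending to 0 stay below the finite function [G], so that
   their energies are bounded, while [form u w] tends to the integral of [g' * w]. *)
Lemma transient_energy_bound : exists2 K : R, 0 < K & forall w (t : R), D w -> 0 < t ->
  `|\int[mu]_x (g' x * w x)| <= K * (t * c0 + t^-1 * form w w).
Proof.
have [K K0 young] := form_young H; exists K => // w t Dw t0.
have lw : w \in L2 by case: Dw.
pose al n : R := n.+1%:R^-1.
pose N n : R := n.+1%:R ^+ 2.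
have al0 n : 0 < al n by rewrite invr_gt0.
have N0 n : 0 < N n by rewrite exprn_gt0.
have alN n : al n * N n = n.+1%:R by rewrite /al /N expr2 mulrA mulVf ?mul1r// pnatr_eq0.
pose S n := damped (al n) T0.
have HS n : sub_markovian_C0_semigroup mu 2%:E (S n).
  by apply: damped_semigroup => //; exact: ltW.
pose u n := Lp_time_integral mu 2 (S n) (N n) g'.
have lu n : u n \in L2 by exact: (time_integral_Lp p2 (HS n)).
have lS n : S n (N n) g' \in L2 by exact: (semigroup_Lp (HS n)).
have S01 n s : 0 < s -> {ae mu, forall x, 0 <= S n s g' x <= 1}.
  by move=> s0; exact: (semigroup_sub_markovian (HS n)).
have u0 n : {ae mu, forall x, 0 <= u n x}.
  have := time_integral_bounds p2 (HS n) (N0 n) lg'2 (S01 n).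
  by apply: filterS => x; rewrite mulr0 => /andP[].
have uG n : {ae mu, forall x, u n x <= G x}.
  (* The L^2 semigroup and its L^1 counterpart agree on [g'], which lies in both spaces; damping
     only decreases a nonnegative function. *)
  have h : {ae mu, forall x, u n x <= Lp_time_integral mu 1 Tb0 (N n) g x}.
    apply: (time_integral_le p2 p11 (HS n) HTb0 (N0 n) lg'2 lg) => s s0.
    have Tg0 : {ae mu, forall x, 0 <= T0 s g' x <= 1} by exact: (semigroup_sub_markovian HT0).
    have Tle := semigroup_le HTb0 s0 lg' lg g'g.
    have Tc := cons s0 lg' lg'2.
    apply: filterS3 Tg0 Tle Tc => x /andP[h0 _] hle hc.
    apply: le_trans hle; rewrite -hc /S /damped ler_piMl// -expR0 ler_expR oppr_le0.
    by rewrite mulr_ge0// ltW.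
  by apply: filterS2 h (HG (N0 n)) => x; exact: le_trans.
have gen n : generator0 E mu A (u n) (fun x => S n (N n) g' x - g' x + al n * u n x).
  apply/genT0; apply: damped_generator => //; first exact: ltW.
  exact: (time_integral_generator p2 (HS n) (N0 n) lg'2).
have Du n : D (u n) by case: (gen n).
have formE n v : D v -> form (u n) v = \int[mu]_x (g' x * v x) -
    \int[mu]_x (v x * S n (N n) g' x) - \int[mu]_x (v x * (al n * u n x)).
  move=> Dv; have lv : v \in L2 by case: Dv.
  have [_ _ _ ->//] := gen n.
  have lau : (fun x => al n * u n x) \in L2 by exact: LfunZ.
  have i1 := L2_pair_integrable lg'2 lv.
  have i2 := L2_pair_integrable lv (lS n).
  have i3 := L2_pair_integrable lv lau.
  have i12 : mu.-integrable setT (EFin \o (fun x => g' x * v x - v x * S n (N n) g' x)).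
    exact: (integrableB measurableT i1 i2).
  rewrite (domain_Rintegral H); last first.
    apply: measurable_funM; last exact: Lfun_meas lv.
    apply: measurable_funD; last exact: Lfun_meas lau.
    by apply: measurable_funB; [exact: Lfun_meas (lS n)|exact: Lfun_meas lg'2].
  rewrite -(RintegralB measurableT i1 i2) -(RintegralB measurableT i12 i3).
  have i123 : mu.-integrable setT
      (EFin \o (fun x => g' x * v x - v x * S n (N n) g' x - v x * (al n * u n x))).
    exact: (integrableB measurableT i12 i3).
  apply/eqP; rewrite eqr_oppLR; apply/eqP.
  transitivity (-1 * \int[mu]_x (g' x * v x - v x * S n (N n) g' x - v x * (al n * u n x))).
    by rewrite -(RintegralZl (-1) measurableT i123); apply: eq_Rintegral => x _; ring.
  by rewrite mulN1r.
have ig : mu.-integrable setT (EFin \o (fun x => `|g x|)).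
  by apply: integrable_norm; apply/Lfun1_integrable.
(* The equation of [u n] is tested with [u n] itself: the remainder at time [N n] is nonnegative and
   drops, and g' u_n <= g' |G| <= |g|. *)
have energy n : form (u n) (u n) + al n * nrm mu 2 (u n) ^+ 2 <= c0.
  have h1 : 0 <= \int[mu]_x (u n x * S n (N n) g' x).
    apply: (@le_trans _ _ (\int[mu]_x (cst 0 x))); first by rewrite Rintegral_cst// mul0r.
    apply: (ae_le_Rintegral measurableT) => //.
    - exact: integrable0.
    - exact: L2_pair_integrable.
    - apply: filterS2 (u0 n) (S01 n _ (N0 n)) => x h /andP[h' _] _.
      by rewrite mulr_ge0.
  have h2 : \int[mu]_x (g' x * u n x) <= c0.
    apply: (ae_le_Rintegral measurableT) => //; first exact: L2_pair_integrable.
    apply: filterS3 (uG n) g'01 g'G => x h /andP[h0 _] h' _; apply: le_trans h'.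
    by rewrite ler_wpM2l// (le_trans h)// ler_norm.
  have h3 : \int[mu]_x (u n x * (al n * u n x)) = al n * nrm mu 2 (u n) ^+ 2.
    rewrite nrm2_sqr// -RintegralZl//; last exact: Lfun2_integrable_sqr.
    by apply: eq_Rintegral => x _; rewrite expr2; ring.
  rewrite formE// h3 subrK.
  by apply: le_trans h2; rewrite gerBl.
have energy1 n : form (u n) (u n) <= c0.
  by apply: le_trans (energy n); rewrite lerDl mulr_ge0 ?sqr_ge0// ltW.
have energy2 n : al n * nrm mu 2 (u n) ^+ 2 <= c0.
  by apply: le_trans (energy n); rewrite lerDr (form_ge0 H (Du n)).
have SN : nrm mu 2 (S n (N n) g') @[n --> \oo] --> (0 : R).
  have L : expR (- n.+1%:R) * nrm mu 2 g' @[n --> \oo] --> (0 * nrm mu 2 g' : R).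
    by apply: cvgM; [exact: cvg_expRN_nat|exact: cvg_cst].
  rewrite mul0r in L; apply: (cvg_dist_le _ L) => n.
  rewrite subr0 ger0_norm ?nrm_ge0// /S /damped alN.
  have lT : T0 (N n) g' \in L2 by exact: (semigroup_Lp HT0).
  rewrite (nrmZ p2 _ lT) ger0_norm ?expR_ge0// ler_wpM2l ?expR_ge0//.
  exact: (semigroup_nrm HT0).
(* The energy balance gives al_n |u_n|^2 <= c0 for the L^2 norm, so al_n |u_n| <= sqrt(al_n c0),
   although |u_n| itself may grow. *)
have aU : nrm mu 2 (fun x => al n * u n x) @[n --> \oo] --> (0 : R).
  have L : Num.sqrt (al n * c0) @[n --> \oo] --> (Num.sqrt (0 * c0) : R).
    apply: (@continuous_cvg _ R R _ _ (fun n => al n * c0) Num.sqrt (0 * c0)).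
      exact: sqrt_continuous.
    by apply: cvgM; [exact: cvg_harmonic|exact: cvg_cst].
  rewrite mul0r sqrtr0 in L; apply: (cvg_dist_le _ L) => n.
  rewrite subr0 ger0_norm ?nrm_ge0// (nrmZ p2 _ (lu n)) gtr0_norm//.
  rewrite -(ger0_norm (mulr_ge0 (ltW (al0 n)) (nrm_ge0 mu 2 (u n)))) -sqrtr_sqr.
  apply: ler_wsqrtr; rewrite exprMn expr2 -mulrA ler_pM2l//.
have L := cvgD (cvg_norm (cvg_L2_pair0 lw lS SN)) (cvg_norm (cvg_L2_pair0 lw
  (fun n => LfunZ p2 (al n) (lu n)) aU)).
rewrite !normr0 addr0 in L.
rewrite -[leRHS]addr0.
apply: (cvg_ge_cst (u := fun n => K * (t * c0 + t^-1 * form w w) +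
   (`|\int[mu]_x (w x * S n (N n) g' x)| + `|\int[mu]_x (w x * (al n * u n x))|))).
  by apply: cvgD; [exact: cvg_cst|exact: L].
move=> n.
have Y := young (u n) w t (Du n) Dw t0.
have E1 : \int[mu]_x (g' x * w x) = form (u n) w + (\int[mu]_x (w x * S n (N n) g' x) +
    \int[mu]_x (w x * (al n * u n x))).
  rewrite formE//.
  move: (\int[mu]_x (g' x * w x)) (\int[mu]_x (w x * S n (N n) g' x)) (\int[mu]_x (w x * (al n * u n x))) => p q r.
  by ring.
rewrite E1; apply: (le_trans (ler_normD _ _)); apply: lerD; last exact: ler_normD.
apply: (le_trans Y); rewrite ler_pM2l// lerD2r ler_pM2l//; exact: energy1.
Qed.

End energy_bound.

Section transience.
Context (R : realType) (d : nat).
Local Notation X := 'rV[R]_d.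
Variables (E : set X) (phi : X -> R) (mu : {measure set X -> \bar R}).
Variables (A : X -> 'M[R]_d) (B : X -> X) (Tb : R -> (X -> R) -> (X -> R)).
Hypothesis H : form_setting E phi mu A.
Hypothesis HTb : sub_markovian_C0_semigroup mu 1 Tb.
Hypothesis gen_prop : L1_generator_properties E mu A B Tb.
Implicit Types (f g h u v w : X -> R).

Local Notation L1 := (Lfun mu 1).
Local Notation L2 := (Lfun mu 2%:E).
Local Notation D := (form_dom E mu A).
Local Notation form := (Defs.form E mu A).

Let p2 : (1 : R) <= 2. Proof. by rewrite ler1n. Qed.
Let p11 : (1 : R) <= 1 := lexx _.

#[local] Opaque form0 Defs.form.

Lemma Lfun1_bounded_Lfun2 f (M : R) : f \in L1 -> {ae mu, forall x, `|f x| <= M} -> f \in L2.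
Proof.
move=> lf fM; have mf := Lfun_meas lf.
have ia : mu.-integrable setT (EFin \o (fun x => `|f x|)).
  by apply: integrable_norm; apply/Lfun1_integrable.
apply: Lfun2I => //; apply: (integrable_ae_le measurableT _ (integrableZl measurableT M ia)).
  exact: measurable_funX.
apply: filterS fM => x Hx _; rewrite normrX expr2 ler_wpM2r//.
Qed.

Lemma bounded_mul_integrable f g (M : R) : f \in L1 -> measurable_fun setT g ->
  {ae mu, forall x, `|g x| <= M} -> mu.-integrable setT (EFin \o (fun x => f x * g x)).
Proof.
move=> lf mg gM; have mf := Lfun_meas lf.
have ia : mu.-integrable setT (EFin \o (fun x => `|f x|)).
  by apply: integrable_norm; apply/Lfun1_integrable.
apply: (integrable_ae_le measurableT _ (integrableZl measurableT M ia)).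
  exact: measurable_funM.
by apply: filterS gM => x Hx _; rewrite normrM mulrC ler_wpM2r.
Qed.

(** Here -L u = g - s - c u, and in the energy inequality the terms coming from s u and c u^2 have a
    favourable sign. *)
Lemma generator_energy u s g (c M : R) : semigroup_generator mu 1 Tb u
    (fun x => s x - g x + c * u x) -> s \in L1 -> g \in L1 -> 0 <= c ->
  {ae mu, forall x, 0 <= s x} -> {ae mu, forall x, 0 <= u x <= M} ->
  D u /\ form u u <= \int[mu]_x (g x * u x).
Proof.
move=> gen ls lg c0 s0 uM.
have u0 : {ae mu, forall x, `|u x| <= M}.
  by apply: filterS uM => x /andP[h0 h1]; rewrite ger0_norm.
have bu : ae_bounded mu u by exists M.
have lu : u \in L1 by case: gen.
have mu1 := Lfun_meas lu.
split; first exact: (L1_generator_dom gen_prop gen bu).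
apply: (le_trans (L1_generator_energy gen_prop gen bu)).
have i1 := bounded_mul_integrable ls mu1 u0.
have i2 := bounded_mul_integrable lg mu1 u0.
have i3 := integrableZl measurableT c (bounded_mul_integrable lu mu1 u0).
have i13 : mu.-integrable setT (EFin \o (fun x => s x * u x + c * (u x * u x))).
  exact: (integrableD measurableT i1 i3).
rewrite (domain_Rintegral H); last first.
  apply: measurable_funM => //; apply: measurable_funD; last exact: measurable_funM.
  by apply: measurable_funB; [exact: Lfun_meas ls|exact: Lfun_meas lg].
have -> : \int[mu]_x ((s x - g x + c * u x) * u x) =
    \int[mu]_x (s x * u x + c * (u x * u x) - g x * u x).
  by apply: eq_Rintegral => x _; ring.
rewrite (RintegralB measurableT i13 i2) opprB gerBl.
apply: (@le_trans _ _ (\int[mu]_x (cst 0 x))); first by rewrite Rintegral_cst// mul0r.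
apply: (ae_le_Rintegral measurableT) => //; first exact: integrable0.
by apply: filterS2 s0 uM => x h1 /andP[h2 _] _; rewrite addr_ge0 ?mulr_ge0.
Qed.

(** Since g <= 1, the time integral is at most t; this boundedness is what admits it to the energy
    inequality. *)
Lemma resolvent_energy (t : R) g : 0 < t -> g \in L1 -> {ae mu, forall x, 0 <= g x <= 1} ->
  let h := Lp_time_integral mu 1 Tb t g in
  [/\ D h, {ae mu, forall x, 0 <= h x} & form h h <= \int[mu]_x (g x * h x)].
Proof.
move=> t0 lg g01 h.
have S01 s : 0 < s -> {ae mu, forall x, 0 <= Tb s g x <= 1}.
  by move=> s0; exact: (semigroup_sub_markovian HTb).
have hb := time_integral_bounds p11 HTb t0 lg S01; rewrite mulr0 mulr1 in hb.
have h0 : {ae mu, forall x, 0 <= h x} by apply: filterS hb => x /andP[].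
have lT : Tb t g \in L1 by exact: (semigroup_Lp HTb).
have Tg0 : {ae mu, forall x, 0 <= Tb t g x} by apply: filterS (S01 t t0) => x /andP[].
have gen : semigroup_generator mu 1 Tb h (fun x => Tb t g x - g x + 0 * h x).
  rewrite (_ : (fun x => _) = (fun x => Tb t g x - g x)); last first.
    by apply/funext => x; rewrite mul0r addr0.
  exact: (time_integral_generator p11 HTb t0 lg).
by have [] := generator_energy gen lT lg (lexx 0) Tg0 hb.
Qed.

Lemma form_transient_L1 : form_transient E mu A -> transient_L1 mu Tb.
Proof.
move=> [T0 [HT0 genT0 [Tb0 [HTb0 cons [g [lg g0 fin]]]]]].
have g0' : {ae mu, forall x, 0 <= g x} by apply: filterS g0 => x /ltW.
have [G mG HG] := potential_majorant HTb0 lg g0' fin.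
have mg := Lfun_meas lg.
pose g' x := Num.min `|g x| 1 / (1 + `|G x|).
have den x : 1 <= 1 + `|G x| by rewrite lerDl.
have den0 x : 0 < 1 + `|G x| by exact: lt_le_trans (den x).
have m0 x : 0 <= Num.min `|g x| 1 by rewrite le_min normr_ge0 ler01.
have g'm x : g' x <= Num.min `|g x| 1.
  by rewrite /g' ler_pdivrMr// ler_peMr.
have g'0 x : 0 <= g' x by rewrite /g' divr_ge0// ltW.
have mg' : measurable_fun setT g'.
  apply: measurable_funM.
    by apply: measurable_minr; [exact: measurableT_comp|exact: measurable_cst].
  apply: (measurableT_comp (f := fun y : R => (1 + `|y|)^-1)) => //.
  apply: continuous_measurable_fun => y; apply: cvgV.
    by rewrite gt_eqF// ltr_wpDr.
  by apply: cvgD; [exact: cvg_cst|exact: norm_continuous].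
have lg' : g' \in L1.
  apply: (Lfun1_le mg' lg); apply: nearW => x; rewrite ger0_norm//.
  by apply: (le_trans (g'm x)); rewrite ge_min lexx.
have g'01 : {ae mu, forall x, 0 <= g' x <= 1}.
  by apply: nearW => x; rewrite g'0/= (le_trans (g'm x))// ge_min lexx orbT.
have lg'2 : g' \in L2.
  apply: (Lfun1_bounded_Lfun2 (M := 1) lg').
  by apply: filterS g'01 => x /andP[h0 h1]; rewrite ger0_norm.
have g'g : {ae mu, forall x, g' x <= g x}.
  apply: filterS g0' => x gx; apply: (le_trans (g'm x)).
  by rewrite (ger0_norm gx) ge_min lexx.
have g'G : {ae mu, forall x, g' x * `|G x| <= `|g x|}.
  apply: nearW => x; rewrite /g' mulrAC ler_pdivrMr//.
  by apply: ler_pM => //; [rewrite ge_min lexx|rewrite lerDr].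
have [K K0 HK] := transient_energy_bound H HT0 genT0 HTb0 cons lg HG lg' lg'2 g'01 g'g g'G.
set c0 := \int[mu]_x `|g x| in HK.
have c00 : 0 <= c0 by apply: Rintegral_ge0.
exists g'; split => //.
  apply: filterS g0 => x gx; rewrite /g' divr_gt0// lt_min ltr01 andbT normr_gt0 gt_eqF//.
(* The weight t = 2 K leaves half of the energy on the right-hand side, where f <= y absorbs it. *)
have ar (y f : R) : f <= y -> y <= K * (2 * K * c0 + (2 * K)^-1 * f) -> y <= 4 * K ^+ 2 * c0.
  move=> fy; rewrite mulrDr => h.
  have e1 : K * ((2 * K)^-1 * f) = f / 2 by field; rewrite gt_eqF.
  have e2 : K * (2 * K * c0) = 2 * K ^+ 2 * c0 by ring.
  by move: h; rewrite e1 e2; lra.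
have g'pos : {ae mu, forall x, 0 < g' x}.
  apply: filterS g0 => x gx; rewrite /g' divr_gt0// lt_min ltr01 andbT normr_gt0 gt_eqF//.
apply: (potential_lty HTb (c := 4 * K ^+ 2 * c0) lg' g'pos) => n.
have [Dh h0 Eh] := resolvent_energy (ltr0Sn R n) lg' g'01.
set h := Lp_time_integral mu 1 Tb n.+1%:R g' in Dh h0 Eh *.
have lh : h \in L2 by case: Dh.
have igh := L2_pair_integrable lg'2 lh.
rewrite EFin_Rintegral//; last exact: integrable_norm.
rewrite lee_fin.
have -> : \int[mu]_x `|g' x * h x| = \int[mu]_x (g' x * h x).
  apply: ae_eq_Rintegral => //.
  - by apply: measurableT_comp => //; apply: measurable_funM => //; exact: Lfun_meas lh.
  - by apply: measurable_funM => //; exact: Lfun_meas lh.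
  - by apply: filterS h0 => x hx _; rewrite ger0_norm// mulr_ge0.
apply: (ar _ _ Eh); apply: (le_trans (ler_norm _)); apply: HK => //.
by rewrite mulr_gt0.
Qed.

End transience.

(** * Failure of transience *)

Lemma nondecreasing_bounded_cauchy (R : realType) (u : nat -> R) (M e : R) :
  (forall n, u n <= u n.+1) -> (forall n, u n <= M) -> 0 < e ->
  exists N : nat, forall m n, (N <= n)%N -> (n <= m)%N -> u m - u n < e.
Proof.
move=> H uM e0.
have nd : {homo u : m n / (m <= n)%N >-> m <= n} by apply/nondecreasing_seqP.
have C : cvgn u.
  by apply: nondecreasing_is_cvgn => //; exists M => _ [n _ <-].
have /cvg_seqP/(_ _ e0)[N HN] := C.
exists N => m n Nn nm; have ln : u m <= limn u by exact: nondecreasing_cvgn_le.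
have := HN n Nn; rewrite distrC => /(le_lt_trans (ler_norm _)).
by apply: le_lt_trans; rewrite lerD2r.
Qed.

Section minimizing_sequence.
Context (R : realType) (d : nat).
Local Notation X := 'rV[R]_d.
Variables (E : set X) (phi : X -> R) (mu : {measure set X -> \bar R}).
Variable A : X -> 'M[R]_d.
Hypothesis H : form_setting E phi mu A.
Implicit Types (f g h u v w : X -> R).

Local Notation D := (form_dom E mu A).
Local Notation form := (Defs.form E mu A).

Let DB u v : D u -> D v -> D (u \- v). Proof. exact: (form_domB H). Qed.

#[local] Opaque form0 Defs.form.

(** Written in the shape c f + g to which the bilinearity lemmas apply. *)
Definition midpoint v w : X -> R := fun x => 2^-1 * (w \- v) x + v x.

Lemma form_dom_midpoint v w : D v -> D w -> D (midpoint v w).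
Proof. by move=> Dv Dw; apply: (form_dom_lin H) => //; exact: DB. Qed.

(** No symmetry is involved: along the line from v to w the energy is a quadratic polynomial, in
    which the mixed terms enter only through their sum. *)
Lemma form_parallelogram v w : D v -> D w ->
  form (w \- v) (w \- v) =
  2 * form v v + 2 * form w w - 4 * form (midpoint v w) (midpoint v w).
Proof.
move=> Dv Dw; have Dd := DB Dw Dv.
have sq (c : R) : form (fun x => c * (w \- v) x + v x) (fun x => c * (w \- v) x + v x) =
    c ^+ 2 * form (w \- v) (w \- v) + c * (form (w \- v) v + form v (w \- v)) + form v v.
  have Dc := form_dom_lin H c Dd Dv.
  rewrite (form_linl H c Dd Dv Dc) (form_linr H c Dd Dv Dd) (form_linr H c Dd Dv Dv).
  move: (form (w \- v) (w \- v)) (form (w \- v) v) (form v (w \- v)) (form v v) => *; ring.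
have := sq 1; have -> : (fun x => 1 * (w \- v) x + v x) = w.
  by apply/funext => x /=; rewrite mul1r subrK.
move=> ->; have := sq 2^-1; rewrite -/(midpoint v w) => ->.
move: (form (w \- v) (w \- v)) (form (w \- v) v) (form v (w \- v)) (form v v) => p q r s.
by field.
Qed.

(* Near-minimizers of the energy over decreasing convex sets form a Cauchy sequence, by the
   parallelogram identity. *)
Lemma convex_minimizing_cauchy (P : nat -> set (X -> R)) (M : R) :
  (forall n v, P n v -> D v) -> (forall n v, P n.+1 v -> P n v) ->
  (forall n v w, P n v -> P n w -> P n (midpoint v w)) ->
  (forall n, exists2 v, P n v & form v v <= M) ->
  exists v_ : nat -> X -> R, (forall n, P n (v_ n)) /\ form_cauchy form v_.
Proof.
move=> PD Pdec Pmid PM.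
pose en n : set R := [set form v v | v in P n].
pose al n := inf (en n).
have lb0 n : lbound (en n) 0 by move=> _ [v Pv <-]; apply: (form_ge0 H); exact: PD Pv.
have ne n : en n !=set0 by have [v Pv _] := PM n; exists (form v v), v.
have hinf n : has_inf (en n) by split => //; exists 0; exact: lb0.
have al_le n v : P n v -> al n <= form v v.
  by move=> Pv; apply: (inf_lbound (hinf n).2); exists v.
have alM n : al n <= M by have [v Pv vM] := PM n; exact: le_trans (al_le n v Pv) vM.
have al_nd n : al n <= al n.+1.
  by apply: lb_le_inf => // _ [v Pv <-]; apply: al_le; exact: Pdec.
have /boolp.choice[v_ Hv] : forall n, exists v, P n v /\ form v v < al n + n.+1%:R^-1.
  move=> n; have e0 : 0 < n.+1%:R^-1 :> R by rewrite invr_gt0.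
  by have [_ [v Pv <-] h] := inf_adherent e0 (hinf n); exists v.
exists v_; split => [n|]; first by have [] := Hv n.
have Pdec' m n v : (n <= m)%N -> P m v -> P n v.
  move=> nm; rewrite -(subnK nm); elim: (m - n)%N => // k IH.
  by rewrite addSn => /Pdec.
have Dv n : D (v_ n) by apply: (PD n); have [] := Hv n.
have ar (p q s am an f1 f2 e : R) : 0 < e -> am - an < e / 8 -> f1 < e / 8 -> f2 < e / 8 ->
    p < an + f1 -> q < am + f2 -> an <= s -> 2 * p + 2 * q - 4 * s < e by lra.
move=> e e0; have e8 : 0 < e / 8 by rewrite divr_gt0.
have [N1 HN1] := nondecreasing_bounded_cauchy al_nd alM e8.
have hc : (n.+1%:R^-1 : R) @[n --> \oo] --> (0 : R) by exact: cvg_harmonic.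
have /cvg_seqP/(_ _ e8)[N2 HN2] := hc.
have inv8 n : (N2 <= n)%N -> n.+1%:R^-1 < e / 8 :> R.
  by move=> h; have := HN2 n h; rewrite subr0 => /(le_lt_trans (ler_norm _)).
have key m n : (maxn N1 N2 <= n)%N -> (n <= m)%N -> form (v_ m \- v_ n) (v_ m \- v_ n) < e.
  rewrite geq_max => /andP[n1 n2] nm.
  rewrite (form_parallelogram (Dv n) (Dv m)).
  have [Pn hn] := Hv n; have [Pm hm] := Hv m.
  (* The midpoint lies in [P n], so its energy is at least the infimum [al n], while the endpoints
     nearly attain [al n] and [al m], which are close because the infima increase and are
     bounded. *)
  have hs := al_le n _ (Pmid n _ _ Pn (Pdec' _ _ _ nm Pm)).
  exact: (ar _ _ _ _ _ _ _ _ e0 (HN1 m n n1 nm) (inv8 n n2) (inv8 m (leq_trans n2 nm)) hn hm hs).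
exists (maxn N1 N2) => m n hm hn.
have [nm|/ltnW mn] := leqP n m; first exact: key.
have -> : form (v_ m \- v_ n) (v_ m \- v_ n) = form (v_ n \- v_ m) (v_ n \- v_ m).
  rewrite (form_sqB_eq DB (formBl H) (formBr H) (Dv m) (Dv n)).
  rewrite (form_sqB_eq DB (formBl H) (formBr H) (Dv n) (Dv m)).
  move: (form (v_ m) (v_ m)) (form (v_ m) (v_ n)) (form (v_ n) (v_ m)) (form (v_ n) (v_ n)) => *.
  by ring.
exact: key.
Qed.

End minimizing_sequence.

Section recurrence.
Context (R : realType) (d : nat).
Local Notation X := 'rV[R]_d.
Variables (E : set X) (phi : X -> R) (mu : {measure set X -> \bar R}).
Variables (A : X -> 'M[R]_d) (B : X -> X) (Tb : R -> (X -> R) -> (X -> R)).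
Hypothesis H : form_setting E phi mu A.
Hypothesis B_L2 : L2_loc_field E mu B.
Hypothesis B_div : divergence_free E mu B.
Hypothesis HTb : sub_markovian_C0_semigroup mu 1 Tb.
Hypothesis gen_prop : L1_generator_properties E mu A B Tb.
Implicit Types (f g h u v w : X -> R).

Local Notation L1 := (Lfun mu 1).
Local Notation L2 := (Lfun mu 2%:E).
Local Notation D := (form_dom E mu A).
Local Notation form := (Defs.form E mu A).
Local Notation wgrad := (Defs.wgrad E mu A).

Let mE : measurable E. Proof. exact: measurable_domain (setting_domain H). Qed.
Let p2 : (1 : R) <= 2. Proof. by rewrite ler1n. Qed.
Let p11 : (1 : R) <= 1 := lexx _.

#[local] Opaque form0 Defs.form.

(** Such a function is bounded and vanishes off a set of finite measure. *)
Lemma form_dom_loc_L1 chi : form_dom_loc E mu A chi -> ae_bounded mu chi -> chi \in L1.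
Proof.
move=> [V HV Dchi] [M HM]; have [lchi _] := Dchi.
have mV := rel_compact_measurable (setting_domain H) HV.
have Vfin := rel_compact_finite_measure (setting_domain H) (setting_density H)
      (setting_measure H) HV.
have mchi := Lfun_meas lchi.
apply/Lfun1_integrable; apply: (integrable_restrict_ae measurableT mV) => //.
  by apply: filterS (form_dom_in_off H Dchi) => x Hx _.
have iM : mu.-integrable V (EFin \o (fun=> `|M|)).
  by apply: (bounded_integrable (M := `|M|)) => // x _; rewrite normr_id.
apply: (integrable_ae_le mV _ iM); first exact: measurable_funS mchi.
by apply: filterS HM => x Hx _; exact: le_trans Hx (ler_norm _).
Qed.

Lemma form_dom_loc_dom chi : form_dom_loc E mu A chi -> D chi.
Proof. by move=> [V HV Dchi]; exact: form_dom_in_dom Dchi. Qed.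

Lemma drift_loc_integrable chi : form_dom_loc E mu A chi ->
  mu.-integrable E (EFin \o (fun x => dotp (B x) (wgrad chi x))).
Proof.
move=> Lchi; have [V HV Dchi] := Lchi; have [_ cK KE] := HV.
have Dc := form_dom_loc_dom Lchi.
have mf : measurable_fun E (fun x => dotp (B x) (wgrad chi x)).
  by apply: (drift_measurable H B_L2) => i; exact: (wgrad_measurable H).
apply: (integrable_restrict_ae mE (compact_measurable_rV cK) KE mf).
  apply: filterS (wgrad_off H HV Dchi) => x Hx Ex nKx.
  by rewrite Hx ?dotp0r// => Vx; apply: nKx; exact: subset_closure.
exact: (drift_wgrad_integrable H B_L2 Dc cK KE).
Qed.

(** The form of -L tested against [chi], with the drift moved onto [chi] by antisymmetry. As no
    gradient of [v] appears in it, the drift term keeps its meaning for bounded [v] outside the form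
    domain. *)
Definition drift_form v chi : R :=
  form v chi + \int[mu]_(x in E) (dotp (B x) (wgrad chi x) * v x).

Lemma drift_form_midpoint v w chi : D v -> D w -> ae_bounded mu v -> ae_bounded mu w ->
  form_dom_loc E mu A chi ->
  drift_form (midpoint v w) chi = 2^-1 * drift_form v chi + 2^-1 * drift_form w chi.
Proof.
move=> Dv Dw bv bw Lchi; have Dc := form_dom_loc_dom Lchi.
have Dd := form_domB H Dw Dv.
have lv : v \in L2 by case: Dv.
have lw : w \in L2 by case: Dw.
have i1 := drift_integrable H B_L2 Lchi lv bv; have i2 := drift_integrable H B_L2 Lchi lw bw.
rewrite /drift_form (form_linl H 2^-1 Dd Dv Dc) (formBl H Dw Dv Dc).
have -> : \int[mu]_(x in E) (dotp (B x) (wgrad chi x) * midpoint v w x) =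
    2^-1 * \int[mu]_(x in E) (dotp (B x) (wgrad chi x) * v x) +
    2^-1 * \int[mu]_(x in E) (dotp (B x) (wgrad chi x) * w x).
  have j1 := integrableZl mE 2^-1 i1; have j2 := integrableZl mE 2^-1 i2.
  rewrite -(RintegralZl 2^-1 mE i1) -(RintegralZl 2^-1 mE i2) -RintegralD//.
  by apply: eq_Rintegral => x _; rewrite /midpoint /=; field.
move: (form w chi) (form v chi) (Rintegral _ _ _) (Rintegral _ _ _) => p q r s.
by field.
Qed.

(** Integration by parts, with -L u = g - s - c u, followed by [drift_antisymmetry]. *)
Lemma drift_form_generator u s g chi (c : R) : semigroup_generator mu 1 Tb u
    (fun x => s x - g x + c * u x) -> s \in L1 -> g \in L1 -> ae_bounded mu u ->
  form_dom_loc E mu A chi -> ae_bounded mu chi ->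
  drift_form u chi = \int[mu]_x (g x * chi x) - \int[mu]_x (s x * chi x)
    - c * \int[mu]_x (u x * chi x).
Proof.
move=> gen ls lg bu Lchi bchi.
have Du := L1_generator_dom gen_prop gen bu.
have Dc := form_dom_loc_dom Lchi; have lc : chi \in L2 by case: Dc.
have mc := Lfun_meas lc; have lu : u \in L1 by case: gen.
have [M HM] := bchi.
have i1 := bounded_mul_integrable ls mc HM.
have i2 := bounded_mul_integrable lg mc HM.
have i3 := bounded_mul_integrable lu mc HM; have i3' := integrableZl measurableT c i3.
have := L1_generator_by_parts gen_prop gen bu Lchi bchi.
rewrite (drift_antisymmetry H B_L2 B_div Du bu Lchi bchi) opprK -/(drift_form u chi) => ->.
rewrite (domain_Rintegral H); last first.
  apply: measurable_funM => //; apply: measurable_funD.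
    by apply: measurable_funB; [exact: Lfun_meas ls|exact: Lfun_meas lg].
  by apply: measurable_funM => //; exact: Lfun_meas lu.
have i13 : mu.-integrable setT (EFin \o (fun x => s x * chi x - g x * chi x)).
  exact: (integrableB measurableT i1 i2).
have -> : \int[mu]_x ((s x - g x + c * u x) * chi x) =
    \int[mu]_x (s x * chi x - g x * chi x + c * (u x * chi x)).
  by apply: eq_Rintegral => x _; ring.
rewrite (RintegralD measurableT i13 i3') (RintegralB measurableT i1 i2) (RintegralZl c measurableT i3).
by move: (Rintegral _ _ _) (Rintegral _ _ _) (Rintegral _ _ _) => *; ring.
Qed.

End recurrence.

Section recurrence_criterion.
Context (R : realType) (d : nat).
Local Notation X := 'rV[R]_d.
Variables (E : set X) (phi : X -> R) (mu : {measure set X -> \bar R}).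
Variables (A : X -> 'M[R]_d) (B : X -> X) (Tb T : R -> (X -> R) -> (X -> R)).
Hypothesis E0 : E !=set0.
Hypothesis H : form_setting E phi mu A.
Hypothesis mu_full : full_support mu E.
Hypothesis B_L2 : L2_loc_field E mu B.
Hypothesis B_div : divergence_free E mu B.
Hypothesis HTb : sub_markovian_C0_semigroup mu 1 Tb.
Hypothesis gen_prop : L1_generator_properties E mu A B Tb.
Hypothesis cons : L1_L2_consistent mu Tb T.
Variable chi : nat -> X -> R.
Hypothesis chi_loc : forall n, form_dom_loc E mu A (chi n) /\ ae_bounded mu (chi n).
Hypothesis chi01 : forall n, {ae mu, forall x, 0 <= chi n x <= 1}.
Hypothesis chi_cvg : {ae mu, forall x, chi n x @[n --> \oo] --> (1 : R)}.
Implicit Types (f g h u v w : X -> R).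

Local Notation L1 := (Lfun mu 1).
Local Notation L2 := (Lfun mu 2%:E).
Local Notation D := (form_dom E mu A).
Local Notation form := (Defs.form E mu A).
Local Notation wgrad := (Defs.wgrad E mu A).

Let mE : measurable E. Proof. exact: measurable_domain (setting_domain H). Qed.
Let p2 : (1 : R) <= 2. Proof. by rewrite ler1n. Qed.
Let p11 : (1 : R) <= 1 := lexx _.

#[local] Opaque form0 Defs.form.

(** A zero integral would make the whole space null, against full support at a point of the nonempty
    [E]. *)
Lemma ae_pos_integral_gt0 f : f \in L1 -> (forall x, 0 <= f x) ->
  {ae mu, forall x, 0 < f x} -> 0 < \int[mu]_x f x.
Proof.
move=> lf f0 fpos; rewrite lt_neqAle Rintegral_ge0// andbT eq_sym; apply/negP => /eqP f00.
have if_ : mu.-integrable setT (EFin \o f) by exact/Lfun1_integrable.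
have fz := Rintegral_eq0_ae measurableT if_ (fun x _ => f0 x) f00.
have [x0 Ex0] := E0.
have := mu_full Ex0 openT (Logic.I : setT x0); rewrite setIT.
have : {ae mu, forall x : X, False}.
  by apply: filterS2 fz fpos => x /(_ Logic.I) ->; rewrite ltxx.
move=> [N [mN N0 sN]]; apply/negP; rewrite -leNgt -N0.
by apply: le_measure; [exact: mem_set|exact: mem_set|move=> x _; apply: sN].
Qed.

(* [u n] plays the role of a damped potential of [g'], with remainder [s n]. *)
Section approximating_solutions.
Variables (g' : X -> R) (k : R) (u s : nat -> X -> R) (al : nat -> R).
Hypothesis lg' : g' \in L1.
Hypothesis g'0 : {ae mu, forall x, 0 <= g' x}.
Hypothesis al0 : forall n, 0 <= al n.
Hypothesis al_cvg : al n @[n --> \oo] --> (0 : R).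
Hypothesis gen : forall n, semigroup_generator mu 1 Tb (u n)
  (fun x => s n x - g' x + al n * u n x).
Hypothesis ls : forall n, s n \in L1.
Hypothesis s0 : forall n, {ae mu, forall x, 0 <= s n x}.
Hypothesis s_cvg : nrm mu 1 (s n) @[n --> \oo] --> (0 : R).
Hypothesis u_bound : forall n, {ae mu, forall x, 0 <= u n x <= k}.
Hypothesis u_mono : forall n, {ae mu, forall x, u n x <= u n.+1 x}.

(** The error with which [v] solves -L v = g' when tested against the cutoff [chi m]. *)
Let defect v m := drift_form E mu A B v (chi m) - \int[mu]_x (g' x * chi m x).

Let u_ae_bounded n : ae_bounded mu (u n).
Proof.
by exists k; apply: filterS (u_bound n) => x /andP[h0 h1]; rewrite ger0_norm.
Qed.

Let u_L1 n : u n \in L1. Proof. by case: (gen n). Qed.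

Let chi_L1 m : chi m \in L1.
Proof. by have [h1 h2] := chi_loc m; exact: (form_dom_loc_L1 H). Qed.

(** The equation of [u n] leaves the remainder [s n], which tends to 0 in L^1, and [al n] times the
    integral of [u n * chi m], which stays bounded by k times the L^1 norm of [chi m]. *)
Lemma defect_cvg0 m : defect (u n) m @[n --> \oo] --> (0 : R).
Proof.
have [Lchi bchi] := chi_loc m; have [M HM] := bchi.
have mc := Lfun_meas (chi_L1 m).
pose c := \int[mu]_x `|chi m x|.
have L : M * nrm mu 1 (s n) + al n * (k * c) @[n --> \oo] --> (M * 0 + 0 * (k * c) : R).
  by apply: cvgD; apply: cvgM => //; exact: cvg_cst.
rewrite mulr0 mul0r addr0 in L; apply: (cvg_dist_le _ L) => n; rewrite subr0.
have -> : defect (u n) m = (- \int[mu]_x (s n x * chi m x)) - al n * \int[mu]_x (u n x * chi m x).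
  rewrite /defect (drift_form_generator H B_L2 B_div gen_prop (gen n) (ls n) lg' (u_ae_bounded n) Lchi bchi).
  by move: (Rintegral _ _ _) (Rintegral _ _ _) (Rintegral _ _ _) => *; ring.
have i1 := bounded_mul_integrable (ls n) mc HM.
have i3 := bounded_mul_integrable (u_L1 n) mc HM.
have ic : mu.-integrable setT (EFin \o (fun x => `|chi m x|)).
  by apply: integrable_norm; apply/Lfun1_integrable.
have is_ : mu.-integrable setT (EFin \o (fun x => `|s n x|)).
  by apply: integrable_norm; apply/Lfun1_integrable.
apply: (le_trans (ler_normB _ _)); rewrite normrN; apply: lerD.
  rewrite nrm1E// -(RintegralZl M measurableT is_).
  apply: (le_trans (le_normr_Rintegral measurableT i1)).
  apply: (ae_le_Rintegral measurableT).
  - exact: integrable_norm.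
  - exact: (integrableZl measurableT M is_).
  - by apply: filterS HM => x Hx _; rewrite normrM mulrC ler_wpM2r.
rewrite normrM ger0_norm//; apply: ler_wpM2l => //.
rewrite -(RintegralZl k measurableT ic).
apply: (le_trans (le_normr_Rintegral measurableT i3)).
apply: (ae_le_Rintegral measurableT).
- exact: integrable_norm.
- exact: (integrableZl measurableT k ic).
- by apply: filterS (u_bound n) => x /andP[h0 h1] _; rewrite normrM ler_wpM2r// ger0_norm.
Qed.

Lemma approximating_solutions_extended : exists v, [/\ extended_space E mu A v,
  {ae mu, forall x, 0 <= v x}, ae_bounded mu v &
  forall m, extended_form E mu A v (chi m) +
    \int[mu]_(x in E) (dotp (B x) (wgrad (chi m) x) * v x) = \int[mu]_x (g' x * chi m x)].
Proof.
have Du n : D (u n) by have [] := generator_energy H gen_prop (gen n) (ls n) lg' (al0 n) (s0 n) (u_bound n).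
have energy n : form (u n) (u n) <= k * \int[mu]_x (g' x).
  have [_] := generator_energy H gen_prop (gen n) (ls n) lg' (al0 n) (s0 n) (u_bound n).
  move=> /le_trans; apply.
  have ig : mu.-integrable setT (EFin \o g') by exact/Lfun1_integrable.
  have uk : {ae mu, forall x, `|u n x| <= k}.
    by apply: filterS (u_bound n) => x /andP[h0 h1]; rewrite ger0_norm.
  rewrite -(RintegralZl k measurableT ig); apply: (ae_le_Rintegral measurableT).
  - exact: (bounded_mul_integrable lg' (Lfun_meas (u_L1 n)) uk).
  - exact: (integrableZl measurableT k ig).
  - by apply: filterS2 (u_bound n) g'0 => x /andP[h0 h1] h2 _; rewrite mulrC ler_wpM2r.
have [v mv Hv] := ae_measurable_lim measurableT (fun n => Lfun_meas (u_L1 n)).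
have uae : {ae mu, forall x, [/\ u n x @[n --> \oo] --> (v x : R), forall n, u n x <= v x & 0 <= v x <= k]}.
  apply: filterS2 (ae_foralln u_bound) (ae_foralln u_mono) => x Bx Mx.
  have nd : {homo (u ^~ x) : m n / (m <= n)%N >-> m <= n} by apply/nondecreasing_seqP.
  have C : cvgn (u ^~ x).
    by apply: nondecreasing_is_cvgn => //; exists k => _ [n _ <-]; have /andP[] := Bx n.
  have L := Hv x C; split=> // [n|].
    by rewrite -(cvg_lim _ L)//; exact: (nondecreasing_cvgn_le nd C).
  apply/andP; split.
    by apply: (cvg_ge_cst L) => n; have /andP[] := Bx n.
  by apply: (cvg_le_cst L) => n; have /andP[] := Bx n.
(* The clause on defects stands in for membership in the convex hull of the u_j, j >= n: [u n]
   satisfies it, and it survives midpoints because the defect is affine. The bounds by [u n] and [v]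
   force convergence to [v] almost everywhere without any uniform bound in L^2. *)
pose P n : set (X -> R) := [set w | [/\ D w, {ae mu, forall x, u n x <= w x <= v x} &
  forall m (e : R), (forall j, (n <= j)%N -> `|defect (u j) m| <= e) -> `|defect w m| <= e]].
have Pb n w : P n w -> {ae mu, forall x, `|w x| <= k}.
  move=> [_ hw _]; apply: filterS3 hw (u_bound n) uae => x /andP[h1 h2] /andP[h3 _] [_ _ /andP[_ h4]].
  by rewrite ger0_norm ?(le_trans h2)// (le_trans h3).
have [v_ [Pv cv]] : exists v_ : nat -> X -> R, (forall n, P n (v_ n)) /\ form_cauchy form v_.
  apply: (convex_minimizing_cauchy H (M := k * \int[mu]_x (g' x))).
  - by move=> n w [].
  - move=> n w [Dw hw ew]; split => //.
      by apply: filterS2 hw (u_mono n) => x /andP[h1 h2] h3; rewrite h2 (le_trans h3).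
    by move=> m e He; apply: ew => j nj; apply: He; exact: ltnW.
  - move=> n w1 w2 P1 P2; have b1 := Pb _ _ P1; have b2 := Pb _ _ P2.
    have [D1 h1 e1] := P1; have [D2 h2 e2] := P2; split.
    + exact: (form_dom_midpoint H).
    + apply: filterS2 h1 h2 => x /andP[l1 r1] /andP[l2 r2]; rewrite /midpoint /=.
      by apply/andP; split; lra.
    + move=> m e He; have [Lchi _] := chi_loc m.
      have := e1 m e He; have := e2 m e He; rewrite /defect.
      rewrite (drift_form_midpoint H B_L2 D1 D2 _ _ Lchi); [|by exists k|by exists k].
      have ar (p q r : R) : `|q - r| <= e -> `|p - r| <= e -> `|2^-1 * p + 2^-1 * q - r| <= e.
        by rewrite !ler_norml => /andP[? ?] /andP[? ?]; apply/andP; split; lra.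
      exact: ar.
  - move=> n; exists (u n); last exact: energy.
    split; first exact: Du.
      by apply: filterS uae => x [_ h _]; rewrite lexx h.
    by move=> m e He; exact: He.
have Dv n : D (v_ n) by have [] := Pv n.
have v_cvg : {ae mu, forall x, v_ n x @[n --> \oo] --> (v x : R)}.
  have hv : {ae mu, forall x, forall n, u n x <= v_ n x <= v x}.
    by apply: ae_foralln => n; have [] := Pv n.
  apply: filterS2 hv uae => x hx [L _ _].
  by apply: (squeeze_cvgr _ L (@cvg_cst _ _ _ _ _)); apply: nearW.
have ext : extended_approx E mu A v_ v by [].
exists v; split.
- by split => //; exists v_.
- by apply: filterS uae => x [_ _ /andP[]].
- by exists k; apply: filterS uae => x [_ _ /andP[h1 h2]]; rewrite ger0_norm.
- move=> m; have [Lchi _] := chi_loc m.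
  have Dc := form_dom_loc_dom Lchi.
  have C1 := extended_form_cvg H ext Dc.
  have iB := drift_loc_integrable H B_L2 Lchi.
  have mB : measurable_fun E (fun x => dotp (B x) (wgrad (chi m) x)).
    by apply/measurable_EFinP; exact: (measurable_int _ iB).
  have mvE w : measurable_fun setT w -> measurable_fun E w.
    by move=> mw; exact: measurable_funS mw.
  have C2 : \int[mu]_(x in E) (dotp (B x) (wgrad (chi m) x) * v_ n x) @[n --> \oo] -->
      \int[mu]_(x in E) (dotp (B x) (wgrad (chi m) x) * v x).
    apply: (dominated_cvg_Rintegral mE _ _ _ (integrableZl mE k (integrable_norm iB)) _).2.
    + move=> n; apply: measurable_funM => //; apply: mvE.
      by apply: Lfun_meas; exact: (form_dom_L2 (Dv n)).
    + by apply: measurable_funM => //; exact: mvE.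
    + by apply: filterS v_cvg => x Hx _; apply: cvgM => //; exact: cvg_cst.
    + by move=> n; apply: filterS (Pb n _ (Pv n)) => x Hx _; rewrite normrM mulrC ler_wpM2r.
  have C3 : defect (v_ n) m @[n --> \oo] --> (0 : R).
    have /cvg_seqP L := defect_cvg0 m.
    apply/cvg_seqP => e e0; have e20 : 0 < e / 2 by rewrite divr_gt0.
    have [N HN] := L _ e20; exists N => n Nn; rewrite subr0.
    apply: (@le_lt_trans _ _ (e / 2)); last by rewrite ltr_pdivrMr// ltr_pMr// ltr1n.
    have [_ _ h] := Pv n; apply: h => j nj.
    by have := HN j (leq_trans Nn nj); rewrite subr0 => /ltW.
  have C4 : defect (v_ n) m @[n --> \oo] --> (extended_form E mu A v (chi m) +
      \int[mu]_(x in E) (dotp (B x) (wgrad (chi m) x) * v x) - \int[mu]_x (g' x * chi m x) : R).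
    by apply: cvgB; [exact: cvgD|exact: cvg_cst].
  apply/eqP; rewrite -subr_eq0; apply/eqP.
  by apply: (cvg_unique _ C4 C3).
Qed.

End approximating_solutions.

Lemma not_transient_of_cutoffs :
  (forall g, extended_space E mu A g -> {ae mu, forall x, 0 <= g x} -> ae_bounded mu g ->
     (extended_form E mu A g (chi n)
        + \int[mu]_(x in E) (dotp (B x) (wgrad (chi n) x) * g x))
       @[n --> \oo] --> (0 : R)) ->
  ~ transient mu T.
Proof.
move=> chi_lim [Tb' [HTb' cons' [g [lg g0 fin]]]].
have g0' : {ae mu, forall x, 0 <= g x} by apply: filterS g0 => x /ltW.
have [G mG HG] := potential_majorant HTb' lg g0' fin.
have mg := Lfun_meas lg.
pose f x := Num.min `|g x| 1.
have f0 x : 0 <= f x by rewrite le_min normr_ge0 ler01.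
have f1 x : f x <= 1 by rewrite ge_min lexx orbT.
have mf : measurable_fun setT f.
  by apply: measurable_minr; [exact: measurableT_comp|exact: measurable_cst].
have lf : f \in L1.
  by apply: (Lfun1_le mf lg); apply: nearW => x; rewrite ger0_norm// ge_min lexx.
have fpos : 0 < \int[mu]_x f x.
  apply: ae_pos_integral_gt0 => //.
  by apply: filterS g0 => x gx; rewrite lt_min ltr01 andbT normr_gt0 gt_eqF.
(* [G] is finite everywhere, so these sets exhaust the space and one of them retains a positive part
   of the integral of [f]. *)
pose Gn n := [set x | G x <= n%:R].
have mGn n : measurable (Gn n).
  rewrite (_ : Gn n = setT `&` G @^-1` `]-oo, n%:R]%classic); first exact: mG.
  by rewrite setTI; apply/seteqP; split => x /=; rewrite in_itv.
pose fn n x := f x * \1_(Gn n) x.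
have mfn n : measurable_fun setT (fn n) by apply: measurable_funM.
have fn01 n x : 0 <= fn n x <= f x.
  by rewrite /fn indicE; case: (x \in Gn n); rewrite /= ?mulr1 ?mulr0 f0 ?lexx.
have [k0 fk] : exists k0 : nat, 0 < \int[mu]_x fn k0 x.
  have iff : mu.-integrable setT (EFin \o f) by exact/Lfun1_integrable.
  have L : \int[mu]_x fn n x @[n --> \oo] --> \int[mu]_x f x.
    apply: (dominated_cvg_Rintegral measurableT mfn mf _ iff _).2.
    - apply: nearW => x _; apply/cvg_seqP => e e0; exists (Num.truncn (G x)).+1 => n nG.
      rewrite /fn indicE mem_set ?mulr1 ?subrr ?normr0//.
      by rewrite /Gn /=; apply: (le_trans (ltW (truncnS_gt _))); rewrite ler_nat.
    - by move=> n; apply: nearW => x _; have /andP[h0 h1] := fn01 n x; rewrite ger0_norm.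
  have /cvg_seqP/(_ _ fpos)[N HN] := L; exists N.
  have := HN N (leqnn _); rewrite distrC => /(le_lt_trans (ler_norm _)).
  by rewrite ltrBlDr -subr_gt0 addrAC subrr add0r.
set g' := fn k0 in fk.
(* The successor makes [k] positive, as the maximum principle requires. *)
pose k : R := k0.+1%:R.
have kpos : 0 < k by rewrite ltr0n.
have g'G x : g' x != 0 -> G x <= k.
  rewrite /g' /fn indicE; case: (boolP (x \in Gn k0)) => [/set_mem h _|_]; last first.
    by rewrite /= mulr0 eqxx.
  by apply: (le_trans h); rewrite ler_nat.
have lg' : g' \in L1.
  apply: (Lfun1_le (mfn k0) lf); apply: nearW => x.
  by have /andP[h0 h1] := fn01 k0 x; rewrite !ger0_norm.
have g'01 : {ae mu, forall x, 0 <= g' x <= 1}.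
  by apply: nearW => x; have /andP[-> h1] := fn01 k0 x; exact: le_trans h1 (f1 x).
have g'0 : {ae mu, forall x, 0 <= g' x} by apply: filterS g'01 => x /andP[].
have lg'2 : g' \in L2.
  apply: (Lfun1_bounded_Lfun2 (M := 1) lg').
  by apply: filterS g'01 => x /andP[h0 h1]; rewrite ger0_norm.
have g'g : {ae mu, forall x, g' x <= g x}.
  apply: filterS g0' => x gx; have /andP[_ h] := fn01 k0 x; apply: (le_trans h).
  by rewrite /f (ger0_norm gx) ge_min lexx.
pose al n : R := n.+1%:R^-1.
pose N n : R := n.+1%:R ^+ 2.
have al0 n : 0 < al n by rewrite invr_gt0.
have N0 n : 0 < N n by rewrite exprn_gt0.
have alN n : al n * N n = n.+1%:R by rewrite /al /N expr2 mulrA mulVf ?mul1r// pnatr_eq0.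
pose S n := damped (al n) Tb.
have HS n : sub_markovian_C0_semigroup mu 1 (S n).
  by apply: (damped_semigroup p11) => //; exact: ltW.
pose u n := Lp_time_integral mu 1 (S n) (N n) g'.
have lS n : S n (N n) g' \in L1 by exact: (semigroup_Lp (HS n)).
have uG n : {ae mu, forall x, u n x <= G x}.
  have h : {ae mu, forall x, u n x <= Lp_time_integral mu 1 Tb' (N n) g x}.
    apply: (time_integral_le p11 p11 (HS n) HTb' (N0 n) lg' lg) => t t0.
    have Tg0 := semigroup_ge0 HTb t0 lg' g'0.
    have Tle := semigroup_le HTb' t0 lg' lg g'g.
    (* The L^1 semigroup behind the assumed transience need not be given as [Tb]; both agree with
       [T] on [g'], which lies in L^1 and L^2. *)
    have Tc : {ae mu, forall x, Tb t g' x = Tb' t g' x}.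
      by apply: filterS2 (cons t0 lg' lg'2) (cons' t g' t0 lg' lg'2) => x <- <-.
    apply: filterS3 Tg0 Tle Tc => x h0 hle hc.
    apply: le_trans hle; rewrite -hc /S /damped ler_piMl// -expR0 ler_expR oppr_le0.
    by rewrite mulr_ge0// ltW.
  by apply: filterS2 h (HG _ (N0 n)) => x; exact: le_trans.
have ub n : {ae mu, forall x, 0 <= u n x <= k}.
  (* Where [g'] does not vanish, u_n <= G <= k; the maximum principle extends the bound to the whole
     space. *)
  have h1 : {ae mu, forall x, u n x <= k}.
    apply: (damped_maximum_principle HTb (al0 n) (N0 n) kpos lg' g'0).
    by apply: filterS (uG n) => x h /g'G; exact: le_trans h.
  have h0 := time_integral_ge0 (HS n) (N0 n) lg' g'0.
  by apply: filterS2 h0 h1 => x h0 h1; rewrite h0 h1.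
(* Two effects add up: weaker damping over a fixed length, then a longer interval at fixed
   damping. *)
have um n : {ae mu, forall x, u n x <= u n.+1 x}.
  have h1 : {ae mu, forall x, u n x <= Lp_time_integral mu 1 (S n.+1) (N n) g' x}.
    apply: (time_integral_le p11 p11 (HS n) (HS n.+1) (N0 n) lg' lg') => t t0.
    apply: filterS (semigroup_ge0 HTb t0 lg' g'0) => x h; rewrite /S /damped ler_wpM2r//.
    rewrite ler_expR lerN2 ler_wpM2r ?(ltW t0)//.
    by rewrite /al lef_pV2 ?posrE ?ltr0n// ler_nat.
  have h2 : {ae mu, forall x, Lp_time_integral mu 1 (S n.+1) (N n) g' x <= u n.+1 x}.
    apply: (time_integral_mono (HS n.+1) (N0 n) _ lg' g'0).
    by rewrite /N lerXn2r ?nnegrE// ler_nat.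
  by apply: filterS2 h1 h2 => x; exact: le_trans.
have gen n : semigroup_generator mu 1 Tb (u n) (fun x => S n (N n) g' x - g' x + al n * u n x).
  apply: (damped_generator p11 (ltW (al0 n)) HTb).
  exact: (time_integral_generator p11 (HS n) (N0 n) lg').
have S0 n : {ae mu, forall x, 0 <= S n (N n) g' x} by exact: (semigroup_ge0 (HS n)).
have Scvg : nrm mu 1 (S n (N n) g') @[n --> \oo] --> (0 : R).
  have L : expR (- n.+1%:R) * nrm mu 1 g' @[n --> \oo] --> (0 * nrm mu 1 g' : R).
    by apply: cvgM; [exact: cvg_expRN_nat|exact: cvg_cst].
  rewrite mul0r in L; apply: (cvg_dist_le _ L) => n.
  rewrite subr0 ger0_norm ?nrm_ge0// /S /damped alN.
  have lT : Tb (N n) g' \in L1 by exact: (semigroup_Lp HTb).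
  rewrite (nrmZ p11 _ lT) ger0_norm ?expR_ge0// ler_wpM2l ?expR_ge0//.
  exact: (semigroup_nrm (p := 1) HTb).
have alc : al n @[n --> \oo] --> (0 : R) by exact: cvg_harmonic.
have [v [Ev v0 bv Hv]] := approximating_solutions_extended lg' g'0 (fun n => ltW (al0 n))
  alc gen lS S0 Scvg ub um.
have := chi_lim v Ev v0 bv.
under eq_fun do rewrite Hv.
have ig : mu.-integrable setT (EFin \o g') by exact/Lfun1_integrable.
have mc n : measurable_fun setT (chi n).
  by have [h1 h2] := chi_loc n; exact: Lfun_meas (form_dom_loc_L1 H h1 h2).
have L : \int[mu]_x (g' x * chi n x) @[n --> \oo] --> \int[mu]_x g' x.
  apply: (dominated_cvg_Rintegral measurableT _ (Lfun_meas lg') _ ig _).2.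
  - by move=> n; apply: measurable_funM => //; exact: Lfun_meas lg'.
  - apply: filterS chi_cvg => x Hx _; rewrite -[X in _ --> X]mulr1.
    by apply: cvgM => //; exact: cvg_cst.
  - move=> n; apply: filterS2 (chi01 n) g'0 => x /andP[h0 h1] h _.
    by rewrite ger0_norm ?mulr_ge0// ler_piMr.
move=> L0; have := cvg_unique (@Rhausdorff R) L L0.
by move=> z; rewrite z ltxx in fk.
Qed.

End recurrence_criterion.

Theorem corollary14 (R : realType) (d : nat) (E : set 'rV[R]_d)
    (phi : 'rV[R]_d -> R)
    (mu : {sigma_finite_measure set 'rV[R]_d -> \bar R})
    (A : 'rV[R]_d -> 'M[R]_d) (B : 'rV[R]_d -> 'rV[R]_d)
    (Tb T : R -> ('rV[R]_d -> R) -> ('rV[R]_d -> R)) :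
  E !=set0 ->
  open_or_closed_null_boundary E ->
  loc_integrable (lebesgue_rV d) E phi ->
  {ae lebesgue_rV d, forall x, E x -> 0 < phi x} ->
  (forall S : set 'rV[R]_d, measurable S ->
    mu S = (\int[lebesgue_rV d]_(x in E `&` S) (phi x)%:E)%E) ->
  full_support mu E ->
  (forall i j, loc_integrable mu E (fun x => A x i j)) ->
  loc_elliptic E A ->
  closable_form E mu A ->
  strong_sector E mu A ->
  L2_loc_field E mu B ->
  divergence_free E mu B ->
  dense_generator0_dom_0b E mu A ->
  constructed_L1_semigroup E mu A B Tb ->
  L1_generator_properties E mu A B Tb ->
  sub_markovian_C0_semigroup mu 2%:E T ->
  L1_L2_consistent mu Tb T ->
  (form_transient E mu A -> transient mu T)
  /\
  ((exists chi : nat -> 'rV[R]_d -> R,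
      [/\ forall n, form_dom_loc E mu A (chi n) /\ ae_bounded mu (chi n),
          forall n, {ae mu, forall x, 0 <= chi n x <= 1},
          {ae mu, forall x, chi n x @[n --> \oo] --> (1 : R)} &
          forall g : 'rV[R]_d -> R,
            extended_space E mu A g ->
            {ae mu, forall x, 0 <= g x} ->
            ae_bounded mu g ->
            (extended_form E mu A g (chi n)
               + \int[mu]_(x in E) (dotp (B x) (wgrad E mu A (chi n) x) * g x))
              @[n --> \oo] --> (0 : R)]) ->
   ~ transient mu T).
Proof.
move=> E0 ocE iphi phi0 muE mu_full iA ell clos sector B_L2 B_div dens cL1 gen_prop HT cons.
have H : form_setting E phi mu A by split.
have HTb := L1_semigroup cL1.
split=> [ft|[chi [chi_loc chi01 chi_cvg chi_lim]]].
  exists Tb; split => //; exact: (form_transient_L1 H HTb gen_prop ft).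
exact: (not_transient_of_cutoffs E0 H mu_full B_L2 B_div HTb gen_prop cons
  chi_loc chi01 chi_cvg chi_lim).
Qed.
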